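(* Let $i:X\hookrightarrow(M,\pi)$ be a coregular coisotropic submanifold of a Poisson manifold. Choose a complement $G$ to $TX^{\perp_\pi}$ in $TX$, so $TX=TX^{\perp_\pi}\oplus G$, let $j:(TX^{\perp_\pi})^*\hookrightarrow T^*X$ be the induced inclusion, let $\mathrm{pr}:(TX^{\perp_\pi})^*\to X$ be the bundle projection and $\omega_{can}$ the canonical symplectic form on $T^*X$. Then the Dirac structure $$\big(\mathrm{pr}^!(i^!L_\pi)\big)^{j^*\omega_{can}}$$ on $(TX^{\perp_\pi})^*$ defines a Poisson structure on a neighborhood $U\subset(TX^{\perp_\pi})^*$ of $X$, which is Poisson diffeomorphic around $X$ with the local Poisson saturation of $X$.
   Context: ''Poisson diffeomorphic around $X$'' means that there is a Poisson diffeomorphism between neighborhoods of $X$ in the two Poisson manifolds; $X$ is viewed inside $(TX^{\perp_\pi})^*$ as the zero section. $\pi^\sharp:T^*M\to TM$ is given by $\langle\pi^\sharp(\alpha),\beta\rangle=\pi(\alpha,\beta)$. For an embedded submanifold $i:X\hookrightarrow M$, $TX^\circ\subset T^*M|_X$ is the annihilator of $TX$ and $TX^{\perp_\pi}:=\pi^\sharp(TX^\circ)$. $X$ is coregular if $\pi^\sharp$ composed with the projection $TM|_X\to TM|_X/TX$, as a map $T^*M|_X\to TM|_X/TX$, has constant rank; equivalently $TX^{\perp_\pi}$ has constant rank, and is then a vector subbundle of $TM|_X$. $X$ is coisotropic if $TX^{\perp_\pi}\subset TX$. A Poisson submanifold is a submanifold $P$ with $\pi^\sharp(T^*M|_P)\subset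 TP$; it has an induced Poisson structure $\pi_P$. Local Poisson saturation. A Poisson spray is a vector field $\chi$ on $T^*M$ with $\mathrm{d}\mathrm{pr}(\chi(\xi))=\pi^\sharp(\xi)$ for all $\xi\in T^*M$ and $m_t^*\chi=t\chi$ for all $t>0$, where here $\mathrm{pr}:T^*M\to M$ is the projection and $m_t$ is fiberwise multiplication by $t$. On a neighborhood $\Sigma\subset T^*M$ of the zero section its flow $\phi^t_\chi$ is defined for $t\in[0,1]$, and $\exp_\chi:\Sigma\to M$, $\exp_\chi(\xi)=\mathrm{pr}(\phi^1_\chi(\xi))$. Choosing a complement to $TX^{\perp_\pi}$ in $TM|_X$ gives an inclusion $(TX^{\perp_\pi})^*\hookrightarrow T^*M|_X$; for $\Sigma$ small enough, $P:=\exp_\chi((TX^{\perp_\pi})^*\cap\Sigma)$ is an embedded Poisson submanifold containing $X$, it equals $\exp_\chi(\Sigma|_X)$, and (after shrinking) it is the union of the symplectic leaves of $(V,\pi|_V)$ meeting $X$ for some open neighborhood $V$ of $X$. $(P,\pi_P)$ is called the local Poisson saturation of $X$. Dirac notions. $L_\pi=\{\pi^\sharp(\alpha)+\alpha:\alpha\in T^*M\}$. For a map $\varphi$ into a Dirac manifold with Dirac structure $L$, $\varphi^!L=\{v+(\mathrm{d}\varphi)^*\beta:\mathrm{d}\varphi(v)+\beta\in L\}$; for $X$ coregular, $i^!L_\pi$ is a smooth Dirac structure on $X$. For a closed two-form $\eta$, $L^\eta=\{v+\alpha+\iota_v\eta:v+\alpha\in L\}$. A Dirac structure defines a Poisson structure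 on $U$ if it equals $L_{\pi'}$ there for some Poisson structure $\pi'$ on $U$. Sign convention: $\omega_{can}=\sum_i\mathrm{d}q^i\wedge\mathrm{d}p_i$. *)

(* Defs.v *)
From HB Require Import structures.
From mathcomp Require Import all_boot all_order all_algebra.
From mathcomp Require Import all_classical all_reals all_analysis.
Set Implicit Arguments.
Unset Strict Implicit.
Unset Printing Implicit Defensive.
Import Order.TTheory GRing.Theory Num.Theory.
Import numFieldNormedType.Exports.
Local Open Scope classical_set_scope.
Local Open Scope ring_scope.

(* Conventions.  Tangent vectors and covectors at a point of an n-dimensional
   manifold are row vectors 'rV[R]_n, namely their components in one chart
   [chart_at x] picked at each point x.  The pairing of v with a is v *m a^T, a
   linear map with matrix J acts by v |-> v *m J (the convention of [jacobian]),
   and its transpose acts on covectors by b |-> b *m J^T. *)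

(* To be used for U open in R^n only. *)
Fixpoint Ck (R : realType) (n : nat) (V : normedModType R) (k : nat)
    (U : set 'rV[R]_n) (f : 'rV[R]_n -> V) : Prop :=
  match k with
  | 0%N => forall x, U x -> {for x, continuous f}
  | k'.+1 => (forall x, U x -> differentiable f x) /\
             (forall v : 'rV[R]_n, Ck k' U (fun x => 'D_v f x))
  end.

Definition Cinfty (R : realType) (n : nat) (V : normedModType R)
  (U : set 'rV[R]_n) (f : 'rV[R]_n -> V) : Prop := forall k, Ck k U f.

(* [cmap] matters on [cdom] only, [cinv] on the image of [cdom] only. *)
Record chart (R : realType) (n : nat) (T : Type) := Chart {
  cdom : set T;
  cmap : T -> 'rV[R]_n;
  cinv : 'rV[R]_n -> T }.

(* The topology is not a separate datum: it is the one given by the charts,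
   see [mopen].  The axioms of a manifold are in [is_manifold]. *)
Record premanifold (R : realType) (n : nat) := Premanifold {
  carrier :> Type;
  atlas : set (chart R n carrier) }.

Definition chart_at (R : realType) (n : nat) (M : premanifold R n) (x : M) :
    chart R n M :=
  match pselect (exists c, atlas c /\ cdom c x) with
  | left h => projT1 (cid h)
  | right _ => Chart set0 (fun=> 0) (fun=> x)
  end.

Definition mopen (R : realType) (n : nat) (M : premanifold R n)
    (U : set M) : Prop :=
  forall c, atlas c -> open (cmap c @` (U `&` cdom c)).

Definition smooth_on (R : realType) (n : nat) (M : premanifold R n)
    (V : normedModType R) (U : set M) (f : M -> V) : Prop :=
  forall c, atlas c -> Cinfty (cmap c @` (U `&` cdom c)) (f \o cinv c).

Definition smooth_map (R : realType) (n p : nat) (M : premanifold R n)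
    (N : premanifold R p) (U : set M) (F : M -> N) : Prop :=
  forall c, atlas c ->
    mopen (U `&` F @^-1` cdom c) /\
    smooth_on (U `&` F @^-1` cdom c) (cmap c \o F).

Definition is_manifold (R : realType) (n : nat) (M : premanifold R n) : Prop :=
  [/\ forall x : M, exists2 c, atlas c & cdom c x,
      forall c : chart R n M, atlas c ->
        [/\ forall x, cdom c x -> cinv c (cmap c x) = x,
            mopen (cdom c) & smooth_on (cdom c) (cmap c)],
      forall x y : M, x <> y -> exists U V : set M,
        [/\ mopen U, mopen V, U x, V y & U `&` V = set0] &
      exists B : nat -> set M, (forall i, mopen (B i)) /\
        forall (U : set M) x, mopen U -> U x -> exists i, B i x /\ B i `<=` U].

Definition mnbhd (R : realType) (n : nat) (M : premanifold R n)
    (S U : set M) : Prop :=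
  exists O, [/\ mopen O, S `<=` O & O `<=` U].

(* v *m tcoord x c are the components in c of the tangent vector v at x. *)
Definition tcoord (R : realType) (n : nat) (M : premanifold R n) (x : M)
    (c : chart R n M) : 'M[R]_n :=
  jacobian (cmap c \o cinv (chart_at x)) (cmap (chart_at x) x).

(* Row i of fcoord x c is the coordinate vector d/dc_i at x. *)
Definition fcoord (R : realType) (n : nat) (M : premanifold R n) (x : M)
    (c : chart R n M) : 'M[R]_n :=
  jacobian (cmap (chart_at x) \o cinv c) (cmap c x).

Definition mder (R : realType) (n p : nat) (M : premanifold R n)
    (N : premanifold R p) (F : M -> N) (x : M) : 'M[R]_(n, p) :=
  jacobian (cmap (chart_at (F x)) \o F \o cinv (chart_at x))
           (cmap (chart_at x) x).

Definition tangent (R : realType) (n p : nat) (M : premanifold R n)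
    (N : premanifold R p) (F : M -> N) (x : M) : 'Hom('rV[R]_n, 'rV[R]_p) :=
  linfun (mulmxr (mder F x)).

Definition grad (R : realType) (n : nat) (M : premanifold R n) (f : M -> R)
    (x : M) : 'rV[R]_n :=
  \row_i 'D_(delta_mx 0 i) (f \o cinv (chart_at x)) (cmap (chart_at x) x).

(* Sections of F^* TN; vector fields on N are the case F = idfun. *)
Definition smooth_section (R : realType) (n p : nat) (M : premanifold R n)
    (N : premanifold R p) (F : M -> N) (U : set M) (s : M -> 'rV[R]_p) : Prop :=
  forall c, atlas c ->
    smooth_on (U `&` F @^-1` cdom c) (fun x => s x *m tcoord (F x) c).

Definition local_frame (R : realType) (n p : nat) (M : premanifold R n)
    (N : premanifold R p) (F : M -> N) (r : nat) (W : M -> {vspace 'rV[R]_p})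
    (U : set M) (s : 'I_r -> M -> 'rV[R]_p) : Prop :=
  (forall a, smooth_section F U (s a)) /\
  (forall x, U x -> basis_of (W x) [tuple s a x | a < r]).

(* W is a smooth vector subbundle of F^* TN *)
Definition subbundle (R : realType) (n p : nat) (M : premanifold R n)
    (N : premanifold R p) (F : M -> N) (W : M -> {vspace 'rV[R]_p}) : Prop :=
  exists r, forall x : M, exists U, exists s : 'I_r -> M -> 'rV[R]_p,
    [/\ mopen U, U x & local_frame F W U s].

Definition complement (K : fieldType) (V : vectType K) (W G T : {vspace V}) :
    Prop :=
  (W :&: G)%VS = 0%VS /\ (W + G)%VS = T.

Definition embedding (R : realType) (n p : nat) (M : premanifold R n)
    (N : premanifold R p) (F : M -> N) : Prop :=
  [/\ smooth_map setT F, injective F, forall x, row_free (mder F x) &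
      forall U, mopen U -> exists2 V, mopen V & F @` U = V `&` range F].

(* The charts are (q, p), with q a chart of M and p_i the value on d/dq_i. *)
Definition cotangent (R : realType) (n : nat) (M : premanifold R n) :
    premanifold R (n + n) :=
  @Premanifold R (n + n) (M * 'rV[R]_n)%type [set c |
    exists2 q : chart R n M, atlas q &
    [/\ cdom c = [set z | cdom q z.1],
        forall z, cdom c z ->
          cmap c z = row_mx (cmap q z.1) (z.2 *m (fcoord z.1 q)^T) &
        forall z, cdom c z -> cinv c (cmap c z) = z]].

Definition cot_proj (R : realType) (n : nat) (M : premanifold R n)
  (z : cotangent M) : M := z.1.

Definition cot_scale (R : realType) (n : nat) (M : premanifold R n) (t : R)
  (z : cotangent M) : cotangent M := (z.1, t *: z.2).

Definition dual_fiber (R : realType) (n : nat) (W : {vspace 'rV[R]_n}) :=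
  'Hom(subvs_of W, R^o).

Definition dual_eval (R : realType) (n : nat) (W : {vspace 'rV[R]_n})
    (xi : dual_fiber W) (v : 'rV[R]_n) : R :=
  (xi : 'Hom(subvs_of W, R^o)) (vsproj W v).

(* The total space of W^*, for W a subbundle of rank r of TM.  The charts are
   (q, y), with q a chart of M on an open set U and y the components in the dual
   of a local frame s of W on U. *)
Definition dual_bundle (R : realType) (n r : nat) (M : premanifold R n)
    (W : M -> {vspace 'rV[R]_n}) : premanifold R (n + r) :=
  @Premanifold R (n + r) {x : M & dual_fiber (W x)} [set c |
    exists q : chart R n M, exists U : set M,
    exists s : 'I_r -> M -> 'rV[R]_n,
    [/\ atlas q, mopen U, U `<=` cdom q & local_frame idfun W U s] /\
    [/\ cdom c = [set e | U (projT1 e)],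
        forall e, cdom c e ->
          cmap c e = row_mx (cmap q (projT1 e))
            (\row_a dual_eval (projT2 e) (s a (projT1 e))) &
        forall e, cdom c e -> cinv c (cmap c e) = e]].

Definition dual_proj (R : realType) (n r : nat) (M : premanifold R n)
    (W : M -> {vspace 'rV[R]_n}) (e : dual_bundle r W) : M := projT1 e.

Definition zero_section (R : realType) (n r : nat) (M : premanifold R n)
    (W : M -> {vspace 'rV[R]_n}) : set (dual_bundle r W) :=
  [set e | projT2 e = 0 :> 'Hom(subvs_of (W (projT1 e)), R^o)].

(* Extension by zero on G of a linear form on W. *)
Definition dual_incl (R : realType) (n : nat) (W G : {vspace 'rV[R]_n})
    (xi : dual_fiber W) : 'rV[R]_n :=
  \row_a dual_eval xi (daddv_pi W G (delta_mx 0 a)).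

Definition bundle_incl (R : realType) (n r : nat) (M : premanifold R n)
    (W G : M -> {vspace 'rV[R]_n}) (e : dual_bundle r W) : cotangent M :=
  (projT1 e, dual_incl (G (projT1 e)) (projT2 e)).

(* A bivector pi is given by matrices with pi(a, b) = a *m pi x *m b^T, so that
   pi^sharp(a) = a *m pi x. *)
Definition bracket (R : realType) (n : nat) (M : premanifold R n)
    (pi : M -> 'M[R]_n) (f g : M -> R) (x : M) : R :=
  (grad f x *m pi x *m (grad g x)^T) 0 0.

Definition poisson_on (R : realType) (n : nat) (M : premanifold R n) (U : set M)
    (pi : M -> 'M[R]_n) : Prop :=
  [/\ forall x, U x -> (pi x)^T = - pi x,
      forall c, atlas c -> smooth_on (U `&` cdom c)
        (fun x => (tcoord x c)^T *m pi x *m tcoord x c) &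
      forall (V : set M) (f g h : M -> R), mopen V -> V `<=` U ->
        smooth_on V f -> smooth_on V g -> smooth_on V h ->
        forall x, V x ->
          bracket pi f (bracket pi g h) x + bracket pi g (bracket pi h f) x +
          bracket pi h (bracket pi f g) x = 0].

Definition sharp (R : realType) (n : nat) (M : premanifold R n)
    (pi : M -> 'M[R]_n) (x : M) : 'Hom('rV[R]_n, 'rV[R]_n) :=
  linfun (mulmxr (pi x)).

Definition poisson_map_at (R : realType) (n p : nat) (M : premanifold R n)
    (N : premanifold R p) (piM : M -> 'M[R]_n) (piN : N -> 'M[R]_p) (F : M -> N)
    (x : M) : Prop :=
  (mder F x)^T *m piM x *m mder F x = piN (F x).

Definition conormal (R : realType) (k m : nat) (X : premanifold R k)
    (M : premanifold R m) (i : X -> M) (x : X) : {vspace 'rV[R]_m} :=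
  lker (linfun (mulmxr (mder i x)^T) : 'Hom('rV[R]_m, 'rV[R]_k)).

(* TX^{perp_pi}, as a subbundle of TM|_X *)
Definition Tperp (R : realType) (k m : nat) (X : premanifold R k)
    (M : premanifold R m)
    (i : X -> M) (pi : M -> 'M[R]_m) (x : X) : {vspace 'rV[R]_m} :=
  (sharp pi (i x) @: conormal i x)%VS.

(* r is the rank of the map pi^sharp mod TX from T^*M|_X to TM|_X / TX *)
Definition coregular (R : realType) (k m : nat) (X : premanifold R k)
    (M : premanifold R m) (i : X -> M) (pi : M -> 'M[R]_m) (r : nat) : Prop :=
  forall x, (\dim (limg (sharp pi (i x)) + limg (tangent i x))
             - \dim (limg (tangent i x)) = r)%N.

Definition coisotropic (R : realType) (k m : nat) (X : premanifold R k)
    (M : premanifold R m) (i : X -> M) (pi : M -> 'M[R]_m) : Prop :=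
  forall x, (Tperp i pi x <= limg (tangent i x))%VS.

(* TX^{perp_pi} as a subbundle of TX, for X coisotropic *)
Definition TperpX (R : realType) (k m : nat) (X : premanifold R k)
    (M : premanifold R m)
    (i : X -> M) (pi : M -> 'M[R]_m) (x : X) : {vspace 'rV[R]_k} :=
  (tangent i x @^-1: Tperp i pi x)%VS.

Definition poisson_submanifold (R : realType) (p m : nat) (P : premanifold R p)
    (M : premanifold R m) (iP : P -> M) (pi : M -> 'M[R]_m) : Prop :=
  [/\ is_manifold P, embedding iP &
      forall y, (limg (sharp pi (iP y)) <= limg (tangent iP y))%VS].

Definition dirac_field (R : realType) (n : nat) (M : premanifold R n) :=
  M -> set ('rV[R]_n * 'rV[R]_n).

Definition dirac_graph (R : realType) (n : nat) (M : premanifold R n)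
    (pi : M -> 'M[R]_n) : dirac_field M :=
  fun x => [set w | exists a : 'rV[R]_n, w = (a *m pi x, a)].

Definition dirac_pull (R : realType) (n p : nat) (M : premanifold R n)
    (N : premanifold R p) (F : M -> N) (L : dirac_field N) : dirac_field M :=
  fun x => [set w | exists v : 'rV[R]_n, exists2 b : 'rV[R]_p,
    L (F x) (v *m mder F x, b) & w = (v, b *m (mder F x)^T)].

(* A two-form eta is given by matrices with eta(u, v) = u *m eta x *m v^T; then
   iota_v eta is v *m eta x. *)
Definition dirac_gauge (R : realType) (n : nat) (M : premanifold R n)
    (L : dirac_field M) (eta : M -> 'M[R]_n) : dirac_field M :=
  fun x => [set w | exists v : 'rV[R]_n, exists2 a : 'rV[R]_n,
    L x (v, a) & w = (v, a + v *m eta x)].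

Definition form_pull (R : realType) (n p : nat) (M : premanifold R n)
    (N : premanifold R p) (F : M -> N) (eta : N -> 'M[R]_p) (x : M) : 'M[R]_n :=
  mder F x *m eta (F x) *m (mder F x)^T.

(* sum_i dq_i /\ dp_i.  Every chart of [cotangent M] is a canonical chart
   (q, p), so this matrix is right whichever [chart_at z] is. *)
Definition omega_can (R : realType) (n : nat) (M : premanifold R n)
    (z : cotangent M) : 'M[R]_(n + n) :=
  block_mx 0 1%:M (- 1%:M) 0.

Definition poisson_spray (R : realType) (m : nat) (M : premanifold R m)
    (pi : M -> 'M[R]_m) (chi : cotangent M -> 'rV[R]_(m + m)) : Prop :=
  [/\ smooth_section (@idfun (cotangent M)) setT chi,
      forall z, chi z *m mder (@cot_proj R m M) z = z.2 *m pi z.1 &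
      forall (t : R) z, 0 < t ->
        chi (cot_scale t z) = t *: (chi z *m mder (@cot_scale R m M t) z)].

(* g is an integral curve on [0, 1]; its values elsewhere matter only near the
   endpoints. *)
Definition integral_curve (R : realType) (n : nat) (N : premanifold R n)
    (chi : N -> 'rV[R]_n) (g : R -> N) : Prop :=
  forall t : R, 0 <= t <= 1 ->
    (\forall s \near t, cdom (chart_at (g t)) (g s)) /\
    is_derive t 1 (cmap (chart_at (g t)) \o g) (chi (g t)).

(* exp_chi z = y *)
Definition exp_rel (R : realType) (m : nat) (M : premanifold R m)
    (chi : cotangent M -> 'rV[R]_(m + m)) (z : cotangent M) (y : M) : Prop :=
  exists g : R -> cotangent M,
    [/\ integral_curve chi g, g 0 = z & cot_proj (g 1) = y].

Definition local_poisson_saturation (R : realType) (k m p : nat)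
    (X : premanifold R k) (M : premanifold R m) (i : X -> M) (pi : M -> 'M[R]_m)
    (P : premanifold R p) (iP : P -> M) (piP : P -> 'M[R]_p) : Prop :=
  [/\ poisson_submanifold iP pi,
      poisson_on setT piP /\ (forall y, poisson_map_at piP pi iP y),
      range i `<=` range iP &
      exists chi : cotangent M -> 'rV[R]_(m + m),
      exists Sigma : set (cotangent M),
      exists C : X -> {vspace 'rV[R]_m},
      [/\ poisson_spray pi chi,
          mnbhd [set z : cotangent M | z.2 = 0] Sigma /\
            (forall z, Sigma z -> exists y, exp_rel chi z y),
          subbundle i C /\
            (forall x, complement (Tperp i pi x) (C x) fullv) &
          range iP = [set y | exists x, exists xi : dual_fiber (Tperp i pi x),
            Sigma (i x, dual_incl (C x) xi) /\
            exp_rel chi (i x, dual_incl (C x) xi) y]]].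

(* (A, piA) on U and (B, piB) are Poisson diffeomorphic on neighborhoods of SA
   and SB. *)
Definition poisson_diffeo_around (R : realType) (n p : nat)
    (A : premanifold R n)
    (B : premanifold R p) (U : set A) (piA : A -> 'M[R]_n) (piB : B -> 'M[R]_p)
    (SA : set A) (SB : set B) : Prop :=
  exists UA : set A, exists UB : set B, exists F : A -> B, exists F' : B -> A,
  [/\ [/\ mopen UA, SA `<=` UA & UA `<=` U], mopen UB /\ SB `<=` UB,
      [/\ smooth_map UA F, F @` UA = UB & forall x, UA x -> F' (F x) = x],
      smooth_map UB F' & forall x, UA x -> poisson_map_at piA piB F x].

(* Main.v *)
Require Import Defs.
From HB Require Import structures.
From mathcomp Require Import all_boot all_order all_algebra.
From mathcomp Require Import all_classical all_reals all_analysis.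
From mathcomp Require Import ring lra zify.
Set Implicit Arguments.
Unset Strict Implicit.
Unset Printing Implicit Defensive.
Import Order.TTheory GRing.Theory Num.Theory.
Import numFieldNormedType.Exports.
Local Open Scope classical_set_scope.
Local Open Scope ring_scope.

(**
Let [E] be the bundle dual to [TX^perp], [io : E -> T*M] its inclusion given by a complement of [TX^perp] in [TM|X], and [phi_t] the flow of the spray. With [lambda] the Liouville form put [beta := int_0^1 phi_t^* lambda dt]. Transporting a covector along the flow by a linear differential equation shows that whenever [v] satisfies [pi(b0) = d pr (v)] there is [b] with [pi(b) = d exp (v)] and [exp^* b = pr^* b0 + i_v d beta]; this uses only the Jacobi identity and [d pr (chi(xi)) = pi(xi)]. Pulling back by [io], the map [exp o io] relates the gauge transform of [pr^! i^! L_pi] by [d (io^* beta)] with [L_pi].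

Homogeneity of the spray gives the linearisation of the flow along the zero section. There [j^* omega_can] and [d (io^* beta)] are both of the block form that makes the gauged structure transverse to [TE], and this block form is stable under affine combinations. Both forms have primitives vanishing on the zero section, so Moser's argument deforms one Poisson structure into the other, fixing the zero section. The composite [F : E -> M] pushes the gauged structure to [pi] and every covector on [E] is a pullback by [F], so [F] is an immersion.

A local Poisson saturation [P] contains the image of [F] near [X], so [F] factors through [P] and [k + r <= dim P]. Conversely every point of [P] is the exponential of an element of [E], and this relation is locally Lipschitz, so [dim P <= k + r] by Baire's theorem. Hence [E -> P] is a local diffeomorphism, injective near the zero section since [i] is an embedding.
*)

(** A saturation [P] is given only by its range: nothing is known beforehand about its dimension,
    and no tubular neighbourhood of [X] is at hand. Hence the upper bound on [dim P] counts points
    through a Lipschitz relation, and injectivity near the zero section has a covering argument of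
    its own.

    [X] need not be compact, so no neighbourhood is given on which flows live for time one. Flows
    are built around single rest points: zero covectors for the spray, points of the zero section
    for Moser's field. They agree on overlaps because the global maps, such as [expmap], are defined
    by choosing an integral curve, and such curves are unique.

    The spray and Moser's field are two cases of one computation, [homotopy_curve]: a base curve
    moves by [pi(theta)] while the bivector itself changes in time by [- P B P]. For the spray
    [theta] is the momentum and [B = 0]; for Moser's field [theta = - alpha] and [B = d alpha].

    Local flows run over times in [[-1, 1]], so that derivatives at the times 0 and 1 are
    two-sided. *)

Section RealField.
Variable R : realType.
Local Notation "''rV_' n" := 'rV[R]_n : type_scope.

(** * Smooth functions on euclidean spaces *)

Section Calculus.

Lemma diff_eps (V W : normedModType R) (f : V -> W) x (L : {linear V -> W}) :
  continuous L ->
  (forall e : R, 0 < e -> \forall y \near x, `|f y - f x - L (y - x)| <= e * `|y - x|) ->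
  differentiable f x /\ 'd f x = L :> (V -> W).
Proof.
move=> cL H.
have E : f \o shift x = cst (f x) + L +o_ (0 : V) id.
  apply/eqaddoP => e e0; rewrite /= !near_simpl.
  have := H _ e0; rewrite (near_shift 0 x) /=; apply: filterS => h /=.
  by rewrite subr0 addrK opprD addrA.
have E' := diff_unique cL E.
by split => //; apply/diff_locallyP; rewrite E'.
Qed.

Lemma diff_epsP (V W : normedModType R) (f : V -> W) x : differentiable f x ->
  forall e : R, 0 < e -> \forall y \near x, `|f y - f x - 'd f x (y - x)| <= e * `|y - x|.
Proof.
move=> /diff_locallyP [_ /eqaddoP H] e e0.
have := H _ e0; rewrite (near_shift 0 x) /= !near_simpl /=.
apply: filterS => h /=.
by rewrite opprD addrA /= subr0 addrK.
Qed.

Lemma near_eq_diff (V W : normedModType R) (f g : V -> W) x :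
  (\forall y \near x, f y = g y) -> differentiable f x -> differentiable g x.
Proof.
move=> fg df.
have [] // := @diff_eps V W g x ('d f x) _ _; first exact: diff_continuous.
move=> e e0; have fgx := nbhs_singleton fg.
near=> y; rewrite -fgx -(_ : f y = g y); first by near: y; apply: diff_epsP.
by near: y.
Unshelve. all: by end_near. Qed.

Section Ck.
Variables (n : nat).
Implicit Types (U : set 'rV_n) (k : nat) (V W Z : normedModType R).

Lemma CkE V k U (f : 'rV_n -> V) : Ck k.+1 U f <->
  (forall x, U x -> differentiable f x) /\ forall v, Ck k U ('D_v f).
Proof. by []. Qed.

Lemma CkS V k U (f : 'rV_n -> V) : Ck k.+1 U f -> Ck k U f.
Proof.
elim: k f => [|k IH] f /CkE [df Df]; first by move=> x /df /differentiable_continuous.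
by apply/CkE; split=> // v; apply: IH.
Qed.

Lemma Ck_sub V k U U' (f : 'rV_n -> V) : U `<=` U' -> Ck k U' f -> Ck k U f.
Proof.
move=> sU; elim: k f => [|k IH] f; first by move=> h x /sU /h.
by move=> /CkE [df Df]; apply/CkE; split=> [x /sU /df//|v]; apply: IH.
Qed.

Lemma Ck_loc V k U (f : 'rV_n -> V) :
  (forall x, U x -> exists2 O : set 'rV_n, O x & Ck k O f) -> Ck k U f.
Proof.
elim: k f => [|k IH] f H; first by move=> x Ux; have [A Ax cA] := H x Ux; exact: cA.
apply/CkE; split=> [x /H [A Ax /CkE[df _]]|v]; first exact: df.
by apply: IH => x /H [A Ax /CkE[_ Df]]; exists A.
Qed.

Lemma Ck_ext V k U (f g : 'rV_n -> V) : open U ->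
  (forall x, U x -> f x = g x) -> Ck k U f -> Ck k U g.
Proof.
move=> oU.
have near_fg (f1 g1 : 'rV_n -> V) x : (forall x, U x -> f1 x = g1 x) -> U x -> \forall y \near x, f1 y = g1 y.
  by move=> fg Ux; near do (apply: fg); exact: open_nbhs_nbhs.
elim: k f g => [|k IH] f g fg.
  move=> cf x Ux; rewrite /prop_for /continuous_at -(fg _ Ux).
  apply: cvg_trans (cf x Ux); apply: (@near_eq_cvg _ _ (nbhs x)); exact: near_fg.
move=> /CkE[df Df]; apply/CkE; split=> [x Ux|v].
  by apply: near_eq_diff (df x Ux); apply: near_fg.
by apply: IH (Df v) => x Ux; apply: near_eq_derive; apply: near_fg.
Unshelve. all: by end_near. Qed.

Lemma Ck_cst V k U (a : V) : Ck k U (fun _ : 'rV_n => a).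
Proof.
elim: k a => [|k IH] a; first by move=> x _; exact: cst_continuous.
apply/CkE; split=> [x _|v]; first exact: differentiable_cst.
by under eq_fun do rewrite derive_cst; apply: IH.
Qed.

Lemma Ck_lin V k U (f : {linear 'rV_n -> V}) : continuous f -> Ck k U f.
Proof.
move=> cf; case: k => [x _|k]; first exact: cf.
apply/CkE; split=> [x _|v]; first exact: linear_differentiable.
have -> : (fun x => 'D_v f x) = fun=> f v.
  by apply/funext => x; rewrite deriveE ?diff_lin//; exact: linear_differentiable.
exact: Ck_cst.
Qed.

Lemma CkD V k U (f g : 'rV_n -> V) : open U ->
  Ck k U f -> Ck k U g -> Ck k U (fun x => f x + g x).
Proof.
move=> oU; elim: k f g => [|k IH] f g.
  by move=> cf cg x Ux; apply: continuousD; [exact: cf|exact: cg].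
move=> /CkE[df Df] /CkE[dg Dg]; apply/CkE; split=> [x Ux|v].
  by apply: differentiableD; [exact: df|exact: dg].
apply: Ck_ext (IH _ _ (Df v) (Dg v)) => // x Ux.
by rewrite -deriveD//; apply: diff_derivable; [exact: df|exact: dg].
Qed.

Lemma Ck_linpost V W k U (L : {linear V -> W}) (f : 'rV_n -> V) : open U -> continuous L ->
  Ck k U f -> Ck k U (fun x => L (f x)).
Proof.
move=> oU cL; elim: k f => [|k IH] f.
  by move=> cf x Ux; apply: continuous_comp; [exact: cf|exact: cL].
move=> /CkE[df Df]; apply/CkE; split=> [x Ux|v].
  by apply: differentiable_comp; [exact: df|exact: linear_differentiable].
apply: Ck_ext (IH _ (Df v)) => // x Ux.
rewrite !deriveE; [|by apply: differentiable_comp; [exact: df|exact: linear_differentiable]|exact: df].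
by rewrite (@diff_comp _ _ _ _ f L) ?diff_lin//=; [exact: df|exact: linear_differentiable].
Qed.

Lemma CkN V k U (f : 'rV_n -> V) : open U ->
  Ck k U f -> Ck k U (fun x => - f x).
Proof. by move=> oU; apply: (@Ck_linpost V V k U -%R) => // x; exact: oppr_continuous. Qed.

Lemma Ck_sum V k U (I : Type) (s : seq I) (P : pred I) (f : I -> 'rV_n -> V) : open U ->
  (forall i, P i -> Ck k U (f i)) -> Ck k U (fun x => \sum_(i <- s | P i) f i x).
Proof.
move=> oU H; elim: s => [|a s IH].
  by under eq_fun do rewrite big_nil; exact: Ck_cst.
rewrite (_ : (fun x => _) = fun x => if P a then f a x + \sum_(i <- s | P i) f i x else \sum_(i <- s | P i) f i x); last by apply/funext => x; rewrite big_cons.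
case Pa : (P a) => //; apply: CkD => //; exact: H.
Qed.

Lemma Ck_coord k U p q (f : 'rV_n -> 'M[R]_(p, q)) i j : open U ->
  Ck k U f -> Ck k U (fun x => f x i j).
Proof.
have @L : {linear 'M[R]_(p, q) -> R}.
  by exists (fun N : 'M[R]_(_, _) => N i j); do 2![eexists]; do ?[constructor];
     rewrite ?mxE// => ? *; rewrite ?mxE//; move=> ?; rewrite !mxE.
move=> oU; apply: (@Ck_linpost _ _ _ _ L) => //; exact: coord_continuous.
Qed.

Lemma CkM k U (f g : 'rV_n -> R) : open U ->
  Ck k U f -> Ck k U g -> Ck k U (fun x => f x * g x).
Proof.
move=> oU; elim: k f g => [|k IH] f g.
  by move=> cf cg x Ux; apply: continuousM; [exact: cf|exact: cg].
move=> cf cg; have /CkE[df Df] := cf; have /CkE[dg Dg] := cg; apply/CkE; split=> [x Ux|v].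
  by apply: differentiableM; [exact: df|exact: dg].
apply: Ck_ext (CkD oU (IH _ _ (CkS cf) (Dg v)) (IH _ _ (CkS cg) (Df v))) => // x Ux.
by rewrite deriveM//; apply: diff_derivable; [exact: df|exact: dg].
Qed.

Lemma CkV k U (f : 'rV_n -> R) : open U -> (forall x, U x -> f x != 0) ->
  Ck k U f -> Ck k U (fun x => (f x)^-1).
Proof.
move=> oU f0; elim: k => [|k IH].
  by move=> cf x Ux; apply: continuousV; [exact: f0|exact: cf].
move=> cf; have /CkE[df Df] := cf; apply/CkE; split=> [x Ux|v].
  by apply: differentiableV; [exact: df|exact: f0].
have cV := IH (CkS cf).
apply: Ck_ext (CkN oU (CkM oU (CkM oU cV cV) (Df v))) => // x Ux.
rewrite deriveV//; [|exact: f0|by apply: diff_derivable; exact: df].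
by rewrite -expr2 exprVn scaleNr.
Qed.

Lemma CkZl V k U (a : 'rV_n -> R) (c : V) : open U ->
  Ck k U a -> Ck k U (fun x => a x *: c).
Proof.
move=> oU; elim: k a => [|k IH] a.
  by move=> ca x Ux; apply: continuousZr_tmp; exact: ca.
move=> /CkE[da Da]; apply/CkE; split=> [x Ux|v].
  by apply: differentiableZl; exact: da.
apply: Ck_ext (IH _ (Da v)) => // x Ux.
have dax := da _ Ux; have dac := differentiableZl c dax.
by rewrite !deriveE ?diffZl.
Qed.

Lemma Ck_mx k U p q (f : 'rV_n -> 'M[R]_(p, q)) : open U ->
  (forall i j, Ck k U (fun x => f x i j)) -> Ck k U f.
Proof.
move=> oU H.
have -> : f = fun x => \sum_i \sum_j f x i j *: delta_mx i j.
  by apply/funext => x; rewrite -matrix_sum_delta.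
by apply: Ck_sum => // i _; apply: Ck_sum => // j _; exact: CkZl.
Qed.

Lemma CkZ k U p q (a : 'rV_n -> R) (f : 'rV_n -> 'M[R]_(p, q)) : open U ->
  Ck k U a -> Ck k U f -> Ck k U (fun x => a x *: f x).
Proof.
move=> oU ca cf; apply: Ck_mx => // i j; under eq_fun do rewrite mxE.
by apply: CkM => //; exact: Ck_coord.
Qed.

Lemma Ck_prod k U (I : Type) (s : seq I) (P : pred I) (f : I -> 'rV_n -> R) : open U ->
  (forall i, P i -> Ck k U (f i)) -> Ck k U (fun x => \prod_(i <- s | P i) f i x).
Proof.
move=> oU H; elim: s => [|a s IH].
  by under eq_fun do rewrite big_nil; exact: Ck_cst.
rewrite (_ : (fun x => _) = fun x => if P a then f a x * \prod_(i <- s | P i) f i x else \prod_(i <- s | P i) f i x); last by apply/funext => x; rewrite big_cons.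
case Pa : (P a) => //; apply: CkM => //; exact: H.
Qed.

Lemma Ck_mulmx k U p q r (f : 'rV_n -> 'M[R]_(p, q)) (g : 'rV_n -> 'M[R]_(q, r)) : open U ->
  Ck k U f -> Ck k U g -> Ck k U (fun x => f x *m g x).
Proof.
move=> oU cf cg; apply: Ck_mx => // i j; under eq_fun do rewrite mxE.
by apply: Ck_sum => // l _; apply: CkM => //; exact: Ck_coord.
Qed.

Lemma Ck_det k U p (f : 'rV_n -> 'M[R]_p) : open U ->
  Ck k U f -> Ck k U (fun x => \det (f x)).
Proof.
move=> oU cf; apply: Ck_sum => // s _; apply: CkM => //; first exact: Ck_cst.
by apply: Ck_prod => // i _; exact: Ck_coord.
Qed.

Lemma Ck_adj k U p (f : 'rV_n -> 'M[R]_p) : open U ->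
  Ck k U f -> Ck k U (fun x => \adj (f x)).
Proof.
move=> oU cf; apply: Ck_mx => // i j; under eq_fun do rewrite mxE.
apply: CkM => //; first exact: Ck_cst.
apply: Ck_det => //; apply: Ck_mx => // a b.
by under eq_fun do rewrite !mxE; exact: Ck_coord.
Qed.

Lemma Ck_invmx k U p (f : 'rV_n -> 'M[R]_p) : open U -> (forall x, U x -> f x \in unitmx) ->
  Ck k U f -> Ck k U (fun x => invmx (f x)).
Proof.
move=> oU uf cf.
apply: (@Ck_ext _ _ _ (fun x => (\det (f x))^-1 *: \adj (f x))) => //.
  by move=> x Ux; rewrite /invmx uf.
apply: CkZ => //; last exact: Ck_adj.
apply: CkV => //; last exact: Ck_det.
by move=> x /uf; rewrite unitmxE unitfE.
Qed.

Lemma Ck_id k U : Ck k U (fun x : 'rV_n => x).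
Proof. by apply: (Ck_lin k U (f := idfun)) => x; exact: cvg_id. Qed.
End Ck.

Lemma rV_sum_delta n (x : 'rV_n) : x = \sum_i x 0 i *: delta_mx 0 i.
Proof. by rewrite {1}(row_sum_delta x). Qed.

Lemma derive_coord_sum (V : normedModType R) n (g : 'rV_n -> V) x v : differentiable g x ->
  'D_v g x = \sum_i v 0 i *: 'D_(delta_mx 0 i) g x.
Proof.
move=> dg; rewrite deriveE// {1}(rV_sum_delta v) linear_sum.
by apply: eq_bigr => i _; rewrite linearZ/= deriveE.
Qed.

Lemma derive_comp (V : normedModType R) n p (f : 'rV_n -> 'rV_p) (g : 'rV_p -> V) x v :
  differentiable f x -> differentiable g (f x) ->
  'D_v (g \o f) x = 'D_('D_v f x) g (f x).
Proof.
move=> df dg; rewrite !deriveE//; last exact: differentiable_comp.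
by rewrite diff_comp.
Qed.

(** The induction closes because a derivative of [g \o f] is a sum of coordinates of ['D_v f], each
    times a partial derivative of [g] composed with [f]. *)
Lemma Ck_comp_vec n p q (q' : nat) k (U : set 'rV_n) (U' : set 'rV_p) (f : 'rV_n -> 'rV_p) (g : 'rV_p -> 'M[R]_(q, q')) :
  open U -> (forall x, U x -> U' (f x)) ->
  Ck k U f -> Ck k U' g -> Ck k U (g \o f).
Proof.
move=> oU UU'; elim: k g => [|k IH] g.
  by move=> cf cg x Ux; apply: continuous_comp; [exact: cf|apply: cg; exact: UU'].
move=> cf /CkE[dg Dg]; have /CkE[df Df] := cf; apply/CkE; split=> [x Ux|v].
  by apply: differentiable_comp; [exact: df|apply: dg; exact: UU'].
have H : Ck k U (fun x => \sum_i ('D_v f x) 0 i *: ('D_(delta_mx 0 i) g \o f) x).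
  apply: Ck_sum => // i _; apply: CkZ => //; first exact: Ck_coord.
  by apply: IH (Dg _) => //; exact: CkS.
apply: Ck_ext H => // x Ux.
have dfx := df _ Ux; have dgx := dg _ (UU' _ Ux).
by rewrite (derive_comp _ dfx dgx) (derive_coord_sum _ dgx).
Qed.
End Calculus.

Lemma near_open (T : topologicalType) (x : T) (P : T -> Prop) : (\forall y \near x, P y) ->
  exists2 U : set T, open_nbhs x U & forall y, U y -> P y.
Proof. by rewrite /prop_near1 nbhsE => -[U oU H]; exists U. Qed.

(** * Smoothness at a point *)

Section SmoothAt.

(** Smoothness on some neighbourhood, so that the property passes to derivatives and to nearby
    points without an open set being carried along. *)
Definition smooth_at n (V : normedModType R) (x : 'rV_n) (f : 'rV_n -> V) : Prop :=
  exists2 U, open_nbhs x U & Cinfty U f.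

Section SmoothClosure.
Variable n : nat.
Implicit Types (x : 'rV_n) (V W Z : normedModType R).

Lemma sm_lift1 V W x (f : 'rV_n -> V) (g : 'rV_n -> W) :
  (forall k U, open U -> Ck k U f -> Ck k U g) -> smooth_at x f -> smooth_at x g.
Proof. by move=> H [U [oU Ux] cf]; exists U => // k; exact: H. Qed.

Lemma sm_lift2 V W Z x (f : 'rV_n -> V) (h : 'rV_n -> Z) (g : 'rV_n -> W) :
  (forall k U, open U -> Ck k U f -> Ck k U h -> Ck k U g) -> smooth_at x f -> smooth_at x h -> smooth_at x g.
Proof.
move=> H [U [oU Ux] cf] [U' [oU' Ux'] ch]; exists (U `&` U').
  by split=> //; exact: openI.
have oUU := openI oU oU'.
move=> k; apply: H => //; [apply: Ck_sub (cf k)|apply: Ck_sub (ch k)]; by move=> y [].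
Qed.

Lemma sm_cst V x (a : V) : smooth_at x (fun=> a).
Proof. by exists setT => [|k]; [split=> //; exact: openT|exact: Ck_cst]. Qed.

Lemma sm_id x : smooth_at x id.
Proof. by exists setT => [|k]; [split=> //; exact: openT|exact: Ck_id]. Qed.

Lemma sm_ext V x (f g : 'rV_n -> V) : (\forall y \near x, f y = g y) -> smooth_at x f -> smooth_at x g.
Proof.
move=> /near_open [U [oU Ux] fg] [U' [oU' Ux'] cf]; exists (U `&` U').
  by split=> //; exact: openI.
move=> k; apply: (@Ck_ext _ _ _ _ f); first exact: openI.
  by move=> y [Uy _]; exact: fg.
by apply: Ck_sub (cf k) => y [].
Qed.

Lemma sm_near V x (f : 'rV_n -> V) : smooth_at x f -> \forall y \near x, smooth_at y f.
Proof.
move=> [U [oU Ux] cf]; have := open_nbhs_nbhs (conj oU Ux).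
by apply: filterS => y Uy; exists U.
Qed.

Lemma sm_diff V x (f : 'rV_n -> V) : smooth_at x f -> differentiable f x.
Proof. by move=> [U [oU Ux] cf]; have /CkE[+ _] := cf 1%N; exact. Qed.

Lemma sm_cont V x (f : 'rV_n -> V) : smooth_at x f -> {for x, continuous f}.
Proof. by move=> /sm_diff /differentiable_continuous. Qed.

Lemma sm_der V x (f : 'rV_n -> V) v : smooth_at x f -> smooth_at x ('D_v f).
Proof. by move=> [U oU cf]; exists U => // k; have /CkE[_] := cf k.+1. Qed.

Lemma smD V x (f g : 'rV_n -> V) : smooth_at x f -> smooth_at x g -> smooth_at x (fun y => f y + g y).
Proof. by apply: sm_lift2 => k U; exact: CkD. Qed.

Lemma smN V x (f : 'rV_n -> V) : smooth_at x f -> smooth_at x (fun y => - f y).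
Proof. by apply: sm_lift1 => k U; exact: CkN. Qed.

Lemma smB V x (f g : 'rV_n -> V) : smooth_at x f -> smooth_at x g -> smooth_at x (fun y => f y - g y).
Proof. by move=> sf sg; apply: smD => //; exact: smN. Qed.

Lemma smM x (f g : 'rV_n -> R) : smooth_at x f -> smooth_at x g -> smooth_at x (fun y => f y * g y).
Proof. by apply: sm_lift2 => k U; exact: CkM. Qed.

Lemma sm_sum V x (I : Type) (s : seq I) (P : pred I) (f : I -> 'rV_n -> V) :
  (forall i, P i -> smooth_at x (f i)) -> smooth_at x (fun y => \sum_(i <- s | P i) f i y).
Proof.
move=> H; elim: s => [|a s IH].
  by under eq_fun do rewrite big_nil; exact: sm_cst.
rewrite (_ : (fun x => _) = fun x => if P a then f a x + \sum_(i <- s | P i) f i x else \sum_(i <- s | P i) f i x); last by apply/funext => y; rewrite big_cons.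
by case Pa : (P a) => //; apply: smD => //; exact: H.
Qed.

Lemma smZ p q x (a : 'rV_n -> R) (f : 'rV_n -> 'M[R]_(p, q)) :
  smooth_at x a -> smooth_at x f -> smooth_at x (fun y => a y *: f y).
Proof. by apply: sm_lift2 => k U; exact: CkZ. Qed.

Lemma sm_mulmx p q r x (f : 'rV_n -> 'M[R]_(p, q)) (g : 'rV_n -> 'M[R]_(q, r)) :
  smooth_at x f -> smooth_at x g -> smooth_at x (fun y => f y *m g y).
Proof. by apply: sm_lift2 => k U; exact: Ck_mulmx. Qed.

Lemma sm_coord p q x (f : 'rV_n -> 'M[R]_(p, q)) i j :
  smooth_at x f -> smooth_at x (fun y => f y i j).
Proof. by apply: sm_lift1 => k U; exact: Ck_coord. Qed.

Lemma sm_mx p q x (f : 'rV_n -> 'M[R]_(p, q)) :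
  (forall i j, smooth_at x (fun y => f y i j)) -> smooth_at x f.
Proof.
move=> H; have -> : f = fun x => \sum_i \sum_j f x i j *: delta_mx i j.
  by apply/funext => y; rewrite -matrix_sum_delta.
by apply: sm_sum => i _; apply: sm_sum => j _; apply: smZ => //; exact: sm_cst.
Qed.

Lemma near_unitmx p x (f : 'rV_n -> 'M[R]_p) : smooth_at x f -> f x \in unitmx ->
  \forall y \near x, f y \in unitmx.
Proof.
move=> [U [oU Ux] cf] ux.
have sd : smooth_at x (fun y => \det (f y)) by exists U => // k; exact: Ck_det.
have H : nbhs (\det (f x)) [set z : R | z != 0].
  apply: open_nbhs_nbhs; split; first exact: open_neq.
  by move: ux; rewrite unitmxE unitfE.
have : \forall y \near x, \det (f y) != 0 by exact: (sm_cont sd H).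
by apply: filterS => y; rewrite unitmxE unitfE.
Qed.

Lemma sm_invmx p x (f : 'rV_n -> 'M[R]_p) : f x \in unitmx ->
  smooth_at x f -> smooth_at x (fun y => invmx (f y)).
Proof.
move=> ux sf; have [U [oU Ux] cf] := sf.
have /near_open [U' [oU' Ux'] H] := near_unitmx sf ux.
exists (U `&` U'); first by split => //; exact: openI.
move=> k; apply: Ck_invmx; [exact: openI|by move=> y [_] /H|].
by apply: Ck_sub (cf k) => y [].
Qed.

Lemma sm_tr p q x (f : 'rV_n -> 'M[R]_(p, q)) : smooth_at x f -> smooth_at x (fun y => (f y)^T).
Proof. by move=> sf; apply: sm_mx => i j; under eq_fun do rewrite mxE; exact: sm_coord. Qed.

Lemma sm_row_mx p q1 q2 x (f : 'rV_n -> 'M[R]_(p, q1)) (g : 'rV_n -> 'M[R]_(p, q2)) :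
  smooth_at x f -> smooth_at x g -> smooth_at x (fun y => row_mx (f y) (g y)).
Proof.
move=> sf sg; apply: sm_mx => i j; under eq_fun do rewrite mxE.
by case: splitP => l _; exact: sm_coord.
Qed.

Lemma sm_col_mx p1 p2 q x (f : 'rV_n -> 'M[R]_(p1, q)) (g : 'rV_n -> 'M[R]_(p2, q)) :
  smooth_at x f -> smooth_at x g -> smooth_at x (fun y => col_mx (f y) (g y)).
Proof.
move=> sf sg; apply: sm_mx => i j; under eq_fun do rewrite mxE.
by case: splitP => l _; exact: sm_coord.
Qed.

Lemma sm_lsub p q1 q2 x (f : 'rV_n -> 'M[R]_(p, q1 + q2)) : smooth_at x f -> smooth_at x (fun y => lsubmx (f y)).
Proof. by move=> sf; apply: sm_mx => i j; under eq_fun do rewrite mxE; exact: sm_coord. Qed.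

Lemma sm_rsub p q1 q2 x (f : 'rV_n -> 'M[R]_(p, q1 + q2)) : smooth_at x f -> smooth_at x (fun y => rsubmx (f y)).
Proof. by move=> sf; apply: sm_mx => i j; under eq_fun do rewrite mxE; exact: sm_coord. Qed.
End SmoothClosure.

Lemma sm_comp n p q q' (x : 'rV_n) (f : 'rV_n -> 'rV_p) (g : 'rV_p -> 'M[R]_(q, q')) :
  smooth_at x f -> smooth_at (f x) g -> smooth_at x (fun y => g (f y)).
Proof.
move=> sf [U' [oU' Ux'] cg]; have [U [oU Ux] cf] := sf.
have : \forall y \near x, U' (f y) by apply: (sm_cont sf); exact: open_nbhs_nbhs.
move=> /near_open [A [oA Ax] AU]; exists (U `&` A); first by split=> //; exact: openI.
move=> k; apply: (@Ck_comp_vec _ _ _ _ _ _ U' f g); [exact: openI|by move=> y [_ /AU]| |exact: cg].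
by apply: Ck_sub (cf k) => y [].
Qed.

Lemma sm_CinftyP n (V : normedModType R) (U : set 'rV_n) (f : 'rV_n -> V) : 
  (forall x, U x -> smooth_at x f) -> Cinfty U f.
Proof. by move=> H k; apply: Ck_loc => x /H [A [oA Ax] cA]; exists A. Qed.

Lemma Cinfty_sm n (V : normedModType R) (U : set 'rV_n) (f : 'rV_n -> V) : open U ->
  Cinfty U f -> forall x, U x -> smooth_at x f.
Proof. by move=> oU H x Ux; exists U. Qed.

Lemma row_jac n p (x : 'rV_n) (f : 'rV_n -> 'rV_p) i : differentiable f x ->
  row i (jacobian f x) = 'D_(delta_mx 0 i) f x.
Proof. by move=> df; rewrite rowE -(deriveEjacobian (delta_mx 0 i) df). Qed.

Lemma jacE n p (x : 'rV_n) (f : 'rV_n -> 'rV_p) i j : differentiable f x ->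
  jacobian f x i j = ('D_(delta_mx 0 i) f x) 0 j.
Proof. by move=> df; rewrite -(row_jac _ df) [RHS]mxE. Qed.

Lemma derive_mulE n p (x : 'rV_n) (f : 'rV_n -> 'rV_p) v : differentiable f x ->
  'D_v f x = v *m jacobian f x.
Proof. exact: deriveEjacobian. Qed.

Lemma sm_jac n p (x : 'rV_n) (f : 'rV_n -> 'rV_p) : smooth_at x f -> smooth_at x (jacobian f).
Proof.
move=> sf; apply: sm_mx => i j.
have : smooth_at x (fun y => ('D_(delta_mx 0 i) f y) 0 j) by apply: sm_coord; exact: sm_der.
apply: sm_ext; near=> y; rewrite jacE//.
by apply: sm_diff; near: y; exact: sm_near.
Unshelve. all: by end_near. Qed.

Lemma jac_comp n p q (x : 'rV_n) (f : 'rV_n -> 'rV_p) (g : 'rV_p -> 'rV_q) :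
  differentiable f x -> differentiable g (f x) ->
  jacobian (fun y => g (f y)) x = jacobian f x *m jacobian g (f x).
Proof.
move=> df dg; apply/row_matrixP => i.
have dgf : differentiable (fun y => g (f y)) x by exact: differentiable_comp.
rewrite row_jac// row_mul row_jac//.
by rewrite -(derive_mulE _ dg); exact: (derive_comp _ df dg).
Qed.

Lemma jac_id n (x : 'rV_n) : jacobian id x = 1%:M.
Proof.
apply/row_matrixP => i; rewrite row_jac; last exact: (sm_diff (sm_id x)).
by rewrite derive_id rowE mulmx1.
Qed.

Lemma jac_near n p (x : 'rV_n) (f g : 'rV_n -> 'rV_p) :
  (\forall y \near x, f y = g y) -> differentiable f x -> jacobian f x = jacobian g x.
Proof.
move=> fg df; have dg := near_eq_diff fg df.
apply/row_matrixP => i; apply: eq_trans (row_jac i df) _.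
apply: eq_trans (esym (row_jac i dg)).
exact: (@near_eq_derive R _ _ f g x (delta_mx 0 i) fg).
Qed.
End SmoothAt.

(** * Ordinary differential equations and flows *)

Section DirectionalDerivatives.
Variables (V : normedModType R).

Lemma isd_coord p q (u : V -> 'M[R]_(p, q)) (x v : V) (d : 'M[R]_(p, q)) i j :
  is_derive x v u d -> is_derive x v (fun s => u s i j) (d i j).
Proof.
move=> [du <-]; apply: DeriveDef; first by have /derivable_mxP := du.
by rewrite derive_mx// mxE.
Qed.

Lemma isd_mx p q (u : V -> 'M[R]_(p, q)) (x v : V) (d : 'M[R]_(p, q)) :
  (forall i j, is_derive x v (fun s => u s i j) (d i j)) -> is_derive x v u d.
Proof.
move=> H; have du : derivable u x v by apply/derivable_mxP => i j; have [] := H i j.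
apply: DeriveDef => //; rewrite derive_mx//; apply/matrixP => i j; rewrite mxE.
by have [_ ] := H i j.
Qed.

Lemma isd_mulmx p q r (f : V -> 'M[R]_(p, q)) (g : V -> 'M[R]_(q, r)) (x v : V) (df : 'M[R]_(p, q)) (dg : 'M[R]_(q, r)) :
  is_derive x v f df -> is_derive x v g dg ->
  is_derive x v (fun s => f s *m g s) (df *m g x + f x *m dg).
Proof.
move=> hf hg; apply: isd_mx => i j.
rewrite (_ : (fun s => _) = \sum_l ((fun s => f s i l) * (fun s => g s l j))); last first.
  by apply/funext => s; rewrite fct_sumE mxE.
have -> : (df *m g x + f x *m dg) i j = \sum_l (f x i l *: dg l j + g x l j *: df i l).
  rewrite !mxE -big_split; apply: eq_bigr => l _ /=.
  by rewrite /GRing.scale/= addrC [df i l * _]mulrC.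
apply: is_derive_sum => l.
exact: (is_deriveM (isd_coord i l hf) (isd_coord l j hg)).
Qed.

Lemma isd_tr p q (f : V -> 'M[R]_(p, q)) (x v : V) (df : 'M[R]_(p, q)) :
  is_derive x v f df -> is_derive x v (fun s => (f s)^T) df^T.
Proof.
move=> hf; apply: isd_mx => i j; rewrite mxE.
rewrite (_ : (fun s => _) = (fun s => f s j i)); first exact: isd_coord.
by apply/funext => s; rewrite mxE.
Qed.

Lemma isd_row_mx p q1 q2 (u : V -> 'M[R]_(p, q1)) (w : V -> 'M[R]_(p, q2)) (x v : V) (du : 'M[R]_(p, q1)) (dw : 'M[R]_(p, q2)) :
  is_derive x v u du -> is_derive x v w dw -> is_derive x v (fun s => row_mx (u s) (w s)) (row_mx du dw).
Proof.
move=> hu hw; apply: isd_mx => i j; rewrite mxE.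
rewrite (_ : (fun s => _) = fun s => match fintype.split j with inl l => u s i l | inr l => w s i l end); last first.
  by apply/funext => s; rewrite mxE.
by case: (fintype.split j) => l; exact: isd_coord.
Qed.

Lemma isd_lsub p q1 q2 (u : V -> 'M[R]_(p, q1 + q2)) (x v : V) (d : 'M[R]_(p, q1 + q2)) :
  is_derive x v u d -> is_derive x v (fun s => lsubmx (u s)) (lsubmx d).
Proof.
move=> h; apply: isd_mx => i j; rewrite mxE.
rewrite (_ : (fun s => _) = (fun s => u s i (lshift q2 j))); first exact: isd_coord.
by apply/funext => s; rewrite mxE.
Qed.

Lemma isd_rsub p q1 q2 (u : V -> 'M[R]_(p, q1 + q2)) (x v : V) (d : 'M[R]_(p, q1 + q2)) :
  is_derive x v u d -> is_derive x v (fun s => rsubmx (u s)) (rsubmx d).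
Proof.
move=> h; apply: isd_mx => i j; rewrite mxE.
rewrite (_ : (fun s => _) = (fun s => u s i (rshift q1 j))); first exact: isd_coord.
by apply/funext => s; rewrite mxE.
Qed.

Lemma is_derive_chain (W : normedModType R) (f : V -> W) (u : R -> V) (t : R) (d : V) :
  is_derive t 1 u d -> differentiable f (u t) -> is_derive t 1 (fun s : R => f (u s)) ('D_d f (u t)).
Proof.
move=> [/derivable1_diffP du <-] df.
have dc : differentiable (fun s => f (u s)) t by exact: (differentiable_comp du df).
apply: DeriveDef; first exact: diff_derivable.
rewrite (deriveE (1 : R) dc) (deriveE _ df) (deriveE (1 : R) du).
have E := congr1 (fun L : R -> W => L 1) (diff_comp du df); exact: E.
Qed.

Lemma is_derive_line (W : normedModType R) (g : V -> W) (y v : V) (s : R) : differentiable g (y + s *: v) ->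
  is_derive s 1 (fun s : R => g (y + s *: v)) ('D_v g (y + s *: v)).
Proof.
move=> dg; apply: (is_derive_chain (u := fun s : R => y + s *: v)) dg.
have := is_diffD (is_diff_cst y s) (is_diff_scalel s v); rewrite add0r => -[df E].
by apply: DeriveDef; [exact: diff_derivable|rewrite deriveE// E scale1r].
Qed.
End DirectionalDerivatives.

(** * Mean value estimates, Gronwall's inequality, Picard iteration *)

Section Curves.

Lemma mx_norm_le p q (A : 'M[R]_(p, q)) (c : R) : 0 <= c ->
  (forall i j, `|A i j| <= c) -> `|A| <= c.
Proof.
by move=> c0 H; rewrite /Num.Def.normr/= mx_normrE (bigmax_le _ c0)//= => i _.
Qed.

Lemma mx_coord_le p q (A : 'M[R]_(p, q)) i j : `|A i j| <= `|A|.
Proof.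
rewrite [leRHS]/Num.Def.normr/= mx_normrE.
exact: (le_bigmax _ (fun i : 'I_p * 'I_q => `|A i.1 i.2|) (i, j)).
Qed.

Lemma mulmx_norm p q r (A : 'M[R]_(p, q)) (B : 'M[R]_(q, r)) :
  `|A *m B| <= q%:R * `|A| * `|B|.
Proof.
apply: mx_norm_le => [|i j]; first by rewrite !mulr_ge0.
rewrite mxE (le_trans (ler_norm_sum _ _ _))//.
have -> : q%:R * `|A| * `|B| = \sum_(l < q) `|A| * `|B|.
  by rewrite sumr_const card_ord -mulrA mulr_natl.
by apply: ler_sum => l _; rewrite normrM ler_pM// mx_coord_le.
Qed.

Lemma is_derive_cont (V : normedModType R) (u : R -> V) (t : R) d :
  is_derive t 1 u d -> {for t, continuous u}.
Proof. by move=> [/derivable1_diffP du _]; exact: differentiable_continuous. Qed.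

Lemma is_derive_within (V : normedModType R) (u : R -> V) (du : R -> V) (a b : R) :
  (forall t, a <= t <= b -> is_derive t 1 u (du t)) -> {within `[a, b], continuous u}.
Proof.
move=> H; apply: derivable_within_continuous => t; rewrite in_itv/= => /H.
by case.
Qed.

Lemma derive_nondecr (f df : R -> R) (a b : R) : a <= b ->
  (forall t, a <= t <= b -> is_derive t 1 f (df t)) ->
  (forall t, a <= t <= b -> 0 <= df t) -> f a <= f b.
Proof.
move=> ab df1 df0.
have [|c cab E] := @MVT_segment R f df a b ab _ (is_derive_within df1).
  by move=> t; rewrite in_itv/= => /andP[at_ tb]; apply: df1; rewrite !ltW.
by rewrite -subr_ge0 E mulr_ge0 ?subr_ge0// df0.
Qed.

(** The norm is the maximum of the entries, and each entry of [u], with either sign, plus [h] is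
    nondecreasing. *)
Lemma derive_compare p q (u du : R -> 'M[R]_(p, q)) (h dh : R -> R) (a b : R) : a <= b ->
  (forall t, a <= t <= b -> is_derive t 1 u (du t)) ->
  (forall t, a <= t <= b -> is_derive t 1 h (dh t)) ->
  (forall t, a <= t <= b -> `|du t| <= dh t) -> `|u b - u a| <= h b - h a.
Proof.
move=> ab Hu Hh H.
have dh0 t : a <= t <= b -> 0 <= dh t by move=> tab; apply: le_trans (H t tab).
have hab := derive_nondecr ab Hh dh0.
apply: mx_norm_le => [|i j]; first by rewrite subr_ge0.
have C t : a <= t <= b -> `|du t i j| <= dh t.
  by move=> tab; apply: le_trans (H t tab); exact: mx_coord_le.
rewrite !mxE ler_norml; apply/andP; split.
- have := @derive_nondecr (fun t => u t i j + h t) (fun t => du t i j + dh t) a b ab.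
  have D t : a <= t <= b -> is_derive t 1 (fun t => u t i j + h t) (du t i j + dh t).
    by move=> tab; apply: is_deriveD; [exact: isd_coord (Hu _ tab)|exact: Hh].
  move=> /(_ D) E; have {E}/E : forall t, a <= t <= b -> 0 <= du t i j + dh t.
    by move=> t /C; rewrite ler_norml => /andP[? ?]; lra.
  by lra.
- have := @derive_nondecr (fun t => h t - u t i j) (fun t => dh t - du t i j) a b ab.
  have D t : a <= t <= b -> is_derive t 1 (fun t => h t - u t i j) (dh t - du t i j).
    by move=> tab; apply: is_deriveB; [exact: Hh|exact: isd_coord (Hu _ tab)].
  move=> /(_ D) E; have {E}/E : forall t, a <= t <= b -> 0 <= dh t - du t i j.
    by move=> t /C; rewrite ler_norml => /andP[? ?]; lra.
  by lra.
Qed.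

Lemma is_derive_linc (c t : R) : is_derive t 1 (fun s : R => c * s) c.
Proof.
have -> : (fun s : R => c * s) = c *: (id : R -> R) by [].
by apply: is_derive_eq; rewrite /GRing.scale/= mulr1.
Qed.

Lemma vec_mean_value p q (u du : R -> 'M[R]_(p, q)) (a b C : R) : a <= b ->
  (forall t, a <= t <= b -> is_derive t 1 u (du t)) ->
  (forall t, a <= t <= b -> `|du t| <= C) -> `|u b - u a| <= C * (b - a).
Proof.
move=> ab Hu HC; rewrite mulrBr.
exact: (@derive_compare p q u du (fun s => C * s) (fun=> C) a b ab Hu (fun t _ => is_derive_linc C t) HC).
Qed.

Lemma derive0_const p q (u : R -> 'M[R]_(p, q)) (a b : R) : a <= b ->
  (forall t, a <= t <= b -> is_derive t 1 u 0) -> u b = u a.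
Proof.
move=> ab H; apply/eqP; rewrite -subr_eq0 -normr_le0 -(mul0r (b - a)).
by apply: (@vec_mean_value p q u (fun=> 0) a b 0 ab H) => t _; rewrite normr0.
Qed.

Lemma is_derive_expc (c t : R) : is_derive t 1 (fun s : R => expR (c * s)) (c * expR (c * t)).
Proof.
have h := is_derive_linc c t.
have -> : (fun s : R => expR (c * s)) = expR \o (fun s => c * s) by [].
by apply: is_derive_eq; rewrite mulrC.
Qed.

(** After weighting by [expR (- 2 (K + 1) t)], the increment of [u] up to the point of maximum is at
    most half of that maximum and can be absorbed; the factor 2 in the conclusion is the price.
    Adding [e] to the norm lets one bound serve both the homogeneous and the perturbed
    inequality. *)
Lemma gronwall p q (u du : R -> 'M[R]_(p, q)) (T K e : R) : 0 <= T -> 0 <= K -> 0 <= e ->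
  (forall t, 0 <= t <= T -> is_derive t 1 u (du t)) ->
  (forall t, 0 <= t <= T -> `|du t| <= K * `|u t| + e) ->
  `|u T| + e <= 2 * (`|u 0| + e) * expR (2 * (K + 1) * T).
Proof.
move=> T0 K0 e0 Hu HK.
pose c := K + 1; pose g (t : R) : R := (`|u t| + e) * expR (- (2 * c) * t).
have cg : {within `[0, T], continuous g}.
  have cu := is_derive_within Hu.
  have cw : {within `[0, T], continuous (fun t => `|u t| + e)}.
    move=> t; apply: cvgD; last exact: cvg_cst.
    by apply: cvg_norm; exact: cu.
  have ce : {within `[0, T], continuous (fun t => expR (- (2 * c) * t))}.
    apply: continuous_subspaceT => t.
    exact: is_derive_cont (is_derive_expc _ t).
  by move=> t; apply: cvgM; [exact: cw|exact: ce].
have [t tT tmax] := EVT_max T0 cg.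
have {tT} /andP[t0 tT] : 0 <= t <= T by move: tT; rewrite in_itv.
have gE s : `|u s| + e = g s * expR (2 * c * s).
  rewrite /g -[X in _ = X]mulrA -[X in _ * X]expRD (_ : - (2 * c) * s + 2 * c * s = 0); first by rewrite expR0 mulr1.
  by ring.
have g0 : 0 <= g t by rewrite mulr_ge0 ?addr_ge0// expR_ge0.
have H : `|u t - u 0| <= g t / 2 * expR (2 * c * t) - g t / 2 * expR (2 * c * 0).
  apply: (@derive_compare p q u du (fun s => g t / 2 * expR (2 * c * s))
    (fun s => g t * c * expR (2 * c * s)) 0 t) => //.
  - by move=> s /andP[s0 st]; apply: Hu; rewrite s0 (le_trans st).
  - move=> s _; have h := is_derive_expc (2 * c) s.
    have -> : (fun s => g t / 2 * expR (2 * c * s)) = (g t / 2) *: (fun s => expR (2 * c * s)) by [].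
    by apply: is_derive_eq; rewrite /GRing.scale/=; field.
  - move=> s /andP[s0 st]; have sT : 0 <= s <= T by rewrite s0 (le_trans st).
    have gs : g s <= g t by apply: tmax; rewrite in_itv.
    apply: le_trans (HK s sT) _.
    have : K * `|u s| + e <= c * (`|u s| + e).
      by rewrite /c; have := mulr_ge0 K0 e0; have := normr_ge0 (u s); nra.
    move=> /le_trans; apply.
    have -> : g t * c * expR (2 * c * s) = c * (g t * expR (2 * c * s)) by ring.
    apply: ler_wpM2l; first by rewrite addr_ge0.
    by rewrite gE; apply: ler_wpM2r => //; exact: expR_ge0.
have E1 : 1 <= expR (2 * c * t) by rewrite -expR0 ler_expR !mulr_ge0// addr_ge0.
have gt2 : g t <= 2 * (`|u 0| + e).
  have h1 : `|u t| <= `|u 0| + `|u t - u 0|.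
    by rewrite -[in leLHS](subrK (u 0) (u t)) addrC ler_normD.
  move: H; rewrite mulr0 expR0 mulr1 => H.
  have := gE t; have := normr_ge0 (u 0); nra.
rewrite gE -/c; apply: ler_wpM2r; first exact: expR_ge0.
by apply: le_trans gt2; apply: tmax; rewrite in_itv/= T0 lexx.
Qed.

Local Notation mu := (@lebesgue_measure R).

Lemma primitive_R (g : R -> R) (T : R) : 0 < T -> continuous g ->
  exists G : R -> R, forall t, - T < t < T -> is_derive t 1 G (g t).
Proof.
move=> T0 cg.
exists (fun x => \int[mu]_(t in `[- T, x]) g t)%R => t /andP[Tt tT].
have ig : mu.-integrable `[- T, T] (EFin \o g).
  apply: continuous_compact_integrable; first exact: segment_compact.
  exact: continuous_subspaceT.
have [H1 H2] := @continuous_FTC1_closed R g (- T) t T tT ig Tt (cg t).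
by rewrite -H2 derive1E; exact: (DeriveDef H1 erefl).
Qed.

Lemma primitive p q (g : R -> 'M[R]_(p, q)) (T : R) : 0 < T -> continuous g ->
  exists G : R -> 'M[R]_(p, q), forall t, - T < t < T -> is_derive t 1 G (g t).
Proof.
move=> T0 cg.
have H (ij : 'I_p * 'I_q) : exists G : R -> R, forall t, - T < t < T -> is_derive t 1 G (g t ij.1 ij.2).
  apply: primitive_R => // t.
  apply: (@continuous_comp _ _ _ g (fun N : 'M[R]_(p,q) => N ij.1 ij.2)); [exact: cg|exact: coord_continuous].
exists (fun t => \matrix_(i, j) (projT1 (cid (H (i, j)))) t) => t tT.
apply: isd_mx => i j; under eq_fun do rewrite mxE.
by have := projT2 (cid (H (i, j))); exact.
Qed.

Lemma is_derive_comp1 (V : normedModType R) (u : R -> V) (h : R -> R) (t : R) (d : V) (dh : R) :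
  is_derive t 1 h dh -> is_derive (h t) 1 u d -> is_derive t 1 (fun s => u (h s)) (dh *: d).
Proof.
move=> hh [/derivable1_diffP Du <-]; have := is_derive_chain hh Du.
by rewrite !deriveE// -[in 'd _ _ dh](mulr1 dh) -[dh * 1]/(dh *: 1) linearZ.
Qed.

Lemma is_derive_opp_arg (V : normedModType R) (u : R -> V) (t : R) (d : V) :
  is_derive (- t) 1 u d -> is_derive t 1 (fun s => u (- s)) (- d).
Proof. by move=> du; rewrite -scaleN1r; exact: (@is_derive_comp1 V u (fun s => - s)). Qed.

Lemma is_deriveDc p q (u : R -> 'M[R]_(p, q)) (t : R) (d c : 'M[R]_(p, q)) :
  is_derive t 1 u d -> is_derive t 1 (fun s => c + u s) d.
Proof.
move=> h; have := is_deriveD (is_derive_cst c t 1) h.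
by rewrite add0r.
Qed.

Lemma vec_mean_value0 p q (v dv : R -> 'M[R]_(p, q)) (C T : R) :
  v 0 = 0 -> (forall t : R, `|t| <= T -> is_derive t 1 v (dv t)) ->
  (forall t : R, `|t| <= T -> `|dv t| <= C) ->
  forall t : R, `|t| <= T -> `|v t| <= C * `|t|.
Proof.
move=> v0 Hv HC t tT; have [t0|t0] := leP 0 t.
  rewrite ger0_norm// -[v t]subr0 -v0 -[X in C * X]subr0.
  by apply: (@vec_mean_value p q v dv) => // s /andP[s0 st]; [apply: Hv|apply: HC];
    rewrite ger0_norm// (le_trans st)// -(ger0_norm t0).
rewrite ltr0_norm// -[v t]opprK normrN -sub0r -v0 -[X in C * X]sub0r.
apply: (@vec_mean_value p q v dv) => // [|s /andP[ts s0]|s /andP[ts s0]]; first exact: ltW.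
  by apply: Hv; rewrite ler0_norm// (le_trans _ tT)// ltr0_norm// lerN2.
by apply: HC; rewrite ler0_norm// (le_trans _ tT)// ltr0_norm// lerN2.
Qed.

Lemma primitive_global p q (g : R -> 'M[R]_(p, q)) : continuous g ->
  exists G : R -> 'M[R]_(p, q), G 0 = 0 /\ forall t : R, is_derive t 1 G (g t).
Proof.
move=> cg.
have H (k : nat) : exists G : R -> 'M[R]_(p, q), G 0 = 0 /\
    forall t : R, - k.+1%:R < t < k.+1%:R -> is_derive t 1 G (g t).
  have k0 : (0 : R) < k.+1%:R by rewrite ltr0n.
  have [G HG] := primitive k0 cg.
  exists (fun t => - G 0 + G t); split; first by rewrite addNr.
  by move=> t /HG; exact: is_deriveDc.
pose G k := projT1 (cid (H k)).
have G0 k : G k 0 = 0 by have [] := projT2 (cid (H k)).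
have dG k (t : R) : - k.+1%:R < t < k.+1%:R -> is_derive t 1 (G k) (g t).
  by have [_] := projT2 (cid (H k)); exact.
have diff0 k l (t : R) : `|t| < k.+1%:R -> `|t| < l.+1%:R -> is_derive t 1 (fun s => G k s - G l s) 0.
  rewrite !ltr_norml => tk tl; rewrite -(subrr (g t)).
  by apply: is_deriveB; exact: dG.
have eqG k l (t : R) : `|t| < k.+1%:R -> `|t| < l.+1%:R -> G k t = G l t.
  move=> tk tl; apply/eqP; rewrite -subr_eq0; apply/eqP.
  have e0 : G k 0 - G l 0 = 0 by rewrite !G0 subrr.
  have [t0|t0] := leP 0 t.
  - rewrite -[RHS]e0; apply: (@derive0_const p q (fun s => G k s - G l s) 0 t t0) => s /andP[s0 st].
    by apply: diff0; rewrite ger0_norm// (le_lt_trans st)// -(ger0_norm t0).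
  - rewrite -[RHS]e0; symmetry.
    apply: (@derive0_const p q (fun s => G k s - G l s) t 0 (ltW t0)) => s /andP[ts s0].
    apply: diff0; rewrite ler0_norm//; apply: (@le_lt_trans _ _ `|t|) => //; rewrite ltr0_norm// lerN2//.
have nk (t : R) : `|t| < (Num.truncn `|t|).+1%:R by rewrite truncnS_gt.
(* The index may jump near [t], but any two primitives that reach past [t] agree there, since both
   vanish at 0. *)
exists (fun t => G (Num.truncn `|t|) t); split; first by rewrite G0.
move=> t; set k := (Num.truncn `|t|).+1.
have tk : `|t| < k.+1%:R by apply: lt_trans (nk t) _; rewrite ltr_nat.
have : is_derive t 1 (G k) (g t) by apply: dG; rewrite -ltr_norml.
apply: near_eq_is_derive; near=> s; apply: eqG; last exact: nk.
near: s; have /cvgr_lt : (fun s : R => `|s|) @ t --> `|t| by apply: cvg_norm; exact: cvg_id.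
by apply.
Unshelve. all: by end_near. Qed.

(** In the norm weighted by [expR (- 2 K |t|)], integrating a [K]-Lipschitz difference halves it.
    This is the contraction behind [picard], valid on windows of any length. *)
Lemma contraction_step p q (v dv : R -> 'M[R]_(p, q)) (K B T : R) :
  0 <= K -> 0 <= B -> v 0 = 0 -> (forall t : R, is_derive t 1 v (dv t)) ->
  (forall t : R, `|t| <= T -> `|dv t| <= K * (B * expR (2 * K * `|t|))) ->
  forall t : R, `|t| <= T -> `|v t| <= B / 2 * expR (2 * K * `|t|).
Proof.
move=> K0 B0 v0 Hv Hd.
have pos (w dw : R -> 'M[R]_(p, q)) : w 0 = 0 -> (forall t : R, is_derive t 1 w (dw t)) ->
  (forall t : R, `|t| <= T -> `|dw t| <= K * (B * expR (2 * K * `|t|))) ->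
  forall t, 0 <= t -> t <= T -> `|w t| <= B / 2 * expR (2 * K * t).
  move=> w0 Hw Hdw t t0 tT.
  have := @derive_compare p q w dw (fun s => B / 2 * expR (2 * K * s))
    (fun s => K * (B * expR (2 * K * s))) 0 t t0 (fun s _ => Hw s).
  rewrite w0 subr0 mulr0 expR0 mulr1 => H.
  have : `|w t| <= B / 2 * expR (2 * K * t) - B / 2.
    apply: H => [s _|s /andP[s0 st]].
    - have h := is_derive_expc (2 * K) s.
      have -> : (fun s => B / 2 * expR (2 * K * s)) = (B / 2) *: (fun s => expR (2 * K * s)) by [].
      by apply: is_derive_eq; rewrite /GRing.scale/=; field.
    - by rewrite -[in leRHS](ger0_norm s0); apply: Hdw; rewrite ger0_norm// (le_trans st).
  by move=> /le_trans; apply; rewrite gerBl divr_ge0.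
move=> t tT; have [t0|t0] := leP 0 t.
  by rewrite ger0_norm//; apply: (pos v dv) => //; rewrite -(ger0_norm t0).
rewrite ltr0_norm// -{1}(opprK t).
apply: (pos (fun s => v (- s)) (fun s => - dv (- s))).
- by rewrite oppr0.
- by move=> s; apply: is_derive_opp_arg.
- by move=> s sT; rewrite normrN -(normrN s); apply: Hd; rewrite normrN.
- by rewrite oppr_ge0 ltW.
- by rewrite -(ltr0_norm t0).
Qed.

Lemma seq_tail (V : normedModType R) (u : nat -> V) (C : R) : 0 <= C ->
  (forall n, `|u n.+1 - u n| <= C * 2^-1 ^+ n) ->
  forall n m, (n <= m)%N -> `|u m - u n| <= 2 * C * 2^-1 ^+ n - 2 * C * 2^-1 ^+ m.
Proof.
move=> C0 H n m /subnK <-; elim: (m - n)%N => [|j IH].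
  by rewrite add0n !subrr normr0.
rewrite addSn; set l := (j + n)%N in IH *.
have -> : u l.+1 - u n = (u l.+1 - u l) + (u l - u n) by rewrite addrA subrK.
apply: le_trans (ler_normD _ _) _; have := H l.
by rewrite exprS; lra.
Qed.

Lemma half_small (e : R) : 0 < e -> exists n, forall m, (n <= m)%N -> 2^-1 ^+ m < e.
Proof.
move=> e0; have /cvgrPdist_lt/(_ _ e0) [n _ H] : (geometric 1 (2^-1 : R)) @ \oo --> (0 : R).
  by apply: cvg_geometric; rewrite ger0_norm// invf_lt1// ltr1n.
exists n => m nm; have := H m nm.
by rewrite /geometric/= sub0r normrN mul1r ger0_norm// exprn_ge0.
Qed.

Lemma seq_limit p q (u : nat -> 'M[R]_(p, q)) (C : R) : 0 <= C ->
  (forall n, `|u n.+1 - u n| <= C * 2^-1 ^+ n) ->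
  exists l, forall n, `|l - u n| <= 2 * C * 2^-1 ^+ n.
Proof.
move=> C0 H; have T := seq_tail C0 H.
have cu : cvgn u.
  apply/cauchy_cvgP/cauchy_exP => e e0.
  have C1 : 0 < 2 * C + 1 by rewrite ltr_wpDl// mulr_ge0.
  have [N HN] := half_small (divr_gt0 e0 C1).
  exists (u N), N => // m /= Nm; rewrite -ball_normE /= distrC.
  apply: le_lt_trans (T _ _ Nm) _.
  have : 0 <= 2 * C * 2^-1 ^+ m by rewrite !mulr_ge0// exprn_ge0.
  have := HN N (leqnn N); rewrite ltr_pdivlMr// => h1 h2.
  have : 0 <= (2^-1 : R) ^+ N by rewrite exprn_ge0.
  by lra.
exists (limn u) => n; apply/ler_addgt0Pr => e e0.
have /cvgrPdist_lt/(_ _ e0) [m _ Hm] := cu.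
have := Hm (maxn m n) (leq_maxl _ _); have := T n (maxn m n) (leq_maxr _ _).
set M := maxn m n => h1 h2.
have -> : limn u - u n = (limn u - u M) + (u M - u n) by rewrite addrA subrK.
apply: le_trans (ler_normD _ _) _.
have : 0 <= 2 * C * 2^-1 ^+ M by rewrite !mulr_ge0// exprn_ge0.
by move: h1 h2 => /=; lra.
Qed.

(** By [contraction_step] consecutive iterates differ by a multiple of [2^-k], uniformly on every
    bounded window. The Lipschitz bound is global, so the solution is too; local fields are first
    extended by clamping. *)
Lemma picard p q (F : R -> 'M[R]_(p, q) -> 'M[R]_(p, q)) (K : R) (x0 : 'M[R]_(p, q)) : 0 <= K ->
  (forall u : R -> 'M[R]_(p, q), continuous u -> continuous (fun t => F t (u t))) ->
  (forall (t : R) x y, `|F t x - F t y| <= K * `|x - y|) ->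
  exists u : R -> 'M[R]_(p, q), u 0 = x0 /\ forall t : R, is_derive t 1 u (F t (u t)).
Proof.
move=> K0 cF lF.
have step (u : {u : R -> 'M[R]_(p, q) | continuous u}) : exists w : {w : R -> 'M[R]_(p, q) | continuous w},
    sval w 0 = x0 /\ forall t : R, is_derive t 1 (sval w) (F t (sval u t)).
  have [G [G0 dG]] := primitive_global (cF _ (svalP u)).
  have dw (t : R) : is_derive t 1 (fun s => x0 + G s) (F t (sval u t)) by exact: is_deriveDc.
  have cw : continuous (fun s => x0 + G s) by move=> t; exact: is_derive_cont (dw t).
  by exists (exist _ (fun s => x0 + G s) cw); split => //=; rewrite G0 addr0.
pose nxt u := projT1 (cid (step u)).
pose us k := iter k nxt (exist _ (fun=> x0) (@cst_continuous _ _ x0)).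
pose u k := sval (us k).
have u0 k : u k 0 = x0.
  by case: k => [//|k]; have [] := projT2 (cid (step (us k))).
have du k (t : R) : is_derive t 1 (u k.+1) (F t (u k t)).
  by have [_] := projT2 (cid (step (us k))); exact.
have cu k : continuous (u k) by exact: (svalP (us k)).
have bd (T : R) : 0 <= T -> exists2 C, 0 <= C & forall k (t : R), `|t| <= T -> `|u k.+1 t - u k t| <= C * 2^-1 ^+ k.
  move=> T0.
  have cg : {within `[- T, T], continuous (fun t => `|u 1%N t - u 0%N t|)}.
    apply: continuous_subspaceT => t; apply: continuous_comp; last exact: norm_continuous.
    by apply: continuousB; exact: cu.
  have [|c _ cmax] := EVT_max _ cg; first by lra.
  set A := `|u 1%N c - u 0%N c| in cmax.
  have A0 : 0 <= A by exact: normr_ge0.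
  have H k (t : R) : `|t| <= T -> `|u k.+1 t - u k t| <= A * 2^-1 ^+ k * expR (2 * K * `|t|).
    elim: k t => [|k IH] t tT.
      rewrite expr0 mulr1; apply: (@le_trans _ _ A).
        by apply: cmax; rewrite in_itv/= -ler_norml.
      have E1 : 1 <= expR (2 * K * `|t|) by rewrite -(@expR0 R) ler_expR !mulr_ge0.
      by rewrite ler_peMr.
    have -> : A * 2^-1 ^+ k.+1 = (A * 2^-1 ^+ k) / 2 by rewrite exprS; field.
    apply: (@contraction_step _ _ (fun s => u k.+2 s - u k.+1 s) (fun s => F s (u k.+1 s) - F s (u k s)) K (A * 2^-1 ^+ k) T) => //.
    - by rewrite mulr_ge0// exprn_ge0.
    - by rewrite !u0 subrr.
    - move=> s sT; apply: le_trans (lF _ _ _) _; apply: ler_wpM2l => //.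
      exact: IH.
  exists (A * expR (2 * K * T)) => [|k t tT]; first by rewrite mulr_ge0// expR_ge0.
  apply: le_trans (H k t tT) _; rewrite -!mulrA ler_wpM2l// mulrC ler_wpM2r ?exprn_ge0//.
  by rewrite ler_expR !ler_wpM2l.
(* The rate is stated for every window [T] and every constant [C], so that one value of the limit
   can be compared with the iterates on all windows. *)
have lim_ex (t : R) : exists l, forall T C : R, 0 <= C -> `|t| <= T ->
    (forall k (t : R), `|t| <= T -> `|u k.+1 t - u k t| <= C * 2^-1 ^+ k) ->
    forall k, `|l - u k t| <= 2 * C * 2^-1 ^+ k.
  have [C C0 HC] := bd _ (normr_ge0 t).
  have [l Hl] := seq_limit C0 (fun k => HC k t (lexx _)).
  exists l => T C' C'0 tT HC' k.
  have [l' Hl'] := seq_limit C'0 (fun k => HC' k t tT).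
  suff -> : l = l' by [].
  apply/eqP; rewrite -subr_eq0 -normr_le0; apply/ler_addgt0Pr => e e0.
  have D0 : 0 < 2 * C + 2 * C' + 1 by lra.
  have [N HN] := half_small (divr_gt0 e0 D0).
  have := HN N (leqnn _); rewrite ltr_pdivlMr// => hN.
  have -> : l - l' = (l - u N t) - (l' - u N t) by rewrite opprB addrA subrK.
  apply: le_trans (ler_normB _ _) _; have := Hl N; have := Hl' N.
  have : 0 <= (2^-1 : R) ^+ N by rewrite exprn_ge0.
  by lra.
pose U t := projT1 (cid (lim_ex t)).
have HU (t : R) := projT2 (cid (lim_ex t)); rewrite -/(U _) in HU.
have cU : continuous U.
  move=> t; apply/cvgrPdist_lt => e e0.
  have [C C0 HC] := bd (`|t| + 1) (addr_ge0 (normr_ge0 t) ler01).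
  have D0 : 0 < 4 * C + 1 by lra.
  have [N HN] := half_small (divr_gt0 (divr_gt0 e0 (ltr0n _ 2 : 0 < 2)) D0).
  have := HN N (leqnn _); rewrite ltr_pdivlMr// => hN.
  have h2 : 0 <= (2^-1 : R) ^+ N by rewrite exprn_ge0.
  near=> s.
  have s1 : `|s| <= `|t| + 1.
    have -> : s = t - (t - s) by rewrite opprB addrC subrK.
    apply: le_trans (ler_normB _ _) _; rewrite lerD2l.
    by near: s; apply: cvgr_dist_le => //; exact: cvg_id.
  have t1 : `|t| <= `|t| + 1 by rewrite lerDl.
  have h3 := HU t _ C C0 t1 HC N; have h4 := HU s _ C C0 s1 HC N.
  have h5 : `|u N t - u N s| < e / 2.
    near: s; have /cvgrPdist_lt : u N @ t --> u N t by exact: cu.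
    by apply; lra.
  have -> : U t - U s = (U t - u N t) + (u N t - u N s) - (U s - u N s).
    by rewrite opprB (addrA (U t - u N t)) subrK addrA subrK.
  apply: le_lt_trans (ler_normB _ _) _.
  have := ler_normD (U t - u N t) (u N t - u N s).
  by lra.
(* [w] is the integral of [F s (U s)]. Both [U] and [w] stay within a multiple of [2^-N] of the same
   iterate for every [N], so they coincide, and [U] inherits the derivative of [w]. *)
have [w [w0 dw]] : exists w : R -> 'M[R]_(p, q), w 0 = x0 /\ forall t : R, is_derive t 1 w (F t (U t)).
  have [G [G0 dG]] := primitive_global (cF _ cU).
  exists (fun s => x0 + G s); split => [|t]; first by rewrite G0 addr0.
  exact: is_deriveDc.
suff UW : U = w by exists w; split => // t; have := dw t; rewrite [in F t _]UW.
apply/funext => t; apply/eqP; rewrite -subr_eq0 -normr_le0; apply/ler_addgt0Pr => e e0.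
have [C C0 HC] := bd _ (normr_ge0 t).
pose D := 2 * C + K * (2 * C) * `|t| + 1.
have D0 : 0 < D by rewrite /D ltr_wpDl// addr_ge0// ?mulr_ge0.
have [N HN] := half_small (divr_gt0 e0 D0).
have := HN N (leqnn _); rewrite ltr_pdivlMr// => hN.
have p0 : 0 <= (2^-1 : R) ^+ N by rewrite exprn_ge0.
have h1 : `|w t - u N.+1 t| <= K * (2 * C * 2^-1 ^+ N) * `|t|.
  apply: (@vec_mean_value0 _ _ (fun s => w s - u N.+1 s) (fun s => F s (U s) - F s (u N s)) _ `|t|) => //.
  - by rewrite w0 u0 subrr.
  - move=> s st; apply: le_trans (lF _ _ _) _; apply: ler_wpM2l => //.
    exact: (HU s `|t| C).
have h2 : `|U t - u N.+1 t| <= 2 * C * 2^-1 ^+ N.+1 by apply: (HU t _ _ C0 (lexx _)).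
have -> : U t - w t = (U t - u N.+1 t) - (w t - u N.+1 t) by rewrite opprB addrA subrK.
apply: le_trans (ler_normB _ _) _; rewrite add0r.
apply: le_trans (lerD h2 h1) _.
have : D * 2^-1 ^+ N <= e by rewrite mulrC ltW.
rewrite /D exprS => h; have := mulr_ge0 C0 p0; lra.
Unshelve. all: by end_near. Qed.
End Curves.

(** * Trajectories of smooth vector fields: existence nearby and uniqueness *)

Section ODE.

Lemma cont_dist (V : normedModType R) (u : R -> V) (t e : R) : {for t, continuous u} -> 0 < e ->
  \forall s \near t, `|u t - u s| < e.
Proof. by move=> cu e0; apply: (@cvgr_dist_lt _ _ _ (nbhs t) _ u (u t)). Qed.

Lemma cont_sumf (T : topologicalType) (V : normedModType R) (I : Type) (r : seq I) (f : I -> T -> V) (x : T) :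
  (forall i, {for x, continuous (f i)}) -> {for x, continuous (fun y => \sum_(i <- r) f i y)}.
Proof.
move=> H; elim: r => [|a r IH].
  rewrite (_ : (fun y => _) = fun=> 0); last by apply/funext => y; rewrite big_nil.
  exact: cst_continuous.
rewrite (_ : (fun y => _) = fun y => f a y + \sum_(i <- r) f i y); last by apply/funext => y; rewrite big_cons.
by apply: continuousD => //; exact: H.
Qed.

Lemma cont_mx (T : topologicalType) p q (f : T -> 'M[R]_(p, q)) (x : T) :
  (forall i j, {for x, continuous (fun y => f y i j)}) -> {for x, continuous f}.
Proof.
move=> H; rewrite (_ : f = fun y => \sum_i \sum_j f y i j *: delta_mx i j); last first.
  by apply/funext => y; rewrite -matrix_sum_delta.
by apply: cont_sumf => i; apply: cont_sumf => j; apply: continuousZr_tmp; exact: H.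
Qed.

Lemma cont_coord (T : topologicalType) p q (f : T -> 'M[R]_(p, q)) (x : T) i j :
  {for x, continuous f} -> {for x, continuous (fun y => f y i j)}.
Proof. by move=> cf; apply: (@continuous_comp _ _ _ f (fun N : 'M[R]_(p, q) => N i j)) => //; exact: coord_continuous. Qed.

Lemma cont_mulmx (T : topologicalType) p q r (f : T -> 'M[R]_(p, q)) (g : T -> 'M[R]_(q, r)) (x : T) :
  {for x, continuous f} -> {for x, continuous g} -> {for x, continuous (fun y => f y *m g y)}.
Proof.
move=> cf cg; apply: cont_mx => i j.
rewrite (_ : (fun y => _) = fun y => \sum_l f y i l * g y l j); last by apply/funext => y; rewrite mxE.
by apply: cont_sumf => l; apply: continuousM; exact: cont_coord.
Qed.

(** The supremum of the good initial segments is itself good by the closing step, and by the opening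
    step it cannot lie below [T]. *)
Lemma real_induction (T : R) (P : R -> Prop) : P 0 ->
  (forall t : R, 0 <= t -> t < T -> (forall s, 0 <= s -> s <= t -> P s) ->
     exists2 e : R, 0 < e & forall s, t <= s -> s <= t + e -> s <= T -> P s) ->
  (forall t : R, 0 < t -> t <= T -> (forall s, 0 <= s -> s < t -> P s) -> P t) ->
  forall t : R, 0 <= t -> t <= T -> P t.
Proof.
move=> P0 Po Pc t t0 tT.
pose S := [set r : R | 0 <= r /\ r <= T /\ forall s, 0 <= s -> s <= r -> P s].
have S0 : S 0 by split=> //; split; [exact: le_trans tT|move=> s s0 s1; have -> : s = 0 by apply/eqP; rewrite eq_le s0 s1].
have hS : has_sup S by split; [exists 0|exists T => r [_ []]].
pose m := sup S.
have m0 : 0 <= m by exact: sup_upper_bound.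
have mT : m <= T by apply: ge_sup; [exists 0|move=> r [_ []]].
have Pm s : 0 <= s -> s < m -> P s.
  move=> s0 sm; have ms : 0 < m - s by rewrite subr_gt0.
  have [r [_ [_ Hr]] sr] := sup_adherent ms hS.
  by apply: Hr => //; move: sr; rewrite opprB addrCA subrr addr0 => /ltW.
have Pmm : P m.
  have [m1|m1] := leP m 0; first by rewrite (_ : m = 0)//; apply/eqP; rewrite eq_le m1.
  exact: Pc.
have Pm' s : 0 <= s -> s <= m -> P s.
  by move=> s0; rewrite le_eqVlt => /orP[/eqP->//|]; exact: Pm.
have [mT1|Tm] := ltP m T; last by apply: Pm' => //; exact: le_trans Tm.
have [e e0 He] := Po m m0 mT1 Pm'.
have : S (Num.min T (m + e)).
  split; [by rewrite le_min (le_trans t0 tT) addr_ge0// ltW|split; first by rewrite ge_min lexx].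
  move=> s s0; rewrite le_min => /andP[sT sme].
  by have [/Pm'|/ltW ms] := leP s m; [exact|exact: He].
move=> /(sup_upper_bound hS); rewrite -/m ge_min => /orP[Tm|].
  by move: mT1; rewrite ltNge Tm.
by rewrite gerDl leNgt e0.
Qed.

Lemma derive_norm_le p q n (g : 'rV_n -> 'M[R]_(p, q)) (x v : 'rV_n) (K : R) :
  differentiable g x -> (forall i, `|'D_(delta_mx 0 i) g x| <= K) -> `|'D_v g x| <= n%:R * K * `|v|.
Proof.
move=> dg HK; rewrite (derive_coord_sum v dg) (le_trans (ler_norm_sum _ _ _))//.
have -> : n%:R * K * `|v| = \sum_(i < n) K * `|v| by rewrite sumr_const card_ord -mulrA mulr_natl.
apply: ler_sum => i _; rewrite normrZ mulrC ler_pM//; exact: mx_coord_le.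
Qed.

Lemma lip_local p q n (g : 'rV_n -> 'M[R]_(p, q)) (z : 'rV_n) : smooth_at z g ->
  exists d K : R, [/\ 0 < d, 0 <= K & forall x y, ball z d x -> ball z d y ->
    [/\ smooth_at x g, `|g x| <= K & `|g x - g y| <= K * `|x - y|]].
Proof.
move=> sg.
have B (h : 'rV_n -> 'M[R]_(p, q)) : smooth_at z h -> \forall x \near z, `|h x| <= `|h z| + 1.
  move=> /sm_cont ch; have : {for z, continuous (fun x => `|h x|)}.
    by apply: continuous_comp; [exact: ch|exact: norm_continuous].
  rewrite /prop_for /continuous_at.
  by move=> /cvgr_le; apply; rewrite ltrDl.
pose K := `|g z| + 1 + n%:R * (\sum_i (`|'D_(delta_mx 0 i) g z| + 1)).
have H : \forall x \near z, [/\ smooth_at x g, `|g x| <= `|g z| + 1 &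
     forall i, `|'D_(delta_mx 0 i) g x| <= `|'D_(delta_mx 0 i) g z| + 1].
  near=> x; split; [near: x; exact: sm_near|near: x; exact: B|near: x].
  apply: filter_forall => i; apply: (B ('D_(delta_mx 0 i) g)); exact: sm_der.
have /nbhs_ballP[d /= d0 Hd] := H; exists d, K.
have K0 : 0 <= \sum_i (`|'D_(delta_mx 0 i) g z| + 1) by apply: sumr_ge0 => i _; rewrite addr_ge0.
split => // [|x y xb yb]; first by rewrite /K !addr_ge0// mulr_ge0.
have [sx gx Dx] := Hd _ xb; split => //; first by apply: le_trans gx _; rewrite /K lerDl mulr_ge0.
have seg (s : R) : 0 <= s <= 1 -> ball z d (y + s *: (x - y)).
  move=> /andP[s0 s1]; move: xb yb; rewrite -!ball_normE /= => xb yb.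
  have -> : z - (y + s *: (x - y)) = s *: (z - x) + (1 - s) *: (z - y).
    by rewrite !scalerBr !scalerBl !scale1r; apply/matrixP => i j; rewrite !mxE; ring.
  apply: le_lt_trans (ler_normD _ _) _; rewrite !normrZ (ger0_norm s0) ger0_norm ?subr_ge0//.
  have : 0 <= 1 - s by rewrite subr_ge0.
  move=> h; pose M := Num.max `|z - x| `|z - y|.
  have Md : M < d by rewrite gt_max xb.
  have h1 : s * `|z - x| <= s * M by rewrite ler_wpM2l// le_max lexx.
  have h2 : (1 - s) * `|z - y| <= (1 - s) * M by rewrite ler_wpM2l// le_max lexx orbT.
  lra.
have ds (s : R) : 0 <= s <= 1 -> is_derive s 1 (fun s : R => g (y + s *: (x - y))) ('D_(x - y) g (y + s *: (x - y))).
  by move=> /seg /Hd [/sm_diff dg _ _]; exact: is_derive_line.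
have := @vec_mean_value p q _ _ 0 1 (K * `|x - y|) ler01 ds.
rewrite scale0r scale1r addr0 (addrC y) subrK subr0 mulr1; apply => s s01.
have [/sm_diff dg _ Ds] := Hd _ (seg s s01).
pose S := \sum_i (`|'D_(delta_mx 0 i) g z| + 1).
have dn : `|'D_(x - y) g (y + s *: (x - y))| <= n%:R * S * `|x - y|.
  apply: derive_norm_le => // i; apply: le_trans (Ds i) _; rewrite /S (bigD1 i)//= lerDl.
  by apply: sumr_ge0 => j _; rewrite addr_ge0.
by apply: le_trans dn _; rewrite ler_wpM2r// /K lerDr addr_ge0.
Unshelve. all: by end_near. Qed.

(** Compactness of [[- T, T]] makes the local bounds uniform. In the proof the single index [k]
    gives both the radius [1 / (k + 1)] and the bound [k], so that the covering argument runs along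
    the one filter of large [k]. *)
Lemma tube p q n (g : 'rV_n -> 'M[R]_(p, q)) (c : R -> 'rV_n) (T : R) : 0 <= T ->
  (forall t : R, `|t| <= T -> {for t, continuous c} /\ smooth_at (c t) g) ->
  exists d K : R, [/\ 0 < d, 0 <= K & forall t : R, `|t| <= T -> forall x y, ball (c t) d x -> ball (c t) d y ->
    [/\ smooth_at x g, `|g x| <= K & `|g x - g y| <= K * `|x - y|]].
Proof.
move=> T0 H.
pose P (k : nat) (t : R) := forall x y, ball (c t) (k.+1%:R^-1) x -> ball (c t) (k.+1%:R^-1) y ->
    [/\ smooth_at x g, `|g x| <= k%:R & `|g x - g y| <= k%:R * `|x - y|].
have /compact_near_coveringP cov := @segment_compact R (- T) T.
have [|k _ Hk] := cov nat \oo P _.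
  move=> t; rewrite /= in_itv/= -ler_norml => /H [ct /lip_local[d [K [d0 K0 Hd]]]].
  have d2 : 0 < d / 2 by lra.
  near=> s k => x y xb yb.
  have cs : ball (c t) (d / 2) (c s).
    by near: s; apply: ct; exact: nbhsx_ballx.
  have kd : k.+1%:R^-1 < d / 2 :> R by near: k; exact: near_infty_natSinv_lt (PosNum d2).
  have kK : K <= k%:R by near: k; exact: nbhs_infty_ger.
  have bb w : ball (c s) k.+1%:R^-1 w -> ball (c t) d w.
    move=> wb; have -> : d = d / 2 + d / 2 by field.
    apply: ball_triangle cs _; apply: le_ball wb; exact: ltW.
  have [s1 s2 s3] := Hd _ _ (bb _ xb) (bb _ yb); split => //; first exact: le_trans kK.
  by apply: le_trans s3 _; rewrite ler_wpM2r.
exists (k.+1%:R^-1), k%:R; split => // t tT; apply: (Hk k) => //=.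
by rewrite in_itv/= -ler_norml.
Unshelve. all: by end_near. Qed.

Lemma gronwall_abs p q (u du : R -> 'M[R]_(p, q)) (T K e : R) : 0 <= K -> 0 <= e ->
  (forall t : R, `|t| <= T -> is_derive t 1 u (du t)) ->
  (forall t : R, `|t| <= T -> `|du t| <= K * `|u t| + e) ->
  forall t : R, `|t| <= T -> `|u t| <= 2 * (`|u 0| + e) * expR (2 * (K + 1) * T).
Proof.
move=> K0 e0 Hu HK t tT.
have mono (s : R) : s <= T -> 2 * (`|u 0| + e) * expR (2 * (K + 1) * s) <= 2 * (`|u 0| + e) * expR (2 * (K + 1) * T).
  move=> sT; apply: ler_wpM2l; first by rewrite mulr_ge0// addr_ge0.
  by rewrite ler_expR; apply: ler_wpM2l => //; rewrite mulr_ge0// addr_ge0.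
have [t0|t0] := leP 0 t.
  have h : `|u t| + e <= 2 * (`|u 0| + e) * expR (2 * (K + 1) * t).
    by apply: (@gronwall p q u du) => // s /andP[s0 st]; [apply: Hu|apply: HK];
      rewrite ger0_norm// (le_trans st)// -(ger0_norm t0).
  apply: le_trans (mono t _); last by rewrite -(ger0_norm t0).
  by apply: le_trans h; rewrite lerDl.
have h : `|u (- - t)| + e <= 2 * (`|u (- 0)| + e) * expR (2 * (K + 1) * (- t)).
  have nt : - t <= T by rewrite -(ltr0_norm t0).
  apply: (@gronwall p q (fun s => u (- s)) (fun s => - du (- s))) => //.
  - by rewrite oppr_ge0 ltW.
  - move=> s /andP[s0 st]; apply: is_derive_opp_arg; apply: Hu.
    by rewrite normrN ger0_norm// (le_trans st).
  - move=> s /andP[s0 st]; rewrite normrN; apply: HK.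
    by rewrite normrN ger0_norm// (le_trans st).
rewrite opprK oppr0 in h.
apply: le_trans (mono (- t) _); last by rewrite -(ltr0_norm t0).
by apply: le_trans h; rewrite lerDl.
Qed.

(** Clamping times to [[- T, T]], and points to a box around a curve, turns a field that is smooth
    near the curve into a globally Lipschitz one, as [picard] asks. *)
Definition clamp (d x : R) : R := Num.max (- d) (Num.min x d).

Lemma clamp_id (d x : R) : `|x| <= d -> clamp d x = x.
Proof.
rewrite ler_norml => /andP[h1 h2]; rewrite /clamp (min_idPl h2).
by apply/max_idPr.
Qed.

Lemma clamp_le (d x : R) : 0 <= d -> `|clamp d x| <= d.
Proof.
move=> d0; rewrite /clamp ler_norml le_max lexx/= ge_max ge_min lexx orbT andbT.
by lra.
Qed.

Lemma clamp_lip (d x y : R) : `|clamp d x - clamp d y| <= `|x - y|.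
Proof.
rewrite /clamp.
wlog xy : x y / x <= y.
  by move=> H; have [|/ltW] := leP x y; [exact: H|move=> yx; rewrite distrC (distrC x); exact: H].
rewrite (ler0_norm (_ : x - y <= 0)); last by lra.
by rewrite ler_norml; case: (leP x d); case: (leP y d); move=> ? ?;
  rewrite ?/Num.max; repeat case: ltP => ?; apply/andP; split; lra.
Qed.

Lemma clamp_cont (d : R) : continuous (clamp d).
Proof.
move=> x; apply/cvgrPdist_lt => e e0; near=> y.
apply: le_lt_trans (clamp_lip _ _ _) _; near: y.
by apply: cvgr_dist_lt => //; exact: cvg_id.
Unshelve. all: by end_near. Qed.

Definition clampv n (d : R) (x : 'rV_n) : 'rV_n := \row_i clamp d (x 0 i).

Lemma clampv_id n (d : R) (x : 'rV_n) : `|x| <= d -> clampv d x = x.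
Proof.
move=> xd; apply/rowP => i; rewrite mxE clamp_id//.
by apply: le_trans xd; exact: mx_coord_le.
Qed.

Lemma clampv_le n (d : R) (x : 'rV_n) : 0 <= d -> `|clampv d x| <= d.
Proof. by move=> d0; apply: mx_norm_le => // i j; rewrite mxE clamp_le. Qed.

Lemma clampv_lip n (d : R) (x y : 'rV_n) : `|clampv d x - clampv d y| <= `|x - y|.
Proof.
apply: mx_norm_le => // i j; rewrite !mxE; apply: le_trans (clamp_lip _ _ _) _.
by have := mx_coord_le (x - y) 0 j; rewrite !mxE.
Qed.

Lemma clampv_cont n (d : R) : continuous (@clampv n d).
Proof.
move=> x; apply/(@cvgrPdist_lt _ _ _ (nbhs x)) => e e0; near=> y.
apply: le_lt_trans (clampv_lip _ _ _) _; near: y.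
by apply: (@cvgr_dist_lt _ _ _ (nbhs x) _ id x) => //; exact: cvg_id.
Unshelve. all: by end_near. Qed.

Definition trajectory n (f : 'rV_n -> 'rV_n) (T : R) (c : R -> 'rV_n) :=
  forall t : R, `|t| <= T -> is_derive t 1 c (f (c t)) /\ smooth_at (c t) f.

Lemma trajectory_cont n (f : 'rV_n -> 'rV_n) (T : R) (c : R -> 'rV_n) t :
  trajectory f T c -> `|t| <= T -> {for t, continuous c}.
Proof. by move=> tc tT; have [dc _] := tc t tT; exact: is_derive_cont dc. Qed.

(** The clamped field has a global solution from [x]. Gronwall's inequality keeps this solution so
    close to [c] that the clamping never acts, hence it is a trajectory of [f] itself. *)
Lemma flow_exists n (f : 'rV_n -> 'rV_n) (c : R -> 'rV_n) (T : R) : 0 <= T ->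
  trajectory f T c -> exists r C : R, [/\ 0 < r, 0 <= C & forall x : 'rV_n, ball (c 0) r x ->
    exists u : R -> 'rV_n, [/\ u 0 = x, trajectory f T u & forall t : R, `|t| <= T -> `|u t - c t| <= C * `|x - c 0|]].
Proof.
move=> T0 tc.
have Hc t : `|t| <= T -> {for t, continuous c} /\ smooth_at (c t) f.
  by move=> tT; split; [exact: trajectory_cont tc tT|have [] := tc t tT].
have [d [K [d0 K0 HK]]] := @tube 1 n n f c T T0 Hc.
pose ct (t : R) := clamp T t.
have ctT t : `|ct t| <= T by exact: clamp_le.
pose g (t : R) (z : 'rV_n) := c (ct t) + clampv (d / 2) (z - c (ct t)).
have gb t z : ball (c (ct t)) d (g t z).
  rewrite -ball_normE /= /g opprD addrA subrr add0r normrN.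
  have : `|clampv (d / 2) (z - c (ct t))| <= d / 2 by apply: clampv_le; lra.
  by lra.
pose F t z := f (g t z).
have cF (u : R -> 'rV_n) : continuous u -> continuous (fun t => F t (u t)).
  move=> cu t; have [/sm_cont sf _ _] := HK _ (ctT t) _ _ (gb t (u t)) (gb t (u t)).
  have cc : {for t, continuous (fun s => c (ct s))}.
    apply: continuous_comp; first exact: clamp_cont.
    exact: (trajectory_cont tc (ctT t)).
  apply: (@continuous_comp _ _ _ (fun t => g t (u t)) f); last exact: sf.
  apply: continuousD => //.
  apply: (@continuous_comp _ _ _ (fun s => u s - c (ct s)) (@clampv n (d / 2))); last exact: clampv_cont.
  by apply: continuousB => //; exact: cu.
have lF (t : R) x y : `|F t x - F t y| <= K * `|x - y|.
  have [_ _ h] := HK _ (ctT t) _ _ (gb t x) (gb t y).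
  apply: le_trans h _; apply: ler_wpM2l => //.
  have -> : g t x - g t y = clampv (d / 2) (x - c (ct t)) - clampv (d / 2) (y - c (ct t)).
    by rewrite /g opprD addrACA subrr add0r.
  apply: le_trans (clampv_lip _ _ _) _.
  by rewrite opprB addrA subrK.
have d2 : 0 < d / 2 by lra.
pose E := expR (2 * (K + 1) * T); have E0 : 0 < E by exact: expR_gt0.
(* [2 * E] is the Gronwall factor, so starting points in this ball stay within [d / 4] of [c], where
   clamping at [d / 2] is the identity. *)
exists (d / (8 * E)), (2 * E); split; [by rewrite divr_gt0// mulr_gt0|by rewrite mulr_ge0// ltW|].
move=> x; rewrite -ball_normE /= distrC ltr_pdivlMr ?mulr_gt0// => xr.
have [u [u0 du]] := picard x K0 cF lF.
have W1 t : `|t| <= T -> `|u t - c t| <= 2 * E * `|x - c 0|.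
  move=> tT; apply: le_trans (_ : 2 * (`|u 0 - c 0| + 0) * E <= _); last first.
    by rewrite u0 addr0; lra.
  apply: (@gronwall_abs 1 n (fun s => u s - c s) (fun s => F s (u s) - f (c s)) T K 0) => // [s sT|s sT].
    by have [dc _] := tc s sT; exact: is_deriveB.
  rewrite addr0; have -> : f (c s) = F s (c s).
    rewrite /F /g /ct clamp_id// subrr clampv_id ?normr0 ?addr0//; exact: ltW.
  exact: lF.
have W t : `|t| <= T -> `|u t - c t| <= d / 2 by move=> /W1 /le_trans; apply; lra.
exists u; split => // t tT; have uE : g t (u t) = u t.
  by rewrite /g /ct clamp_id// clampv_id ?W// addrC subrK.
split; first by have := du t; rewrite /F uE.
by have [] := HK _ (ctT t) _ _ (gb t (u t)) (gb t (u t)); rewrite uE.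
Qed.

(** Agreement spreads forward by Gronwall's inequality on a ball where [f] is Lipschitz, and passes
    to limits by continuity. Negative times follow by reversing [f]. *)
Lemma trajectory_unique n (f : 'rV_n -> 'rV_n) (T : R) (u w : R -> 'rV_n) :
  trajectory f T u -> trajectory f T w -> u 0 = w 0 -> forall t, `|t| <= T -> u t = w t.
Proof.
move: u w; have H (f' : 'rV_n -> 'rV_n) (u w : R -> 'rV_n) : trajectory f' T u -> trajectory f' T w -> u 0 = w 0 ->
    forall t, 0 <= t -> t <= T -> u t = w t.
  move=> tu tw uw0; apply: real_induction => // [t t0 tT H|t t0 tT H].
  - have tT' : `|t| <= T by rewrite ger0_norm// ltW.
    have [d [K [d0 K0 HK]]] := lip_local (tu t tT').2.
    have uwt : u t = w t by exact: H.
    have cu := trajectory_cont tu tT'; have cw := trajectory_cont tw tT'.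
    have : \forall s \near t, ball (u t) d (u s) /\ ball (u t) d (w s).
      near=> s; split; near: s; first by apply: cu; exact: nbhsx_ballx.
      by rewrite uwt; apply: cw; exact: nbhsx_ballx.
    move=> /nbhs_ballP[e /= e0 He]; exists (e / 2); first by lra.
    move=> s ts se sT; apply/eqP; rewrite -subr_eq0 -normr_le0.
    pose v r := u (t + r) - w (t + r).
    have dv r : 0 <= r <= s - t -> is_derive r 1 v (f' (u (t + r)) - f' (w (t + r))).
      move=> /andP[r0 rs]; have rT : `|t + r| <= T by rewrite ger0_norm ?addr_ge0//; lra.
      rewrite -[X in is_derive _ _ _ X]scale1r.
      apply: (@is_derive_comp1 _ (fun r => u r - w r) (fun r => t + r)).
        by have := is_deriveD (is_derive_cst t r 1) (is_derive_id r 1); rewrite add0r.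
      by have [? _] := tu _ rT; have [? _] := tw _ rT; exact: is_deriveB.
    have := @gronwall 1 n v _ (s - t) K 0 _ K0 (lexx _) dv.
    rewrite /v !addr0 uwt subrr normr0 mulr0 mul0r (addrC t) subrK; apply.
      by rewrite subr_ge0.
    move=> r /andP[r0 rs]; rewrite addr0.
    have [|b1 b2] := He (t + r).
      by rewrite -ball_normE /= opprD addrA subrr add0r normrN ger0_norm//; lra.
    by have [] := HK _ _ b1 b2.
  - have tT' : `|t| <= T by rewrite ger0_norm// ltW.
    have cu := trajectory_cont tu tT'; have cw := trajectory_cont tw tT'.
    apply/eqP; rewrite -subr_eq0 -normr_le0; apply/ler_addgt0Pr => e e0.
    have : \forall s \near t, `|u t - u s| < e / 2 /\ `|w t - w s| < e / 2.
      have e2 : 0 < e / 2 by lra.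
      by near=> s; split; near: s; [exact: cont_dist|exact: cont_dist].
    move=> /nbhs_ballP[a /= a0 Ha].
    pose s := t - Num.min (a / 2) t.
    have m0 : 0 < Num.min (a / 2) t by rewrite lt_min t0 andbT; lra.
    have [|h1 h2] := Ha s.
      rewrite -ball_normE /= /s opprB addrC subrK gtr0_norm// gt_min.
      by apply/orP; left; lra.
    have us : u s = w s.
      apply: H; last by rewrite /s gtrBl.
      by rewrite /s subr_ge0 ge_min lexx orbT.
    have -> : u t - w t = (u t - u s) - (w t - w s) by rewrite us opprB addrA subrK.
    by apply: le_trans (ler_normB _ _) _; lra.
move=> u w tu tw uw0 t tT; have [t0|t0] := leP 0 t.
  by apply: (H f) => //; rewrite -(ger0_norm t0).
have rev (z : R -> 'rV_n) : trajectory f T z -> trajectory (fun x => - f x) T (fun s => z (- s)).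
  move=> tz s sT; have [] := tz (- s); rewrite ?normrN// => dz sz; split; last exact: smN.
  exact: is_derive_opp_arg.
rewrite -(opprK t); apply: (H (fun x => - f x) (fun s => u (- s)) (fun s => w (- s))); [exact: rev|exact: rev|by rewrite oppr0| |].
  by rewrite oppr_ge0 ltW.
by rewrite -(ltr0_norm t0).
Unshelve. all: by end_near. Qed.

Definition flow_on n (f : 'rV_n -> 'rV_n) (T : R) (B : set 'rV_n) (phi : R -> 'rV_n -> 'rV_n) :=
  forall x, B x -> phi 0 x = x /\ trajectory f T (phi^~ x).

(** The quadratic remainder is what makes flows differentiable in [flow_diff]; on a constant
    trajectory with [T = 0] it also serves [inj_near]. *)
Lemma jac_tube n (f : 'rV_n -> 'rV_n) (c : R -> 'rV_n) (T : R) : 0 <= T -> trajectory f T c ->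
  exists d K : R, [/\ 0 < d, 0 <= K & forall t : R, `|t| <= T -> forall x y, ball (c t) d x -> ball (c t) d y ->
    [/\ smooth_at x f, `|jacobian f x| <= K, `|f x - f y| <= K * `|x - y| &
       `|f y - f x - (y - x) *m jacobian f x| <= K * `|y - x| ^+ 2]].
Proof.
move=> T0 tc.
have H1 t : `|t| <= T -> {for t, continuous c} /\ smooth_at (c t) f.
  by move=> tT; split; [exact: trajectory_cont tc tT|have [] := tc t tT].
have H2 t : `|t| <= T -> {for t, continuous c} /\ smooth_at (c t) (jacobian f).
  by move=> tT; split; [exact: trajectory_cont tc tT|have [_ /sm_jac] := tc t tT].
have [d1 [K1 [d10 K10 HK1]]] := @tube 1 n n f c T T0 H1.
have [d2 [K2 [d20 K20 HK2]]] := @tube n n n (jacobian f) c T T0 H2.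
exists (Num.min d1 d2), (K1 + K2 + n%:R * K2).
have nK : 0 <= n%:R * K2 by rewrite mulr_ge0.
split; [by rewrite lt_min d10|by rewrite !addr_ge0|move=> t tT x y xb yb].
have b1 z : ball (c t) (Num.min d1 d2) z -> ball (c t) d1 z by apply: le_ball; rewrite ge_min lexx.
have b2 z : ball (c t) (Num.min d1 d2) z -> ball (c t) d2 z by apply: le_ball; rewrite ge_min lexx orbT.
have [s1 s2 s3] := HK1 t tT _ _ (b1 _ xb) (b1 _ yb).
have [_ s4 _] := HK2 t tT _ _ (b2 _ xb) (b2 _ yb).
have seg (s : R) : 0 <= s <= 1 -> ball (c t) (Num.min d1 d2) (x + s *: (y - x)).
  move=> /andP[s0 h1]; move: xb yb; rewrite -!ball_normE /=; set d := Num.min d1 d2 => xb yb.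
  have -> : c t - (x + s *: (y - x)) = s *: (c t - y) + (1 - s) *: (c t - x).
    by rewrite !scalerBr !scalerBl !scale1r; apply/matrixP => i j; rewrite !mxE; ring.
  apply: le_lt_trans (ler_normD _ _) _; rewrite !normrZ (ger0_norm s0) ger0_norm ?subr_ge0//.
  have h : 0 <= 1 - s by rewrite subr_ge0.
  pose M := Num.max `|c t - x| `|c t - y|.
  have Md : M < d by rewrite gt_max xb.
  have h2 : s * `|c t - y| <= s * M by rewrite ler_wpM2l// le_max lexx orbT.
  have h3 : (1 - s) * `|c t - x| <= (1 - s) * M by rewrite ler_wpM2l// le_max lexx.
  lra.
split => //.
- by apply: le_trans s4 _; lra.
- by apply: le_trans s3 _; rewrite ler_wpM2r//; lra.
pose g (s : R) := f (x + s *: (y - x)) - s *: ((y - x) *m jacobian f x).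
have dg (s : R) : 0 <= s <= 1 -> is_derive s 1 g ((y - x) *m jacobian f (x + s *: (y - x)) - (y - x) *m jacobian f x).
  move=> s01; have [/sm_diff df _ _] := HK1 t tT _ _ (b1 _ (seg s s01)) (b1 _ yb).
  have h1 := is_derive_line df.
  have h2 : is_derive s 1 (fun s : R => s *: ((y - x) *m jacobian f x)) ((y - x) *m jacobian f x).
    rewrite -[X in is_derive _ _ _ X]scale1r.
    have hd := is_diff_scalel s ((y - x) *m jacobian f x); have [d3 d4] := hd.
    by apply: DeriveDef; [exact: diff_derivable|rewrite deriveE// d4].
  have E := derive_mulE (y - x) df.
  by have h3 := is_deriveB h1 h2; rewrite E in h3; exact: h3.
have := @vec_mean_value 1 n g _ 0 1 (n%:R * K2 * `|y - x| ^+ 2) ler01 dg.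
rewrite /g scale0r !scale1r scale0r subr0 addr0 (addrC x) subrK subr0 mulr1 addrAC.
move=> h; apply: le_trans (h _) _; last by rewrite ler_wpM2r ?exprn_ge0//; lra.
move=> s s01; rewrite -mulmxBr; apply: le_trans (mulmx_norm _ _) _.
have [_ _ h4] := HK2 t tT _ _ (b2 _ (seg s s01)) (b2 _ xb).
have E : x + s *: (y - x) - x = s *: (y - x) by rewrite addrC addKr.
rewrite E normrZ in h4.
have : `|s| * `|y - x| <= `|y - x| by rewrite ler_piMl// ger0_norm; case/andP: s01.
move=> h5; have -> : n%:R * K2 * `|y - x| ^+ 2 = n%:R * `|y - x| * (K2 * `|y - x|) by ring.
apply: ler_wpM2l; first by rewrite mulr_ge0.
by apply: le_trans h4 _; rewrite ler_wpM2l.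
Qed.
End ODE.

(** * Smooth dependence of flows on the initial point *)

Section FlowRegularity.

Lemma linear_mulmxr_cont n p (A : 'M[R]_(n, p)) : continuous (mulmxr A : 'rV_n -> 'rV_p).
Proof. by move=> x; apply: (@cont_mulmx _ _ _ _ id (cst A)); [exact: cvg_id|exact: cst_continuous]. Qed.

Lemma is_derive_mulmxl p q r (A : 'M[R]_(p, q)) (u : R -> 'M[R]_(q, r)) (t : R) (d : 'M[R]_(q, r)) :
  is_derive t 1 u d -> is_derive t 1 (fun s => A *m u s) (A *m d).
Proof. by move=> du; have := isd_mulmx (is_derive_cst A t 1) du; rewrite mul0mx add0r. Qed.

(** [M] solves the variational equation along the trajectory of [x]. The defect
    [phi t y - phi t x - (y - x) *m M t] satisfies the same linear equation up to an error of order
    [|y - x|^2] and starts at 0, so Gronwall's inequality bounds it by a multiple of [|y - x|^2]. *)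
Lemma flow_diff n (f : 'rV_n -> 'rV_n) (T : R) (B : set 'rV_n) (phi : R -> 'rV_n -> 'rV_n) x :
  0 <= T -> open B -> flow_on f T B phi -> B x ->
  exists M : R -> 'M[R]_n, [/\ M 0 = 1%:M,
    (forall t : R, `|t| <= T -> is_derive t 1 M (M t *m jacobian f (phi t x))) &
    (forall t : R, `|t| <= T -> differentiable (phi t) x /\ forall v, 'D_v (phi t) x = v *m M t)].
Proof.
move=> T0 oB fl Bx; have [x0 tx] := fl x Bx.
have [d [K [d0 K0 HK]]] := jac_tube T0 tx.
pose ct (t : R) := clamp T t.
have ctT t : `|ct t| <= T by exact: clamp_le.
pose A (t : R) := jacobian f (phi (ct t) x).
have xball t : ball (phi (ct t) x) d (phi (ct t) x) by exact: ballxx.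
have Ab t : `|A t| <= K.
  by have [] := HK _ (ctT t) _ _ (xball t) (xball t).
have cA : continuous A.
  move=> t; have [/sm_jac/sm_cont sf _ _ _] := HK _ (ctT t) _ _ (xball t) (xball t).
  apply: (@continuous_comp _ _ _ (fun s => phi (ct s) x) (jacobian f)) => //.
  apply: (@continuous_comp _ _ _ ct (fun s => phi s x)); first exact: clamp_cont.
  exact: (trajectory_cont tx (ctT t)).
have nK : 0 <= n%:R * K by rewrite mulr_ge0.
have cF (u : R -> 'M[R]_n) : continuous u -> continuous (fun t => u t *m A t).
  by move=> cu t; apply: cont_mulmx; [exact: cu|exact: cA].
have lF (t : R) (Z Z' : 'M[R]_n) : `|Z *m A t - Z' *m A t| <= n%:R * K * `|Z - Z'|.
  rewrite -mulmxBl; apply: le_trans (mulmx_norm _ _) _.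
  by rewrite -!mulrA ler_wpM2l// mulrC ler_wpM2r.
have [M [M0 dM]] := @picard n n (fun t Z => Z *m A t) (n%:R * K) 1%:M nK cF lF.
have AE t : `|t| <= T -> A t = jacobian f (phi t x) by move=> tT; rewrite /A /ct clamp_id.
exists M; split; [exact: M0|by move=> t tT; have h := dM t; rewrite (AE t tT) in h; exact: h|move=> t tT].
suff H : exists2 C : R, 0 <= C & exists2 a : R, 0 < a & forall y, ball x a y -> B y /\
    `|phi t y - phi t x - (y - x) *m M t| <= C * `|y - x| ^+ 2.
  have [C C0 [a a0 Ha]] := H.
  have [||dphi Ephi] := @diff_eps _ _ (phi t) x (mulmxr (M t)).
  - exact: linear_mulmxr_cont.
  - move=> e e0; have C1 : 0 < e / (C + 1) by rewrite divr_gt0// ltr_wpDl.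
    have /nbhs_ballP[b /= b0 Hb] : \forall y \near x, ball x a y /\ ball x (e / (C + 1)) y.
      by near=> y; split; near: y; exact: nbhsx_ballx.
    apply/nbhs_ballP; exists b => // y /Hb [/Ha[_ h1]]; rewrite -ball_normE /= distrC => h2.
    apply: le_trans h1 _; rewrite expr2 mulrA ler_wpM2r//.
    by move: h2; rewrite ltr_pdivlMr ?ltr_wpDl// => /ltW; have := normr_ge0 (y - x); nra.
  - by split=> // v; rewrite (deriveE v dphi) Ephi.
have [a a0 Ha] : exists2 a : R, 0 < a & forall y, ball x a y -> B y.
  have /nbhs_ballP[a /= a0 Ha] : nbhs x B by exact: open_nbhs_nbhs.
  by exists a.
have [r [C [r0 C0 HC]]] := flow_exists T0 tx; rewrite /= x0 in HC.
have near_tube y : ball x (Num.min a r) y -> forall s, `|s| <= T -> `|phi s y - phi s x| <= C * `|y - x|.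
  move=> yb s sT; have [|u [u0 tu Hu]] := HC y; first by apply: le_ball yb; rewrite ge_min lexx orbT.
  have [|y0 ty] := fl y; first by apply/Ha/(le_ball _ yb); rewrite ge_min lexx.
  by rewrite (trajectory_unique ty tu)//= ?y0 ?u0//; exact: Hu.
pose E := expR (2 * (n%:R * K + 1) * T); have E0 : 0 < E by exact: expR_gt0.
exists (2 * (K * C ^+ 2) * E); first by rewrite !mulr_ge0 ?exprn_ge0// ltW.
exists (Num.min (Num.min a r) (d / (C + 1))); first by rewrite !lt_min a0 r0 divr_gt0// ltr_wpDl.
move=> y yb; have yb1 : ball x (Num.min a r) y by apply: le_ball yb; rewrite ge_min lexx.
have yb2 : ball x (d / (C + 1)) y by apply: le_ball yb; rewrite ge_min lexx orbT.
have By : B y by apply/Ha/(le_ball _ yb1); rewrite ge_min lexx.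
split => //; have [y0 ty] := fl y By.
have intube s : `|s| <= T -> ball (phi s x) d (phi s y).
  move=> sT; rewrite -ball_normE /= distrC; apply: le_lt_trans (near_tube y yb1 s sT) _.
  move: yb2; rewrite -ball_normE /= distrC ltr_pdivlMr ?ltr_wpDl//.
  by have := normr_ge0 (y - x); nra.
pose v s := phi s y - phi s x - (y - x) *m M s.
pose dv s := f (phi s y) - f (phi s x) - (y - x) *m (M s *m jacobian f (phi s x)).
have Dv (s : R) : `|s| <= T -> is_derive s 1 v (dv s).
  move=> sT; have [d1 _] := ty s sT; have [d2 _] := tx s sT.
  have d3 := dM s; rewrite (AE s sT) in d3.
  have d4 : is_derive s 1 (fun s => (y - x) *m M s) ((y - x) *m (M s *m jacobian f (phi s x))).
    exact: is_derive_mulmxl.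
  by have := is_deriveB (is_deriveB d1 d2) d4.
have bv (s : R) : `|s| <= T -> `|dv s| <= n%:R * K * `|v s| + K * C ^+ 2 * `|y - x| ^+ 2.
  move=> sT; have [_ h1 _ h2] := HK s sT _ _ (ballxx (phi s x) d0) (intube s sT).
  have -> : dv s = v s *m jacobian f (phi s x) + (f (phi s y) - f (phi s x) - (phi s y - phi s x) *m jacobian f (phi s x)).
    by rewrite /dv /v (mulmxBl (phi s y - phi s x)) -mulmxA [RHS]addrC [RHS]addrA subrK.
  apply: le_trans (ler_normD _ _) _; apply: lerD.
    apply: le_trans (mulmx_norm _ _) _.
    by rewrite -!mulrA ler_wpM2l// mulrC ler_wpM2r.
  apply: le_trans h2 _; rewrite -mulrA -exprMn ler_wpM2l//.
  by apply: lerXn2r; rewrite ?nnegrE ?mulr_ge0//; exact: near_tube.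
have e0 : 0 <= K * C ^+ 2 * `|y - x| ^+ 2 by rewrite !mulr_ge0 ?exprn_ge0.
have := gronwall_abs nK e0 Dv bv tT.
rewrite /v y0 x0 M0 mulmx1 subrr normr0 add0r => h; apply: le_trans h _.
by rewrite -/E; lra.
Unshelve. all: by end_near. Qed.

(** The complete lift of [f] to the tangent bundle: its flow sends [(x, v)] to the flow of [x] and
    the derivative of the flow applied to [v]. *)
Definition vprolong n (f : 'rV_n -> 'rV_n) (z : 'rV_(n + n)) : 'rV_(n + n) :=
  row_mx (f (lsubmx z)) (rsubmx z *m jacobian f (lsubmx z)).

Lemma sm_vprolong n (f : 'rV_n -> 'rV_n) z : smooth_at (lsubmx z) f -> smooth_at z (vprolong f).
Proof.
move=> sf; have sl : smooth_at z (fun z : 'rV_(n + n) => lsubmx z) by apply: sm_lsub; exact: sm_id.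
have sr : smooth_at z (fun z : 'rV_(n + n) => rsubmx z) by apply: sm_rsub; exact: sm_id.
apply: sm_row_mx; first exact: (sm_comp sl sf).
apply: sm_mulmx => //; exact: (sm_comp sl (sm_jac sf)).
Qed.

Lemma is_derive_mulmxr p q r (A : 'M[R]_(q, r)) (u : R -> 'M[R]_(p, q)) (t : R) (d : 'M[R]_(p, q)) :
  is_derive t 1 u d -> is_derive t 1 (fun s => u s *m A) (d *m A).
Proof. by move=> du; have := isd_mulmx du (is_derive_cst A t 1); rewrite mulmx0 addr0. Qed.

Lemma open_ballrV n (x : 'rV_n) (r : R) : 0 < r -> open (ball x r).
Proof. by move=> r0; exact: ball_open. Qed.

Lemma norm_row_mx_lt p q1 q2 (A : 'M[R]_(p, q1)) (B : 'M[R]_(p, q2)) (c : R) :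
  `|A| < c -> `|B| < c -> `|row_mx A B| < c.
Proof.
move=> Ac Bc; apply: (@le_lt_trans _ _ (Num.max `|A| `|B|)); last by rewrite gt_max Ac.
apply: mx_norm_le => [|i j]; first by rewrite le_max normr_ge0.
rewrite mxE; case: (fintype.split j) => l; rewrite le_max; apply/orP; [left|right]; exact: mx_coord_le.
Qed.

Lemma Ck_row_mx k n p q1 q2 (U : set 'rV_n) (f : 'rV_n -> 'M[R]_(p, q1)) (g : 'rV_n -> 'M[R]_(p, q2)) :
  open U -> Ck k U f -> Ck k U g -> Ck k U (fun y => row_mx (f y) (g y)).
Proof.
move=> oU cf cg; apply: Ck_mx => // i j.
rewrite (_ : (fun s => _) = fun s => match fintype.split j with inl l => f s i l | inr l => g s i l end); last first.
  by apply/funext => s; rewrite mxE.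
by case: (fintype.split j) => l; exact: Ck_coord.
Qed.

(** Induction on [k] for all dimensions and all fields at once: a derivative of the flow of [f] is a
    component of the flow of [vprolong f], in dimension [n + n]. *)
Lemma flow_Ck k n (f : 'rV_n -> 'rV_n) (T : R) (B : set 'rV_n) (phi : R -> 'rV_n -> 'rV_n) x :
  0 <= T -> open B -> flow_on f T B phi -> B x ->
  exists2 r : R, 0 < r & forall t : R, `|t| <= T -> Ck k (ball x r) (phi t).
Proof.
move=> T0; elim: k n f B phi x => [|k IH] n f B phi x oB fl Bx.
  have /nbhs_ballP[a /= a0 Ha] : nbhs x B by exact: open_nbhs_nbhs.
  exists a => // t tT y /Ha By; have [M [_ _ H]] := flow_diff T0 oB fl By.
  by have [/differentiable_continuous] := H t tT.
have /nbhs_ballP[a /= a0 Ha] : nbhs x B by exact: open_nbhs_nbhs.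
have [x0 tx] := fl x Bx.
have tc2 : trajectory (vprolong f) T (fun t => row_mx (phi t x) 0).
  move=> t tT; have [dx sx] := tx t tT; split; last by apply: sm_vprolong; rewrite row_mxKl.
  rewrite /vprolong row_mxKl row_mxKr mul0mx; apply: isd_row_mx => //.
have [r2 [C2 [r20 C20 H2]]] := flow_exists T0 tc2; rewrite /= x0 in H2.
pose phi2 t z := if pselect (ball (row_mx x 0) r2 z) is left h then projT1 (cid (H2 z h)) t else 0.
have fl2 : flow_on (vprolong f) T (ball (row_mx x 0) r2) phi2.
  move=> z zb; rewrite /phi2; case: pselect => // h.
  by have [] := projT2 (cid (H2 z h)).
have [r3 r30 H3] := IH _ (vprolong f) (ball (row_mx x 0) r2) phi2 (row_mx x 0) (@open_ballrV _ (row_mx x 0) _ r20) fl2 (ballxx _ r20).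
exists (Num.min a (Num.min r2 r3)); first by rewrite !lt_min a0 r20.
move=> t tT; apply/CkE; split=> [y yb|v].
  have By : B y by apply/Ha/(le_ball _ yb); rewrite ge_min lexx.
  by have [M [_ _ H]] := flow_diff T0 oB fl By; have [] := H t tT.
(* The flow of the lift is only given near [(x, 0)]. It is linear in the fibre, so [v] is scaled by
   [e] to fit into the ball and the result divided by [e]. *)
pose e := Num.min r2 r3 / (2 * (`|v| + 1)).
have e0 : 0 < e by rewrite divr_gt0 ?lt_min ?r20// mulr_gt0// ltr_wpDl.
pose r := Num.min a (Num.min r2 r3).
have ev : `|e *: v| < Num.min r2 r3.
  rewrite normrZ gtr0_norm// /e mulrAC ltr_pdivrMr ?mulr_gt0 ?ltr_wpDl// -subr_gt0.
  have : 0 < Num.min r2 r3 by rewrite lt_min r20.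
  by have := normr_ge0 v; nra.
have inb y : ball x r y -> ball (row_mx x 0) (Num.min r2 r3) (row_mx y (e *: v)).
  move=> yb; rewrite -ball_normE /= opp_row_mx add_row_mx sub0r; apply: norm_row_mx_lt.
    by move: yb; rewrite -ball_normE /= => /lt_le_trans; apply; rewrite ge_min lexx orbT.
  by rewrite normrN.
have oball : open (ball x r) by apply: open_ballrV; rewrite !lt_min a0 r20.
pose g (y : 'rV_n) := e^-1 *: rsubmx (phi2 t (row_mx y (e *: v))).
have cg : Ck k (ball x r) g.
  apply: Ck_mx => // i j; under eq_fun do rewrite !mxE.
  apply: CkM => //; first exact: Ck_cst.
  apply: Ck_coord => //.
  apply: (@Ck_comp_vec _ _ _ _ k (ball x r) (ball (row_mx x 0) r3) (fun y => row_mx y (e *: v)) (phi2 t)) => //.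
  - by move=> y /inb; apply: le_ball; rewrite ge_min lexx orbT.
  - by apply: Ck_row_mx => //; [exact: Ck_id|exact: Ck_cst].
  - exact: H3.
apply: Ck_ext cg => // y yb.
have By : B y by apply/Ha/(le_ball _ yb); rewrite ge_min lexx.
have [M [M0 dM HM]] := flow_diff T0 oB fl By.
have [_ ->] := HM t tT; rewrite /g.
have [y0 ty] := fl y By.
have tw : trajectory (vprolong f) T (fun s => row_mx (phi s y) ((e *: v) *m M s)).
  move=> s sT; have [dx sx] := ty s sT; split; last by apply: sm_vprolong; rewrite row_mxKl.
  rewrite /vprolong row_mxKl row_mxKr; apply: isd_row_mx => //.
  by rewrite -mulmxA; apply: is_derive_mulmxl; exact: dM.
have zb : ball (row_mx x 0) r2 (row_mx y (e *: v)) by apply: le_ball (inb _ yb); rewrite ge_min lexx.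
have [z0 tz] := fl2 _ zb.
rewrite (trajectory_unique tz tw) ?row_mxKr//; last by rewrite z0 y0 M0 mulmx1.
by rewrite -scalemxAl scalerA mulVf ?scale1r// gt_eqF.
Unshelve. all: by end_near. Qed.

Lemma flow_smooth n (f : 'rV_n -> 'rV_n) (T : R) (B : set 'rV_n) (phi : R -> 'rV_n -> 'rV_n) :
  0 <= T -> open B -> flow_on f T B phi -> forall x, B x -> forall t : R, `|t| <= T -> smooth_at x (phi t).
Proof.
move=> T0 oB fl x Bx t tT; exists B => // k; apply: Ck_loc => y By.
have [r r0 H] := flow_Ck k T0 oB fl By.
by exists (ball y r); [exact: ballxx|exact: H].
Qed.
End FlowRegularity.

(** * Symmetry of second derivatives and the inverse function theorem *)

Section Flows.

Lemma local_flow n (f : 'rV_n -> 'rV_n) (c : R -> 'rV_n) (T : R) : 0 <= T ->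
  trajectory f T c -> exists r C : R, exists phi, [/\ 0 < r, 0 <= C, flow_on f T (ball (c 0) r) phi &
    forall x, ball (c 0) r x -> forall t : R, `|t| <= T -> `|phi t x - c t| <= C * `|x - c 0|].
Proof.
move=> T0 tc; have [r [C [r0 C0 H]]] := flow_exists T0 tc.
pose phi t z := if pselect (ball (c 0) r z) is left h then projT1 (cid (H z h)) t else 0.
exists r, C, phi; split => // z zb; rewrite /phi; case: pselect => // h.
  by have [] := projT2 (cid (H z h)).
by have [] := projT2 (cid (H z h)).
Qed.

Lemma ball_near (V : normedModType R) (x : V) (P : V -> Prop) : (\forall y \near x, P y) ->
  exists2 d : R, 0 < d & forall y, ball x d y -> P y.
Proof. by move=> /nbhs_ballP[d /= d0 Hd]; exists d. Qed.

Lemma near_ball2 (V : normedModType R) (x : V) (P Q : V -> Prop) :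
  (\forall y \near x, P y) -> (\forall y \near x, Q y) ->
  exists2 d : R, 0 < d & forall y, ball x d y -> P y /\ Q y.
Proof.
move=> /ball_near[d d0 Hd] /ball_near[e e0 He]; exists (Num.min d e); first by rewrite lt_min d0.
by move=> y yb; split; [apply: Hd|apply: He]; apply: le_ball yb; rewrite ge_min lexx ?orbT.
Qed.

Lemma sm_dist n (V : normedModType R) (g : 'rV_n -> V) x (e : R) : smooth_at x g -> 0 < e ->
  \forall y \near x, `|g x - g y| < e.
Proof. by move=> sg e0; apply: (@cvgr_dist_lt _ _ _ (nbhs x) _ g (g x)) => //; exact: sm_cont. Qed.

Lemma mean_value_R (f df : R -> R) (h : R) : 0 < h ->
  (forall s : R, 0 <= s <= h -> is_derive s 1 f (df s)) ->
  exists2 s : R, 0 <= s <= h & f h - f 0 = df s * h.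
Proof.
move=> h0 H; have [|s sh E] := @MVT_segment R f df 0 h (ltW h0) _ (is_derive_within H).
  by move=> s; rewrite in_itv/= => /andP[s0 sh]; apply: H; rewrite !ltW.
by exists s; [move: sh; rewrite in_itv|rewrite E subr0].
Qed.

(** The second difference is symmetric in [a] and [b], while the mean value theorem in one direction
    after the other turns it into a mixed derivative at a nearby point. Comparing the two orders as
    [h] tends to 0 gives [schwarz]. *)
Lemma second_difference n (f : 'rV_n -> R) x (a b : 'rV_n) (h : R) : 0 < h ->
  (forall s t : R, 0 <= s <= h -> 0 <= t <= h -> smooth_at (x + s *: a + t *: b) f) ->
  exists s t : R, [/\ 0 <= s <= h, 0 <= t <= h &
    f (x + h *: a + h *: b) - f (x + h *: a) - f (x + h *: b) + f x = 'D_b ('D_a f) (x + s *: a + t *: b) * h * h].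
Proof.
move=> h0 sm; pose g (s : R) := f (x + s *: a + h *: b) - f (x + s *: a).
have hh : 0 <= h <= h by rewrite lexx andbT ltW.
have h00 : 0 <= (0 : R) <= h by rewrite lexx ltW.
pose dg (s : R) := 'D_a f (x + s *: a + h *: b) - 'D_a f (x + s *: a).
have Dg (s : R) : 0 <= s <= h -> is_derive s 1 g (dg s).
  move=> sh; have d1 := sm_diff (sm s h sh hh); have d2 := sm_diff (sm s 0 sh h00).
  rewrite scale0r addr0 in d2; rewrite addrAC in d1.
  have e1 := is_derive_line d1; have e2 := is_derive_line d2.
  rewrite (addrAC x) in e1.
  have E : (fun s => f (x + h *: b + s *: a)) = (fun s => f (x + s *: a + h *: b)).
    by apply/funext => u; rewrite addrAC.
  by rewrite E in e1; have := is_deriveB e1 e2.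
have [s sh Es] := mean_value_R h0 Dg.
have Dt (t : R) : 0 <= t <= h -> is_derive t 1 (fun t => 'D_a f (x + s *: a + t *: b)) ('D_b ('D_a f) (x + s *: a + t *: b)).
  by move=> th; apply: is_derive_line; apply: sm_diff; apply: sm_der; exact: sm.
have [t th Et] := mean_value_R h0 Dt.
exists s, t; split => //; rewrite scale0r addr0 in Et.
by rewrite -Et -[X in X * h]/(dg s) -Es /g scale0r addr0; ring.
Qed.

Lemma schwarz_aux n (F G : 'rV_n -> R) x (v w : 'rV_n) (d : R) : 0 < d ->
  (forall e : R, 0 < e -> \forall y \near x, `|F x - F y| < e) ->
  (forall e : R, 0 < e -> \forall y \near x, `|G x - G y| < e) ->
  (forall h : R, 0 < h -> h * (2 * (`|v| + `|w| + 1)) <= d -> exists s t s' t' : R,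
    [/\ 0 <= s <= h, 0 <= t <= h, 0 <= s' <= h & 0 <= t' <= h] /\
    F (x + s *: v + t *: w) = G (x + s' *: w + t' *: v)) -> F x = G x.
Proof.
move=> d0 cF cG H; apply/eqP; rewrite -subr_eq0 -normr_le0; apply/ler_addgt0Pr => e e0; rewrite add0r.
have e2 : 0 < e / 2 by lra.
have [a a0 Ha] := near_ball2 (cF _ e2) (cG _ e2).
have nv := normr_ge0 v; have nw := normr_ge0 w.
pose D := 2 * (`|v| + `|w| + 1); have D0 : 0 < D by rewrite mulr_gt0// ltr_wpDl// addr_ge0.
pose h := Num.min a d / D.
have m0 : 0 < Num.min a d by rewrite lt_min a0.
have h0 : 0 < h by rewrite divr_gt0.
have hD : h * D = Num.min a d by rewrite /h divfK// gt_eqF.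
have hd : h * D <= d by rewrite hD ge_min lexx orbT.
have ha : h * D <= a by rewrite hD ge_min lexx.
have inb (s t : R) (v' w' : 'rV_n) : 0 <= s <= h -> 0 <= t <= h -> `|v'| + `|w'| = `|v| + `|w| ->
    ball x a (x + s *: v' + t *: w').
  move=> /andP[s0 sh] /andP[t0 th] vw; rewrite -ball_normE /= -addrA opprD addrA subrr add0r normrN.
  apply: le_lt_trans (ler_normD _ _) _; rewrite !normrZ !ger0_norm//.
  have : s * `|v'| <= h * `|v'| by rewrite ler_wpM2r.
  have : t * `|w'| <= h * `|w'| by rewrite ler_wpM2r.
  have : h * `|v'| + h * `|w'| = h * `|v| + h * `|w| by rewrite -!mulrDr vw.
  have : 0 <= h * `|v| by rewrite mulr_ge0// ltW.
  have : 0 <= h * `|w| by rewrite mulr_ge0// ltW.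
  by move: ha; rewrite /D; lra.
have [s [t [s' [t' [[sh th sh' th'] E]]]]] := H h h0 hd.
have [h1 _] := Ha _ (inb s t v w sh th erefl).
have [_ h2] := Ha _ (inb s' t' w v sh' th' (addrC _ _)).
rewrite E in h1; move: h1 h2; set C := G (x + _ + _) => h1 h2.
have -> : F x - G x = (F x - C) - (G x - C) by ring.
by apply: le_trans (ler_normB _ _) _; lra.
Qed.

Lemma schwarz n (f : 'rV_n -> R) x v w : smooth_at x f ->
  'D_v ('D_w f) x = 'D_w ('D_v f) x.
Proof.
move=> sf; have [d d0 Hd] := ball_near (sm_near sf).
have nv := normr_ge0 v; have nw := normr_ge0 w.
apply: (@schwarz_aux n ('D_v ('D_w f)) ('D_w ('D_v f)) x w v d d0).
- by move=> e e0; exact: (sm_dist (sm_der v (sm_der w sf)) e0).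
- by move=> e e0; exact: (sm_dist (sm_der w (sm_der v sf)) e0).
move=> h h0 hd.
have inb (s t : R) : 0 <= s <= h -> 0 <= t <= h -> smooth_at (x + s *: v + t *: w) f.
  move=> /andP[s0 sh] /andP[t0 th]; apply: Hd; rewrite -ball_normE /= -addrA opprD addrA subrr add0r normrN.
  apply: le_lt_trans (ler_normD _ _) _; rewrite !normrZ !ger0_norm//.
  have : s * `|v| <= h * `|v| by rewrite ler_wpM2r.
  have : t * `|w| <= h * `|w| by rewrite ler_wpM2r.
  have : 0 <= h * `|v| by rewrite mulr_ge0// ltW.
  have : 0 <= h * `|w| by rewrite mulr_ge0// ltW.
  by lra.
have inb' (s t : R) : 0 <= s <= h -> 0 <= t <= h -> smooth_at (x + s *: w + t *: v) f.
  by move=> hs ht; rewrite addrAC; exact: inb.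
have [s [t [sh th E1]]] := second_difference h0 inb.
have [s' [t' [sh' th' E2]]] := second_difference h0 inb'.
exists s', t', s, t; split; first by split.
have h00 : h != 0 by rewrite gt_eqF.
apply: (mulIf h00); apply: (mulIf h00).
apply: eq_trans (esym E2) _; apply: eq_trans E1.
by rewrite (addrAC x); ring.
Qed.

Lemma is_derive_comp_mul n p (f : 'rV_n -> 'rV_p) (u : R -> 'rV_n) (t : R) (d : 'rV_n) :
  is_derive t 1 u d -> differentiable f (u t) -> is_derive t 1 (fun s => f (u s)) (d *m jacobian f (u t)).
Proof.
move=> [/derivable1_diffP du <-] df; rewrite -(derive_mulE _ df).
have dc : differentiable (fun s => f (u s)) t by exact: (differentiable_comp du df).
apply: DeriveDef; first exact: diff_derivable.
rewrite (deriveE (1 : R) dc) (deriveE _ df) (deriveE (1 : R) du).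
exact: (congr1 (fun L : R -> _ => L 1) (diff_comp du df)).
Qed.

(** The map [h] obtained by projecting with [A] has the identity as derivative at [x0], and two
    points with the same image satisfy a quadratic estimate that excludes small positive
    distances. *)
Lemma inj_near n p (f : 'rV_n -> 'rV_p) (x0 : 'rV_n) (A : 'M[R]_(p, n)) : smooth_at x0 f ->
  jacobian f x0 *m A = 1%:M ->
  exists2 d : R, 0 < d & forall x y, ball x0 d x -> ball x0 d y -> f x = f y -> x = y.
Proof.
move=> sf JA.
pose h x := f x *m A - f x0 *m A.
have smh x : smooth_at x f -> smooth_at x h.
  by move=> sfx; apply: smB; [apply: sm_mulmx => //; exact: sm_cst|exact: sm_cst].
have tr : trajectory h 0 (fun=> x0).
  by move=> t _; split; [rewrite /h subrr; exact: is_derive_cst|exact: smh].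
have [d1 [K [d10 K0 H]]] := jac_tube (lexx 0) tr.
have H0 := H 0 (ltac:(by rewrite normr0)).
have J0 : jacobian h x0 = 1%:M.
  have df := sm_diff sf; have dA y : is_diff y (mulmxr A : 'rV_p -> 'rV_n) (mulmxr A).
    have cA := @linear_mulmxr_cont p n A.
    by apply: DiffDef; [exact: linear_differentiable|rewrite diff_lin].
  apply/row_matrixP => i; have dh := sm_diff (smh _ sf).
  rewrite (row_jac i dh) -JA row_mul (row_jac i df) deriveB; last 2 first.
  - by apply: diff_derivable; apply: (@differentiable_comp _ _ _ _ f (mulmxr A)) => //; have [] := dA (f x0).
  - exact: derivable_cst.
  rewrite derive_cst subr0.
  have dc : differentiable (mulmxr A \o f) x0 by apply: differentiable_comp => //; have [] := dA (f x0).
  have -> : 'D_(delta_mx 0 i) (fun x => f x *m A) x0 = 'd (mulmxr A \o f) x0 (delta_mx 0 i) by rewrite -deriveE.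
  have [dA1 dA2] := dA (f x0).
  by rewrite (diff_comp df dA1) /= dA2 (deriveE _ df).
have ui : jacobian h x0 \in unitmx by rewrite J0 unitmx1.
have sJ := sm_jac (smh _ sf).
have si : smooth_at x0 (fun x => invmx (jacobian h x)) by exact: sm_invmx.
have [d2 d20 H2] := near_ball2 (near_unitmx sJ ui) (sm_dist si ltr01).
pose c := `|invmx (jacobian h x0)| + 1.
have c0 : 0 < c by rewrite ltr_wpDl.
pose Q := n%:R * c * K; have Q0 : 0 <= Q by rewrite !mulr_ge0// ltW.
(* On this ball [|y - x|] is at most [1 / (2 (Q + 1))], while [f x = f y] gives
   [|y - x| <= Q |y - x|^2]; together these leave only [x = y]. *)
exists (Num.min (Num.min d1 d2) (4 * (Q + 1))^-1).
  by rewrite !lt_min d10 d20 invr_gt0 mulr_gt0// ltr_wpDl.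
move=> x y xb yb fxy.
have bm z : ball x0 (Num.min (Num.min d1 d2) (4 * (Q + 1))^-1) z -> [/\ ball x0 d1 z, ball x0 d2 z & `|x0 - z| < (4 * (Q + 1))^-1].
  by rewrite -!ball_normE /= !lt_min => /andP[/andP[-> ->] ->].
have [x1 x2 x3] := bm x xb; have [y1 y2 y3] := bm y yb.
have [_ _ _] := H0 _ _ x1 y1; rewrite /h fxy subrr sub0r normrN => Hq.
have [ux ix] := H2 _ x2.
have ic : `|invmx (jacobian h x)| <= c.
  have -> : invmx (jacobian h x) = invmx (jacobian h x0) - (invmx (jacobian h x0) - invmx (jacobian h x)) by rewrite opprB addrC subrK.
  by apply: le_trans (ler_normB _ _) _; rewrite lerD2l ltW.
have E : `|y - x| <= Q * `|y - x| ^+ 2.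
  rewrite -[X in `|X| <= _](mulmxK ux).
  apply: le_trans (mulmx_norm _ _) _; rewrite /Q.
  have := mulr_ge0 K0 (exprn_ge0 2 (normr_ge0 (y - x))); set q := `|y - x| ^+ 2 in Hq * => q0.
  apply: (@le_trans _ _ (n%:R * (K * q) * c)); last by rewrite le_eqVlt; apply/orP; left; apply/eqP; ring.
  by apply: ler_pM => //; rewrite ler_wpM2l.
have xy2 : `|y - x| * (2 * (Q + 1)) <= 1.
  have -> : y - x = (x0 - x) - (x0 - y) by rewrite opprB [RHS]addrC addrA subrK.
  have h1 := ler_normB (x0 - x) (x0 - y).
  move: x3 y3; rewrite -[X in _ < X]mul1r -[X in _ -> _ < X -> _]mul1r !ltr_pdivlMr ?mulr_gt0 ?ltr_wpDl// => x3 y3.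
  have : `|x0 - x - (x0 - y)| * (Q + 1) <= (`|x0 - x| + `|x0 - y|) * (Q + 1) by rewrite ler_wpM2r// addr_ge0.
  lra.
apply/eqP; rewrite eq_sym -subr_eq0 -normr_le0.
have := normr_ge0 (y - x); set a := `|y - x| in E xy2 * => a0.
rewrite expr2 in E; have : Q * (a * a) = a * (Q * a) by ring.
nra.
Qed.

Lemma is_derive_scalev p q (z : 'M[R]_(p, q)) (t : R) : is_derive t 1 (fun s : R => s *: z) z.
Proof.
rewrite -[X in is_derive _ _ _ X]scale1r; have [d3 d4] := is_diff_scalel t z.
by apply: DeriveDef; [exact: diff_derivable|rewrite (deriveE _ d3) d4].
Qed.

(** The inverse is a flow: with [z = y - f x0] held constant, solve [x' = z *m invmx (jacobian f x)]
    from [x0]. Then [f x - t z] is constant, so [x] at time 1 is a preimage of [y], and smoothness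
    of the inverse is smoothness of flows. The equation is started near the rest point [z = 0]. *)
Lemma inverse_function n (f : 'rV_n -> 'rV_n) x0 : smooth_at x0 f -> jacobian f x0 \in unitmx ->
  exists g : 'rV_n -> 'rV_n, [/\ smooth_at (f x0) g, g (f x0) = x0,
    \forall x \near x0, g (f x) = x & \forall y \near f x0, f (g y) = y].
Proof.
move=> sf uf.
pose F (z : 'rV_(n + n)) := row_mx (rsubmx z *m invmx (jacobian f (lsubmx z))) (0 : 'rV_n).
have sF z : smooth_at (lsubmx z) f -> jacobian f (lsubmx z) \in unitmx -> smooth_at z F.
  move=> sfz ufz; have sl : smooth_at z (fun z : 'rV_(n + n) => lsubmx z) by apply: sm_lsub; exact: sm_id.
  have sr : smooth_at z (fun z : 'rV_(n + n) => rsubmx z) by apply: sm_rsub; exact: sm_id.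
  apply: sm_row_mx; last exact: sm_cst.
  apply: sm_mulmx => //; apply: sm_invmx => //.
  exact: (sm_comp sl (sm_jac sfz)).
pose z0 : 'rV_(n + n) := row_mx x0 0.
have t0 : trajectory F 1 (fun=> z0).
  move=> t _; split; last by apply: sF; rewrite row_mxKl.
  by rewrite /F row_mxKr mul0mx row_mx0; exact: is_derive_cst.
have [r [C [phi [r0 C0 fl HC]]]] := local_flow ler01 t0.
have sphi := flow_smooth ler01 (@open_ballrV _ z0 _ r0) fl.
pose g y := lsubmx (phi 1 (row_mx x0 (y - f x0))).
have z0b : ball z0 r z0 by exact: ballxx.
have n1 : `|1 : R| <= 1 by rewrite normr1.
have sg : smooth_at (f x0) g.
  apply: sm_lsub.
  apply: (@sm_comp _ _ _ _ _ (fun y => row_mx x0 (y - f x0)) (phi 1)); last first.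
    by rewrite subrr; exact: sphi.
  apply: sm_row_mx; first exact: sm_cst.
  by apply: smB; [exact: sm_id|exact: sm_cst].
have g0 : g (f x0) = x0.
  have [p0 tp] := fl z0 z0b.
  by rewrite /g subrr -/z0 (trajectory_unique tp t0 p0 n1) row_mxKl.
have [d d0 Hd] : exists2 d : R, 0 < d & forall x, ball x0 d x -> smooth_at x f /\ jacobian f x \in unitmx.
  exact: (near_ball2 (sm_near sf) (near_unitmx (sm_jac sf) uf)).
have fg : \forall y \near f x0, f (g y) = y.
  apply/nbhs_ballP; exists (Num.min r (d / (C + 1))); first by rewrite /= lt_min r0 divr_gt0// ltr_wpDl.
  move=> y; rewrite -ball_normE /= distrC lt_min => /andP[yr].
  rewrite ltr_pdivlMr ?ltr_wpDl// => yd.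
  pose z := y - f x0; rewrite -/z in yr yd.
  have zE : row_mx x0 z - z0 = row_mx 0 z by rewrite opp_row_mx add_row_mx subrr subr0.
  have nz (c : R) : `|z| < c -> `|row_mx (0 : 'rV_n) z| < c.
    by move=> zc; apply: norm_row_mx_lt => //; rewrite normr0 (le_lt_trans _ zc).
  have zb : ball z0 r (row_mx x0 z) by rewrite -ball_normE /= distrC zE; exact: nz.
  have [p0 tp] := fl _ zb.
  have st (t : R) : `|t| <= 1 -> ball x0 d (lsubmx (phi t (row_mx x0 z))).
    move=> t1; rewrite -ball_normE /= distrC.
    apply: (@le_lt_trans _ _ (C * `|row_mx x0 z - z0|)); last first.
      rewrite zE; have := nz (`|z| + 1) _; rewrite ltrDl => /(_ ltr01) _.
      have : `|row_mx (0 : 'rV_n) z| <= `|z|.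
        by apply/ler_addgt0Pr => e e0; apply/ltW/nz; rewrite ltrDl.
      have := normr_ge0 z; nra.
    apply: le_trans (HC _ zb t t1); rewrite -[X in lsubmx _ - X](row_mxKl x0 (0 : 'rV_n)) -linearB/=.
    apply: mx_norm_le => // i j; rewrite mxE; exact: mx_coord_le.
  pose w (t : R) := phi t (row_mx x0 z).
  have dw (t : R) : `|t| <= 1 -> is_derive t 1 w (F (w t)) by move=> t1; have [] := tp t t1.
  have le01 (t : R) : 0 <= t <= 1 -> `|t| <= 1 by move=> /andP[t0' t1]; rewrite ger0_norm.
  have dz (t : R) : 0 <= t <= 1 -> rsubmx (w t) = z.
    move=> /andP[t0' t1]; rewrite -[RHS](row_mxKr x0 z) -p0.
    apply: (@derive0_const _ _ (fun s => rsubmx (w s)) 0 t t0') => s /andP[s0 s_t].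
    have := dw s (le01 s _); rewrite s0 (le_trans s_t)// => /(_ isT) h.
    by have := isd_rsub h; rewrite /F row_mxKr.
  have dl (t : R) : 0 <= t <= 1 -> is_derive t 1 (fun s => lsubmx (w s)) (z *m invmx (jacobian f (lsubmx (w t)))).
    move=> t01; have h := dw t (le01 t t01).
    by have := isd_lsub h; rewrite /F row_mxKl dz.
  have df (t : R) : 0 <= t <= 1 -> is_derive t 1 (fun s => f (lsubmx (w s)) - s *: z) 0.
    move=> t01; have [/sm_diff sft uft] := Hd _ (st t (le01 t t01)).
    have h1 := is_derive_comp_mul (dl t t01) sft; rewrite mulmxKV// in h1.
    have h2 := is_derive_scalev z t.
    by have := is_deriveB h1 h2; rewrite subrr.
  have := derive0_const ler01 df.
  rewrite scale1r scale0r subr0 /w p0 row_mxKl => /eqP; rewrite subr_eq => /eqP.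
  by rewrite /z (addrC (f x0)) subrK.
exists g; split => //.
have [a a0 Ha] := inj_near (A := invmx (jacobian f x0)) sf (mulmxV uf).
have gb : \forall y \near f x0, ball x0 a (g y).
  by rewrite -[x0 in ball x0]g0; apply: (sm_cont sg); exact: nbhsx_ballx.
have fb : \forall x \near x0, ball x0 a (g (f x)) /\ f (g (f x)) = f x.
  have [b b0 Hb] := near_ball2 gb fg.
  have : \forall x \near x0, ball (f x0) b (f x) by apply: (sm_cont sf); exact: nbhsx_ballx.
  by apply: filterS => x /Hb.
have [b b0 Hb] := ball_near fb.
apply/nbhs_ballP; exists (Num.min a b); first by rewrite /= lt_min a0.
move=> x xb; have [|h1 h2] := Hb x; first by apply: le_ball xb; rewrite ge_min lexx orbT.
by apply: Ha => //; apply: le_ball xb; rewrite ge_min lexx.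
Qed.
End Flows.

(** * Transport of a covector along a curve that is driven by a bivector *)

Section HomotopyCurve.

Lemma bounded_curve p q (A : R -> 'M[R]_(p, q)) (T : R) : 0 <= T ->
  (forall t : R, `|t| <= T -> {for t, continuous A}) ->
  exists2 K : R, 0 <= K & forall t : R, `|t| <= T -> `|A t| <= K.
Proof.
move=> T0 cA.
have cg : {within `[- T, T], continuous (fun t => `|A (clamp T t)|)}.
  apply: continuous_subspaceT => t; apply: continuous_comp; last exact: norm_continuous.
  by apply: continuous_comp; [exact: clamp_cont|apply: cA; exact: clamp_le].
have [|c _ cmax] := EVT_max _ cg; first by lra.
exists `|A (clamp T c)| => // t tT; have := cmax t; rewrite clamp_id//; apply.
by rewrite in_itv/= -ler_norml.
Qed.

Lemma linear_ode_exists p q (A : R -> 'M[R]_q) (g : R -> 'M[R]_(p, q)) (T : R) b0 : 0 <= T ->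
  (forall t : R, `|t| <= T -> {for t, continuous A}) ->
  (forall t : R, `|t| <= T -> {for t, continuous g}) ->
  exists b : R -> 'M[R]_(p, q), b 0 = b0 /\ forall t : R, `|t| <= T -> is_derive t 1 b (g t + b t *m A t).
Proof.
move=> T0 cA cg; have [K K0 HK] := bounded_curve T0 cA.
have cl t : `|clamp T t| <= T by exact: clamp_le.
pose F t Z := g (clamp T t) + Z *m A (clamp T t).
have cF (u : R -> 'M[R]_(p, q)) : continuous u -> continuous (fun t => F t (u t)).
  move=> cu t; have c1 : {for t, continuous (fun t => g (clamp T t))}.
    by apply: (@continuous_comp _ _ _ (clamp T) g); [exact: clamp_cont|apply: cg].
  have c2 : {for t, continuous (fun t => A (clamp T t))}.
    by apply: (@continuous_comp _ _ _ (clamp T) A); [exact: clamp_cont|apply: cA].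
  have c3 : {for t, continuous (fun t => u t *m A (clamp T t))}.
    by apply: cont_mulmx => //; exact: cu.
  exact: (@continuousD _ _ _ _ _ _ c1 c3).
have lF (t : R) (Z Z' : 'M[R]_(p, q)) : `|F t Z - F t Z'| <= q%:R * K * `|Z - Z'|.
  rewrite /F opprD addrACA subrr add0r -mulmxBl; apply: le_trans (mulmx_norm _ _) _.
  by rewrite -!mulrA ler_wpM2l// mulrC ler_wpM2r// HK.
have [b [b00 db]] := picard b0 (mulr_ge0 (ler0n _ q) K0) cF lF.
exists b; split => // t tT; have := db t.
by rewrite /F clamp_id.
Qed.

Lemma linear_ode_unique p q (y : R -> 'M[R]_(p, q)) (Z : R -> 'M[R]_q) (T : R) : 0 <= T ->
  (forall t : R, `|t| <= T -> {for t, continuous Z}) ->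
  (forall t : R, `|t| <= T -> is_derive t 1 y (y t *m Z t)) -> y 0 = 0 ->
  forall t : R, `|t| <= T -> y t = 0.
Proof.
move=> T0 cZ dy y0 t tT; have [K K0 HK] := bounded_curve T0 cZ.
have := gronwall_abs (mulr_ge0 (ler0n _ q) K0) (lexx 0) dy _ tT.
rewrite y0 normr0 addr0 mulr0 mul0r normr_le0 => H; apply/eqP/H => s sT.
rewrite addr0; apply: le_trans (mulmx_norm _ _) _.
by rewrite -!mulrA ler_wpM2l// mulrC ler_wpM2r// HK.
Qed.

Section AlongCurve.
Variables (m : nat) (P B : R -> 'M[R]_m) (Pk : 'I_m -> R -> 'M[R]_m).
(* [P] is a bivector along a curve and [Pk k] its partial derivatives there, so that [dirP u] is its derivative in the direction [u]. *)
Definition dirP (u : 'rV_m) (t : R) : 'M[R]_m := \sum_k u 0 k *: Pk k t.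

Lemma dirPD u v t : dirP (u + v) t = dirP u t + dirP v t.
Proof. by rewrite /dirP -big_split; apply: eq_bigr => k _; rewrite mxE scalerDl. Qed.

Lemma dirPN u t : dirP (- u) t = - dirP u t.
Proof. by rewrite /dirP -sumrN; apply: eq_bigr => k _; rewrite mxE scaleNr. Qed.

Hypothesis hP : forall t : R, `|t| <= 1 -> (P t)^T = - P t.
Hypothesis hPk : forall k (t : R), `|t| <= 1 -> (Pk k t)^T = - Pk k t.
Hypothesis hJ : forall (t : R), `|t| <= 1 -> forall x y z : 'rV_m,
  y *m dirP (x *m P t) t *m z^T + z *m dirP (y *m P t) t *m x^T + x *m dirP (z *m P t) t *m y^T = 0.
Hypothesis cPk : forall k (t : R), `|t| <= 1 -> {for t, continuous (Pk k)}.
Hypothesis cB : forall t : R, `|t| <= 1 -> {for t, continuous B}.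
Variable th : R -> 'rV_m.
Hypothesis cth : forall t : R, `|t| <= 1 -> {for t, continuous th}.
Hypothesis dP : forall t : R, `|t| <= 1 -> is_derive t 1 P (dirP (th t *m P t) t - P t *m B t *m P t).

(** Coefficient matrix of the equation for [b] in [homotopy_curve]; it is the negative transpose of
    [covZ], the coefficient in the linearised equation for a variation [v] of the base curve, as
    [covA_mul] and [covZ_mul] together express. *)
Definition covA (t : R) : 'M[R]_m := \matrix_(j, k) (Pk k t *m (th t)^T) j 0.

Lemma dirP_tr u t : `|t| <= 1 -> (dirP u t)^T = - dirP u t.
Proof.
by move=> t1; rewrite /dirP linear_sum -sumrN; apply: eq_bigr => k _; rewrite linearZ/= hPk// scalerN.
Qed.

Lemma covA_mul (b z : 'rV_m) t : `|t| <= 1 ->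
  b *m covA t *m z^T = - (th t *m dirP z t *m b^T).
Proof.
move=> t1; rewrite /dirP mulmx_sumr mulmx_suml -sumrN.
apply/matrixP => i j; rewrite !ord1 mxE summxE; apply: eq_bigr => k _.
have -> : (b *m covA t) 0 k = (b *m (Pk k t *m (th t)^T)) 0 0.
  by rewrite !mxE; apply: eq_bigr => l _; rewrite mxE.
rewrite -scalemxAr -scalemxAl -scalerN !mxE mulrC; congr (_ * _).
have E : (th t *m Pk k t *m b^T)^T = - (b *m (Pk k t *m (th t)^T)).
  by rewrite !trmx_mul trmxK hPk// mulNmx mulmxN.
by move/matrixP/(_ 0 0): E; rewrite !mxE => ->; rewrite opprK.
Qed.

Definition covZ (t : R) : 'M[R]_m := \matrix_(k, j) (th t *m Pk k t) 0 j.

Lemma covZ_mul (y : 'rV_m) t : y *m covZ t = th t *m dirP y t.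
Proof.
rewrite /dirP mulmx_sumr; apply/rowP => j; rewrite mxE summxE; apply: eq_bigr => k _.
by rewrite mxE -scalemxAr [RHS]mxE.
Qed.

Lemma cont_covZ t : `|t| <= 1 -> {for t, continuous covZ}.
Proof.
move=> t1; apply: cont_mx => k j.
rewrite (_ : (fun y => _) = fun s => (th s *m Pk k s) 0 j); last by apply/funext => s; rewrite mxE.
by apply: cont_coord; apply: cont_mulmx; [exact: cth|exact: cPk].
Qed.

Lemma cont_covA t : `|t| <= 1 -> {for t, continuous covA}.
Proof.
move=> t1; apply: cont_mx => k j.
rewrite (_ : (fun y => _) = fun s => (Pk j s *m (th s)^T) k 0); last by apply/funext => s; rewrite mxE.
apply: cont_coord; apply: cont_mulmx; first exact: cPk.
apply: cont_mx => a b; rewrite (_ : (fun y => _) = fun s => th s b a); last by apply/funext => s; rewrite mxE.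
by apply: cont_coord; exact: cth.
Qed.

Variables (v thv : R -> 'rV_m).
Hypothesis cthv : forall t : R, `|t| <= 1 -> {for t, continuous thv}.
Hypothesis dv : forall t : R, `|t| <= 1 -> is_derive t 1 v (thv t *m P t + th t *m dirP (v t) t).

Lemma scal_tr (M : 'M[R]_1) : M^T = M.
Proof. by apply/matrixP => i j; rewrite mxE !ord1. Qed.

(** This is where the Jacobi identity acts: taken on [th], [b] and a test covector, it trades the
    three derivatives of [P] for a single term in [b *m P t - v']. *)
Lemma homotopy_step (b v' : 'rV_m) t : `|t| <= 1 ->
  b *m covA t *m P t + b *m dirP (th t *m P t) t - th t *m dirP v' t = (b *m P t - v') *m covZ t.
Proof.
move=> t1; rewrite covZ_mul -[b *m P t - v']/(b *m P t + - v') dirPD mulmxDr dirPN mulmxN; congr (_ + _).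
suff H (z : 'rV_m) : (b *m covA t *m P t + b *m dirP (th t *m P t) t) *m z^T = th t *m dirP (b *m P t) t *m z^T.
  apply/rowP => j; have := H (delta_mx 0 j); rewrite trmx_delta -!colE => /colP/(_ 0).
  by rewrite [LHS]mxE [RHS]mxE.
rewrite mulmxDl; have -> : b *m covA t *m P t *m z^T = th t *m dirP (z *m P t) t *m b^T.
  rewrite -mulmxA; have -> : P t *m z^T = (- (z *m P t))^T by rewrite raddfN/= trmx_mul hP// mulNmx opprK.
  by rewrite covA_mul// dirPN mulmxN mulNmx opprK.
have -> : th t *m dirP (b *m P t) t *m z^T = - (z *m dirP (b *m P t) t *m (th t)^T).
  by rewrite -[LHS]scal_tr !trmx_mul trmxK dirP_tr// mulNmx mulmxN mulmxA.
apply/eqP; rewrite -subr_eq0 opprK addrC.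
have := hJ t1 (th t) b z => E; apply/eqP; rewrite -[RHS]E.
by rewrite [RHS]addrAC [RHS]addrC; congr (_ + _); rewrite addrC.
Qed.

(** [v] is a variation of the base curve and [thv] the corresponding variation of the driving
    covector [th]. The covector [b] solves [b' = thv + v B + b covA]. Then [b P = v] persists, and
    the pairing of [b] with any other variation [w] changes only by the antisymmetric expression in
    [(v, thv)] and [(w, thw)] plus [B(v, w)]. For the spray that expression is the differential of
    the Liouville form; for Moser's field the total is zero. *)
Lemma homotopy_curve (b0 : 'rV_m) : b0 *m P 0 = v 0 ->
  exists b : R -> 'rV_m, b 0 = b0 /\ forall t : R, `|t| <= 1 -> b t *m P t = v t /\ forall (w : R -> 'rV_m) (thw : 'rV_m),
      is_derive t 1 w (thw *m P t + th t *m dirP (w t) t) ->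
      is_derive t 1 (fun s => b s *m (w s)^T : 'M[R]_1) (thv t *m (w t)^T - thw *m (v t)^T + v t *m B t *m (w t)^T : 'M[R]_1).
Proof.
move=> b0P; pose g t := thv t + v t *m B t.
have cv t : `|t| <= 1 -> {for t, continuous v} by move=> t1; exact: is_derive_cont (dv t1).
have cP t : `|t| <= 1 -> {for t, continuous P} by move=> t1; exact: is_derive_cont (dP t1).
have cg t : `|t| <= 1 -> {for t, continuous g}.
  move=> t1; have c := cont_mulmx (cv t t1) (cB t1).
  exact: (@continuousD _ _ _ _ _ _ (cthv t1) c).
have [b [b00 db]] := linear_ode_exists b0 ler01 cont_covA cg.
exists b; split => // t t1.
(* The defect [b P - v] satisfies a homogeneous linear equation with coefficient [covZ - B P] and
   vanishes at time 0. *)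
have bP : forall t : R, `|t| <= 1 -> b t *m P t - v t = 0.
  apply: (@linear_ode_unique 1 m (fun s => b s *m P s - v s) (fun s => covZ s - B s *m P s) 1 ler01).
  - move=> s s1; have c := cont_mulmx (cB s1) (cP s s1).
    exact: (@continuousB _ _ _ _ _ _ (cont_covZ s1) c).
  - move=> s s1; have h := @is_deriveB _ _ _ _ _ _ _ _ _ (isd_mulmx (db s s1) (dP s1)) (dv s1).
    apply: is_derive_eq h _; rewrite /g [RHS]mulmxBr -homotopy_step//.
    rewrite !mulmxDl !mulNmx mulmxDr mulmxN !mulmxA.
    set a1 := thv s *m P s; set a2 := v s *m B s *m P s; set a3 := b s *m covA s *m P s.
    set a4 := b s *m dirP _ _; set a5 := _ *m P s *m B s *m P s; set a6 := th s *m _.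
    by apply/rowP => j; rewrite !mxE; ring.
  - by rewrite b00 b0P subrr.
split; first by apply/eqP; rewrite -subr_eq0; apply/eqP; exact: bP.
move=> w thw dw; have := isd_mulmx (db t t1) (isd_tr dw) => h; apply: is_derive_eq h _.
have bt : b t *m P t = v t by apply/eqP; rewrite -subr_eq0; apply/eqP; exact: bP.
rewrite /g !mulmxDl covA_mul// linearD/= mulmxDr.
have -> : b t *m (thw *m P t)^T = - (thw *m (v t)^T).
  by rewrite -[RHS]scal_tr raddfN/= !trmx_mul trmxK hP// mulNmx mulmxN mulmxA bt.
have -> : b t *m (th t *m dirP (w t) t)^T = th t *m dirP (w t) t *m (b t)^T.
  by rewrite -[RHS]scal_tr !trmx_mul trmxK.
by apply/matrixP => i j; rewrite !mxE; ring.
Qed.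
End AlongCurve.
End HomotopyCurve.

(** * Jacobi identity and gauge transformations *)

Section Jacobi.

Lemma smooth_isd n p q (f : 'rV_n -> 'M[R]_(p, q)) x v : smooth_at x f -> is_derive x v f ('D_v f x).
Proof. by move=> sf; apply: DeriveDef => //; apply: diff_derivable; exact: sm_diff. Qed.

Lemma derive_mulmx n p q r (f : 'rV_n -> 'M[R]_(p, q)) (g : 'rV_n -> 'M[R]_(q, r)) x v :
  smooth_at x f -> smooth_at x g ->
  'D_v (fun y => f y *m g y) x = 'D_v f x *m g x + f x *m 'D_v g x.
Proof. by move=> sf sg; have [_ ->] := isd_mulmx (smooth_isd v sf) (smooth_isd v sg). Qed.

Lemma derive_trmx n p q (f : 'rV_n -> 'M[R]_(p, q)) x v :
  smooth_at x f -> 'D_v (fun y => (f y)^T) x = ('D_v f x)^T.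
Proof. by move=> sf; have [_ ->] := isd_tr (smooth_isd v sf). Qed.

Lemma derive_addmx n p q (f g : 'rV_n -> 'M[R]_(p, q)) x v :
  smooth_at x f -> smooth_at x g -> 'D_v (fun y => f y + g y) x = 'D_v f x + 'D_v g x.
Proof. by move=> sf sg; apply: deriveD; apply: diff_derivable; exact: sm_diff. Qed.

Lemma derive_near (V W : normedModType R) (f g : V -> W) x v :
  (\forall y \near x, f y = g y) -> 'D_v f x = 'D_v g x.
Proof. by move=> fg; exact: (@near_eq_derive R _ _ f g x v fg). Qed.

Lemma schwarz_mx n p q (f : 'rV_n -> 'M[R]_(p, q)) x v w : smooth_at x f ->
  'D_v ('D_w f) x = 'D_w ('D_v f) x.
Proof.
move=> sf; apply/matrixP => i j.
have H a b : ('D_a ('D_b f) x) i j = 'D_a ('D_b (fun y => f y i j)) x.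
  have [_ <-] := isd_coord i j (smooth_isd a (sm_der b sf)).
  apply: derive_near; near=> y.
  have sy : smooth_at y f by near: y; exact: sm_near.
  by have [_ ->] := isd_coord i j (smooth_isd b sy).
apply: eq_trans (H v w) _; apply: eq_trans (esym (H w v)).
by apply: schwarz; exact: sm_coord.
Unshelve. all: by end_near. Qed.

Lemma jac_symm n p (F : 'rV_n -> 'rV_p) x (u w : 'rV_n) : smooth_at x F ->
  w *m 'D_u (jacobian F) x = u *m 'D_w (jacobian F) x.
Proof.
move=> sF.
have H (a b : 'rV_n) : b *m 'D_a (jacobian F) x = 'D_a ('D_b F) x.
  have := derive_mulmx a (sm_cst x b) (sm_jac sF); rewrite derive_cst mul0mx add0r => <-.
  apply: derive_near; near=> y; rewrite derive_mulE//; apply: sm_diff; near: y; exact: sm_near.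
by rewrite !H; exact: schwarz_mx.
Unshelve. all: by end_near. Qed.

Definition cyclic3 n (f : 'rV_n -> 'M[R]_n) (a b c : 'rV_n) : 'M[R]_1 :=
  b *m f a *m c^T + c *m f b *m a^T + a *m f c *m b^T.

(** The vanishing of the Schouten bracket of [P] with itself, tested on constant covectors of a
    coordinate space. *)
Definition jacobi n (P : 'rV_n -> 'M[R]_n) x :=
  forall a b c : 'rV_n, cyclic3 (fun a => 'D_(a *m P x) P x) a b c = 0.

Definition closed2 n (eta : 'rV_n -> 'M[R]_n) x :=
  forall a b c : 'rV_n, cyclic3 (fun a => 'D_a eta x) a b c = 0.

(* The rows of [row_mx V A] frame a Lagrangian subbundle; the cyclic sum of these matrices is its Courant tensor. *)
Definition courant n (V A : 'rV_n -> 'M[R]_n) x (a : 'rV_n) : 'M[R]_n :=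
  'D_(a *m V x) A x *m (V x)^T + 'D_(a *m V x) V x *m (A x)^T.

(** Tensoriality of the Courant tensor: the terms that differentiate the change of frame [g] carry
    the factor that vanishes by isotropy. *)
Lemma courant_change n (V A g : 'rV_n -> 'M[R]_n) x a :
  smooth_at x V -> smooth_at x A -> smooth_at x g ->
  A x *m (V x)^T + V x *m (A x)^T = 0 ->
  courant (fun y => g y *m V y) (fun y => g y *m A y) x a
    = g x *m courant V A x (a *m g x) *m (g x)^T.
Proof.
move=> sV sA sg iso; rewrite /courant !derive_mulmx// !trmx_mul mulmxA.
set u := _ *m V x; rewrite !mulmxDr !mulmxDl.
set A' := 'D_u A x; set V' := 'D_u V x; set g' := 'D_u g x.
rewrite !mulmxA addrACA -[X in X + _ = _]mulmxDl -!(mulmxA g') -mulmxDr iso mulmx0 mul0mx add0r.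
by [].
Qed.

Lemma courant_gauge n (V A eta : 'rV_n -> 'M[R]_n) x a :
  smooth_at x V -> smooth_at x A -> smooth_at x eta -> (eta x)^T = - eta x ->
  courant V (fun y => A y + V y *m eta y) x a
    = courant V A x a + V x *m 'D_(a *m V x) eta x *m (V x)^T.
Proof.
move=> sV sA se ae; rewrite /courant derive_addmx//; last exact: sm_mulmx.
rewrite derive_mulmx// raddfD/= trmx_mul ae.
rewrite !mulmxDl mulmxDr mulNmx mulmxN !mulmxA.
set u := a *m V x; apply/matrixP => i j; rewrite !mxE; ring.
Qed.

Lemma cyclic3_ext n (f g : 'rV_n -> 'M[R]_n) a b c : (forall a, f a = g a) -> cyclic3 f a b c = cyclic3 g a b c.
Proof. by move=> E; rewrite /cyclic3 !E. Qed.

Lemma cyclic3D n (f g : 'rV_n -> 'M[R]_n) a b c : cyclic3 (fun a => f a + g a) a b c = cyclic3 f a b c + cyclic3 g a b c.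
Proof. by rewrite /cyclic3 !mulmxDr !mulmxDl; apply/matrixP => i j; rewrite !mxE; ring. Qed.

Lemma cyclic3_conj n m (f : 'rV_m -> 'M[R]_m) (B : 'M[R]_(n, m)) a b c :
  cyclic3 (fun a => B *m f (a *m B) *m B^T) a b c = cyclic3 f (a *m B) (b *m B) (c *m B).
Proof. by rewrite /cyclic3 !trmx_mul !mulmxA. Qed.

Lemma scal1_tr (M : 'M[R]_1) : M^T = M.
Proof. by apply/matrixP => i j; rewrite mxE !ord1. Qed.

(** * Pull-back of a Poisson structure along a map, gauged by a closed form *)

Section Gauge.
Variables (n m : nat) (V : 'rV_n -> 'M[R]_n) (b : 'rV_n -> 'M[R]_(n, m))
  (F : 'rV_n -> 'rV_m) (P : 'rV_m -> 'M[R]_m) (eta : 'rV_n -> 'M[R]_n) (x : 'rV_n).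
Hypotheses (sV : smooth_at x V) (sb : smooth_at x b) (sF : smooth_at x F) (sP : smooth_at (F x) P)
  (se : smooth_at x eta).
Hypothesis VF : \forall y \near x, V y *m jacobian F y = b y *m P (F y).
Hypothesis aP : (P (F x))^T = - P (F x).
Hypothesis jP : jacobi P (F x).
Hypothesis ae : (eta x)^T = - eta x.
Hypothesis ce : closed2 eta x.

Let A y := b y *m (jacobian F y)^T.

Lemma sm_frameA : smooth_at x A.
Proof. by apply: sm_mulmx => //; apply: sm_tr; exact: sm_jac. Qed.

Let VFx : V x *m jacobian F x = b x *m P (F x). Proof. exact: nbhs_singleton VF. Qed.

Lemma frame_isotropic : A x *m (V x)^T + V x *m (A x)^T = 0.
Proof.
rewrite /A trmx_mul trmxK mulmxA VFx -mulmxA -trmx_mul VFx trmx_mul aP mulNmx mulmxN mulmxA.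
by rewrite addNr.
Qed.

(** Differentiating [V *m jacobian F = b *m P] eliminates the derivative of [V], and the derivative
    of [b] cancels because [P] is antisymmetric. What is left is the Jacobi expression of [P] and
    terms in the second derivative of [F]. *)
Lemma courant_pull a : courant V A x a =
  b x *m 'D_(a *m b x *m P (F x)) P (F x) *m (b x)^T
  + (b x *m (V x *m 'D_(a *m V x) (jacobian F) x)^T - V x *m 'D_(a *m V x) (jacobian F) x *m (b x)^T).
Proof.
rewrite /courant; set u := a *m V x; have sJ := sm_jac sF.
have -> : 'D_u A x = 'D_u b x *m (jacobian F x)^T + b x *m ('D_u (jacobian F) x)^T.
  by rewrite derive_mulmx//; [rewrite derive_trmx|exact: sm_tr].
have sPF : smooth_at x (fun y => P (F y)) by exact: (sm_comp sF sP).
have E : 'D_u V x *m jacobian F x = 'D_u b x *m P (F x) + b x *m 'D_u (fun y => P (F y)) x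
         - V x *m 'D_u (jacobian F) x.
  rewrite -derive_mulmx// -(derive_near _ VF) derive_mulmx// addrK.
  by [].
have D : 'D_u (fun y => P (F y)) x = 'D_(a *m b x *m P (F x)) P (F x).
  have := derive_comp u (sm_diff sF) (sm_diff sP) => ->.
  by rewrite (derive_mulE u (sm_diff sF)) /u -!mulmxA VFx.
rewrite [(A x)^T]trmx_mul trmxK mulmxA E D !mulmxDl mulNmx trmx_mul.
have -> : 'D_u b x *m (jacobian F x)^T *m (V x)^T = - ('D_u b x *m P (F x) *m (b x)^T).
  by rewrite -mulmxA -trmx_mul VFx trmx_mul aP mulNmx mulmxN mulmxA.
rewrite !mulmxA; set X1 := 'D_u b x *m _ *m _; set X2 := _ *m (V x)^T; set X3 := _ *m (b x)^T; set X4 := _ *m (b x)^T.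
by apply/matrixP => i j; rewrite !mxE; ring.
Qed.

Lemma courant_pull_cyclic a c d : cyclic3 (courant V A x) a c d = 0.
Proof.
rewrite (cyclic3_ext _ _ _ courant_pull) cyclic3D.
rewrite (cyclic3_conj (fun a => 'D_(a *m P (F x)) P (F x)) (b x)) jP add0r.
(* The second derivative of [F] is symmetric in its two arguments, so its contributions cancel in
   pairs in the cyclic sum. *)
have G (B : 'M[R]_(n, m)) (S : 'rV_n -> 'M[R]_(n, m)) : (forall p q : 'rV_n, p *m S q = q *m S p) ->
    cyclic3 (fun a => B *m (S a)^T - S a *m B^T) a c d = 0.
  move=> symS; have H (p q s : 'rV_n) : q *m (B *m (S p)^T - S p *m B^T) *m s^T
     = s *m S p *m (q *m B)^T - q *m S p *m (s *m B)^T.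
    rewrite mulmxBr mulmxBl !trmx_mul !mulmxA; congr (_ - _).
    by rewrite -[LHS]scal1_tr !trmx_mul !trmxK !mulmxA.
  rewrite /cyclic3 (H a c d) (H c d a) (H d a c) (symS d a) (symS c a) (symS d c).
  by apply/matrixP => i j; rewrite !mxE; ring.
apply: (G (b x) (fun a => V x *m 'D_(a *m V x) (jacobian F) x)) => p q.
by rewrite !mulmxA jac_symm.
Qed.

Hypothesis uQ : A x + V x *m eta x \in unitmx.
Let Q y := A y + V y *m eta y.

Lemma sm_Q : smooth_at x Q.
Proof. by apply: smD; [exact: sm_frameA|exact: sm_mulmx]. Qed.

Lemma gauge_smooth : smooth_at x (fun y => invmx (Q y) *m V y).
Proof. by apply: sm_mulmx => //; apply: sm_invmx => //; exact: sm_Q. Qed.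

Lemma gauge_isotropic : Q x *m (V x)^T + V x *m (Q x)^T = 0.
Proof.
rewrite /Q mulmxDl raddfD/= mulmxDr (trmx_mul (V x) (eta x)) ae mulNmx mulmxN !mulmxA addrACA frame_isotropic.
by rewrite subrr addr0.
Qed.

Lemma gauge_antisym : (invmx (Q x) *m V x)^T = - (invmx (Q x) *m V x).
Proof.
have uQT : (Q x)^T \in unitmx by rewrite unitmx_tr.
rewrite trmx_mul trmx_inv; apply: (can_inj (mulmxK uQT)); rewrite mulmxKV//.
apply: (can_inj (mulKmx uQ)); rewrite mulNmx mulmxN mulmxA mulmxA mulmxV// mul1mx.
by apply/eqP; rewrite -addr_eq0 gauge_isotropic.
Qed.

(** Multiplying the frame [(V, Q)] by [invmx Q] gives the frame of a graph, whose Courant tensor is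
    the Jacobi expression. The change of frame conjugates that tensor, the gauge transformation adds
    the cyclic sum of a closed form, and the pulled-back part vanishes. *)
Lemma gauge_jacobi : jacobi (fun y => invmx (Q y) *m V y) x.
Proof.
have sQ := sm_Q; have sQi := sm_invmx uQ sQ.
have nQ : \forall y \near x, invmx (Q y) *m Q y = 1%:M.
  have := near_unitmx sQ uQ; apply: filterS => y uy; exact: mulVmx.
have sPe := gauge_smooth.
move=> p q s.
have E a : 'D_(a *m (invmx (Q x) *m V x)) (fun y => invmx (Q y) *m V y) x
   = courant (fun y => invmx (Q y) *m V y) (fun y => invmx (Q y) *m Q y) x a.
  rewrite /courant; set u := a *m _; rewrite (derive_near _ nQ) derive_cst mul0mx add0r.
  by rewrite (nbhs_singleton nQ) trmx1 mulmx1.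
rewrite (cyclic3_ext _ _ _ E).
have E2 a := courant_change a sV sQ sQi gauge_isotropic.
rewrite (cyclic3_ext _ _ _ E2) (cyclic3_conj (courant V Q x)).
have E3 a := courant_gauge a sV sm_frameA se ae.
rewrite (cyclic3_ext _ _ _ E3) cyclic3D courant_pull_cyclic add0r.
by rewrite (cyclic3_conj (fun a => 'D_a eta x) (V x)) ce.
Qed.
End Gauge.
End Jacobi.

(** * Manifolds, maps and integral curves in charts *)

Section Manifold.

(** The axioms that total spaces of bundles inherit through [bundle_hmfd]. The countable bases of
    [X], for the dimension bound, and of [P], for injectivity, are taken directly from
    [is_manifold]. *)
Definition hmfd n (N : premanifold R n) : Prop :=
  [/\ forall x : N, exists2 c, atlas c & cdom c x,
      forall c : chart R n N, atlas c ->
        [/\ forall x, cdom c x -> cinv c (cmap c x) = x,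
            mopen (cdom c) & smooth_on (cdom c) (cmap c)] &
      forall x y : N, x <> y -> exists U V : set N,
        [/\ mopen U, mopen V, U x, V y & U `&` V = set0]].

Lemma manifold_hmfd n (N : premanifold R n) : is_manifold N -> hmfd N.
Proof. by case. Qed.

Section One.
Variables (n : nat) (N : premanifold R n).
Hypothesis hN : hmfd N.
Implicit Types (z : N) (c : chart R n N) (U : set N).

Lemma chart_atP z : atlas (chart_at z) /\ cdom (chart_at z) z.
Proof.
have [H _ _] := hN; rewrite /chart_at; case: pselect => [h|]; first by case: (cid h).
by case; have [c ac dc] := H z; exists c.
Qed.

Lemma at_atlas z : atlas (chart_at z). Proof. exact: (chart_atP z).1. Qed.
Lemma at_dom z : cdom (chart_at z) z. Proof. exact: (chart_atP z).2. Qed.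

Lemma cinvK c z : atlas c -> cdom c z -> cinv c (cmap c z) = z.
Proof. by move=> ac; have [_ /(_ c ac)[+ _ _] _] := hN; exact. Qed.

Lemma mopen_cdom c : atlas c -> mopen (cdom c).
Proof. by move=> ac; have [_ /(_ c ac)[_ + _] _] := hN. Qed.

Lemma near_cinv c z U : atlas c -> cdom c z -> mopen U -> U z ->
  \forall y \near cmap c z, [/\ cdom c (cinv c y), cmap c (cinv c y) = y & U (cinv c y)].
Proof.
move=> ac dz oU Uz; have oV := oU c ac.
have : nbhs (cmap c z) (cmap c @` (U `&` cdom c)) by apply: open_nbhs_nbhs; split => //; exists z.
by apply: filterS => y [z' [Uz' dz'] <-]; rewrite cinvK.
Qed.

Lemma near_cdom c z : atlas c -> cdom c z ->
  \forall y \near cmap c z, cdom c (cinv c y) /\ cmap c (cinv c y) = y.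
Proof. by move=> ac dz; apply: filterS (near_cinv ac dz (mopen_cdom ac) dz) => y []. Qed.

Lemma sm_trans c c' z : atlas c -> atlas c' -> cdom c z -> cdom c' z ->
  smooth_at (cmap c z) (fun y => cmap c' (cinv c y)).
Proof.
move=> ac ac' dz dz'; have [_ /(_ c' ac')[_ oc' sc'] _] := hN.
by apply: (Cinfty_sm (oc' c ac) (sc' c ac)); exists z.
Qed.

(** Openness is defined by all charts at once; continuity of the transition maps reduces it to one
    chart around each point. *)
Lemma mopenP U : (forall z, U z -> exists c, [/\ atlas c, cdom c z & \forall y \near cmap c z, U (cinv c y)]) -> mopen U.
Proof.
move=> H c ac; rewrite openE => _ [z [Uz dz] <-]; have [c' [ac' dz' Hc']] := H z Uz.
have st := sm_trans ac ac' dz dz'.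
have H1 := near_cinv ac dz (mopen_cdom ac') dz'.
have H2 : \forall y \near cmap c z, U (cinv c' (cmap c' (cinv c y))).
  have ct := sm_cont st; rewrite /prop_for /continuous_at cinvK// in ct.
  exact: (ct _ Hc').
rewrite /interior; near=> y.
have [d1 d2 d3] : [/\ cdom c (cinv c y), cmap c (cinv c y) = y & cdom c' (cinv c y)] by near: y.
have Uy : U (cinv c' (cmap c' (cinv c y))) by near: y.
by exists (cinv c y) => //; split => //; rewrite cinvK in Uy.
Unshelve. all: by end_near. Qed.

Lemma mopen_local U : (forall z, U z -> exists V, [/\ mopen V, V z & V `<=` U]) -> mopen U.
Proof.
move=> H; apply: mopenP => z /H[V [oV Vz VU]]; exists (chart_at z).
have ac := at_atlas z; have dz := at_dom z; split => //.
by apply: filterS (near_cinv ac dz oV Vz) => y [_ _ /VU].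
Qed.

Lemma mopenT : mopen (@setT N).
Proof. by apply: mopen_local => z _; exists (cdom (chart_at z)); split => //; [apply: mopen_cdom; exact: at_atlas|exact: at_dom]. Qed.

Lemma mopenI U V : mopen U -> mopen V -> mopen (U `&` V).
Proof.
move=> oU oV; apply: mopenP => z [Uz Vz]; exists (chart_at z).
have ac := at_atlas z; have dz := at_dom z; split => //.
near=> y; split; have [] : [/\ cdom (chart_at z) (cinv (chart_at z) y), cmap (chart_at z) (cinv (chart_at z) y) = y & U (cinv (chart_at z) y)] by near: y; exact: near_cinv.
  by [].
by move=> _ _ _; have [] : [/\ cdom (chart_at z) (cinv (chart_at z) y), cmap (chart_at z) (cinv (chart_at z) y) = y & V (cinv (chart_at z) y)] by near: y; exact: near_cinv.
Unshelve. all: by end_near. Qed.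

Lemma mopen_chart c (O1 : set 'rV_n) : atlas c -> open O1 -> mopen [set z | cdom c z /\ O1 (cmap c z)].
Proof.
move=> ac oO; apply: mopenP => z [dz Oz]; exists c; split => //.
near=> y; have [d1 d2] : cdom c (cinv c y) /\ cmap c (cinv c y) = y by near: y; exact: near_cdom.
by split => //; rewrite d2; near: y; exact: open_nbhs_nbhs.
Unshelve. all: by end_near. Qed.

Lemma near_trans c c' z (Q : 'rV_n -> Prop) : atlas c -> atlas c' -> cdom c z -> cdom c' z ->
  (\forall y \near cmap c' z, Q y) -> \forall y \near cmap c z, Q (cmap c' (cinv c y)).
Proof.
move=> ac ac' dz dz' H; have ct := sm_cont (sm_trans ac ac' dz dz').
by rewrite /prop_for /continuous_at cinvK// in ct; exact: (ct _ H).
Qed.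


Lemma jac_trans c c' c'' z : atlas c -> atlas c' -> atlas c'' -> cdom c z -> cdom c' z -> cdom c'' z ->
  jacobian (cmap c' \o cinv c) (cmap c z) *m jacobian (cmap c'' \o cinv c') (cmap c' z) =
  jacobian (cmap c'' \o cinv c) (cmap c z).
Proof.
move=> ac ac' ac'' d d' d''.
have s1 := sm_trans ac ac' d d'; have s2 := sm_trans ac' ac'' d' d''.
have E := jac_comp (sm_diff s1) (g := fun y => cmap c'' (cinv c' y)).
rewrite cinvK// in E; rewrite -(E (sm_diff s2)).
have s3 : smooth_at (cmap c z) (fun y => cmap c'' (cinv c' (cmap c' (cinv c y)))).
  by apply: (sm_comp (g := fun y => cmap c'' (cinv c' y)) s1); rewrite cinvK.
apply: (jac_near _ (sm_diff s3)).
by apply: filterS (near_cinv ac d (mopen_cdom ac') d') => y [_ _ d3]; rewrite /= cinvK.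
Qed.

Lemma jac_trans_id c z : atlas c -> cdom c z -> jacobian (cmap c \o cinv c) (cmap c z) = 1%:M.
Proof.
move=> ac d; rewrite -(jac_id (cmap c z)); apply: jac_near; last exact: sm_diff (sm_trans ac ac d d).
by apply: filterS (near_cdom ac d) => y [].
Qed.

Lemma tfcoord z c : atlas c -> cdom c z -> tcoord z c *m fcoord z c = 1%:M.
Proof.
move=> ac d; have a0 := at_atlas z; have d0 := at_dom z.
by rewrite /tcoord /fcoord (jac_trans a0 ac a0)// jac_trans_id.
Qed.

Lemma ftcoord z c : atlas c -> cdom c z -> fcoord z c *m tcoord z c = 1%:M.
Proof. by move=> ac d; exact: mulmx1C (tfcoord ac d). Qed.

Lemma tcoord_trans z c c' : atlas c -> cdom c z -> atlas c' -> cdom c' z ->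
  tcoord z c *m jacobian (cmap c' \o cinv c) (cmap c z) = tcoord z c'.
Proof. by move=> ac d ac' d'; rewrite /tcoord (jac_trans (at_atlas z))//; exact: at_dom. Qed.

Lemma fcoord_trans z c c' : atlas c -> cdom c z -> atlas c' -> cdom c' z ->
  jacobian (cmap c' \o cinv c) (cmap c z) *m fcoord z c' = fcoord z c.
Proof.
by move=> ac d ac' d'; rewrite /fcoord (jac_trans ac ac' (at_atlas z))//; exact: at_dom.
Qed.

Lemma tcoord_at z : tcoord z (chart_at z) = 1%:M.
Proof. by rewrite /tcoord jac_trans_id//; [exact: at_atlas|exact: at_dom]. Qed.

Section Fun.
Variables p q : nat.
Implicit Types f : N -> 'M[R]_(p, q).

Definition msm f z := exists c, [/\ atlas c, cdom c z & smooth_at (cmap c z) (fun y => f (cinv c y))].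

Lemma msm_chart f z c : msm f z -> atlas c -> cdom c z -> smooth_at (cmap c z) (fun y => f (cinv c y)).
Proof.
move=> [c' [ac' d' sf]] ac d; have st := sm_trans ac ac' d d'.
have s3 : smooth_at (cmap c z) (fun y => f (cinv c' (cmap c' (cinv c y)))).
  by apply: (sm_comp (g := fun y => f (cinv c' y)) st); rewrite cinvK.
apply: sm_ext s3; apply: filterS (near_cinv ac d (mopen_cdom ac') d') => y [_ _ d3].
by rewrite cinvK.
Qed.

Lemma msm_smooth_on U f : (forall z, U z -> msm f z) -> smooth_on U f.
Proof.
move=> H c ac; apply: sm_CinftyP => _ [z [Uz dz] <-].
exact: msm_chart (H z Uz) ac dz.
Qed.

Lemma smooth_on_msm U f z : mopen U -> smooth_on U f -> U z -> msm f z.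
Proof.
move=> oU sf Uz; exists (chart_at z); have ac := at_atlas z; have dz := at_dom z; split => //.
by apply: (Cinfty_sm (oU _ ac) (sf _ ac)); exists z.
Qed.

Lemma msm_ext f g z : (exists U, [/\ mopen U, U z & forall y, U y -> f y = g y]) -> msm f z -> msm g z.
Proof.
move=> [U [oU Uz fg]] [c [ac d sf]]; exists c; split => //; apply: sm_ext sf.
by apply: filterS (near_cinv ac d oU Uz) => y [_ _ /fg].
Qed.
End Fun.

Lemma msm_lift1 p q p' q' (f : N -> 'M[R]_(p, q)) (g : N -> 'M[R]_(p', q')) z :
  (forall x (c : 'rV_n -> N), smooth_at x (fun y => f (c y)) -> smooth_at x (fun y => g (c y))) -> msm f z -> msm g z.
Proof. by move=> H [c [ac d s]]; exists c; split => //; exact: H. Qed.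

Lemma msm_lift2 p q p' q' p'' q'' (f : N -> 'M[R]_(p, q)) (h : N -> 'M[R]_(p'', q'')) (g : N -> 'M[R]_(p', q')) z :
  (forall x (c : 'rV_n -> N), smooth_at x (fun y => f (c y)) -> smooth_at x (fun y => h (c y)) -> smooth_at x (fun y => g (c y))) ->
  msm f z -> msm h z -> msm g z.
Proof. by move=> H [c [ac d s]] mh; exists c; split => //; apply: H => //; exact: msm_chart mh ac d. Qed.

Lemma msm_cmap c z : atlas c -> cdom c z -> msm (cmap c) z.
Proof. by move=> ac d; exists c; split => //; exact: (sm_trans ac ac d d). Qed.

Lemma msm_tcoord c c' z : atlas c -> cdom c z -> atlas c' -> cdom c' z ->
  msm (fun y => jacobian (cmap c' \o cinv c) (cmap c y)) z.
Proof.
move=> ac d ac' d'; exists c; split => //.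
have sj := sm_jac (sm_trans ac ac' d d').
apply: sm_ext sj; apply: filterS (near_cdom ac d) => y [_ E]; by rewrite E.
Qed.
End One.

Section Maps.
Variables (n m : nat) (N : premanifold R n) (M : premanifold R m).
Hypotheses (hN : hmfd N) (hM : hmfd M).

Definition mcont (F : N -> M) z := forall V, mopen V -> V (F z) -> exists U, [/\ mopen U, U z & forall y, U y -> V (F y)].

(** Continuity is a separate clause because [cmap c' (F y)] has a meaning only for [F y] in the
    domain of [c']. *)
Definition msmap (F : N -> M) z := mcont F z /\ forall c', atlas c' -> cdom c' (F z) -> msm (fun y => cmap c' (F y)) z.

Lemma msmapI (F : N -> M) z c c' : atlas c -> cdom c z -> atlas c' -> cdom c' (F z) ->
  (\forall y \near cmap c z, cdom c' (F (cinv c y))) ->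
  smooth_at (cmap c z) (fun y => cmap c' (F (cinv c y))) -> msmap F z.
Proof.
move=> ac d ac' d' nd sF; split.
  move=> V oV VF; have ct := sm_cont sF; rewrite /prop_for /continuous_at (cinvK hN)// in ct.
  have [A1 [oO1 O1x] HO] := near_open (ct _ (near_cinv hM ac' d' oV VF)).
  have [A2 [oO2 O2x] HO2] := near_open nd.
  exists [set y | cdom c y /\ (A1 `&` A2) (cmap c y)]; split => //.
    by apply: (mopen_chart hN ac); exact: openI.
  by move=> y [dy [/HO /= [_ _ h] /HO2]]; rewrite (cinvK hN ac dy) in h * => dF; rewrite (cinvK hM) in h.
move=> c'' ac'' d''; exists c; split => //.
have st := sm_trans hM ac' ac'' d' d''.
have s3 : smooth_at (cmap c z) (fun y => cmap c'' (cinv c' (cmap c' (F (cinv c y))))).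
  by apply: (sm_comp (g := fun y => cmap c'' (cinv c' y)) sF); rewrite (cinvK hN).
by apply: sm_ext s3; apply: filterS nd => y dy; rewrite (cinvK hM).
Qed.

Lemma msmap_near F z c V : msmap F z -> atlas c -> cdom c z -> mopen V -> V (F z) ->
  \forall y \near cmap c z, V (F (cinv c y)).
Proof.
move=> [cF _] ac d oV VF; have [U [oU Uz HU]] := cF V oV VF.
by apply: filterS (near_cinv hN ac d oU Uz) => y [_ _ /HU].
Qed.

Lemma msmap_sm F z c c' : msmap F z -> atlas c -> cdom c z -> atlas c' -> cdom c' (F z) ->
  smooth_at (cmap c z) (fun y => cmap c' (F (cinv c y))).
Proof. by move=> [_ sF] ac d ac' d'; exact: (msm_chart hN (sF c' ac' d')). Qed.

Lemma mderE F z c c' : msmap F z -> atlas c -> cdom c z -> atlas c' -> cdom c' (F z) ->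
  mder F z = tcoord z c *m jacobian (cmap c' \o F \o cinv c) (cmap c z) *m fcoord (F z) c'.
Proof.
move=> sF ac d ac' d'; rewrite /mder /tcoord /fcoord.
have a0 := at_atlas hN z; have d0 := at_dom hN z.
have a0' := at_atlas hM (F z); have d0' := at_dom hM (F z).
have s1 := sm_trans hN a0 ac d0 d; have s2 := msmap_sm sF ac d ac' d'; have s3 := sm_trans hM ac' a0' d' d0'.
have s2' : smooth_at (cmap (chart_at z) z) (fun y => cmap c' (F (cinv c (cmap c (cinv (chart_at z) y))))).
  by apply: (sm_comp (g := fun y => cmap c' (F (cinv c y))) s1); rewrite (cinvK hN).
have E2 := jac_comp (sm_diff s1) (g := fun y => cmap c' (F (cinv c y))).
rewrite (cinvK hN)// in E2; rewrite -(E2 (sm_diff s2)).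
have E3 := jac_comp (sm_diff s2') (g := fun y => cmap (chart_at (F z)) (cinv c' y)).
rewrite (cinvK hN a0 d0) (cinvK hN ac d) in E3; rewrite -(E3 (sm_diff s3)).
have s4 : smooth_at (cmap (chart_at z) z) (fun y => cmap (chart_at (F z)) (cinv c' (cmap c' (F (cinv c (cmap c (cinv (chart_at z) y))))))).
  by apply: (sm_comp (g := fun y => cmap (chart_at (F z)) (cinv c' y)) s2'); rewrite (cinvK hN a0 d0) (cinvK hN ac d).
apply: esym; apply: (jac_near _ (sm_diff s4)).
have n1 := msmap_near sF a0 d0 (mopen_cdom hM ac') d'.
apply: filterS2 n1 (near_cinv hN a0 d0 (mopen_cdom hN ac) d) => y dF [_ _ dy].
by rewrite /= (cinvK hN ac dy) (cinvK hM).
Qed.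

Lemma mder_jac F z c c' : msmap F z -> atlas c -> cdom c z -> atlas c' -> cdom c' (F z) ->
  jacobian (cmap c' \o F \o cinv c) (cmap c z) = fcoord z c *m mder F z *m tcoord (F z) c'.
Proof.
move=> sF ac d ac' d'; rewrite (mderE sF ac d ac' d') !mulmxA (ftcoord hN ac d) mul1mx.
by rewrite -mulmxA (ftcoord hM) ?mulmx1.
Qed.

Lemma msmap_smooth_map U F : mopen U -> (forall z, U z -> msmap F z) -> smooth_map U F.
Proof.
move=> oU H c ac; have oUF : mopen (U `&` F @^-1` cdom c).
  apply: (mopen_local hN) => z [Uz dz]; have [V [oV Vz HV]] := (H z Uz).1 _ (mopen_cdom hM ac) dz.
  by exists (U `&` V); split => //; [exact: mopenI|move=> y [Uy /HV]].
split => //; apply: (msm_smooth_on hN) => z [Uz dz]; exact: (H z Uz).2.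
Qed.

Lemma smooth_map_msmap U F z : mopen U -> smooth_map U F -> U z -> msmap F z.
Proof.
move=> oU H Uz; have a' := at_atlas hM (F z); have d' := at_dom hM (F z).
have ac := at_atlas hN z; have d := at_dom hN z.
have [op1 sm1] := H _ a'.
apply: (msmapI ac d a' d').
  by apply: filterS (near_cinv hN ac d op1 _) => // y [_ _ []].
exact: (msm_chart hN (smooth_on_msm hN op1 sm1 (conj Uz d')) ac d).
Qed.

Lemma msmap_ext F G z : (exists U, [/\ mopen U, U z & forall y, U y -> F y = G y]) -> msmap F z -> msmap G z.
Proof.
move=> [U [oU Uz FG]] sF; have Ez := FG z Uz.
have a' := at_atlas hM (F z); have d' := at_dom hM (F z).
have ac := at_atlas hN z; have d := at_dom hN z.
have d'' : cdom (chart_at (F z)) (G z) by rewrite -Ez.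
have nU := near_cinv hN ac d oU Uz.
apply: (msmapI ac d a' d'').
  by apply: filterS2 nU (msmap_near sF ac d (mopen_cdom hM a') d') => y [_ _ /FG ->].
by apply: sm_ext (msmap_sm sF ac d a' d'); apply: filterS nU => y [_ _ /FG ->].
Qed.

Lemma mder_ext F G z : (exists U, [/\ mopen U, U z & forall y, U y -> F y = G y]) -> msmap F z -> mder F z = mder G z.
Proof.
move=> [U [oU Uz FG]] sF; rewrite /mder -(FG z Uz).
have ac := at_atlas hN z; have d := at_dom hN z.
apply: jac_near; last exact: (sm_diff (msmap_sm sF ac d (at_atlas hM _) (at_dom hM _))).
by apply: filterS (near_cinv hN ac d oU Uz) => y [_ _ /FG /= ->].
Qed.
End Maps.

Lemma msm_comp n m p q (N : premanifold R n) (M : premanifold R m) (hN : hmfd N) (hM : hmfd M) (F : N -> M) (f : M -> 'M[R]_(p, q)) z :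
  msmap F z -> msm f (F z) -> msm (fun y => f (F y)) z.
Proof.
move=> sF [c' [ac' d' sf]]; have ac := at_atlas hN z; have d := at_dom hN z.
exists (chart_at z); split => //; have s2 := msmap_sm hN sF ac d ac' d'.
have s3 : smooth_at (cmap (chart_at z) z) (fun y => f (cinv c' (cmap c' (F (cinv (chart_at z) y))))).
  by apply: (sm_comp (g := fun y => f (cinv c' y)) s2); rewrite (cinvK hN).
apply: sm_ext s3.
apply: filterS (msmap_near hN sF ac d (mopen_cdom hM ac') d') => y dy; by rewrite (cinvK hM).
Qed.

Lemma msmap_comp n m l (N : premanifold R n) (M : premanifold R m) (K : premanifold R l) (hN : hmfd N) (hM : hmfd M) (hK : hmfd K)
   (F : N -> M) (G : M -> K) z : msmap F z -> msmap G (F z) -> msmap (fun y => G (F y)) z.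
Proof.
move=> sF sG; split.
  move=> V oV VG; have [U [oU UF HU]] := sG.1 V oV VG; have [U' [oU' U'z HU']] := sF.1 U oU UF.
  by exists U'; split => // y /HU' /HU.
by move=> c' ac' d'; apply: (msm_comp hN hM (f := fun y => cmap c' (G y)) sF); exact: sG.2.
Qed.

Lemma mder_comp n m l (N : premanifold R n) (M : premanifold R m) (K : premanifold R l) (hN : hmfd N) (hM : hmfd M) (hK : hmfd K)
   (F : N -> M) (G : M -> K) z : msmap F z -> msmap G (F z) -> mder (fun y => G (F y)) z = mder F z *m mder G (F z).
Proof.
move=> sF sG; have ac := at_atlas hN z; have d := at_dom hN z.
have ac' := at_atlas hM (F z); have d' := at_dom hM (F z).
have a2 := at_atlas hK (G (F z)); have d2 := at_dom hK (G (F z)).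
have s1 := msmap_sm hN sF ac d ac' d'; have s2 := msmap_sm hM sG ac' d' a2 d2.
have E := jac_comp (sm_diff s1) (g := fun y => cmap (chart_at (G (F z))) (G (cinv (chart_at (F z)) y))).
rewrite (cinvK hN ac d) in E; have {E} E := E (sm_diff s2); rewrite /mder -[RHS]E.
have s3 : smooth_at (cmap (chart_at z) z) (fun y => cmap (chart_at (G (F z))) (G (cinv (chart_at (F z)) (cmap (chart_at (F z)) (F (cinv (chart_at z) y)))))).
  by apply: (sm_comp (g := fun y => cmap (chart_at (G (F z))) (G (cinv (chart_at (F z)) y))) s1); rewrite (cinvK hN).
apply: esym; apply: (jac_near _ (sm_diff s3)).
by apply: filterS (msmap_near hN sF ac d (mopen_cdom hM ac') d') => y dy; rewrite /= (cinvK hM).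
Qed.

Lemma msmap_id n (N : premanifold R n) (hN : hmfd N) z : msmap (@idfun N) z.
Proof.
split; first by move=> V oV Vz; exists V.
by move=> c' ac' d'; exact: msm_cmap.
Qed.
End Manifold.

(** * Integral curves of time-dependent fields on a manifold *)

Section Curves.
Section One.
Variables (n : nat) (N : premanifold R n).
Hypothesis hN : hmfd N.
Implicit Types (X : R -> N -> 'rV_n) (g h : R -> N) (c : chart R n N).

Definition mcurve X g (a b : R) := forall t : R, a <= t <= b ->
  (\forall s \near t, cdom (chart_at (g t)) (g s)) /\
  is_derive t 1 (cmap (chart_at (g t)) \o g) (X t (g t)).

Lemma mcurve_chart X g a b t c : mcurve X g a b -> a <= t <= b -> atlas c -> cdom c (g t) ->
  (\forall s \near t, cdom c (g s)) /\ is_derive t 1 (fun s : R => cmap c (g s)) (X t (g t) *m tcoord (g t) c).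
Proof.
move=> cg tab ac dc; have [nd dg] := cg t tab.
have a0 := at_atlas hN (g t); have d0 := at_dom hN (g t).
have cont := is_derive_cont dg.
have H := near_cinv hN a0 d0 (mopen_cdom hN ac) dc.
have nc : \forall s \near t, cdom c (g s).
  have := cont _ H; rewrite near_simpl; apply: filterS2 nd => s d [_ _].
  by rewrite /= cinvK.
split => //.
have st := sm_trans hN a0 ac d0 dc.
have D := is_derive_comp_mul (f := fun y => cmap c (cinv (chart_at (g t)) y)) dg (sm_diff st).
have [D1 D2] := D; apply: DeriveDef.
  have [E1 E2] : is_derive t 1 (fun s : R => cmap c (cinv (chart_at (g t)) (cmap (chart_at (g t)) (g s)))) (X t (g t) *m tcoord (g t) c) by exact: D.
  apply/derivable1_diffP; apply: near_eq_diff; last by apply/derivable1_diffP; exact: E1.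
  by apply: filterS nd => s d; rewrite cinvK.
rewrite -[RHS]D2; apply: derive_near; apply: filterS nd => s d.
by rewrite /= cinvK.
Qed.

Lemma mcurve_cont X g a b t U : mcurve X g a b -> a <= t <= b -> mopen U -> U (g t) -> \forall s \near t, U (g s).
Proof.
move=> cg tab oU Ut; have a0 := at_atlas hN (g t); have d0 := at_dom hN (g t).
have [nd dg] := mcurve_chart cg tab a0 d0.
have := is_derive_cont dg (near_cinv hN a0 d0 oU Ut); rewrite near_simpl.
by apply: filterS2 nd => s d [_ _]; rewrite cinvK.
Qed.

(** Time is appended as one more coordinate, so that joint smoothness in point and time is
    smoothness on one coordinate space and a time-dependent field becomes an autonomous one. *)
Definition tpt (y : 'rV_n) (t : R) : 'rV_(n + 1) := row_mx y t%:M.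

Definition fld X c (w : 'rV_(n + 1)) : 'rV_n :=
  X (rsubmx w 0 0) (cinv c (lsubmx w)) *m tcoord (cinv c (lsubmx w)) c.

Definition freg X t z := exists c, [/\ atlas c, cdom c z & smooth_at (tpt (cmap c z) t) (fld X c)].

Lemma fld_tpt X c y t : fld X c (tpt y t) = X t (cinv c y) *m tcoord (cinv c y) c.
Proof. by rewrite /fld /tpt row_mxKl row_mxKr mxE eqxx. Qed.

Lemma sm_lsubid k l (w : 'rV_(k + l)) : smooth_at w (fun w : 'rV_(k + l) => lsubmx w).
Proof. by apply: sm_lsub; exact: sm_id. Qed.
Lemma sm_rsubid k l (w : 'rV_(k + l)) : smooth_at w (fun w : 'rV_(k + l) => rsubmx w).
Proof. by apply: sm_rsub; exact: sm_id. Qed.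

Lemma freg_chart X t z c : freg X t z -> atlas c -> cdom c z -> smooth_at (tpt (cmap c z) t) (fld X c).
Proof.
move=> [c' [ac' d' s']] ac d.
have sl := sm_lsubid (tpt (cmap c z) t); have sr := sm_rsubid (tpt (cmap c z) t).
have st : smooth_at (tpt (cmap c z) t) (fun w => cmap c' (cinv c (lsubmx w))).
  apply: (sm_comp (g := fun y => cmap c' (cinv c y)) sl); rewrite row_mxKl; exact: sm_trans.
have sF : smooth_at (tpt (cmap c z) t) (fun w => fld X c' (row_mx (cmap c' (cinv c (lsubmx w))) (rsubmx w))).
  apply: (sm_comp (g := fld X c') (sm_row_mx st sr)); rewrite row_mxKl row_mxKr (cinvK hN ac d); exact: s'.
have sJ : smooth_at (tpt (cmap c z) t) (fun w => jacobian (fun y => cmap c (cinv c' y)) (cmap c' (cinv c (lsubmx w)))).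
  apply: (sm_comp (g := jacobian (fun y => cmap c (cinv c' y))) st); rewrite row_mxKl (cinvK hN ac d).
  by apply: sm_jac; exact: sm_trans.
apply: sm_ext (sm_mulmx sF sJ).
have n1 := near_cinv hN ac d (mopen_cdom hN ac') d'.
have := sm_cont sl; rewrite /prop_for /continuous_at /tpt row_mxKl => cl.
have n2 := cl _ n1; near=> w.
have [d1 d2 d3] : [/\ cdom c (cinv c (lsubmx w)), cmap c (cinv c (lsubmx w)) = lsubmx w & cdom c' (cinv c (lsubmx w))] by near: w.
rewrite /fld row_mxKl row_mxKr (cinvK hN ac' d3) -mulmxA; congr (_ *m _).
exact: tcoord_trans.
Unshelve. all: by end_near. Qed.

Lemma ball_tpt (y0 y : 'rV_n) (t0 t d : R) : `|y0 - y| < d -> `|t0 - t| < d -> ball (tpt y0 t0) d (tpt y t).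
Proof.
move=> h1 h2; rewrite -ball_normE /= /tpt opp_row_mx add_row_mx; apply: norm_row_mx_lt => //.
rewrite -raddfB/=; apply: le_lt_trans h2; apply: mx_norm_le => // i j.
by rewrite mxE !ord1 eqxx.
Qed.

(** One [K] bounds both the speed and the Lipschitz constant on the box: the speed bound keeps
    curves inside, the Lipschitz bound compares them. *)
Definition goodbox X c z t (d K : R) := [/\ 0 < d, 0 <= K,
  forall y, ball (cmap c z) d y -> cdom c (cinv c y) /\ cmap c (cinv c y) = y &
  forall y y' s, ball (cmap c z) d y -> ball (cmap c z) d y' -> ball t d s ->
    `|fld X c (tpt y s)| <= K /\ `|fld X c (tpt y s) - fld X c (tpt y' s)| <= K * `|y - y'|].

Lemma goodbox_ex X c z t : freg X t z -> atlas c -> cdom c z -> exists d K, goodbox X c z t d K.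
Proof.
move=> rX ac d; have [e [K [e0 K0 H]]] := lip_local (freg_chart rX ac d).
have [e' e'0 H'] := ball_near (near_cdom hN ac d).
exists (Num.min e e'), K; have m0 : 0 < Num.min e e' by rewrite lt_min e0.
have le1 : Num.min e e' <= e by rewrite ge_min lexx.
have le2 : Num.min e e' <= e' by rewrite ge_min lexx orbT.
split => //; first by move=> y /(le_ball le2) /H'.
move=> y y' s /(le_ball le1) yb /(le_ball le1) y'b /(le_ball le1) sb.
move: yb y'b sb; rewrite -!ball_normE /= => yb y'b sb.
have b1 := ball_tpt yb sb; have b2 := ball_tpt y'b sb.
have [_ h1 h2] := H _ _ b1 b2; split => //; apply: le_trans h2 _; apply: ler_wpM2l => //.
rewrite /tpt opp_row_mx add_row_mx subrr; apply: mx_norm_le => // i j.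
by rewrite mxE; case: (fintype.split j) => l; [exact: mx_coord_le|rewrite mxE normr0].
Qed.

(* A curve cannot leave the box before its speed allows it. *)
Lemma curve_stays X c z t d K h (a b : R) : atlas c -> goodbox X c z t d K -> a <= b ->
  (forall s, a <= s <= b -> ball t d s) -> mcurve X h a b -> cdom c (h a) ->
  ball (cmap c z) (d / 2) (cmap c (h a)) -> K * (b - a) < d / 2 ->
  forall s, a <= s <= b -> [/\ cdom c (h s), ball (cmap c z) d (cmap c (h s)) &
    is_derive s 1 (fun s : R => cmap c (h s)) (fld X c (tpt (cmap c (h s)) s))].
Proof.
move=> ac [d0 K0 Hc HX] ab tb ch da ba Kba.
have er x : a + x - a = x by rewrite addrC addrA addNr add0r.
have ea x : a + (x - a) = x by rewrite addrC subrK.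
have inb y s : a <= s -> s <= b -> `|y - cmap c (h a)| <= K * (s - a) -> ball (cmap c z) d y.
  move=> as_ sb ys; have e : K * (s - a) <= K * (b - a) by apply: ler_wpM2l => //; lra.
  move: ba; rewrite -!ball_normE /= => ba.
  have -> : cmap c z - y = (cmap c z - cmap c (h a)) - (y - cmap c (h a)) by rewrite opprB addrA subrK.
  by apply: le_lt_trans (ler_normB _ _) _; lra.
have key (s1 s2 : R) : a <= s1 -> s1 <= s2 -> s2 <= b ->
    (forall r, s1 <= r <= s2 -> cdom c (h r) /\ ball (cmap c z) d (cmap c (h r))) ->
    `|cmap c (h s2) - cmap c (h s1)| <= K * (s2 - s1).
  move=> as1 s12 s2b H.
  apply: (@vec_mean_value 1 n (fun s => cmap c (h s)) (fun s => X s (h s) *m tcoord (h s) c)) => // r /andP[r1 r2].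
    have rab : a <= r <= b by apply/andP; split; lra.
    have [dr _] := H r (introT andP (conj r1 r2)).
    by have [] := mcurve_chart ch rab ac dr.
  have [dr br] := H r (introT andP (conj r1 r2)).
  have rt : ball t d r by apply: tb; apply/andP; split; lra.
  by have [+ _] := HX _ _ _ br br rt; rewrite fld_tpt (cinvK hN ac dr).
pose P (r : R) := cdom c (h (a + r)) /\ `|cmap c (h (a + r)) - cmap c (h a)| <= K * r.
have HP : forall r : R, 0 <= r -> r <= b - a -> P r.
  apply: real_induction.
  - by rewrite /P addr0 subrr normr0 mulr0.
  - move=> r r0 rb H; have [dr kr] := H r r0 (lexx r).
    have rab : a <= a + r <= b by apply/andP; split; lra.
    have br : ball (cmap c z) d (cmap c (h (a + r))).
      by apply: (inb _ (a + r)); [lra|lra|rewrite er].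
    have oB : open (ball (cmap c z) d) by exact: (@open_ballrV _ _ d d0).
    have := mcurve_cont ch rab (mopen_chart hN ac oB) (conj dr br).
    move=> /nbhs_ballP[e /= e0 He]; exists (e / 2); first by lra.
    move=> s rs se sb.
    have Hs q : r <= q <= s -> cdom c (h (a + q)) /\ ball (cmap c z) d (cmap c (h (a + q))).
      move=> /andP[q1 q2]; apply: He; rewrite -ball_normE /= opprD addrACA subrr add0r.
      by rewrite ler0_norm; lra.
    have [ds _] : cdom c (h (a + s)) /\ ball (cmap c z) d (cmap c (h (a + s))) by apply: Hs; lra.
    split => //.
    have h1 : `|cmap c (h (a + s)) - cmap c (h (a + r))| <= K * (a + s - (a + r)).
      apply: key; [lra|lra|lra|] => q /andP[q1 q2].
      by have := Hs (q - a); rewrite ea; apply; apply/andP; split; lra.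
    have -> : cmap c (h (a + s)) - cmap c (h a) = (cmap c (h (a + s)) - cmap c (h (a + r))) + (cmap c (h (a + r)) - cmap c (h a)) by rewrite addrA subrK.
    apply: le_trans (ler_normD _ _) _; have : K * (a + s - (a + r)) = K * s - K * r by ring.
    by lra.
  - move=> r r0 rb H.
    have rab : a <= a + r <= b by apply/andP; split; lra.
    have Hb q : 0 <= q -> q < r -> cdom c (h (a + q)) /\ ball (cmap c z) d (cmap c (h (a + q))).
      move=> q0 qr; have [dq kq] := H q q0 qr; split => //.
      by apply: (inb _ (a + q)); [lra|lra|rewrite er].
    have lip (q1 q2 : R) : 0 <= q1 -> q1 <= q2 -> q2 < r -> `|cmap c (h (a + q2)) - cmap c (h (a + q1))| <= K * (q2 - q1).
      move=> h0 h1 h2; have -> : K * (q2 - q1) = K * (a + q2 - (a + q1)) by congr (_ * _); ring.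
      apply: key; [lra|lra|lra|] => q /andP[h3 h4].
      by have := Hb (q - a); rewrite ea; apply; lra.
    (* Times that approach [r] geometrically; by the speed bound the chart images form a Cauchy
       sequence, whose limit is [l]. *)
    pose sq k := r * (1 - 2^-1 ^+ k.+1); pose u k := cmap c (h (a + sq k)).
    have pk k : 0 < (2^-1 : R) ^+ k by rewrite exprn_gt0// invr_gt0.
    have pk1 k : (2^-1 : R) ^+ k.+1 <= 1 by rewrite exprn_ile1//; lra.
    have sq0 k : 0 <= sq k by rewrite /sq mulr_ge0//; [lra|have := pk1 k; lra].
    have sqr k : sq k < r by rewrite /sq gtr_pMr// ltrBlDr ltrDl pk.
    have sqS k : sq k.+1 - sq k = r / 4 * 2^-1 ^+ k by rewrite /sq !exprS; field.
    have [|k|l Hl] := @seq_limit 1 n u (K * (r / 4)).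
    + by rewrite mulr_ge0//; lra.
    + rewrite -mulrA -sqS; apply: lip => //.
      by rewrite -subr_ge0 sqS; have := pk k; set x := _ ^+ k; nra.
    have lK : `|l - cmap c (h a)| <= K * r.
      apply/ler_addgt0Pr => e e0.
      have [k Hk] : exists k, forall m, (k <= m)%N -> 2^-1 ^+ m < e / (K * (r / 4) * 2 + 1).
        apply: half_small; rewrite divr_gt0//; have : 0 <= K * (r / 4) by rewrite mulr_ge0//; lra.
        by lra.
      have Kr0 : 0 <= K * (r / 4) by rewrite mulr_ge0//; lra.
      have h1 : 2 * (K * (r / 4)) * 2^-1 ^+ k <= e.
        have := Hk k (leqnn k); rewrite ltr_pdivlMr; last by lra.
        have := pk k; set x := _ ^+ k; nra.
      have -> : l - cmap c (h a) = (l - u k) + (u k - cmap c (h a)) by rewrite addrA subrK.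
      apply: le_trans (ler_normD _ _) _; have := Hl k.
      have [_] := H (sq k) (sq0 k) (sqr k); rewrite -/(u k).
      have : K * sq k <= K * r by apply: ler_wpM2l => //; exact: ltW.
      by lra.
    have lb : ball (cmap c z) d l by apply: (inb _ (a + r)); [lra|lra|rewrite er].
    have [dl El] := Hc l lb.
    suff E : h (a + r) = cinv c l by rewrite /P E; split => //; rewrite El.
    (* The curve is known to be in the chart only before time [r], so its value at [r] might lie
       outside. Were that value not the point with coordinates [l], disjoint neighbourhoods of the
       two points would both contain the curve at the times [sq k]. *)
    apply: contrapT => ne; have [_ _ haus] := hN; have [U [V [oU oV Uh Vl UV]]] := haus _ _ ne.
    have := mcurve_cont ch rab oU Uh => /nbhs_ballP[e /= e0 He].
    have := near_cinv hN ac dl oV Vl; rewrite El => /nbhs_ballP[e' /= e'0 He'].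
    pose M := 2 * (K * (r / 4)) + r + 1.
    have M1 : 1 <= M by rewrite /M; have : 0 <= K * (r / 4) by [rewrite mulr_ge0//; lra]; lra.
    have [k Hk] : exists k, forall m, (k <= m)%N -> 2^-1 ^+ m < Num.min e e' / M.
      by apply: half_small; rewrite divr_gt0// ?lt_min ?e0//; lra.
    have := Hk k (leqnn k); rewrite ltr_pdivlMr; last by lra.
    rewrite lt_min => /andP[h1 h2].
    have Kr0 : 0 <= K * (r / 4) by rewrite mulr_ge0//; lra.
    have pk0 := pk k.
    have hU : U (h (a + sq k)).
      apply: He; rewrite -ball_normE /= opprD addrACA subrr add0r gtr0_norm ?subr_gt0//.
      rewrite /sq exprS; set x := _ ^+ k in h1 pk0 *; move: h1; rewrite /M; nra.
    have hV : V (h (a + sq k)).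
      have [dq _] := H (sq k) (sq0 k) (sqr k).
      have [|_ _] := He' (cmap c (h (a + sq k))); last by rewrite cinvK.
      rewrite -ball_normE /=; apply: le_lt_trans (Hl k) _.
      set x := _ ^+ k in h2 pk0 *; move: h2; rewrite /M; nra.
    by have : (U `&` V) (h (a + sq k)) by []; rewrite UV.
move=> s /andP[as_ sb].
have sa0 : 0 <= s - a by lra.
have sa1 : s - a <= b - a by lra.
have [ds ks] := HP (s - a) sa0 sa1; rewrite ea in ds ks.
split => //; first exact: (inb _ s).
have sab : a <= s <= b by rewrite as_ sb.
have [_] := mcurve_chart ch sab ac ds.
by rewrite fld_tpt (cinvK hN ac ds).
Qed.
End One.
End Curves.

(** * Lipschitz dependence of integral curves on their initial points *)

Section Dependence.
Variables (n : nat) (N : premanifold R n).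
Hypothesis hN : hmfd N.
Implicit Types (X : R -> N -> 'rV_n) (g h : R -> N) (c : chart R n N).

Lemma mcurve_sub X g (a b a' b' : R) : a <= a' -> b' <= b -> mcurve X g a b -> mcurve X g a' b'.
Proof. by move=> aa bb cg t /andP[t1 t2]; apply: cg; apply/andP; split; lra. Qed.

Lemma box_gronwall X c z t d K h h' (a b : R) : atlas c -> goodbox X c z t d K -> a <= b ->
  (forall s, a <= s <= b -> ball t d s) -> mcurve X h a b -> mcurve X h' a b -> cdom c (h a) -> cdom c (h' a) ->
  ball (cmap c z) (d / 2) (cmap c (h a)) -> ball (cmap c z) (d / 2) (cmap c (h' a)) -> K * (b - a) < d / 2 ->
  [/\ cdom c (h b), cdom c (h' b) &
  `|cmap c (h b) - cmap c (h' b)| <= 2 * expR (2 * (K + 1) * (b - a)) * `|cmap c (h a) - cmap c (h' a)|].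
Proof.
move=> ac gb ab tb ch ch' da da' ba ba' Kab.
have S := curve_stays hN ac gb ab tb ch da ba Kab.
have S' := curve_stays hN ac gb ab tb ch' da' ba' Kab.
have [d0 K0 _ HX] := gb.
have bb : a <= b <= b by rewrite ab lexx.
have [db _ _] := S b bb; have [db' _ _] := S' b bb; split => //.
pose v r := cmap c (h (a + r)) - cmap c (h' (a + r)).
have dv r : 0 <= r <= b - a -> is_derive r 1 v (fld X c (tpt (cmap c (h (a + r))) (a + r)) - fld X c (tpt (cmap c (h' (a + r))) (a + r))).
  move=> /andP[r0 rb]; have rab : a <= a + r <= b by apply/andP; split; lra.
  have [_ _ h1] := S _ rab; have [_ _ h2] := S' _ rab; have hB := is_deriveB h1 h2.
  have hs : is_derive r 1 (fun r : R => a + r) 1.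
    by have := is_deriveD (is_derive_cst a r 1) (is_derive_id r 1); rewrite add0r.
  by have := is_derive_comp1 hs hB; rewrite scale1r.
have ba0 : 0 <= b - a by lra.
have := @gronwall 1 n v _ (b - a) K 0 ba0 K0 (lexx _) dv.
rewrite /v !addr0 (addrC a) subrK mulrAC; apply.
move=> r /andP[r0 rb]; have rab : a <= a + r <= b by apply/andP; split; lra.
have [_ b1 _] := S _ rab; have [_ b2 _] := S' _ rab; rewrite addr0.
by have [_] := HX _ _ _ b1 b2 (tb _ rab).
Qed.

Section Lip.
Variables (X : R -> N -> 'rV_n) (g : R -> N).
Hypothesis cg : mcurve X g 0 1.
Hypothesis rg : forall t, 0 <= t <= 1 -> freg X t (g t).
Let c0 := chart_at (g 0).

(** Quantified over pairs of curves and not over initial points: no flow is assumed to exist near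
    [g], and the curves are supplied by the user of the estimate, for instance by [exp_rel]. *)
Let close c t (e : R) (V : set N) (K : R) := forall h h', mcurve X h 0 1 -> mcurve X h' 0 1 -> V (h 0) -> V (h' 0) ->
  [/\ cdom c (h t), ball (cmap c (g t)) e (cmap c (h t)), cdom c (h' t) &
     `|cmap c (h t) - cmap c (h' t)| <= K * `|cmap c0 (h 0) - cmap c0 (h' 0)|].

Let dep c t := forall e : R, 0 < e -> exists V K, [/\ mopen V, V (g 0), 0 <= K & close c t e V K].

Let dep_chart c c' t : atlas c -> cdom c (g t) -> atlas c' -> cdom c' (g t) -> dep c t -> dep c' t.
Proof.
move=> ac d ac' d' H e e0.
have [r [L [r0 L0 HL]]] := lip_local (sm_trans hN ac ac' d d').
have [r' r'0 Hr'] := ball_near (near_cinv hN ac d (mopen_cdom hN ac') d').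
pose m := Num.min (Num.min r r') (e / (L + 1)).
have m0 : 0 < m by rewrite !lt_min r0 r'0 divr_gt0//; lra.
have [V [K [oV Vg K0 HV]]] := H m m0.
have mr : m <= r by rewrite /m ge_min ge_min lexx.
have mr' : m <= r' by rewrite /m ge_min ge_min lexx orbT.
have me : m <= e / (L + 1) by rewrite /m ge_min lexx orbT.
exists V, (L * K); split => //; first exact: mulr_ge0.
move=> h h' ch ch' Vh Vh'; have [dh bh dh' lh] := HV h h' ch ch' Vh Vh'.
have [_ bh' _ _] := HV h' h ch' ch Vh' Vh.
have [_ _ d1] := Hr' _ (le_ball mr' bh); have [_ _ d2] := Hr' _ (le_ball mr' bh').
rewrite (cinvK hN ac dh) in d1; rewrite (cinvK hN ac dh') in d2.
have b0 : ball (cmap c (g t)) r (cmap c (g t)) by exact: ballxx.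
have [_ _ l1] := HL _ _ b0 (le_ball mr bh); have [_ _ l2] := HL _ _ (le_ball mr bh) (le_ball mr bh').
rewrite (cinvK hN ac dh) (cinvK hN ac d) in l1; rewrite (cinvK hN ac dh') (cinvK hN ac dh) in l2.
split => //.
  move: bh; rewrite -!ball_normE /= => bh; apply: le_lt_trans l1 _.
  have h1 : `|cmap c (g t) - cmap c (h t)| < e / (L + 1) by exact: lt_le_trans bh me.
  have L1 : 0 < L + 1 by lra.
  have : (L + 1) * `|cmap c (g t) - cmap c (h t)| < e by rewrite mulrC -ltr_pdivlMr.
  have := normr_ge0 (cmap c (g t) - cmap c (h t)); lra.
by rewrite -mulrA; apply: le_trans l2 _; apply: ler_wpM2l.
Qed.

(** The interval around [t] transfers dependence between any two of its times, earlier to later. It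
    thus serves the opening step of the real induction, from [t] onwards, and the closing step, from
    just before [t]. *)
Let dep_step t : 0 <= t <= 1 -> exists2 e : R, 0 < e & forall s0 s, 0 <= s0 -> s0 <= s -> s <= 1 -> `|s0 - t| < e -> `|s - t| < e ->
  (forall c, atlas c -> cdom c (g s0) -> dep c s0) -> (forall c, atlas c -> cdom c (g s) -> dep c s).
Proof.
move=> t01; pose c := chart_at (g t); have ac : atlas c by exact: at_atlas.
have dc : cdom c (g t) by exact: at_dom.
have [d [K gb]] := goodbox_ex hN (rg t01) ac dc; have [d0 K0 HcX HX] := gb.
have d4 : 0 < d / 4 by lra.
have oB : open (ball (cmap c (g t)) (d / 4)) by exact: (@open_ballrV _ _ _ d4).
have := mcurve_cont hN cg t01 (mopen_chart hN ac oB) (conj dc (ballxx _ d4)).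
move=> /nbhs_ballP[e1 /= e10 He1].
pose e := Num.min e1 (d / (8 * (K + 1))).
have K1 : 0 < K + 1 by lra.
have e0 : 0 < e by rewrite lt_min e10 divr_gt0//; lra.
have ee1 : e <= e1 by rewrite ge_min lexx.
have eK : e * (8 * (K + 1)) <= d by rewrite -ler_pdivlMr ?ge_min ?lexx ?orbT//; lra.
exists e => // s0 s s00 s0s s1 s0t st H.
have near_g r : `|r - t| < e -> cdom c (g r) /\ ball (cmap c (g t)) (d / 4) (cmap c (g r)).
  by move=> rt; apply: He1; rewrite -ball_normE /= distrC; exact: lt_le_trans rt ee1.
have [ds0 bs0] := near_g _ s0t; have [ds bs] := near_g _ st.
have ab2 : s - s0 <= 2 * e by move: s0t st; rewrite !ltr_norml => /andP[? ?] /andP[? ?]; lra.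
have Kab : K * (s - s0) < d / 2 by nra.
have tb r : s0 <= r <= s -> ball t d r.
  move=> /andP[r1 r2]; rewrite -ball_normE /=; move: s0t st; rewrite !ltr_norml => /andP[h1 h2] /andP[h3 h4].
  have : e <= d by nra.
  by move=> ed; apply/andP; split; lra.
suff Hd : dep c s by move=> c' ac' d'; exact: (dep_chart ac ds ac' d' Hd).
move=> eps eps0; pose C := 2 * expR (2 * (K + 1) * (s - s0)).
have C0 : 0 < C by rewrite mulr_gt0// expR_gt0.
pose m := Num.min (d / 4) (eps / C).
have m0 : 0 < m by rewrite lt_min d4 divr_gt0.
have [V [K' [oV Vg K'0 HV]]] := H c ac ds0 m m0.
have md : m <= d / 4 by rewrite ge_min lexx.
have mC : m <= eps / C by rewrite ge_min lexx orbT.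
exists V, (C * K'); split => //; first by rewrite mulr_ge0// ltW.
have b2 y : ball (cmap c (g s0)) m y -> ball (cmap c (g t)) (d / 2) y.
  move=> /(le_ball md) yb; have -> : d / 2 = d / 4 + d / 4 by lra.
  exact: ball_triangle bs0 yb.
have sub h : mcurve X h 0 1 -> mcurve X h s0 s by apply: mcurve_sub.
move=> h h' ch ch' Vh Vh'; have [dh bh dh' lh] := HV h h' ch ch' Vh Vh'.
have [_ bh' _ _] := HV h' h ch' ch Vh' Vh.
have bg : ball (cmap c (g t)) (d / 2) (cmap c (g s0)) by apply: b2; exact: ballxx.
have [r1 r2 r3] := box_gronwall ac gb s0s tb (sub _ ch) (sub _ ch') dh dh' (b2 _ bh) (b2 _ bh') Kab.
have [_ _ r4] := box_gronwall ac gb s0s tb (sub _ cg) (sub _ ch) ds0 dh bg (b2 _ bh) Kab.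
split => //.
  move: bh; rewrite -!ball_normE /= => bh; apply: le_lt_trans r4 _.
  by rewrite -/C mulrC -ltr_pdivlMr//; exact: lt_le_trans bh mC.
by apply: le_trans r3 _; rewrite -/C -mulrA ler_wpM2l// ltW.
Qed.

Lemma curve_lipschitz t c : 0 <= t <= 1 -> atlas c -> cdom c (g t) -> forall e : R, 0 < e ->
  exists V K, [/\ mopen V, V (g 0), 0 <= K & forall h h', mcurve X h 0 1 -> mcurve X h' 0 1 -> V (h 0) -> V (h' 0) ->
  [/\ cdom c (h t), ball (cmap c (g t)) e (cmap c (h t)), cdom c (h' t) &
     `|cmap c (h t) - cmap c (h' t)| <= K * `|cmap (chart_at (g 0)) (h 0) - cmap (chart_at (g 0)) (h' 0)|]].
Proof.
move=> /andP[t0 t1] ac d; apply: (_ : dep c t).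
move: t t0 t1 c ac d.
suff H : forall t, 0 <= t -> t <= 1 -> forall c, atlas c -> cdom c (g t) -> dep c t by move=> t t0 t1 c ac d; exact: H.
apply: real_induction.
- move=> c ac d; have a0 : atlas c0 by exact: at_atlas.
  have d0 : cdom c0 (g 0) by exact: at_dom.
  apply: (dep_chart a0 d0 ac d) => e e0.
  exists [set y | cdom c0 y /\ ball (cmap c0 (g 0)) e (cmap c0 y)], 1; split => //.
  + by apply: (mopen_chart hN a0); exact: (@open_ballrV _ _ _ e0).
  + by split => //; exact: ballxx.
  + by move=> h h' _ _ [d1 b1] [d2 b2]; split => //; rewrite mul1r.
- move=> t t0 t1 H; have [|e e0 He] := @dep_step t; first by rewrite t0 ltW.
  exists (e / 2); first by lra.
  move=> s ts se s1; apply: (He t s) => //; first by rewrite subrr normr0.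
    by rewrite ger0_norm; lra.
  exact: (H t t0 (lexx t)).
- move=> t t0 t1 H; have [|e e0 He] := @dep_step t; first by rewrite t1 ltW.
  pose s := t - Num.min (e / 2) t.
  have m0 : 0 < Num.min (e / 2) t by rewrite lt_min t0 andbT; lra.
  have m1 : Num.min (e / 2) t <= e / 2 by rewrite ge_min lexx.
  have m2 : Num.min (e / 2) t <= t by rewrite ge_min lexx orbT.
  have s0 : 0 <= s by rewrite /s; lra.
  have st : s < t by rewrite /s; lra.
  apply: (He s t) => //; [lra| |by rewrite subrr normr0|].
    by rewrite ltr0_norm /s; lra.
  exact: (H s s0 st).
Qed.

Lemma curve_unique h t : mcurve X h 0 1 -> h 0 = g 0 -> 0 <= t <= 1 -> h t = g t.
Proof.
move=> ch h0 t01; have ac := at_atlas hN (g t); have d := at_dom hN (g t).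
have [V [K [oV Vg K0 H]]] := curve_lipschitz t01 ac d ltr01.
have Vh : V (h 0) by rewrite h0.
have [d1 _ d2 l] := H h g ch cg Vh Vg.
move: l; rewrite h0 subrr normr0 mulr0 normr_le0 subr_eq0 => /eqP E.
by rewrite -(cinvK hN ac d1) E (cinvK hN ac d).
Qed.
End Lip.

Definition tfield X c (w : 'rV_(n + 1)) : 'rV_(n + 1) := row_mx (fld X c w) (1%:M : 'rV_1).

(** At a rest point the constant curve is a trajectory over all of [[-1, 1]], so by [local_flow]
    nearby points also flow that long, without leaving the chart. *)
Lemma rest_flow X z c (e : R) : atlas c -> cdom c z -> 0 < e ->
  (forall t : R, `|t| <= 1 -> freg X t z /\ X t z = 0) ->
  exists r phi, [/\ 0 < r, flow_on (tfield X c) 1 (ball (tpt (cmap c z) 0) r) phi &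
   forall y, ball (cmap c z) r y -> [/\ cdom c (cinv c y), cmap c (cinv c y) = y,
      (forall t : R, `|t| <= 1 -> let y' := lsubmx (phi t (tpt y 0)) in
        [/\ phi t (tpt y 0) = tpt y' t, ball (cmap c z) e y', cdom c (cinv c y') & cmap c (cinv c y') = y']) &
      mcurve X (fun t => cinv c (lsubmx (phi t (tpt y 0)))) (- 1) 1]].
Proof.
move=> ac d e0 HX; set y0 := cmap c z.
have tr : trajectory (tfield X c) 1 (fun t => tpt y0 t).
  move=> t t1; have [rX X0] := HX t t1; split; last first.
    by apply: sm_row_mx; [exact: freg_chart|exact: sm_cst].
  rewrite /tfield fld_tpt (cinvK hN ac d) X0 mul0mx.
  have hc : is_derive t 1 (fun _ : R => y0) 0 by exact: (is_derive_cst y0 t 1).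
  apply: (@isd_row_mx _ 1 n 1 _ (fun t : R => t%:M : 'rV_1) _ _ _ _ hc).
  apply: isd_mx => i j; rewrite !ord1 mxE eqxx.
  rewrite (_ : (fun s => _) = (fun s : R => s)); first exact: is_derive_id.
  by apply/funext => s; rewrite mxE eqxx.
have [r1 [C [phi [r10 C0 fl Hphi]]]] := local_flow ler01 tr.
have [e1 e10 He1] := ball_near (near_cdom hN ac d).
pose r := Num.min (Num.min r1 e1) (Num.min (e / (C + 1)) (e1 / (C + 1))).
have C1 : 0 < C + 1 by lra.
have r0 : 0 < r by rewrite !lt_min r10 e10 !divr_gt0.
have rr1 : r <= r1 by rewrite /r !ge_min lexx.
have re1 : r <= e1 by rewrite /r !ge_min lexx !orbT.
have re : r <= e / (C + 1) by rewrite /r !ge_min lexx !orbT.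
have re' : r <= e1 / (C + 1) by rewrite /r !ge_min lexx !orbT.
exists r, phi; split => //; first by move=> x xb; apply: fl; exact: le_ball xb.
move=> y yb; have [dy Ey] := He1 y (le_ball re1 yb).
have yb' : ball (tpt y0 0) r1 (tpt y 0).
  move: yb; rewrite -ball_normE /= => yb; apply: ball_tpt; first exact: lt_le_trans rr1.
  by rewrite subrr normr0.
have Hc t : `|t| <= 1 -> `|lsubmx (phi t (tpt y 0)) - y0| <= C * `|y - y0|.
  move=> t1; have := Hphi _ yb' t t1.
  have -> : tpt y 0 - tpt y0 0 = row_mx (y - y0) 0 by rewrite /tpt opp_row_mx add_row_mx subrr.
  have -> : phi t (tpt y 0) - tpt y0 t = row_mx (lsubmx (phi t (tpt y 0)) - y0) (rsubmx (phi t (tpt y 0)) - t%:M).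
    by rewrite -[X in X - _ = _]hsubmxK /tpt opp_row_mx add_row_mx.
  move=> h; apply: le_trans (le_trans _ h) _.
    apply: mx_norm_le => // i j.
    have := mx_coord_le (row_mx (lsubmx (phi t (tpt y 0)) - y0) (rsubmx (phi t (tpt y 0)) - t%:M)) i (lshift 1 j).
    by rewrite row_mxEl.
  apply: ler_wpM2l => //; apply: mx_norm_le => // i j; rewrite mxE.
  by case: (fintype.split j) => l; [exact: mx_coord_le|rewrite mxE normr0].
have Hb (e2 : R) t : r <= e2 / (C + 1) -> `|t| <= 1 -> ball y0 e2 (lsubmx (phi t (tpt y 0))).
  move=> h t1; move: yb; rewrite -!ball_normE /= distrC => yb; rewrite distrC; apply: le_lt_trans (Hc t t1) _.
  have : `|y - y0| * (C + 1) < e2 by rewrite -ltr_pdivlMr//; exact: lt_le_trans yb h.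
  by have := normr_ge0 (y - y0); lra.
have [p0 pt] := fl _ yb'.
(* The appended coordinate runs at unit speed, so the suspended flow really evaluates the field at
   time [t]. *)
have time t : `|t| <= 1 -> rsubmx (phi t (tpt y 0)) = t%:M.
  move=> t1; pose w (s : R) : 'rV_1 := rsubmx (phi s (tpt y 0)) - (s%:M : 'rV_1).
  have dw (s : R) : `|s| <= 1 -> is_derive s 1 w (0 : 'rV_1).
    move=> s1; have [dp _] := pt s s1.
    have h1 := isd_rsub dp; rewrite /tfield row_mxKr in h1.
    have h2 : is_derive s 1 (fun s : R => s%:M : 'rV_1) (1%:M : 'rV_1).
      apply: isd_mx => i j; rewrite !ord1 mxE eqxx.
      rewrite (_ : (fun s => _) = (fun s : R => s)); first exact: is_derive_id.
      by apply/funext => s'; rewrite mxE eqxx.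
    by have := is_deriveB h1 h2; rewrite subrr.
  have w0 : w 0 = 0 by rewrite /w p0 /tpt row_mxKr subrr.
  apply/eqP; rewrite -subr_eq0 -normr_le0.
  have := @vec_mean_value0 1 1 w (fun=> 0) 0 1 w0 dw _ t t1; rewrite mul0r; apply.
  by move=> s _; rewrite normr0.
split => //.
  move=> t t1 y'; have [h1 h2] := He1 _ (Hb _ t re' t1); split => //; last exact: (Hb _ t re t1).
  by rewrite /tpt -(time t t1) hsubmxK.
move=> t /andP[t0 t1]; have t1' : `|t| <= 1 by rewrite ler_norml t0.
set g := fun t => cinv c (lsubmx (phi t (tpt y 0))).
have [dg Eg] := He1 _ (Hb _ t re' t1').
have a0 := at_atlas hN (g t); have d0 := at_dom hN (g t).
have [dp _] := pt t t1'; have dl := isd_lsub dp.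
have nn := near_cinv hN ac dg (mopen_cdom hN a0) d0; rewrite Eg in nn.
have cl := is_derive_cont dl nn; rewrite near_simpl in cl.
have cl' : \forall s \near t, cdom (chart_at (g t)) (g s).
  by have := cl : nbhs t (fun s => _); apply: filterS => s [].
split; first exact: cl'.
have st := sm_trans hN ac a0 dg d0; rewrite Eg in st.
have D := is_derive_comp_mul (f := fun y => cmap (chart_at (g t)) (cinv c y)) dl (sm_diff st).
suff <- : lsubmx (tfield X c (phi t (tpt y 0))) *m jacobian (fun y => cmap (chart_at (g t)) (cinv c y)) (lsubmx (phi t (tpt y 0))) = X t (g t) by exact: D.
rewrite /tfield row_mxKl -[phi t (tpt y 0)]hsubmxK (time t t1') -[row_mx _ _]/(tpt _ _) fld_tpt -mulmxA.
rewrite [lsubmx (tpt _ _)]row_mxKl.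
have := tcoord_trans hN ac dg a0 d0; rewrite Eg => ->.
by rewrite tcoord_at// mulmx1.
Qed.
End Dependence.

(** * Differential forms and Moser's argument *)

Section Forms.

Lemma bilin_ext n m (A B : 'M[R]_(n, m)) : (forall (v : 'rV_n) (w : 'rV_m), v *m A *m w^T = v *m B *m w^T) -> A = B.
Proof.
move=> H; apply/matrixP => i j; have := H (delta_mx 0 i) (delta_mx 0 j).
rewrite trmx_delta -!mulmxA -!colE -!rowE => /matrixP/(_ 0 0).
by rewrite !mxE.
Qed.

Lemma derive_dir_add n p q (f : 'rV_n -> 'M[R]_(p, q)) x u v : differentiable f x ->
  'D_(u + v) f x = 'D_u f x + 'D_v f x.
Proof. by move=> df; rewrite !deriveE// linearD. Qed.

(** The exterior derivative of the one-form [a], as the matrix with [v *m extd a x *m w^T = D_v a .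
    w - D_w a . v]. *)
Definition extd n (a : 'rV_n -> 'rV_n) x : 'M[R]_n := jacobian a x - (jacobian a x)^T.

Lemma extd_bilin n (a : 'rV_n -> 'rV_n) x v w : smooth_at x a ->
  v *m extd a x *m w^T = 'D_v a x *m w^T - 'D_w a x *m v^T.
Proof.
move=> sa; have da := sm_diff sa; rewrite (derive_mulE v da) (derive_mulE w da).
rewrite /extd mulmxBr mulmxBl; congr (_ - _).
by rewrite -[LHS]scal1_tr !trmx_mul !trmxK mulmxA.
Qed.

Lemma extd_antisym n (a : 'rV_n -> 'rV_n) x : (extd a x)^T = - extd a x.
Proof. by rewrite /extd raddfB/= trmxK opprB. Qed.

Lemma sm_extd n (a : 'rV_n -> 'rV_n) x : smooth_at x a -> smooth_at x (extd a).
Proof. by move=> sa; apply: smB; [exact: sm_jac|apply: sm_tr; exact: sm_jac]. Qed.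

Lemma extd_near n (a b : 'rV_n -> 'rV_n) x : (\forall y \near x, a y = b y) -> smooth_at x a -> extd a x = extd b x.
Proof. by move=> ab sa; rewrite /extd (jac_near ab (sm_diff sa)). Qed.

Lemma derive_extd n (a : 'rV_n -> 'rV_n) x u v w : smooth_at x a ->
  v *m 'D_u (extd a) x *m w^T = 'D_u ('D_v a) x *m w^T - 'D_u ('D_w a) x *m v^T.
Proof.
move=> sa; have sc := sm_extd sa.
have E1 : 'D_u (fun y => v *m extd a y *m w^T) x = v *m 'D_u (extd a) x *m w^T.
  have s1 : smooth_at x (fun y => v *m extd a y) by apply: sm_mulmx => //; exact: sm_cst.
  rewrite (derive_mulmx u s1 (sm_cst x w^T)) derive_cst mulmx0 addr0.
  by rewrite (derive_mulmx u (sm_cst x v) sc) derive_cst mul0mx add0r.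
have E2 : 'D_u (fun y => 'D_v a y *m w^T - 'D_w a y *m v^T) x = 'D_u ('D_v a) x *m w^T - 'D_u ('D_w a) x *m v^T.
  have s1 : smooth_at x (fun y => 'D_v a y *m w^T) by apply: sm_mulmx; [exact: sm_der|exact: sm_cst].
  have s2 : smooth_at x (fun y => 'D_w a y *m v^T) by apply: sm_mulmx; [exact: sm_der|exact: sm_cst].
  have := deriveB (diff_derivable (sm_diff s1)) (diff_derivable (v := u) (sm_diff s2)) => ->.
  rewrite (derive_mulmx u (sm_der v sa) (sm_cst x w^T)) (derive_mulmx u (sm_der w sa) (sm_cst x v^T)).
  by rewrite !derive_cst !mulmx0 !addr0.
rewrite -E1 -E2; apply: derive_near; apply: filterS (sm_near sa) => y sy; exact: extd_bilin.
Qed.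

Lemma extd_closed n (a : 'rV_n -> 'rV_n) x : smooth_at x a -> closed2 (extd a) x.
Proof.
move=> sa p q s; pose A u v := 'D_u ('D_v a) x.
have eD u v w : v *m 'D_u (extd a) x *m w^T = A u v *m w^T - A u w *m v^T := derive_extd u v w sa.
have sA u v : A u v = A v u := schwarz_mx u v sa.
apply: (eq_trans (congr2 +%R (congr2 +%R (eD p q s) (eD q s p)) (eD s p q))).
rewrite (sA q p) (sA s p) (sA s q); move: (A p q) (A p s) (A q s) => A1 A2 A3.
by apply/matrixP => i j; rewrite !mxE; ring.
Qed.

(** The terms with the second derivative of [g] cancel by [jac_symm]. *)
Lemma extd_pull n m (g : 'rV_n -> 'rV_m) (a : 'rV_m -> 'rV_m) x :
  smooth_at x g -> smooth_at (g x) a ->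
  extd (fun y => a (g y) *m (jacobian g y)^T) x = jacobian g x *m extd a (g x) *m (jacobian g x)^T.
Proof.
move=> sg sa; have sJ := sm_jac sg; have sag := sm_comp sg sa.
have sh : smooth_at x (fun y => a (g y) *m (jacobian g y)^T) by apply: sm_mulmx => //; exact: sm_tr.
have D u v : 'D_u (fun y => a (g y) *m (jacobian g y)^T) x *m v^T =
   'D_(u *m jacobian g x) a (g x) *m (v *m jacobian g x)^T + a (g x) *m (v *m 'D_u (jacobian g) x)^T.
  have e1 := derive_mulmx u sag (sm_tr sJ); have e2 := derive_trmx u sJ.
  have e3 := derive_comp u (sm_diff sg) (sm_diff sa); rewrite (derive_mulE u (sm_diff sg)) in e3.
  apply: (eq_trans (congr1 (mulmx^~ v^T) (eq_trans e1 (congr2 (fun X Y => X *m (jacobian g x)^T + a (g x) *m Y) e3 e2)))).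
  move: ('D_(u *m jacobian g x) a (g x)) ('D_u (jacobian g) x) => X Y.
  by rewrite mulmxDl !trmx_mul !mulmxA.
apply: bilin_ext => v w; apply: (eq_trans (extd_bilin v w sh)).
apply: (eq_trans (congr2 (fun X Y => X - Y) (D _ v w) (D _ w v))).
have E1 := jac_symm v w sg; have E2 := extd_bilin (v *m jacobian g x) (w *m jacobian g x) sa.
have -> : v *m (jacobian g x *m extd a (g x) *m (jacobian g x)^T) *m w^T = v *m jacobian g x *m extd a (g x) *m (w *m jacobian g x)^T.
  by rewrite trmx_mul !mulmxA.
rewrite E2; move: E1; move: ('D_v (jacobian g) x) ('D_w (jacobian g) x) => X Y ->.
move: ('D_(v *m jacobian g x) a (g x)) ('D_(w *m jacobian g x) a (g x)) => X' Y'.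
by apply/matrixP => i j; rewrite !mxE; ring.
Qed.

Section One.
Variables (n : nat) (N : premanifold R n).
Hypothesis hN : hmfd N.
Implicit Types (z : N) (c : chart R n N) (al : N -> 'rV_n).

Definition aform c al y := al (cinv c y) *m (fcoord (cinv c y) c)^T.

Definition asm al z := exists c, [/\ atlas c, cdom c z & smooth_at (cmap c z) (aform c al)].

Lemma aform_trans c c' al y : atlas c -> atlas c' -> cdom c (cinv c y) -> cmap c (cinv c y) = y -> cdom c' (cinv c y) ->
  aform c al y = aform c' al (cmap c' (cinv c y)) *m (jacobian (fun y => cmap c' (cinv c y)) y)^T.
Proof.
move=> ac ac' d E d'; rewrite /aform (cinvK hN ac' d') -mulmxA -trmx_mul; congr (_ *m _^T).
by have := fcoord_trans hN ac d ac' d'; rewrite E => ->.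
Qed.

Lemma aform_trans_near c c' al z : atlas c -> atlas c' -> cdom c z -> cdom c' z ->
  \forall y \near cmap c z, aform c' al (cmap c' (cinv c y)) *m (jacobian (fun y => cmap c' (cinv c y)) y)^T = aform c al y.
Proof.
move=> ac ac' d d'; apply: filterS (near_cinv hN ac d (mopen_cdom hN ac') d') => y [d1 E d2].
by rewrite -aform_trans.
Qed.

Lemma asm_chart al z c : asm al z -> atlas c -> cdom c z -> smooth_at (cmap c z) (aform c al).
Proof.
move=> [c' [ac' d' s']] ac d; apply: sm_ext (aform_trans_near al ac ac' d d') _.
have st := sm_trans hN ac ac' d d'; apply: sm_mulmx; last by apply: sm_tr; exact: sm_jac.
by apply: (sm_comp st); rewrite (cinvK hN).
Qed.

Definition mdform al z := extd (aform (chart_at z) al) (cmap (chart_at z) z).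

Lemma mdform_chart al z c : asm al z -> atlas c -> cdom c z ->
  mdform al z = tcoord z c *m extd (aform c al) (cmap c z) *m (tcoord z c)^T.
Proof.
move=> sa ac d; have a0 := at_atlas hN z; have d0 := at_dom hN z.
have st := sm_trans hN a0 ac d0 d.
have sac := asm_chart sa ac d.
have := @extd_pull _ _ (fun y => cmap c (cinv (chart_at z) y)) (aform c al) (cmap (chart_at z) z) st.
rewrite (cinvK hN)// => /(_ sac) E; rewrite -[RHS]E.
apply: esym; apply: extd_near; first exact: aform_trans_near.
by apply: sm_mulmx; [apply: (sm_comp st); rewrite (cinvK hN)|apply: sm_tr; exact: sm_jac].
Qed.

Lemma mdform_fcoord al z c : asm al z -> atlas c -> cdom c z ->
  extd (aform c al) (cmap c z) = fcoord z c *m mdform al z *m (fcoord z c)^T.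
Proof.
move=> sa ac d; rewrite (mdform_chart sa ac d) !mulmxA (ftcoord hN ac d) mul1mx -mulmxA -trmx_mul (ftcoord hN ac d).
by rewrite trmx1 mulmx1.
Qed.
End One.

Section Pull.
Variables (n m : nat) (N : premanifold R n) (M : premanifold R m).
Hypotheses (hN : hmfd N) (hM : hmfd M).
Variables (F : N -> M) (al : M -> 'rV_m) (z : N).
Hypotheses (sF : msmap F z) (sa : asm al (F z)).
Let pull y := al (F y) *m (mder F y)^T.
Hypothesis nF : exists U, [/\ mopen U, U z & forall y, U y -> msmap F y].

Let pull_near c c' : atlas c -> cdom c z -> atlas c' -> cdom c' (F z) ->
  \forall y \near cmap c z, aform c' al (cmap c' (F (cinv c y))) *m (jacobian (fun y => cmap c' (F (cinv c y))) y)^T = aform c pull y.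
Proof.
move=> ac d ac' d'; have [U [oU Uz HU]] := nF.
apply: filterS2 (near_cinv hN ac d oU Uz) (msmap_near hN sF ac d (mopen_cdom hM ac') d') => y [d1 E Uy] d2.
rewrite /aform (cinvK hM ac' d2) /pull -!mulmxA -!trmx_mul; congr (_ *m _^T).
have := mder_jac hN hM (HU _ Uy) ac d1 ac' d2; rewrite E => H.
by apply: (eq_trans (congr1 (mulmx^~ _) H) _); rewrite -!mulmxA (tfcoord hM ac' d2) mulmx1.
Qed.

Lemma asm_pull : asm pull z.
Proof.
have ac := at_atlas hN z; have d := at_dom hN z; have ac' := at_atlas hM (F z); have d' := at_dom hM (F z).
exists (chart_at z); split => //; apply: sm_ext (pull_near ac d ac' d') _.
have s1 := msmap_sm hN sF ac d ac' d'; apply: sm_mulmx; last by apply: sm_tr; exact: sm_jac.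
by apply: (sm_comp s1); rewrite (cinvK hN)//; exact: asm_chart.
Qed.

Lemma mdform_pull : mdform pull z = mder F z *m mdform al (F z) *m (mder F z)^T.
Proof.
have ac := at_atlas hN z; have d := at_dom hN z; have ac' := at_atlas hM (F z); have d' := at_dom hM (F z).
have s1 := msmap_sm hN sF ac d ac' d'; have s2 := asm_chart hM sa ac' d'.
have s2' : smooth_at (cmap (chart_at (F z)) (F (cinv (chart_at z) (cmap (chart_at z) z)))) (aform (chart_at (F z)) al) by rewrite (cinvK hN).
have E := extd_pull s1 s2'.
rewrite /mdform -(extd_near (pull_near ac d ac' d')); last first.
  by apply: sm_mulmx; [exact: (sm_comp s1)|apply: sm_tr; exact: sm_jac].
apply: (eq_trans E); rewrite (cinvK hN ac d); exact: erefl.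
Qed.
End Pull.

Lemma tube_near n (c : R -> 'rV_n) (T : R) (Q : 'rV_n -> Prop) : 0 <= T ->
  (forall t : R, `|t| <= T -> {for t, continuous c}) -> (forall t : R, `|t| <= T -> \forall w \near c t, Q w) ->
  exists2 d : R, 0 < d & forall t : R, `|t| <= T -> forall x, ball (c t) d x -> Q x.
Proof.
(* [g] is an indicator of failure of [Q]. It is locally zero near the curve, hence smooth there, and
   [tube] applied to it gives a Lipschitz bound; a value 1 at distance below [1 / (K + 1)] from a
   zero would contradict it. *)
move=> T0 cc H; pose g (w : 'rV_n) : 'M[R]_1 := if pselect (Q w) then 0 else 1%:M.
have gQ w : Q w -> g w = 0 by rewrite /g; case: pselect.
have [|d [K [d0 K0 HK]]] := @tube 1 1 n g c T T0.
  move=> t tT; split; first exact: cc.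
  by apply: sm_ext (sm_cst (c t) (0 : 'M[R]_1)); apply: filterS (H t tT) => w /gQ ->.
have K1 : 0 < K + 1 by lra.
exists (Num.min d (1 / (K + 1))); first by rewrite lt_min d0 divr_gt0.
move=> t tT x xb.
have m1 : Num.min d (1 / (K + 1)) <= d by rewrite ge_min lexx.
have m2 : Num.min d (1 / (K + 1)) <= 1 / (K + 1) by rewrite ge_min lexx orbT.
have [_ _] := HK t tT x (c t) (le_ball m1 xb) (ballxx _ d0).
rewrite (gQ (c t)); last exact: nbhs_singleton (H t tT).
rewrite subr0 /g; case: pselect => // nQ.
have xb' : `|x - c t| < 1 / (K + 1) by move: xb; rewrite -ball_normE /= distrC => xb; exact: lt_le_trans xb m2.
move=> /(le_trans (mx_coord_le (1%:M : 'M[R]_1) 0 0)); rewrite mxE eqxx normr1.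
have : `|x - c t| * (K + 1) < 1 by rewrite -ltr_pdivlMr.
by have := normr_ge0 (x - c t); lra.
Qed.
End Forms.

(** * Moser's argument in coordinates *)

Section LocalMoser.

Lemma sm_tpt n (y : 'rV_n) (t : R) : smooth_at y (fun y => tpt y t).
Proof. by apply: sm_row_mx; [exact: sm_id|exact: sm_cst]. Qed.

Lemma derive_tpt n (y u : 'rV_n) (t : R) : 'D_u (fun y => tpt y t) y = row_mx u 0.
Proof.
have h := isd_row_mx (smooth_isd u (sm_id y)) (smooth_isd u (sm_cst y (t%:M : 'rV_1))).
by rewrite derive_id derive_cst in h; have [_ ->] := h.
Qed.

Lemma derive_neg n p q (f : 'rV_n -> 'M[R]_(p, q)) x v : smooth_at x f -> 'D_v (fun y => - f y) x = - 'D_v f x.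
Proof. by move=> sf; apply: deriveN; apply: diff_derivable; exact: sm_diff. Qed.

Variables (n : nat) (P : 'rV_n -> 'M[R]_n) (a : 'rV_n -> 'rV_n).
Let d := extd a.

(** A vector [w] is a pair [(x, t)]. [mosP] is the gauge transform of [P] by the closed form
    [t d a], [mosf] is the image of [- a] under it, which is Moser's vector field, and [mosG] is the
    suspension of that field by time. *)
Definition mosQ (w : 'rV_(n + 1)) : 'M[R]_n := 1%:M + (rsubmx w 0 0) *: (P (lsubmx w) *m extd a (lsubmx w)).
Definition mosP (w : 'rV_(n + 1)) : 'M[R]_n := invmx (mosQ w) *m P (lsubmx w).
Definition mosf (w : 'rV_(n + 1)) : 'rV_n := - a (lsubmx w) *m mosP w.
Definition mosG (w : 'rV_(n + 1)) : 'rV_(n + 1) := row_mx (mosf w) (1%:M : 'rV_1).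

Definition pgood (x : 'rV_n) := [/\ smooth_at x P, smooth_at x a, \forall y \near x, (P y)^T = - P y & jacobi P x].

Lemma mosQ_tpt x t : mosQ (tpt x t) = 1%:M + t *: (P x *m extd a x).
Proof. by rewrite /mosQ /tpt row_mxKl row_mxKr mxE eqxx. Qed.

Lemma sm_mosQ w : smooth_at (lsubmx w) P -> smooth_at (lsubmx w) a -> smooth_at w mosQ.
Proof.
move=> sP sa; have sl := sm_lsubid w; apply: smD; first exact: sm_cst.
apply: smZ; first by apply: sm_coord; exact: sm_rsubid.
by apply: sm_mulmx; [exact: (sm_comp sl sP)|exact: (sm_comp sl (sm_extd sa))].
Qed.

Section Point.
Variable w : 'rV_(n + 1).
Hypotheses (sP : smooth_at (lsubmx w) P) (sa : smooth_at (lsubmx w) a) (uQ : mosQ w \in unitmx).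

Lemma sm_mosP : smooth_at w mosP.
Proof.
apply: sm_mulmx; first by apply: sm_invmx => //; exact: sm_mosQ.
exact: (sm_comp (sm_lsubid w) sP).
Qed.

Lemma sm_mosf : smooth_at w mosf.
Proof. by apply: sm_mulmx; [apply: smN; exact: (sm_comp (sm_lsubid w) sa)|exact: sm_mosP]. Qed.

Lemma sm_mosG : smooth_at w mosG.
Proof. by apply: sm_row_mx; [exact: sm_mosf|exact: sm_cst]. Qed.

Lemma derive_mosG m : 'D_m mosG w = row_mx ('D_m mosf w) 0.
Proof.
have h := isd_row_mx (smooth_isd m sm_mosf) (smooth_isd m (sm_cst w (1%:M : 'rV_1))).
by rewrite derive_cst in h; have [_ ->] := h.
Qed.

(** Differentiate [mosQ w *m mosP w = P] in time. This is the term [- P B P] of [homotopy_curve]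
    with [B = d a]. *)
Lemma derive_time : 'D_(row_mx 0 (1%:M : 'rV_1)) mosP w = - (mosP w *m extd a (lsubmx w) *m mosP w).
Proof.
set e := row_mx _ _; have sQ := sm_mosQ sP sa; have sPl := sm_comp (sm_lsubid w) sP.
have sdl := sm_comp (sm_lsubid w) (sm_extd sa).
have Dl p q (g : 'rV_n -> 'M[R]_(p, q)) : smooth_at (lsubmx w) g -> 'D_e (fun w => g (lsubmx w)) w = 0.
  move=> sg; have E := derive_comp e (sm_diff (sm_lsubid w)) (sm_diff sg).
  have [_ El] := isd_lsub (smooth_isd e (sm_id w)).
  rewrite derive_id row_mxKl in El; apply: (eq_trans E); apply: (eq_trans (congr1 (fun u => 'D_u g (lsubmx w)) El)).
  by rewrite deriveE ?linear0//; exact: sm_diff.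
have nQ : \forall w' \near w, mosQ w' *m mosP w' = P (lsubmx w').
  by apply: filterS (near_unitmx sQ uQ) => w' u'; rewrite /mosP mulKVmx.
have D1 := derive_mulmx e sQ sm_mosP; have D2 := derive_near e nQ.
rewrite D2 (Dl _ _ P sP) in D1.
have DQ : 'D_e mosQ w = P (lsubmx w) *m extd a (lsubmx w).
  have sr : smooth_at w (fun w : 'rV_(n + 1) => (rsubmx w 0 0)%:M : 'M[R]_n).
    by apply: sm_mx => i j; rewrite (_ : (fun y => _) = fun y : 'rV_(n + 1) => (i == j)%:R * rsubmx y 0 0); [apply: smM; [exact: sm_cst|by apply: sm_coord; exact: sm_rsubid]|apply/funext => y; rewrite mxE mulr_natl].
  have sPd := sm_mulmx sPl sdl.
  have E : 'D_e (fun w => (rsubmx w 0 0)%:M *m (P (lsubmx w) *m extd a (lsubmx w))) w = 'D_e (fun w : 'rV_(n + 1) => (rsubmx w 0 0)%:M : 'M[R]_n) w *m (P (lsubmx w) *m extd a (lsubmx w)).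
    rewrite (derive_mulmx e sr sPd) (Dl _ _ (fun x => P x *m extd a x)); first by rewrite mulmx0 addr0.
    exact: (sm_mulmx sP (sm_extd sa)).
  have Er : 'D_e (fun w : 'rV_(n + 1) => (rsubmx w 0 0)%:M : 'M[R]_n) w = 1%:M.
    have [_ Er] := isd_coord 0 0 (isd_rsub (smooth_isd e (sm_id w))).
    rewrite derive_id row_mxKr mxE eqxx in Er.
    have dr : derivable (fun w : 'rV_(n + 1) => rsubmx w 0 0) w e.
      by have [] := isd_coord 0 0 (isd_rsub (smooth_isd e (sm_id w))).
    have h : is_derive w e (fun w : 'rV_(n + 1) => (rsubmx w 0 0)%:M : 'M[R]_n) 1%:M.
      apply: isd_mx => i j; rewrite mxE; case: eqVneq => [->|ij].
        rewrite (_ : (fun s => _) = fun w : 'rV_(n + 1) => rsubmx w 0 0); last by apply/funext => y; rewrite mxE eqxx.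
        exact: (DeriveDef dr Er).
      rewrite (_ : (fun s => _) = fun w : 'rV_(n + 1) => 0); first exact: is_derive_cst.
      by apply/funext => y; rewrite mxE (negbTE ij).
    by have [_] := h.
  rewrite -[P _ *m _]mul1mx -Er -E.
  have -> : mosQ = fun w => 1%:M + (rsubmx w 0 0)%:M *m (P (lsubmx w) *m extd a (lsubmx w)).
    by apply/funext => y; rewrite /mosQ mul_scalar_mx.
  rewrite derive_addmx; [by rewrite derive_cst add0r|exact: sm_cst|exact: sm_mulmx].
rewrite DQ in D1; apply: (can_inj (mulKmx uQ)); rewrite mulmxN; apply/eqP; rewrite -addr_eq0 addrC.
rewrite [X in X + _]mulmxA [X in X *m mosP w + _]mulmxA.
have -> : mosQ w *m mosP w = P (lsubmx w) by rewrite /mosP mulKVmx.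
by apply/eqP; exact: (esym D1).
Qed.
End Point.

Section Slice.
Variables (x : 'rV_n) (t : R).
Hypotheses (gx : pgood x) (uQ : mosQ (tpt x t) \in unitmx).

Let sPw : smooth_at (lsubmx (tpt x t)) P. Proof. by rewrite row_mxKl; case: gx. Qed.
Let saw : smooth_at (lsubmx (tpt x t)) a. Proof. by rewrite row_mxKl; case: gx. Qed.

Let E : (fun y => mosP (tpt y t)) = fun y => invmx (1%:M *m (jacobian id y)^T + P y *m (t *: extd a y)) *m P y.
Proof. by apply/funext => y; rewrite /mosP mosQ_tpt row_mxKl jac_id trmx1 mulmx1 scalemxAr. Qed.

Let uQ' : 1%:M *m (jacobian id x)^T + P x *m (t *: extd a x) \in unitmx.
Proof. by rewrite jac_id trmx1 mulmx1 -scalemxAr -mosQ_tpt. Qed.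

Let aeta : (t *: extd a x)^T = - (t *: extd a x).
Proof. by rewrite linearZ/= extd_antisym scalerN. Qed.

Let VF : \forall y \near x, P y *m jacobian id y = 1%:M *m P (id y).
Proof. by near=> y; rewrite jac_id mulmx1 mul1mx. Unshelve. all: by end_near. Qed.

Let seta : smooth_at x (fun y => t *: extd a y).
Proof. by have [_ sa _ _] := gx; apply: smZ; [exact: sm_cst|exact: sm_extd]. Qed.

(** At fixed [t] this is [gauge_jacobi] for the identity map and the closed form [t d a]. *)
Lemma slice_jacobi : jacobi (fun y => mosP (tpt y t)) x.
Proof.
have [sP sa aP jP] := gx; rewrite E.
apply: (gauge_jacobi sP (sm_cst x 1%:M) (sm_id x) sP seta VF (nbhs_singleton aP) jP aeta _ uQ').
have Ez u : 'D_u (fun y => t *: extd a y) x = t *: 'D_u (extd a) x.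
  by have := deriveZ t (diff_derivable (v := u) (sm_diff (sm_extd sa))).
move=> p q s; rewrite (cyclic3_ext _ _ _ Ez).
have := extd_closed sa p q s; rewrite /cyclic3.
move: ('D_p (extd a) x) ('D_q (extd a) x) ('D_s (extd a) x) => X Y Z H.
by rewrite -!scalemxAr -!scalemxAl -!scalerDr H scaler0.
Qed.

Lemma slice_derive u : 'D_(row_mx u 0) mosP (tpt x t) = 'D_u (fun y => mosP (tpt y t)) x.
Proof.
have sm := sm_mosP sPw saw uQ.
have := derive_comp u (sm_diff (sm_tpt x t)) (sm_diff sm); rewrite derive_tpt => H.
exact: (esym H).
Qed.

Lemma slice_derivef u : 'D_(row_mx u 0) mosf (tpt x t) = - 'D_u a x *m mosP (tpt x t) - a x *m 'D_(row_mx u 0) mosP (tpt x t).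
Proof.
have sm := sm_mosf sPw saw uQ; have smP := sm_mosP sPw saw uQ; have [_ sa _ _] := gx.
have H := derive_comp u (sm_diff (sm_tpt x t)) (sm_diff sm); rewrite derive_tpt in H.
apply: (eq_trans (esym H)).
have -> : mosf \o (fun y => tpt y t) = fun y => - a y *m mosP (tpt y t).
  by apply/funext => y; rewrite /= /mosf row_mxKl.
have s2 : smooth_at x (fun y => mosP (tpt y t)) by exact: (sm_comp (sm_tpt x t) smP).
rewrite (derive_mulmx u (smN sa) s2) slice_derive (derive_neg u sa).
by rewrite (mulNmx (a x)).
Qed.

Lemma slice_near_antisym : \forall w \near tpt x t, (mosP w)^T = - mosP w.
Proof.
have [sP sa aP jP] := gx.
have cl := sm_cont (sm_lsubid (tpt x t)); rewrite /prop_for /continuous_at {2}/tpt row_mxKl in cl.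
have n1 := cl _ aP.
have n2 := near_unitmx (sm_mosQ sPw saw) uQ.
near=> w.
have aw : (P (lsubmx w))^T = - P (lsubmx w) by near: w; exact: n1.
have uw : mosQ w \in unitmx by near: w; exact: n2.
rewrite /mosP trmx_mul aw trmx_inv.
have uT : (mosQ w)^T \in unitmx by rewrite unitmx_tr.
apply: (can_inj (mulmxK uT)); rewrite mulmxKV// mulNmx.
apply: (can_inj (mulKmx uw)); rewrite !mulmxN !mulmxA mulmxV// mul1mx; congr (- _).
have -> : (mosQ w)^T = 1%:M + rsubmx w 0 0 *: (P (lsubmx w) *m extd a (lsubmx w))^T.
  by rewrite /mosQ [LHS]linearD/= tr_scalar_mx linearZ.
rewrite trmx_mul extd_antisym aw /mosQ mulmxDl mul1mx [RHS]mulmxDr mulmx1.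
by rewrite -scalemxAl -scalemxAr mulmxN mulNmx opprK mulmxA.
Unshelve. all: by end_near. Qed.

Lemma slice_antisym : (mosP (tpt x t))^T = - mosP (tpt x t).
Proof. exact: (nbhs_singleton slice_near_antisym). Qed.
End Slice.

Variables (G : 'rV_(n + 1) -> 'rV_(n + 1)) (phi : R -> 'rV_(n + 1) -> 'rV_(n + 1)) (w0 : 'rV_(n + 1)) (r : R).
Hypotheses (r0 : 0 < r) (fl : flow_on G 1 (ball w0 r) phi).
Variables (y : 'rV_n) (x : R -> 'rV_n).
Hypothesis yb : ball w0 r (tpt y 0).
Hypothesis Hx : forall t : R, `|t| <= 1 -> [/\ phi t (tpt y 0) = tpt (x t) t, pgood (x t) & mosQ (tpt (x t) t) \in unitmx].
Hypothesis HG : forall t : R, `|t| <= 1 -> \forall w \near phi t (tpt y 0), mosG w = G w.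
Let f y' := lsubmx (phi 1 (tpt y' 0)).

Let one1 : `|1 : R| <= 1. Proof. by rewrite normr1. Qed.
Let zero1 : `|0 : R| <= 1. Proof. by rewrite normr0. Qed.

Lemma moser_smooth : smooth_at y f.
Proof.
apply: sm_lsub; apply: (sm_comp (sm_tpt y 0)).
exact: (flow_smooth ler01 (@open_ballrV _ w0 r r0) fl yb).
Qed.

(** The case [th = - a], [B = d a] of [homotopy_curve] along a trajectory of Moser's field. The
    variation of [th] is [- D_v a], so the change of the pairing is [d a (v, w)] minus its
    expression by directional derivatives, which is zero. Constancy of the pairing says that [b1]
    pulls back to [b0], and [b P = v] at time 1 says that the flow takes [P] to its gauge
    transform. *)
Lemma moser_local (b0 : 'rV_n) : exists b1 : 'rV_n,
  b1 *m mosP (tpt (f y) 1) = b0 *m P y *m jacobian f y /\ b1 *m (jacobian f y)^T = b0.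
Proof.
have [M [M0 dM Mphi]] := flow_diff ler01 (@open_ballrV _ w0 r r0) fl yb.
have [p0 tr] := fl yb.
have sPw (t : R) : `|t| <= 1 -> smooth_at (lsubmx (tpt (x t) t)) P by move=> /Hx[_ [? _ _ _] _]; rewrite row_mxKl.
have saw (t : R) : `|t| <= 1 -> smooth_at (lsubmx (tpt (x t) t)) a by move=> /Hx[_ [_ ? _ _] _]; rewrite row_mxKl.
have uw (t : R) : `|t| <= 1 -> mosQ (tpt (x t) t) \in unitmx by case/Hx.
have gx (t : R) : `|t| <= 1 -> pgood (x t) by case/Hx.
pose u (v : 'rV_n) (t : R) := lsubmx (row_mx v 0 *m M t).
have dm v (t : R) : `|t| <= 1 -> is_derive t 1 (fun s : R => row_mx v 0 *m M s) (row_mx ('D_(row_mx v 0 *m M t) mosf (tpt (x t) t)) 0).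
  move=> t1; have := is_derive_mulmxl (row_mx v 0) (dM t t1); have [E _ _] := Hx t1; have HGt := HG t1.
  rewrite E in HGt; rewrite E -(jac_near HGt (sm_diff (sm_mosG (sPw t t1) (saw t t1) (uw t t1)))).
  rewrite mulmxA -(derive_mulE _ (sm_diff (sm_mosG (sPw t t1) (saw t t1) (uw t t1)))).
  by rewrite derive_mosG//; [exact: sPw|exact: saw|exact: uw].
have mu v (t : R) : `|t| <= 1 -> row_mx v 0 *m M t = row_mx (u v t) 0.
  move=> t1; rewrite -[LHS]hsubmxK; congr (row_mx _ _).
  have dr (s : R) : `|s| <= 1 -> is_derive s 1 (fun s : R => rsubmx (row_mx v 0 *m M s)) (0 : 'rV_1).
    by move=> s1; have := isd_rsub (dm v s s1); rewrite row_mxKr.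
  have z0 : rsubmx (row_mx v 0 *m M 0) = 0 by rewrite M0 mulmx1 row_mxKr.
  apply/eqP; rewrite -normr_le0.
  have := @vec_mean_value0 1 1 _ (fun=> 0) 0 1 z0 dr _ t t1; rewrite mul0r; apply.
  by move=> s _; rewrite normr0.
have du v (t : R) : `|t| <= 1 -> is_derive t 1 (u v) ('D_(row_mx (u v t) 0) mosf (tpt (x t) t)).
  by move=> t1; have := isd_lsub (dm v t t1); rewrite row_mxKl mu.
have dw (t : R) : `|t| <= 1 -> is_derive t 1 (phi^~ (tpt y 0)) (row_mx (mosf (tpt (x t) t)) (1%:M : 'rV_1)).
  by move=> t1; have [h _] := tr t t1; rewrite -(nbhs_singleton (HG t1)) in h; have [E _ _] := Hx t1; rewrite E in h.
pose Pc (t : R) := mosP (phi t (tpt y 0)).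
pose Bc (t : R) := extd a (lsubmx (phi t (tpt y 0))).
pose Pk (k : 'I_n) (t : R) := 'D_(row_mx (delta_mx 0 k) 0) mosP (phi t (tpt y 0)).
pose th (t : R) := - a (lsubmx (phi t (tpt y 0))).
have cphi (t : R) : `|t| <= 1 -> {for t, continuous (phi^~ (tpt y 0))} by move=> t1; exact: is_derive_cont (dw t t1).
have smP (t : R) : `|t| <= 1 -> smooth_at (phi t (tpt y 0)) mosP.
  by move=> t1; have [E _ _] := Hx t1; rewrite E; apply: sm_mosP; [exact: sPw|exact: saw|exact: uw].
have sma (t : R) : `|t| <= 1 -> smooth_at (phi t (tpt y 0)) (fun w => a (lsubmx w)).
  by move=> t1; have [E _ _] := Hx t1; rewrite E; apply: (sm_comp (sm_lsubid _)); exact: saw.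
have smc (t : R) : `|t| <= 1 -> smooth_at (phi t (tpt y 0)) (fun w => extd a (lsubmx w)).
  by move=> t1; have [E _ _] := Hx t1; rewrite E; apply: (sm_comp (sm_lsubid _)); apply: sm_extd; exact: saw.
have cc p q (g : 'rV_(n + 1) -> 'M[R]_(p, q)) (t : R) : `|t| <= 1 -> smooth_at (phi t (tpt y 0)) g -> {for t, continuous (fun s => g (phi s (tpt y 0)))}.
  move=> t1 sg; apply: (@continuous_comp _ _ _ (phi^~ (tpt y 0)) g); [exact: cphi|exact: sm_cont].
have dirE (v : 'rV_n) (t : R) : `|t| <= 1 -> dirP Pk v t = 'D_(row_mx v 0) mosP (phi t (tpt y 0)).
  move=> t1; have df := sm_diff (smP t t1); rewrite /dirP (deriveE _ df).
  have lin (v' : 'rV_n) : row_mx v' (0 : 'rV_1) = v' *m row_mx 1%:M 0 by rewrite mul_mx_row mulmx1 mulmx0.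
  have -> : row_mx v (0 : 'rV_1) = \sum_k v 0 k *: row_mx (delta_mx 0 k) 0.
    by rewrite lin [in LHS](rV_sum_delta v) mulmx_suml; apply: eq_bigr => k _; rewrite -scalemxAl -lin.
  rewrite linear_sum; apply: eq_bigr => k _.
  by rewrite linearZ/= /Pk deriveE.
have dPt (t : R) : `|t| <= 1 -> is_derive t 1 Pc (dirP Pk (th t *m Pc t) t - Pc t *m Bc t *m Pc t).
  move=> t1; have [E _ _] := Hx t1.
  have h := is_derive_chain (dw t t1) (sm_diff (smP t t1)).
  suff -> : dirP Pk (th t *m Pc t) t - Pc t *m Bc t *m Pc t = 'D_(row_mx (mosf (tpt (x t) t)) (1%:M : 'rV_1)) mosP (phi t (tpt y 0)) by exact: h.
  rewrite dirE// -[row_mx (mosf _) _]addr0.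
  have -> : row_mx (mosf (tpt (x t) t)) (1%:M : 'rV_1) + 0 = row_mx (th t *m Pc t) 0 + row_mx 0 (1%:M : 'rV_1).
    by rewrite addr0 add_row_mx addr0 add0r /th /Pc E.
  rewrite (derive_dir_add _ _ (sm_diff (smP t t1))); congr (_ + _).
  rewrite /Pc /Bc E; apply: esym; apply: derive_time; [exact: sPw|exact: saw|exact: uw].
have hP (t : R) : `|t| <= 1 -> (Pc t)^T = - Pc t.
  by move=> t1; rewrite /Pc; have [-> g1 u1] := Hx t1; exact: slice_antisym.
have hPk k (t : R) : `|t| <= 1 -> (Pk k t)^T = - Pk k t.
  move=> t1; have s1 := smP t t1; rewrite /Pk -(derive_trmx _ s1) -(derive_neg _ s1).
  apply: derive_near; have [E g1 u1] := Hx t1; rewrite E; exact: slice_near_antisym.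
have hJ (t : R) : `|t| <= 1 -> forall x y z : 'rV_n,
  y *m dirP Pk (x *m Pc t) t *m z^T + z *m dirP Pk (y *m Pc t) t *m x^T + x *m dirP Pk (z *m Pc t) t *m y^T = 0.
  move=> t1 p q s; have [E g1 u1] := Hx t1; rewrite !dirE// /Pc E.
  have := slice_jacobi g1 u1 p q s; rewrite /cyclic3.
  by rewrite -!(slice_derive g1 u1).
have cPk k (t : R) : `|t| <= 1 -> {for t, continuous (Pk k)}.
  by move=> t1; exact: (cc _ _ _ _ t1 (sm_der _ (smP t t1))).
have cB (t : R) : `|t| <= 1 -> {for t, continuous Bc} by move=> t1; exact: (cc _ _ _ _ t1 (smc t t1)).
have cth (t : R) : `|t| <= 1 -> {for t, continuous th} by move=> t1; exact: (cc _ _ _ _ t1 (smN (sma t t1))).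
pose thv v (t : R) := - (u v t *m jacobian a (lsubmx (phi t (tpt y 0)))).
have thvE v (t : R) : `|t| <= 1 -> thv v t = - 'D_(u v t) a (x t).
  move=> t1; have := saw t t1; have [E _ _] := Hx t1; rewrite /thv E /tpt row_mxKl => sa.
  by rewrite -(derive_mulE _ (sm_diff sa)).
have dv v (t : R) : `|t| <= 1 -> is_derive t 1 (u v) (thv v t *m Pc t + th t *m dirP Pk (u v t) t).
  move=> t1; have := du v t t1; have [E g1 u1] := Hx t1; rewrite (slice_derivef g1 u1).
  by rewrite (dirE _ _ t1) (thvE _ _ t1) /Pc /th E [lsubmx (tpt _ _)]row_mxKl (mulNmx (a (x t))).
have cthv v (t : R) : `|t| <= 1 -> {for t, continuous (thv v)}.
  move=> t1; have cu := is_derive_cont (du v t t1).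
  have cj : {for t, continuous (fun s => jacobian a (lsubmx (phi s (tpt y 0))))}.
    have := saw t t1; have [E _ _] := Hx t1; rewrite -E => sa.
    exact: (cc _ _ _ _ t1 (sm_comp (sm_lsubid _) (sm_jac sa))).
  have c := cont_mulmx cu cj; exact: (@continuousN _ _ _ _ _ c).
pose v := b0 *m P y.
have u0 v' : u v' 0 = v' by rewrite /u M0 mulmx1 row_mxKl.
have Pc0 : Pc 0 = P y by rewrite /Pc p0 /mosP mosQ_tpt scale0r addr0 invmx1 mul1mx row_mxKl.
have b0P : b0 *m Pc 0 = u v 0 by rewrite u0 Pc0.
have [b [b00 Hb]] := homotopy_curve hP hPk hJ cPk cB cth dPt (cthv v) (dv v) b0P.
have uJ v' : u v' 1 = v' *m jacobian f y.
  rewrite -(derive_mulE _ (sm_diff moser_smooth)) /u -(Mphi 1 one1).2.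
  have sphi : smooth_at (tpt y 0) (phi 1) by exact: (flow_smooth ler01 (@open_ballrV _ w0 r r0) fl yb).
  have h := isd_lsub (smooth_isd v' (sm_comp (sm_tpt y 0) sphi)).
  have E := derive_comp v' (sm_diff (sm_tpt y 0)) (sm_diff sphi); rewrite derive_tpt in E.
  have [_ h2] := h; apply: esym; apply: (eq_trans h2); congr lsubmx; exact: E.
exists (b 1); have [b1P _] := Hb 1 one1; have [E1 _ _] := Hx one1; split.
  by rewrite /f E1 row_mxKl -/v -uJ -b1P /Pc E1.
apply/rowP => j; pose w := delta_mx 0 j : 'rV_n.
have const : b 1 *m (u w 1)^T = b 0 *m (u w 0)^T.
  apply: (@derive0_const 1 1 (fun s => b s *m (u w s)^T) 0 1 ler01) => t /andP[t0 t1].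
  have t1' : `|t| <= 1 by rewrite ger0_norm.
  have [_ /(_ (u w) _ (dv w t t1'))] := Hb t t1'.
  suff -> : thv v t *m (u w t)^T - thv w t *m (u v t)^T + u v t *m Bc t *m (u w t)^T = 0 by [].
  have [E _ _] := Hx t1'; have := extd_bilin (u v t) (u w t) (saw t t1'); rewrite (thvE v t t1') (thvE w t t1') /Bc E.
  rewrite /tpt row_mxKl; move: ('D_(u v t) a (x t)) ('D_(u w t) a (x t)) (extd a (x t)) => X Y Z ->.
  by rewrite !mulNmx; apply/matrixP => i k; rewrite !mxE; ring.
move: const; rewrite u0 uJ b00 trmx_mul mulmxA /w trmx_delta -!colE => /colP/(_ 0).
by rewrite [LHS]mxE [RHS]mxE.
Qed.
End LocalMoser.

(** * The Jacobi identity for brackets of functions and for coordinate matrices *)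

Section PoissonCoord.

Lemma antisym_conj n m (A : 'M[R]_(n, m)) (B : 'M[R]_n) : B^T = - B -> (A^T *m B *m A)^T = - (A^T *m B *m A).
Proof. by move=> aB; rewrite !trmx_mul trmxK aB mulNmx mulmxN mulmxA. Qed.

Lemma mulmx_cancel n m p q (A : 'M[R]_(n, m)) (B : 'M[R]_(m, p)) (C : 'M[R]_(p, q)) (D : 'M[R]_(q, p)) : C *m D = 1%:M -> A *m B *m C *m D = A *m B.
Proof. by move=> E; rewrite -mulmxA E mulmx1. Qed.

Lemma jacobi_near n (P Q : 'rV_n -> 'M[R]_n) x : (\forall y \near x, P y = Q y) -> jacobi P x -> jacobi Q x.
Proof.
move=> PQ jP p q s; rewrite -[RHS](jP p q s); apply: cyclic3_ext => u.
have D := derive_near (u *m P x) PQ; have E := nbhs_singleton PQ.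
by rewrite D E.
Qed.

Section Grad.
Variable n : nat.
Implicit Types (f g h : 'rV_n -> R) (P : 'rV_n -> 'M[R]_n).

Definition cgrad f y : 'rV_n := \row_i 'D_(delta_mx 0 i) f y.
Definition cbr P f g y : R := (cgrad f y *m P y *m (cgrad g y)^T) 0 0.

Lemma cgradE f y v : differentiable f y -> 'D_v f y = (cgrad f y *m v^T) 0 0.
Proof.
move=> df; rewrite (derive_coord_sum v df) mxE; apply: eq_bigr => i _.
by rewrite !mxE mulrC.
Qed.

Lemma sm_cgrad f y : smooth_at y f -> smooth_at y (cgrad f).
Proof.
move=> sf; apply: sm_mx => i j; rewrite (_ : (fun y => _) = 'D_(delta_mx 0 j) f); last by apply/funext => z; rewrite mxE.
exact: sm_der.
Qed.

Lemma derive_cgrad f y u v : smooth_at y f -> ('D_u (cgrad f) y *m v^T) 0 0 = 'D_u ('D_v f) y.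
Proof.
move=> sf; have E := derive_mulmx u (sm_cgrad sf) (sm_cst y v^T); rewrite derive_cst mulmx0 addr0 in E.
rewrite -E; have [_ <-] := isd_coord 0 0 (smooth_isd u (sm_mulmx (sm_cgrad sf) (sm_cst y v^T))).
by apply: derive_near; apply: filterS (sm_near sf) => z sz; rewrite -cgradE//; exact: sm_diff.
Qed.

Lemma sm_cbr P f g y : smooth_at y P -> smooth_at y f -> smooth_at y g -> smooth_at y (cbr P f g).
Proof.
move=> sP sf sg; apply: (sm_coord 0 0 (f := fun y => cgrad f y *m P y *m (cgrad g y)^T)).
by apply: sm_mulmx; [apply: sm_mulmx => //|apply: sm_tr]; exact: sm_cgrad.
Qed.

Lemma derive_cbr P g h y u : smooth_at y P -> smooth_at y g -> smooth_at y h -> (P y)^T = - P y ->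
  'D_u (cbr P g h) y = - 'D_u ('D_(cgrad h y *m P y) g) y + 'D_u ('D_(cgrad g y *m P y) h) y
    + (cgrad g y *m 'D_u P y *m (cgrad h y)^T) 0 0.
Proof.
move=> sP sg sh aP; have gg := sm_cgrad sg; have gh := sm_cgrad sh.
have sgP := sm_mulmx gg sP.
have [_ E] := isd_coord 0 0 (smooth_isd u (sm_mulmx sgP (sm_tr gh))).
rewrite [LHS](_ : _ = 'D_u (fun y => (cgrad g y *m P y *m (cgrad h y)^T) 0 0) y); last by [].
rewrite E (derive_mulmx u sgP (sm_tr gh)) (derive_mulmx u gg sP) (derive_trmx u gh) mulmxDl [LHS]mxE [X in X + _]mxE.
rewrite -(derive_cgrad u (cgrad h y *m P y) sg) -(derive_cgrad u (cgrad g y *m P y) sh).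
move: ('D_u (cgrad g) y) ('D_u (cgrad h) y) ('D_u P y) => X Y Z.
have -> : (cgrad g y *m P y *m Y^T) 0 0 = (Y *m (cgrad g y *m P y)^T) 0 0.
  by rewrite -[in LHS](trmxK (cgrad g y *m P y)) -trmx_mul mxE.
have -> : (X *m P y *m (cgrad h y)^T) 0 0 = - (X *m (cgrad h y *m P y)^T) 0 0.
  by rewrite trmx_mul aP mulNmx mulmxN [in RHS]mxE opprK mulmxA.
by rewrite -addrA [X in _ + X]addrC addrA.
Qed.

(** The six terms with second derivatives of [f], [g] and [h] cancel in pairs by [schwarz]; only
    derivatives of [P] survive. *)
Lemma jacobi_sum P f g h y : smooth_at y P -> smooth_at y f -> smooth_at y g -> smooth_at y h ->
  (P y)^T = - P y ->
  cbr P f (cbr P g h) y + cbr P g (cbr P h f) y + cbr P h (cbr P f g) y =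
  cyclic3 (fun a => 'D_(a *m P y) P y) (cgrad f y) (cgrad g y) (cgrad h y) 0 0.
Proof.
move=> sP sf sg sh aP.
have E a b c : smooth_at y a -> smooth_at y b -> smooth_at y c ->
    cbr P a (cbr P b c) y = - 'D_(cgrad a y *m P y) ('D_(cgrad c y *m P y) b) y
     + 'D_(cgrad a y *m P y) ('D_(cgrad b y *m P y) c) y + (cgrad b y *m 'D_(cgrad a y *m P y) P y *m (cgrad c y)^T) 0 0.
  move=> sa sb sc; rewrite -derive_cbr// (cgradE _ (sm_diff (sm_cbr sP sb sc))) /cbr.
  by rewrite -[in LHS](trmxK (cgrad a y *m P y)) -trmx_mul [LHS]mxE.
have E1 := E _ _ _ sf sg sh; have E2 := E _ _ _ sg sh sf; have E3 := E _ _ _ sh sf sg.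
have S1 := schwarz (cgrad f y *m P y) (cgrad h y *m P y) sg.
have S2 := schwarz (cgrad g y *m P y) (cgrad f y *m P y) sh.
have S3 := schwarz (cgrad h y *m P y) (cgrad g y *m P y) sf.
rewrite /cyclic3 [RHS]mxE [X in _ = X + _]mxE E1 E2 E3.
have alg (a1 a2 b1 b2 c1 c2 t1 t2 t3 : R) : a1 = a2 -> b1 = b2 -> c1 = c2 ->
    - a1 + b2 + t1 + (- b1 + c2 + t2) + (- c1 + a2 + t3) = t1 + t2 + t3 by move=> -> -> ->; ring.
exact: (alg _ _ _ _ _ _ _ _ _ S1 S2 S3).
Qed.
End Grad.

Lemma cgrad_comp n p (g : 'rV_n -> 'rV_p) (f : 'rV_p -> R) y : differentiable g y -> differentiable f (g y) ->
  cgrad (fun y => f (g y)) y = cgrad f (g y) *m (jacobian g y)^T.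
Proof.
move=> dg df; apply/rowP => i; rewrite mxE.
have E := derive_comp (delta_mx 0 i) dg df; apply: (eq_trans E).
rewrite (derive_mulE (delta_mx 0 i) dg) (cgradE _ df) trmx_mul mulmxA trmx_delta -colE.
by rewrite [LHS]mxE.
Qed.

Lemma cgrad_near n (f g : 'rV_n -> R) y : (\forall z \near y, f z = g z) -> cgrad f y = cgrad g y.
Proof. by move=> fg; apply/rowP => i; rewrite !mxE; exact: derive_near. Qed.

Section One.
Variables (n : nat) (N : premanifold R n).
Hypothesis hN : hmfd N.
Implicit Types (z : N) (c : chart R n N) (Pi : N -> 'M[R]_n).

Definition pcoord c Pi y := (tcoord (cinv c y) c)^T *m Pi (cinv c y) *m tcoord (cinv c y) c.

Definition pcgood c Pi z := [/\ smooth_at (cmap c z) (pcoord c Pi),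
  \forall y \near cmap c z, (pcoord c Pi y)^T = - pcoord c Pi y & jacobi (pcoord c Pi) (cmap c z)].

Definition poisson_pt Pi z := exists c, [/\ atlas c, cdom c z & pcgood c Pi z].

Lemma pcoord_trans c c' Pi y : atlas c -> atlas c' -> cdom c (cinv c y) -> cmap c (cinv c y) = y -> cdom c' (cinv c y) ->
  pcoord c' Pi (cmap c' (cinv c y)) = (jacobian (fun y => cmap c' (cinv c y)) y)^T *m pcoord c Pi y *m jacobian (fun y => cmap c' (cinv c y)) y.
Proof.
move=> ac ac' d E d'; rewrite /pcoord (cinvK hN ac' d').
have H := tcoord_trans hN ac d ac' d'; rewrite E in H.
by rewrite -H trmx_mul !mulmxA.
Qed.

(** Independence of the chart is [gauge_jacobi] applied to a transition map with zero two-form: the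
    transition pulls one coordinate expression back to the other. *)
Lemma poisson_pt_chart Pi z c : poisson_pt Pi z -> atlas c -> cdom c z -> pcgood c Pi z.
Proof.
move=> [c' [ac' d' [sP aP jP]]] ac d.
pose F y := cmap c' (cinv c y); pose H y := cmap c (cinv c' y).
have sF : smooth_at (cmap c z) F by exact: sm_trans.
have Fz : F (cmap c z) = cmap c' z by rewrite /F cinvK.
have sH : smooth_at (F (cmap c z)) H by rewrite Fz; exact: sm_trans.
have n1 := near_cinv hN ac d (mopen_cdom hN ac') d'.
have sJ : smooth_at (cmap c z) (fun y => jacobian H (F y)) by apply: (sm_comp sF); exact: sm_jac.
have sPF : smooth_at (cmap c z) (fun y => pcoord c' Pi (F y)) by apply: (sm_comp sF); rewrite Fz.
have nE : \forall y \near cmap c z, (jacobian H (F y))^T *m pcoord c' Pi (F y) *m jacobian H (F y) = pcoord c Pi y.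
  apply: filterS n1 => y [d1 E d2]; have d1' := d1; rewrite -{1}(cinvK hN ac' d2) in d1'.
  have E2 : cmap c' (cinv c' (F y)) = F y by rewrite /F (cinvK hN ac' d2).
  have d2' := d2; rewrite -{1}(cinvK hN ac' d2) in d2'.
  have T := @pcoord_trans c' c Pi (F y) ac' ac d2' E2 d1'.
  apply: eq_trans (esym T) _; congr (pcoord c Pi _); by rewrite /F (cinvK hN ac' d2) E.
have sPc : smooth_at (cmap c z) (pcoord c Pi) by apply: sm_ext nE _; apply: sm_mulmx => //; apply: sm_mulmx => //; exact: sm_tr.
have nA : \forall y \near cmap c z, (pcoord c' Pi (F y))^T = - pcoord c' Pi (F y).
  exact: (near_trans hN ac ac' d d' aP).
split; first exact: sPc.
  apply: filterS2 nE nA => y <- aF.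
  exact: antisym_conj.
have nJ : \forall y \near cmap c z, jacobian F y *m jacobian H (F y) = 1%:M.
  apply: filterS n1 => y [d1 E d2]; have := jac_trans hN ac ac' ac d1 d2 d1; rewrite E => ->.
  by have := jac_trans_id hN ac d1; rewrite E.
pose b y := (jacobian H (F y))^T.
have VF : \forall y \near cmap c z, pcoord c Pi y *m jacobian F y = b y *m pcoord c' Pi (F y).
  apply: filterS2 nE nJ => y <- J1; exact: mulmx_cancel (mulmx1C J1).
have sP' : smooth_at (F (cmap c z)) (pcoord c' Pi) by rewrite Fz.
have J0 := nbhs_singleton nJ.
have A1 y : jacobian F y *m jacobian H (F y) = 1%:M -> b y *m (jacobian F y)^T + pcoord c Pi y *m (0 : 'M[R]_n) = 1%:M.
  by move=> J1; rewrite mulmx0 addr0 /b -trmx_mul J1 trmx1.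
have u1 : b (cmap c z) *m (jacobian F (cmap c z))^T + pcoord c Pi (cmap c z) *m (0 : 'M[R]_n) \in unitmx.
  by rewrite A1// unitmx1.
have cl0 : closed2 (fun _ : 'rV_n => 0 : 'M[R]_n) (cmap c z).
  by move=> p q s; rewrite /cyclic3 !derive_cst !mulmx0 !mul0mx !addr0.
have jF : jacobi (pcoord c' Pi) (F (cmap c z)) by rewrite Fz.
have aF : (pcoord c' Pi (F (cmap c z)))^T = - pcoord c' Pi (F (cmap c z)) by exact: nbhs_singleton nA.
have a0 : (0 : 'M[R]_n)^T = - 0 by rewrite trmx0 oppr0.
have := gauge_jacobi sPc (sm_tr sJ) sF sP' (sm_cst (cmap c z) (0 : 'M[R]_n)) VF aF jF a0 cl0 u1.
have nP : \forall y \near cmap c z, invmx (b y *m (jacobian F y)^T + pcoord c Pi y *m (0 : 'M[R]_n)) *m pcoord c Pi y = pcoord c Pi y.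
  by apply: filterS nJ => y J1; rewrite A1// invmx1 mul1mx.
by move=> jj; exact: (jacobi_near nP jj).
Qed.

Lemma bracket_chart Pi (f g : N -> R) z c : atlas c -> cdom c z ->
  smooth_at (cmap c z) (fun y => f (cinv c y)) -> smooth_at (cmap c z) (fun y => g (cinv c y)) ->
  bracket Pi f g z = cbr (pcoord c Pi) (fun y => f (cinv c y)) (fun y => g (cinv c y)) (cmap c z).
Proof.
move=> ac d sf sg; have a0 := at_atlas hN z; have d0 := at_dom hN z.
have H (h : N -> R) : smooth_at (cmap c z) (fun y => h (cinv c y)) -> grad h z = cgrad (fun y => h (cinv c y)) (cmap c z) *m (tcoord z c)^T.
  move=> sh; have st := sm_trans hN a0 ac d0 d.
  have := cgrad_comp (f := fun y => h (cinv c y)) (sm_diff st); rewrite (cinvK hN)// => /(_ (sm_diff sh)) E.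
  apply: eq_trans E; apply: (@cgrad_near _ _ (fun y => h (cinv c (cmap c (cinv (chart_at z) y)))) ) => //.
  by apply: filterS (near_cinv hN a0 d0 (mopen_cdom hN ac) d) => y [_ _ dy]; rewrite (cinvK hN ac dy).
by rewrite /bracket (H f sf) (H g sg) /cbr /pcoord (cinvK hN ac d) trmx_mul trmxK !mulmxA.
Qed.

Lemma smooth_onR (U : set N) (f : N -> R) z c : mopen U -> smooth_on U f -> U z -> atlas c -> cdom c z ->
  smooth_at (cmap c z) (fun y => f (cinv c y)).
Proof. by move=> oU sf Uz ac d; apply: (Cinfty_sm (oU c ac) (sf c ac)); exists z. Qed.

Lemma bracket_jacobi Pi (V : set N) (f g h : N -> R) z c : mopen V -> V z -> atlas c -> cdom c z ->
  smooth_on V f -> smooth_on V g -> smooth_on V h ->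
  smooth_at (cmap c z) (pcoord c Pi) -> (pcoord c Pi (cmap c z))^T = - pcoord c Pi (cmap c z) ->
  bracket Pi f (bracket Pi g h) z + bracket Pi g (bracket Pi h f) z + bracket Pi h (bracket Pi f g) z =
  cyclic3 (fun a => 'D_(a *m pcoord c Pi (cmap c z)) (pcoord c Pi) (cmap c z)) (cgrad (f \o cinv c) (cmap c z))
   (cgrad (g \o cinv c) (cmap c z)) (cgrad (h \o cinv c) (cmap c z)) 0 0.
Proof.
move=> oV Vz ac d sf sg sh sP aP.
have nE (a b : N -> R) : smooth_on V a -> smooth_on V b ->
   \forall y \near cmap c z, cbr (pcoord c Pi) (a \o cinv c) (b \o cinv c) y = bracket Pi a b (cinv c y).
  move=> sa sb; apply: filterS (near_cinv hN ac d oV Vz) => y [d1 E Vy].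
  by rewrite (bracket_chart Pi ac d1 (smooth_onR oV sa Vy ac d1) (smooth_onR oV sb Vy ac d1)) E.
have sE (a b : N -> R) : smooth_on V a -> smooth_on V b -> smooth_at (cmap c z) (fun y => bracket Pi a b (cinv c y)).
  move=> sa sb; apply: sm_ext (nE a b sa sb) _; apply: sm_cbr => //; exact: (smooth_onR oV _ Vz ac d).
have fz := smooth_onR oV sf Vz ac d; have gz := smooth_onR oV sg Vz ac d; have hz := smooth_onR oV sh Vz ac d.
rewrite (bracket_chart Pi ac d fz (sE _ _ sg sh)) (bracket_chart Pi ac d gz (sE _ _ sh sf)) (bracket_chart Pi ac d hz (sE _ _ sf sg)).
rewrite -(jacobi_sum sP fz gz hz aP) /cbr.
by rewrite -(cgrad_near (nE _ _ sg sh)) -(cgrad_near (nE _ _ sh sf)) -(cgrad_near (nE _ _ sf sg)).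
Qed.

Lemma poisson_onI (U : set N) Pi : (forall z, U z -> (Pi z)^T = - Pi z) -> (forall z, U z -> poisson_pt Pi z) -> poisson_on U Pi.
Proof.
move=> aP H; split => //.
  move=> c ac; apply: (msm_smooth_on hN) => z [Uz d]; exists c; split => //.
  by have [+ _ _] := poisson_pt_chart (H z Uz) ac d.
move=> V f g h oV VU sf sg sh z Vz.
have ac := at_atlas hN z; have d := at_dom hN z; have [sP aPz jP] := poisson_pt_chart (H z (VU z Vz)) ac d.
by rewrite (bracket_jacobi oV Vz ac d sf sg sh sP (nbhs_singleton aPz)) jP mxE.
Qed.

Lemma poisson_on_pt (U : set N) Pi z : mopen U -> poisson_on U Pi -> U z -> poisson_pt Pi z.
Proof.
move=> oU [aP sP jP] Uz; have ac := at_atlas hN z; have d := at_dom hN z.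
set c := chart_at z in ac d *.
have oV : mopen (U `&` cdom c) by apply: mopenI => //; exact: mopen_cdom.
have sPz : smooth_at (cmap c z) (pcoord c Pi) by apply: (Cinfty_sm (oV c ac) (sP c ac c ac)); exists z.
have nA : \forall y \near cmap c z, (pcoord c Pi y)^T = - pcoord c Pi y.
  apply: filterS (near_cinv hN ac d oU Uz) => y [_ _ Uy].
  by apply: antisym_conj; exact: aP.
exists c; split => //; split => // p q s.
(* Linear functions of the chart have arbitrary constant gradients, so the bracket identity for them
   gives the coordinate identity for all covectors. *)
pose lf (a : 'rV_n) (z : N) : R := (a *m (cmap c z)^T) 0 0.
have slf a : smooth_on (U `&` cdom c) (lf a).
  move=> c' ac'; apply: sm_CinftyP => _ [z' [[_ dz'] dz''] <-].
  apply: (sm_coord 0 0 (f := fun y => a *m (cmap c (cinv c' y))^T)).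
  apply: sm_mulmx; first exact: sm_cst.
  by apply: sm_tr; exact: sm_trans.
have gl a : cgrad (lf a \o cinv c) (cmap c z) = a.
  have n1 : \forall y \near cmap c z, (a *m y^T) 0 0 = (lf a \o cinv c) y.
    by apply: filterS (near_cdom hN ac d) => y [_ E]; rewrite /lf /= E.
  rewrite -(cgrad_near n1); apply/rowP => i; rewrite mxE.
  have h := isd_coord 0 0 (isd_mulmx (smooth_isd (delta_mx 0 i) (sm_cst (cmap c z) a)) (isd_tr (smooth_isd (delta_mx 0 i) (sm_id (cmap c z))))).
  rewrite derive_cst derive_id mul0mx add0r trmx_delta -colE [X in is_derive _ _ _ X]mxE in h.
  by have [_ ->] := h.
have := bracket_jacobi oV (conj Uz d) ac d (slf p) (slf q) (slf s) sPz (nbhs_singleton nA).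
have VU : U `&` cdom c `<=` U by move=> ? [].
have -> := jP _ (lf p) (lf q) (lf s) oV VU (slf p) (slf q) (slf s) z (conj Uz d).
rewrite !gl.
by move=> E; apply/matrixP => i j; rewrite !ord1 -E [RHS]mxE.
Qed.
End One.
End PoissonCoord.

Lemma invmx_eq (K : fieldType) p (X Y : 'M[K]_p) : X *m Y = 1%:M -> invmx X = Y.
Proof. by move=> E; have [uX _] := mulmx1_unit E; apply: (can_inj (mulKmx uX)); rewrite mulmxV. Qed.

Lemma unit_conj (K : fieldType) p (A B C : 'M[K]_p) : A \in unitmx -> C \in unitmx -> (A *m B *m C \in unitmx) = (B \in unitmx).
Proof. by move=> uA uC; rewrite !unitmx_mul uA uC andbT. Qed.

Section ConjInv.
Variables (K : fieldType) (p : nat) (T F q : 'M[K]_p).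
Hypotheses (TF : T *m F = 1%:M) (uq : q \in unitmx).
Let FT : F *m T = 1%:M. Proof. exact: mulmx1C. Qed.

Lemma invmx_conj : invmx (T^T *m q *m F^T) = T^T *m invmx q *m F^T.
Proof.
apply: invmx_eq; rewrite !mulmxA -(mulmxA _ F^T) -trmx_mul TF trmx1 mulmx1.
by rewrite -(mulmxA _ _ (invmx _)) mulmxV// mulmx1 -trmx_mul FT trmx1.
Qed.

Lemma invmx_conj_mul (A : 'M[K]_p) : invmx (T^T *m q *m F^T) *m (T^T *m A *m T) = T^T *m (invmx q *m A) *m T.
Proof.
rewrite invmx_conj !mulmxA; congr (_ *m _ *m _).
by rewrite -[_ *m F^T *m T^T]mulmxA -trmx_mul TF trmx1 mulmx1.
Qed.

Lemma covec_conj (a : 'rV[K]_p) (A : 'M[K]_p) : - (a *m F^T) *m (T^T *m A *m T) = - a *m A *m T.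
Proof. by rewrite !mulNmx !mulmxA -(mulmxA a) -trmx_mul TF trmx1 mulmx1. Qed.
End ConjInv.

Lemma poisson_transport (K : fieldType) p (T F T1 F1 A P J : 'M[K]_p) (b0 b1 : 'rV[K]_p) : T *m F = 1%:M -> T1 *m F1 = 1%:M ->
  b1 *m (T1^T *m A *m T1) = b0 *m F^T *m (T^T *m P *m T) *m J -> b1 *m J^T = b0 *m F^T ->
  b1 *m T1^T *m A = b0 *m P *m (T *m J *m F1) /\ b1 *m T1^T *m (T *m J *m F1)^T = b0.
Proof.
move=> TF TF1 h1 h2; have FT1 := mulmx1C TF1.
have EF : b0 *m F^T *m (T^T *m P *m T) = b0 *m P *m T by rewrite !mulmxA -(mulmxA b0) -trmx_mul TF trmx1 mulmx1.
rewrite EF in h1; split.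
  have [u1 _] := mulmx1_unit TF1; apply: (can_inj (mulmxK u1)); move: h1; rewrite !mulmxA => ->.
  by rewrite -[RHS]mulmxA FT1 mulmx1.
rewrite !trmx_mul !mulmxA -[X in X *m _ *m _](mulmxA b1) -trmx_mul FT1 trmx1 mulmx1.
by rewrite h2 -mulmxA -trmx_mul TF trmx1 mulmx1.
Qed.

(** Choice with a default: maps such as [expmap] are total, and where a witness exists a uniqueness
    statement identifies the chosen value. *)
Definition choose_or (T : Type) (d : T) (Q : T -> Prop) : T :=
  if pselect (exists x, Q x) is left h then projT1 (cid h) else d.

Lemma choose_orP (T : Type) (d : T) (Q : T -> Prop) : (exists x, Q x) -> Q (choose_or d Q).
Proof. by rewrite /choose_or; case: pselect => // h _; case: (cid h). Qed.

(** * Moser's argument near a set where the one-form vanishes *)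

Section Moser.
Variables (n : nat) (N : premanifold R n).
Hypothesis hN : hmfd N.
Variables (Z U : set N) (Pi : N -> 'M[R]_n) (al : N -> 'rV_n).
Hypotheses (oU : mopen U) (ZU : Z `<=` U) (hPi : forall z, U z -> poisson_pt Pi z) (hal : forall z, U z -> asm al z).
Hypothesis al0 : forall z, Z z -> al z = 0.
Hypothesis unitZ : forall z (t : R), Z z -> 1%:M + t *: (Pi z *m mdform al z) \in unitmx.
Implicit Types (z : N) (c : chart R n N).

Definition mosX (t : R) z : 'rV_n := - al z *m (invmx (1%:M + t *: (Pi z *m mdform al z)) *m Pi z).

Section Chart.
Variables (c : chart R n N) (z : N) (t : R).
Hypotheses (ac : atlas c) (d : cdom c z) (Uz : U z).
Let P := pcoord c Pi.
Let a := aform c al.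

Lemma mosQ_chart : mosQ P a (tpt (cmap c z) t) = (tcoord z c)^T *m (1%:M + t *: (Pi z *m mdform al z)) *m (fcoord z c)^T.
Proof.
rewrite mosQ_tpt mulmxDr mulmxDl mulmx1 -trmx_mul (ftcoord hN ac d) trmx1; congr (_ + _).
rewrite -scalemxAr -scalemxAl; congr (_ *: _).
rewrite (mdform_fcoord hN (hal Uz) ac d) /P /pcoord (cinvK hN ac d) !mulmxA; congr (_ *m _ *m _).
by rewrite -(mulmxA _ (tcoord z c)) (tfcoord hN ac d) mulmx1.
Qed.

Lemma mosQ_unit : (mosQ P a (tpt (cmap c z) t) \in unitmx) = (1%:M + t *: (Pi z *m mdform al z) \in unitmx).
Proof.
have [u1 u2] := mulmx1_unit (tfcoord hN ac d).
have uT : (tcoord z c)^T \in unitmx by rewrite unitmx_tr.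
have uF : (fcoord z c)^T \in unitmx by rewrite unitmx_tr.
exact: (eq_trans (congr1 (fun X : 'M[R]_n => X \in unitmx) mosQ_chart) (unit_conj _ uT uF)).
Qed.

Lemma pcoord_at : pcoord c Pi (cmap c z) = (tcoord z c)^T *m Pi z *m tcoord z c.
Proof. by rewrite /pcoord (cinvK hN ac d). Qed.

Lemma mosX_chart : 1%:M + t *: (Pi z *m mdform al z) \in unitmx ->
  fld mosX c (tpt (cmap c z) t) = mosf P a (tpt (cmap c z) t).
Proof.
move=> u; rewrite fld_tpt (cinvK hN ac d) /mosX /mosf /mosP [lsubmx (tpt _ _)]row_mxKl.
have -> : a (cmap c z) = al z *m (fcoord z c)^T by rewrite /a /aform (cinvK hN ac d).
have -> : P (cmap c z) = (tcoord z c)^T *m Pi z *m tcoord z c by rewrite /P /pcoord (cinvK hN ac d).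
rewrite mosQ_chart (invmx_conj_mul (tfcoord hN ac d) u).
by rewrite (covec_conj (tfcoord hN ac d)).
Qed.
End Chart.

Let unitary (t : R) z := 1%:M + t *: (Pi z *m mdform al z) \in unitmx.

Lemma pgood_chart c z : atlas c -> cdom c z -> U z -> pgood (pcoord c Pi) (aform c al) (cmap c z).
Proof.
move=> ac d Uz; have [sP aP jP] := poisson_pt_chart hN (hPi Uz) ac d.
by split => //; exact: (asm_chart hN (hal Uz) ac d).
Qed.

Lemma near_tpt (y : 'rV_n) (t : R) (Q : 'rV_n -> Prop) : (\forall x \near y, Q x) -> \forall w \near tpt y t, Q (lsubmx w).
Proof.
move=> H; have cl := sm_cont (sm_lsubid (tpt y t)); rewrite /prop_for /continuous_at {2}/tpt row_mxKl in cl.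
exact: (cl _ H).
Qed.

Let goodw c w := [/\ cdom c (cinv c (lsubmx w)), cmap c (cinv c (lsubmx w)) = lsubmx w, U (cinv c (lsubmx w)) & mosQ (pcoord c Pi) (aform c al) w \in unitmx].

Lemma near_goodw c z t : atlas c -> cdom c z -> U z -> unitary t z -> \forall w \near tpt (cmap c z) t, goodw c w.
Proof.
move=> ac d Uz u; have [sP sa _ _] := pgood_chart ac d Uz.
have sP' : smooth_at (lsubmx (tpt (cmap c z) t)) (pcoord c Pi) by rewrite row_mxKl.
have sa' : smooth_at (lsubmx (tpt (cmap c z) t)) (aform c al) by rewrite row_mxKl.
have n2 : \forall w \near tpt (cmap c z) t, mosQ (pcoord c Pi) (aform c al) w \in unitmx.
  by apply: near_unitmx; [exact: sm_mosQ|rewrite mosQ_unit].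
by apply: filterS2 (near_tpt t (near_cinv hN ac d oU Uz)) n2 => w [h1 h2 h3] h4.
Qed.

Lemma tpt_lsub (w : 'rV_(n + 1)) : w = tpt (lsubmx w) (rsubmx w 0 0).
Proof.
rewrite -[LHS]hsubmxK; congr row_mx; apply/matrixP => i j; rewrite !ord1 [RHS]mxE.
by rewrite eqxx.
Qed.

Lemma goodw_G c w : atlas c -> goodw c w -> mosG (pcoord c Pi) (aform c al) w = tfield mosX c w.
Proof.
move=> ac [d E Uz u]; rewrite /mosG /tfield; congr row_mx.
have Ew := tpt_lsub w; have H := mosX_chart (t := rsubmx w 0 0) ac d Uz; have H2 := mosQ_unit (rsubmx w 0 0) ac d Uz.
have Ew' : tpt (cmap c (cinv c (lsubmx w))) (rsubmx w 0 0) = w by rewrite E -Ew.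
by rewrite Ew' in H H2; apply: esym; apply: H; rewrite -H2.
Qed.

Lemma mosX_freg t z : U z -> unitary t z -> freg mosX t z.
Proof.
move=> Uz u; have ac := at_atlas hN z; have d := at_dom hN z.
exists (chart_at z); split => //; have [sP sa _ _] := pgood_chart ac d Uz.
have sP' : smooth_at (lsubmx (tpt (cmap (chart_at z) z) t)) (pcoord (chart_at z) Pi) by rewrite row_mxKl.
have sa' : smooth_at (lsubmx (tpt (cmap (chart_at z) z) t)) (aform (chart_at z) al) by rewrite row_mxKl.
have uQ : mosQ (pcoord (chart_at z) Pi) (aform (chart_at z) al) (tpt (cmap (chart_at z) z) t) \in unitmx by rewrite mosQ_unit.
apply: sm_ext (sm_mosf sP' sa' uQ); apply: filterS (near_goodw ac d Uz u) => w gw.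
by have := goodw_G ac gw => /(congr1 lsubmx); rewrite !row_mxKl.
Qed.

Let one1 : `|1 : R| <= 1. Proof. by rewrite normr1. Qed.
Let I01 : (0 : R) <= 1 <= (1 : R). Proof. by rewrite ler01 lexx. Qed.

(** The field [mosX] vanishes on [Z] together with [al], so points near [Z] flow for time one, and
    [unitZ] provides the gauge transforms at all times there. The last clause says that [f] relates
    [Pi] to its gauge transform by [d al], and that every covector at [z] is pulled back from
    [f z]. *)
Lemma moser : exists O1 (f : N -> N), [/\ mopen O1, Z `<=` O1, O1 `<=` U,
   forall z, Z z -> f z = z & forall z, O1 z -> [/\ msmap f z, U (f z), unitary 1 (f z) &
     forall b0 : 'rV_n, exists b1 : 'rV_n, b1 *m (invmx (1%:M + Pi (f z) *m mdform al (f z)) *m Pi (f z)) = b0 *m Pi z *m mder f z /\ b1 *m (mder f z)^T = b0]].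
Proof.
(* Defined by curves and not by charts, so that the local flows around different points of [Z] are
   automatically restrictions of one map. *)
pose f z : N := choose_or z (fun y => exists g, [/\ mcurve mosX g 0 1, g 0 = z & y = g 1]).
pose good z := [/\ msmap f z, U (f z), unitary 1 (f z) &
     forall b0 : 'rV_n, exists b1 : 'rV_n, b1 *m (invmx (1%:M + Pi (f z) *m mdform al (f z)) *m Pi (f z)) = b0 *m Pi z *m mder f z /\ b1 *m (mder f z)^T = b0].
pose nice z := exists O1, [/\ mopen O1, O1 z, O1 `<=` U & forall z, O1 z -> good z].
suff H z0 : Z z0 -> nice z0 /\ f z0 = z0.
  pose O1 : set N := [set z | exists z0 V, [/\ Z z0, mopen V, V z, V `<=` U & forall z, V z -> good z]].
  exists O1, f; split.
  - apply: (mopen_local hN) => z [z0 [V [Zz oV Vz VU HV]]]; exists V; split => // z' Vz'; by exists z0, V.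
  - by move=> z Zz; have [[V [oV Vz VU HV]] _] := H z Zz; exists z, V.
  - by move=> z [z0 [V [_ _ Vz VU _]]]; exact: VU.
  - by move=> z /H[].
  - by move=> z [z0 [V [_ _ Vz _ HV]]]; exact: HV.
move=> Zz; have Uz := ZU Zz; set c := chart_at z0; have ac : atlas c := at_atlas hN z0; have d : cdom c z0 := at_dom hN z0.
have ct (t : R) : `|t| <= 1 -> {for t, continuous (fun t => tpt (cmap c z0) t)}.
  move=> _; apply: cont_mx => i j; rewrite /tpt.
  rewrite (_ : (fun y => _) = fun y : R => match fintype.split j with inl l => cmap c z0 i l | inr l => (i == l)%:R * y end).
    by case: (fintype.split j) => l; [exact: cst_continuous|apply: continuousM; [exact: cst_continuous|exact: cvg_id]].
  by apply/funext => y; rewrite mxE; case: (fintype.split j) => // l; rewrite mxE mulr_natl.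
(* At [z0] the gauge transform exists for each time; compactness of the time interval gives one
   radius that is good for all times. *)
have [e e0 He] := tube_near ler01 ct (fun t _ => near_goodw ac d Uz (unitZ t Zz)).
have [|r [phi [r0 fl Hphi]]] := rest_flow hN ac d e0 (X := mosX).
  move=> t _; split; first by apply: mosX_freg => //; exact: unitZ.
  by rewrite /mosX al0// oppr0 mul0mx.
have ball0 : ball (cmap c z0) r (cmap c z0) by exact: ballxx.
have yb' y : ball (cmap c z0) r y -> ball (tpt (cmap c z0) 0) r (tpt y 0).
  by rewrite -ball_normE /= => yb; apply: ball_tpt => //; rewrite subrr normr0.
have Hy y : ball (cmap c z0) r y -> f (cinv c y) = cinv c (lsubmx (phi 1 (tpt y 0))) /\
    forall t : R, `|t| <= 1 -> goodw c (phi t (tpt y 0)).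
  move=> yb; have [dy Ey Hp cv] := Hphi y yb.
  have gt (t : R) : `|t| <= 1 -> goodw c (phi t (tpt y 0)).
    move=> t1; have [E1 b1 _ _] := Hp t t1; rewrite E1; apply: (He t t1).
    by move: b1; rewrite -ball_normE /= => b1; apply: ball_tpt => //; rewrite subrr normr0.
  split => //.
  set g := fun t => cinv c (lsubmx (phi t (tpt y 0))).
  have g0 : g 0 = cinv c y.
    by rewrite /g (fl _ (yb' _ yb)).1 row_mxKl.
  have cg : mcurve mosX g 0 1 by apply: mcurve_sub cv; lra.
  have rg t : 0 <= t <= 1 -> freg mosX t (g t).
    move=> /andP[t0 t1]; have t1' : `|t| <= 1 by rewrite ger0_norm.
    have [d1 E1 U1 u1] := gt t t1'; apply: (mosX_freg U1).
    have [E2 _ _ _] := Hp t t1'; rewrite /unitary -(mosQ_unit t ac d1 U1) E1 -E2; exact: u1.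
  rewrite /f; have [|h [ch h0 ->]] := choose_orP (cinv c y) (Q := fun y' => exists g, [/\ mcurve mosX g 0 1, g 0 = cinv c y & y' = g 1]).
    by exists (g 1), g.
  by rewrite -/(g 1); apply: (curve_unique hN cg rg ch) => //; rewrite h0 g0.
have sphi y : ball (cmap c z0) r y -> smooth_at y (fun y => lsubmx (phi 1 (tpt y 0))).
  by move=> yb; apply: (moser_smooth (n := n) r0 fl); exact: yb'.
split; last first.
  have [E _] := Hy _ ball0; rewrite (cinvK hN ac d) in E; rewrite E.
  have [_ _ Hp _] := Hphi _ ball0.
  pose g (t : R) := z0.
  have cg : mcurve mosX g 0 1.
    move=> t t01; split; first by near=> s; exact: at_dom.
    rewrite (_ : mosX t (g t) = 0); last by rewrite /mosX al0// oppr0 mul0mx.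
    exact: (is_derive_cst (cmap (chart_at (g t)) z0) t 1).
  have rg t : 0 <= t <= 1 -> freg mosX t (g t) by move=> _; apply: mosX_freg => //; exact: unitZ.
  rewrite -E /f; have [|h [ch h0 ->]] := choose_orP z0 (Q := fun y' => exists g, [/\ mcurve mosX g 0 1, g 0 = z0 & y' = g 1]).
    by exists z0, g.
  exact: (curve_unique hN cg rg ch h0 I01).
exists [set z | cdom c z /\ ball (cmap c z0) r (cmap c z)]; split.
- by apply: (mopen_chart hN ac); exact: (@open_ballrV _ _ _ r0).
- by split.
- move=> z [dz bz]; have [_ H] := Hy _ bz; have [] := H 0; first by rewrite normr0.
  by rewrite (fl _ (yb' _ bz)).1 row_mxKl (cinvK hN ac dz).
move=> z [dz bz]; have [E gt] := Hy _ bz; rewrite (cinvK hN ac dz) in E.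
have [d1 E1 U1 u1] := gt 1 one1.
have [_ _ Hp _] := Hphi _ bz; have [Ep _ _ _] := Hp 1 one1.
have Uf : U (f z) by rewrite E.
have df : cdom c (f z) by rewrite E.
have cf : cmap c (f z) = lsubmx (phi 1 (tpt (cmap c z) 0)) by rewrite E.
have uf : unitary 1 (f z).
  by rewrite /unitary -(mosQ_unit 1 ac df Uf) cf -Ep.
have nb : \forall y \near cmap c z, ball (cmap c z0) r y by apply: open_nbhs_nbhs; split => //; exact: (@open_ballrV _ _ _ r0).
have sf : msmap f z.
  apply: (msmapI hN hN ac dz ac df).
    by apply: filterS nb => y /Hy[-> H]; have [] := H 1 one1.
  apply: sm_ext (sphi _ bz); apply: filterS nb => y /Hy[-> H].
  by have [_ -> _ _] := H 1 one1.
split => // b0.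
have wb := yb' _ bz.
pose x (t : R) := lsubmx (phi t (tpt (cmap c z) 0)).
have Hx (t : R) : `|t| <= 1 -> [/\ phi t (tpt (cmap c z) 0) = tpt (x t) t, pgood (pcoord c Pi) (aform c al) (x t) & mosQ (pcoord c Pi) (aform c al) (tpt (x t) t) \in unitmx].
  move=> t1; have [E2 _ _ _] := Hp t t1; have [d2 E3 U2 u2] := gt t t1; split; first exact: E2.
    by rewrite /x -E3; exact: pgood_chart.
  by rewrite /x -E2; exact: u2.
have HG (t : R) : `|t| <= 1 -> \forall w \near phi t (tpt (cmap c z) 0), mosG (pcoord c Pi) (aform c al) w = tfield mosX c w.
  move=> t1; have [E2 _ _ _] := Hp t t1; have [d2 E3 U2 u2] := gt t t1; rewrite E2 -{1}E3.
  apply: filterS (near_goodw (t := t) ac d2 U2 _) => [w|]; first exact: goodw_G.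
  by rewrite /unitary -(mosQ_unit t ac d2 U2) E3 -E2.
pose F := fcoord z c; pose T1 := tcoord (f z) c.
have [b1 [h1 h2]] := moser_local r0 fl wb Hx HG (b0 *m F^T).
set J := jacobian _ _ in h1 h2.
have EJ : jacobian (cmap c \o f \o cinv c) (cmap c z) = J.
  apply: esym; apply: (jac_near _ (sm_diff (sphi _ bz))); apply: filterS nb => y /Hy[/= -> H].
  by have [_ -> _ _] := H 1 one1.
have Em := mderE hN hN sf ac dz ac df; rewrite EJ in Em.
exists (b1 *m T1^T).
have [ut1 _] := mulmx1_unit (tfcoord hN ac df).
have PT : mosP (pcoord c Pi) (aform c al) (tpt (lsubmx (phi 1 (tpt (cmap c z) 0))) 1) = T1^T *m (invmx (1%:M + Pi (f z) *m mdform al (f z)) *m Pi (f z)) *m T1.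
  have uf' : 1%:M + Pi (f z) *m mdform al (f z) \in unitmx by move: uf; rewrite /unitary scale1r.
  rewrite -cf /mosP [lsubmx (tpt _ _)]row_mxKl (mosQ_chart 1 ac df Uf) scale1r.
  by rewrite -(invmx_conj_mul (tfcoord hN ac df) uf') /pcoord (cinvK hN ac df).
have PZ := pcoord_at ac dz.
rewrite PT PZ in h1; move: (invmx _ *m Pi (f z)) h1 => A h1.
rewrite Em; exact: (poisson_transport (tfcoord hN ac dz) (tfcoord hN ac df) h1 h2).
Unshelve. all: by end_near. Qed.
End Moser.

(** * Transport of the Liouville form by a flow *)

Section FlowForm.

(* [u] stands for the [x]-derivative of [psi t (j x)], which is only known for [|t| <= T]. *)
Lemma flow_clairaut n k (f : 'rV_n -> 'rV_n) (T r : R) (w : 'rV_n) (psi : R -> 'rV_n -> 'rV_n) (j : 'rV_k -> 'rV_n) x v :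
  0 <= T -> 0 < r -> flow_on f T (ball w r) psi -> smooth_at x j -> ball w r (j x) ->
  exists u : R -> 'rV_n, forall t : R, `|t| <= T -> u t = 'D_v (fun x => psi t (j x)) x /\
    is_derive t 1 u ('D_v (fun x => f (psi t (j x))) x).
Proof.
move=> T0 r0 fl sj jb; have oB := @open_ballrV _ w r r0.
have [M [M0 dM HM]] := flow_diff T0 oB fl jb.
exists (fun t => 'D_v j x *m M t) => t tT.
have sp := flow_smooth T0 oB fl jb tT.
have E : 'D_v (fun x => psi t (j x)) x = 'D_v j x *m M t.
  apply: (eq_trans (derive_comp v (sm_diff sj) (sm_diff sp))); exact: (HM t tT).2.
split; first exact: esym.
have [_ tr] := fl _ jb; have [_ sf] := tr t tT.
have E2 : 'D_v (fun x => f (psi t (j x))) x = 'D_v j x *m (M t *m jacobian f (psi t (j x))).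
  apply: (eq_trans (derive_comp v (sm_diff (sm_comp sj sp)) (sm_diff sf))).
  apply: (eq_trans (congr1 (fun u => 'D_u f (psi t (j x))) E)).
  by rewrite (derive_mulE _ (sm_diff sf)) mulmxA.
by rewrite E2; exact: is_derive_mulmxl (dM t tT).
Qed.

Section Form.
Variables (n : nat) (Y : 'rV_n -> 'rV_n) (lam : 'rV_n -> 'rV_n) (phi : R -> 'rV_n -> 'rV_n) (x0 : 'rV_n) (r : R).
Hypotheses (r0 : 0 < r) (fl : flow_on Y 1 (ball x0 r) phi).
Hypothesis sl : forall x, ball x0 r x -> forall t : R, `|t| <= 1 -> smooth_at (phi t x) lam.
Let oB : open (ball x0 r) := @open_ballrV _ x0 r r0.

Lemma flow_jac x : ball x0 r x -> exists M : R -> 'M[R]_n, [/\ M 0 = 1%:M,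
    forall t : R, `|t| <= 1 -> is_derive t 1 M (M t *m jacobian Y (phi t x)) &
    forall t : R, `|t| <= 1 -> M t = jacobian (phi t) x].
Proof.
move=> xb; have [M [M0 dM HM]] := flow_diff ler01 oB fl xb; exists M; split => // t t1.
have [d E] := HM t t1; apply/row_matrixP => i; rewrite row_jac// E.
by rewrite rowE.
Qed.

(** The complete lift of [Y] with one more coordinate that accumulates [lam(v)] along the flow. That
    coordinate computes a component of the integral of [phi_t^* lam], so smoothness of the integral
    is smoothness of a flow, and no differentiation under the integral sign is required. *)
Definition xi (s : 'rV_(n + n + 1)) : 'rV_(n + n + 1) :=
  row_mx (vprolong Y (lsubmx s)) (lam (lsubmx (lsubmx s)) *m (rsubmx (lsubmx s))^T).

Lemma sm_xi s : smooth_at (lsubmx (lsubmx s)) Y -> smooth_at (lsubmx (lsubmx s)) lam -> smooth_at s xi.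
Proof.
move=> sY slam; have sls := sm_lsubid s; apply: sm_row_mx.
  by apply: (sm_comp sls); exact: sm_vprolong.
apply: sm_mulmx.
  by apply: (sm_comp (f := fun s : 'rV_(n + n + 1) => lsubmx (lsubmx s))) => //; exact: sm_lsub.
by apply: sm_tr; exact: sm_rsub.
Qed.

(** [linear_ode_exists] with zero coefficient is integration of a curve whose continuity is known on
    [[-1, 1]] only. *)
Lemma form_primitive x : ball x0 r x -> exists a : R -> 'rV_n, a 0 = 0 /\
  forall t : R, `|t| <= 1 -> is_derive t 1 a (lam (phi t x) *m (jacobian (phi t) x)^T).
Proof.
move=> xb; have [M [M0 dM HM]] := flow_jac xb; have [p0 tr] := fl xb.
have cM (t : R) : `|t| <= 1 -> {for t, continuous (fun t => lam (phi t x) *m (M t)^T)}.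
  move=> t1; have [dp _] := tr t t1; apply: cont_mulmx.
    apply: (@continuous_comp _ _ _ (phi^~ x) lam); first exact: is_derive_cont dp.
    exact: sm_cont (sl xb t1).
  exact: is_derive_cont (isd_tr (dM t t1)).
have c0 (t : R) : `|t| <= 1 -> {for t, continuous (fun _ : R => 0 : 'M[R]_n)} by move=> _; exact: cst_continuous.
have [a [a0 da]] := linear_ode_exists 0 ler01 c0 cM.
exists a; split => // t t1; have := da t t1.
by rewrite mulmx0 addr0 HM.
Qed.

Definition form_flow (t : R) (x : 'rV_n) : 'rV_n :=
  if pselect (ball x0 r x) is left h then projT1 (cid (form_primitive h)) t else 0.

Lemma form_flowP x : ball x0 r x -> form_flow 0 x = 0 /\
  forall t : R, `|t| <= 1 -> is_derive t 1 (form_flow^~ x) (lam (phi t x) *m (jacobian (phi t) x)^T).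
Proof.
move=> xb; rewrite /form_flow; case: pselect => // h.
have -> : (fun t => projT1 (cid (form_primitive h)) t) = projT1 (cid (form_primitive h)) by [].
by case: (cid _).
Qed.

Definition xinit i (x : 'rV_n) : 'rV_(n + n + 1) := row_mx (row_mx x (delta_mx 0 i : 'rV_n)) (0 : 'rV_1).

Lemma sm_xinit i x : smooth_at x (xinit i).
Proof. by apply: sm_row_mx; [apply: sm_row_mx; [exact: sm_id|exact: sm_cst]|exact: sm_cst]. Qed.

Lemma xi_flow x i : ball x0 r x -> exists (r1 : R) psi, [/\ 0 < r1,
   flow_on xi 1 (ball (xinit i x) r1) psi &
   \forall x' \near x, ball (xinit i x) r1 (xinit i x') /\
     forall t : R, `|t| <= 1 -> psi t (xinit i x') =
      row_mx (row_mx (phi t x') ((delta_mx 0 i : 'rV_n) *m jacobian (phi t) x')) (form_flow t x' *m (delta_mx 0 i : 'rV_n)^T)].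
Proof.
move=> xb; set d := delta_mx 0 i : 'rV_n.
have C x' : ball x0 r x' -> exists c : R -> 'rV_(n + n + 1), [/\ c 0 = xinit i x', trajectory xi 1 c &
    forall t : R, `|t| <= 1 -> c t = row_mx (row_mx (phi t x') (d *m jacobian (phi t) x')) (form_flow t x' *m d^T)].
  move=> xb'; have [M [M0 dM HM]] := flow_jac xb'; have [p0 tr] := fl xb'; have [a0 da] := form_flowP xb'.
  exists (fun t => row_mx (row_mx (phi t x') (d *m M t)) (form_flow t x' *m d^T)); split.
  - by rewrite p0 M0 mulmx1 a0 mul0mx /xinit.
  - move=> t t1; have [dp sY] := tr t t1; split; last by apply: sm_xi; rewrite !row_mxKl//; exact: sl.
    rewrite /xi /vprolong !row_mxKl row_mxKr.
    apply: isd_row_mx; first apply: isd_row_mx => //.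
      by rewrite -mulmxA; exact: is_derive_mulmxl (dM t t1).
    have := is_derive_mulmxr d^T (da t t1); rewrite -(HM t t1).
    by rewrite trmx_mul mulmxA.
  - by move=> t t1; rewrite HM.
have [c [c0 tc Ec]] := C x xb.
have [r1 [K [psi [r10 K0 fpsi _]]]] := local_flow ler01 tc; rewrite c0 in fpsi.
exists r1, psi; split => //.
have n1 : \forall x' \near x, ball x0 r x' by apply: open_nbhs_nbhs; split.
have n2 : \forall x' \near x, ball (xinit i x) r1 (xinit i x').
  by apply: (sm_cont (sm_xinit i x)); exact: nbhsx_ballx.
apply: filterS2 n1 n2 => x' b1 b2; split => // t t1.
have [c' [c0' tc' Ec']] := C x' b1; have [ps0 tps] := fpsi _ b2.
by rewrite -Ec'//; apply: (trajectory_unique tps tc') => //; rewrite ps0.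
Qed.

Lemma form_smooth x t : ball x0 r x -> `|t| <= 1 -> smooth_at x (form_flow t).
Proof.
move=> xb t1; apply: sm_mx => i' i; rewrite !ord1 => {i'}.
have [r1 [psi [r10 fpsi H]]] := xi_flow i xb.
have [b0 _] := nbhs_singleton H.
have sj := sm_xinit i x.
have sp := sm_comp sj (flow_smooth ler01 (@open_ballrV _ _ r1 r10) fpsi b0 t1).
apply: sm_ext (sm_coord 0 0 (sm_rsub sp)); apply: filterS H => x' [_ ->//].
by rewrite row_mxKr trmx_delta -colE mxE.
Qed.

(** The time and space derivatives are exchanged by [flow_clairaut] for the augmented field [xi],
    one component at a time. *)
Lemma form_clairaut x (v : 'rV_n) : ball x0 r x -> exists D : R -> 'rV_n, forall t : R, `|t| <= 1 -> D t = 'D_v (form_flow t) x /\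
  is_derive t 1 D ('D_v (fun x => lam (phi t x) *m (jacobian (phi t) x)^T) x).
Proof.
move=> xb.
have H i : exists D : R -> R, forall t : R, `|t| <= 1 -> D t = ('D_v (form_flow t) x) 0 i /\
  is_derive t 1 D (('D_v (fun x => lam (phi t x) *m (jacobian (phi t) x)^T) x) 0 i).
  have [r1 [psi [r10 fpsi H]]] := xi_flow i xb.
  have [b0 _] := nbhs_singleton H.
  have sj := sm_xinit i x.
  have [u Hu] := flow_clairaut v ler01 r10 fpsi sj b0.
  exists (fun t => (rsubmx (u t)) 0 0) => t t1; have [E D] := Hu t t1.
  have sp := sm_comp sj (flow_smooth ler01 (@open_ballrV _ _ r1 r10) fpsi b0 t1).
  have [_ tr] := fpsi _ b0; have [_ sx] := tr t t1.
  split.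
    have [_ <-] := isd_coord 0 i (smooth_isd v (form_smooth xb t1)).
    have [_] := isd_coord 0 0 (isd_rsub (smooth_isd v sp)); rewrite -E => <-.
    apply: derive_near; apply: filterS H => x' [_ ->//].
    by rewrite row_mxKr trmx_delta -colE mxE.
  have D2 := isd_coord 0 0 (isd_rsub D).
  suff <- : rsubmx ('D_v (fun x => xi (psi t (xinit i x))) x) 0 0 = ('D_v (fun x => lam (phi t x) *m (jacobian (phi t) x)^T) x) 0 i by exact: D2.
  have sxp := sm_comp sp sx.
  have [_ <-] := isd_coord 0 0 (isd_rsub (smooth_isd v sxp)).
  have sphi : smooth_at x (phi t) by exact: (flow_smooth ler01 oB fl xb t1).
  have sh : smooth_at x (fun x => lam (phi t x) *m (jacobian (phi t) x)^T).
    by apply: sm_mulmx; [exact: (sm_comp sphi (sl xb t1))|apply: sm_tr; exact: sm_jac].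
  have [_ <-] := isd_coord 0 i (smooth_isd v sh).
  apply: derive_near; apply: filterS H => x' [_ /(_ t t1) ->].
  rewrite /xi row_mxKr row_mxKl !row_mxKl row_mxKr trmx_mul mulmxA trmx_delta -colE.
  by rewrite mxE.
exists (fun t => \row_i projT1 (cid (H i)) t) => t t1; split.
  by apply/rowP => i; rewrite mxE; have [->] := projT2 (cid (H i)) t t1.
apply: isd_mx => i' i; rewrite !ord1.
rewrite (_ : (fun s => _) = projT1 (cid (H i))); last by apply/funext => s; rewrite mxE.
by have [_] := projT2 (cid (H i)) t t1.
Qed.

(** Exterior derivative commutes with the time integral: the time derivative of [d (form_flow t)] is
    the pull-back of [d lam] by the flow. *)
Lemma form_extd x (v w : 'rV_n) : ball x0 r x -> exists D : R -> 'M[R]_1, forall t : R, `|t| <= 1 ->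
  D t = v *m extd (form_flow t) x *m w^T /\
  is_derive t 1 D (v *m jacobian (phi t) x *m extd lam (phi t x) *m (w *m jacobian (phi t) x)^T).
Proof.
move=> xb; have [D1 H1] := form_clairaut v xb; have [D2 H2] := form_clairaut w xb.
exists (fun t => D1 t *m w^T - D2 t *m v^T) => t t1; have [E1 h1] := H1 t t1; have [E2 h2] := H2 t t1.
split; first by rewrite E1 E2 (extd_bilin v w (form_smooth xb t1)).
have sphi : smooth_at x (phi t) by exact: (flow_smooth ler01 oB fl xb t1).
have sh : smooth_at x (fun x => lam (phi t x) *m (jacobian (phi t) x)^T).
  by apply: sm_mulmx; [exact: (sm_comp sphi (sl xb t1))|apply: sm_tr; exact: sm_jac].
have E3 := extd_bilin v w sh; have E4 := extd_pull sphi (sl xb t1).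
have -> : v *m jacobian (phi t) x *m extd lam (phi t x) *m (w *m jacobian (phi t) x)^T = v *m extd (fun x => lam (phi t x) *m (jacobian (phi t) x)^T) x *m w^T.
  by rewrite E4 trmx_mul !mulmxA.
rewrite E3; exact: is_deriveB (is_derive_mulmxr w^T h1) (is_derive_mulmxr v^T h2).
Qed.
End Form.
End FlowForm.

Section RestFlow.
Variables (n : nat) (N : premanifold R n).
Hypothesis hN : hmfd N.

Definition cfield (chi : N -> 'rV_n) (c : chart R n N) (y : 'rV_n) := chi (cinv c y) *m tcoord (cinv c y) c.

Lemma cfield_freg chi c z t : atlas c -> cdom c z -> smooth_at (cmap c z) (cfield chi c) -> freg (fun _ => chi) t z.
Proof.
move=> ac d sY; exists c; split; [exact: ac|exact: d|].
by apply: (sm_comp (g := cfield chi c) (sm_lsubid (tpt (cmap c z) t))); rewrite row_mxKl.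
Qed.

Lemma rest_flow_auto chi z c (e : R) : atlas c -> cdom c z -> 0 < e -> smooth_at (cmap c z) (cfield chi c) -> chi z = 0 ->
  exists r phi, [/\ 0 < r, flow_on (cfield chi c) 1 (ball (cmap c z) r) phi &
   forall y, ball (cmap c z) r y -> [/\ cdom c (cinv c y), cmap c (cinv c y) = y,
     forall t : R, `|t| <= 1 -> [/\ ball (cmap c z) e (phi t y), cdom c (cinv c (phi t y)) & cmap c (cinv c (phi t y)) = phi t y] &
     mcurve (fun _ => chi) (fun t => cinv c (phi t y)) 0 1]].
Proof.
move=> ac d e0 sY z0.
have [|r [phi [r0 fl H]]] := rest_flow hN ac d e0 (X := fun _ => chi).
  by move=> t _; split => //; exact: (cfield_freg t ac d sY).
have yb y : ball (cmap c z) r y -> ball (tpt (cmap c z) 0) r (tpt y 0).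
  by rewrite -ball_normE /= => yb; apply: ball_tpt => //; rewrite subrr normr0.
exists r, (fun t y => lsubmx (phi t (tpt y 0))); split => // [y /[dup] b /yb b'|y b]; last first.
  have [d1 E1 H1 cv] := H y b; split => //.
    by move=> t t1; have [_ b2 d2 E2] := H1 t t1.
  by apply: mcurve_sub cv; lra.
have [p0 tr] := fl _ b'; split; first by rewrite p0 row_mxKl.
move=> t t1; have [dp sp] := tr t t1; have [_ _ H1 _] := H y b; have [E _ _ _] := H1 t t1; split.
  have := isd_lsub dp; rewrite /tfield row_mxKl; suff -> : fld (fun _ => chi) c (phi t (tpt y 0)) = cfield chi c (lsubmx (phi t (tpt y 0))) by [].
  by [].
have s1 : smooth_at (phi t (tpt y 0)) (fld (fun _ => chi) c).
  apply: sm_ext (sm_lsub sp); near=> w; by rewrite /tfield row_mxKl.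
rewrite E in s1; apply: sm_ext (sm_comp (sm_tpt _ t) s1); near=> w.
by rewrite fld_tpt.
Unshelve. all: by end_near. Qed.
End RestFlow.

(** * The exponential map of a spray in canonical coordinates *)

Section LocalExp.
Variables (m : nat).
Variables (Y : 'rV_(m + m) -> 'rV_(m + m)) (P : 'rV_m -> 'M[R]_m) (phi : R -> 'rV_(m + m) -> 'rV_(m + m)) (x0 : 'rV_(m + m)) (r : R).
Hypotheses (r0 : 0 < r) (fl : flow_on Y 1 (ball x0 r) phi).

Definition liou (z : 'rV_(m + m)) : 'rV_(m + m) := row_mx (rsubmx z) 0.

Lemma sm_liou z : smooth_at z liou.
Proof. by apply: sm_row_mx; [exact: sm_rsubid|exact: sm_cst]. Qed.

(** In coordinates [(q, p)] this is [dp /\ dq], the opposite of [omega_can]. The sign is made up for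
    in [tautform] and in [xiT]. *)
Lemma extd_liou z (u w : 'rV_(m + m)) : u *m extd liou z *m w^T = rsubmx u *m (lsubmx w)^T - rsubmx w *m (lsubmx u)^T.
Proof.
rewrite (extd_bilin u w (sm_liou z)).
have D v : 'D_v liou z = row_mx (rsubmx v) 0.
  have := isd_row_mx (isd_rsub (smooth_isd v (sm_id z))) (smooth_isd v (sm_cst z (0 : 'rV_m))).
  by rewrite derive_id derive_cst => -[_ ->].
by rewrite !D -{1}[w]hsubmxK -{2}[u]hsubmxK !tr_row_mx !mul_row_col !mul0mx !addr0.
Qed.

Let sl x (xb : ball x0 r x) (t : R) (t1 : `|t| <= 1) : smooth_at (phi t x) liou := sm_liou (phi t x).
Definition exp_form := form_flow r0 fl sl 1.

Definition expgood z := [/\ smooth_at (lsubmx z) P, \forall y \near lsubmx z, (P y)^T = - P y, jacobi P (lsubmx z) &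
  \forall w \near z, lsubmx (Y w) = rsubmx w *m P (lsubmx w)].

Let one1 : `|1 : R| <= 1. Proof. by rewrite normr1. Qed.

Lemma exp_form_smooth x : ball x0 r x -> smooth_at x exp_form.
Proof. by move=> xb; exact: form_smooth. Qed.

Lemma lsub_derive_field z u : smooth_at z Y -> expgood z ->
  lsubmx ('D_u Y z) = rsubmx u *m P (lsubmx z) + rsubmx z *m 'D_(lsubmx u) P (lsubmx z).
Proof.
move=> sY [sP _ _ nE]; have [_ <-] := isd_lsub (smooth_isd u sY).
rewrite (derive_near u nE).
have sPl : smooth_at z (fun w : 'rV_(m + m) => P (lsubmx w)) by exact: (sm_comp (sm_lsubid z) sP).
rewrite (derive_mulmx u (sm_rsubid z) sPl).
have [_ ->] := isd_rsub (smooth_isd u (sm_id z)); rewrite derive_id; congr (_ + _ *m _).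
apply: (eq_trans (derive_comp u (sm_diff (sm_lsubid z)) (sm_diff sP))).
have [_ El] := isd_lsub (smooth_isd u (sm_id z)); rewrite derive_id in El.
exact: (congr1 (fun u => 'D_u P (lsubmx z)) El).
Qed.

(** The case [B = 0] of [homotopy_curve]: [th] is the momentum along the flow, and a tangent vector
    transported by the flow splits into a base variation and a momentum variation. The pairing with
    another such vector then changes at the rate of the pulled-back [d liou], whose time integral is
    [extd exp_form]. *)
Lemma exp_homotopy x (v : 'rV_(m + m)) (b0 : 'rV_m) : ball x0 r x ->
  (forall t : R, `|t| <= 1 -> expgood (phi t x)) -> b0 *m P (lsubmx x) = lsubmx v ->
  exists b : 'rV_m, b *m P (lsubmx (phi 1 x)) = v *m lsubmx (jacobian (phi 1) x) /\
    b *m (lsubmx (jacobian (phi 1) x))^T = row_mx b0 0 + v *m extd exp_form x.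
Proof.
move=> xb eg b0P; have [M [M0 dM HM]] := flow_jac r0 fl xb; have [p0 tr] := fl xb.
have sY (t : R) : `|t| <= 1 -> smooth_at (phi t x) Y by move=> t1; have [] := tr t t1.
have dphi (t : R) : `|t| <= 1 -> is_derive t 1 (phi^~ x) (Y (phi t x)) by move=> t1; have [] := tr t t1.
have cphi (t : R) : `|t| <= 1 -> {for t, continuous (phi^~ x)} by move=> t1; exact: is_derive_cont (dphi t t1).
have sP (t : R) : `|t| <= 1 -> smooth_at (lsubmx (phi t x)) P by move=> t1; have [] := eg t t1.
have sPl (t : R) : `|t| <= 1 -> smooth_at (phi t x) (fun w : 'rV_(m + m) => P (lsubmx w)).
  by move=> t1; exact: (sm_comp (sm_lsubid _) (sP t t1)).
pose u (w : 'rV_(m + m)) (t : R) := w *m M t.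
have du w (t : R) : `|t| <= 1 -> is_derive t 1 (u w) ('D_(u w t) Y (phi t x)).
  by move=> t1; rewrite (derive_mulE _ (sm_diff (sY t t1))) /u -mulmxA; exact: is_derive_mulmxl (dM t t1).
pose Pc (t : R) := P (lsubmx (phi t x)).
pose Bc (t : R) := 0 : 'M[R]_m.
pose Pk (k : 'I_m) (t : R) := 'D_(delta_mx 0 k) P (lsubmx (phi t x)).
pose th (t : R) := rsubmx (phi t x).
have cc p q (g : 'rV_(m + m) -> 'M[R]_(p, q)) (t : R) : `|t| <= 1 -> smooth_at (phi t x) g -> {for t, continuous (fun s => g (phi s x))}.
  move=> t1 sg; apply: (@continuous_comp _ _ _ (phi^~ x) g); [exact: cphi|exact: sm_cont].
have dirE (w : 'rV_m) (t : R) : `|t| <= 1 -> dirP Pk w t = 'D_w P (lsubmx (phi t x)).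
  by move=> t1; rewrite (derive_coord_sum w (sm_diff (sP t t1))).
have lY (t : R) : `|t| <= 1 -> lsubmx (Y (phi t x)) = th t *m Pc t.
  by move=> t1; have [_ _ _ nE] := eg t t1; exact: (nbhs_singleton nE).
have dPt (t : R) : `|t| <= 1 -> is_derive t 1 Pc (dirP Pk (th t *m Pc t) t - Pc t *m Bc t *m Pc t).
  move=> t1; rewrite mulmx0 mul0mx subr0 (dirE _ _ t1) -(lY t t1).
  have h := is_derive_chain (f := P) (isd_lsub (dphi t t1)); exact: (h (sm_diff (sP t t1))).
have hP (t : R) : `|t| <= 1 -> (Pc t)^T = - Pc t by move=> t1; have [_ nA _ _] := eg t t1; exact: (nbhs_singleton nA).
have hPk k (t : R) : `|t| <= 1 -> (Pk k t)^T = - Pk k t.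
  move=> t1; have [_ nA _ _] := eg t t1; have s1 := sP t t1; rewrite /Pk -(derive_trmx _ s1) -(derive_neg _ s1).
  exact: derive_near.
have hJ (t : R) : `|t| <= 1 -> forall x y z : 'rV_m,
  y *m dirP Pk (x *m Pc t) t *m z^T + z *m dirP Pk (y *m Pc t) t *m x^T + x *m dirP Pk (z *m Pc t) t *m y^T = 0.
  by move=> t1 p q s; rewrite !dirE//; have [_ _ jP _] := eg t t1; exact: jP.
have cPk k (t : R) : `|t| <= 1 -> {for t, continuous (Pk k)}.
  move=> t1; have s1 := sm_comp (sm_lsubid (phi t x)) (sm_der (delta_mx 0 k) (sP t t1)).
  exact: (cc _ _ _ _ t1 s1).
have cB (t : R) : `|t| <= 1 -> {for t, continuous Bc} by move=> _; exact: cst_continuous.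
have cth (t : R) : `|t| <= 1 -> {for t, continuous th} by move=> t1; exact: (cc _ _ _ _ t1 (sm_rsubid _)).
pose lv w (t : R) := lsubmx (u w t).
pose thv w (t : R) := rsubmx (u w t).
have dv w (t : R) : `|t| <= 1 -> is_derive t 1 (lv w) (thv w t *m Pc t + th t *m dirP Pk (lv w t) t).
  move=> t1; have := isd_lsub (du w t t1).
  by rewrite (lsub_derive_field _ (sY t t1) (eg t t1)) (dirE _ _ t1).
have cthv w (t : R) : `|t| <= 1 -> {for t, continuous (thv w)}.
  by move=> t1; exact: is_derive_cont (isd_rsub (du w t t1)).
have b0P' : b0 *m Pc 0 = lv v 0 by rewrite /Pc p0 /lv /u M0 mulmx1.
have [b [b00 Hb]] := homotopy_curve hP hPk hJ cPk cB cth dPt (cthv v) (dv v) b0P'.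
exists (b 1); have [b1P _] := Hb 1 one1; rewrite -(HM 1 one1); split; first by rewrite mulmx_lsub.
apply/rowP => j; pose w := delta_mx 0 j : 'rV_(m + m).
have [D HD] := form_extd r0 fl sl v w xb.
have const : b 1 *m (lv w 1)^T - D 1 = b 0 *m (lv w 0)^T - D 0.
  apply: (@derive0_const 1 1 (fun s => b s *m (lv w s)^T - D s) 0 1 ler01) => t /andP[t0 t1].
  have t1' : `|t| <= 1 by rewrite ger0_norm.
  have [_ /(_ (lv w) _ (dv w t t1')) h1] := Hb t t1'; have [_ h2] := HD t t1'.
  rewrite -(HM t t1') extd_liou in h2; have := is_deriveB h1 h2.
  by rewrite mulmx0 mul0mx addr0 /thv /lv /u subrr.
have zero1 : `|0 : R| <= 1 by rewrite normr0.
have D0 : D 0 = 0.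
  have [-> _] := HD 0 zero1; rewrite (extd_near (b := fun=> 0)).
  - rewrite (extd_bilin v w (sm_cst x (0 : 'rV_(m + m)))) !derive_cst !mul0mx subr0.
    by [].
  - apply: filterS (open_nbhs_nbhs (conj (@open_ballrV _ x0 r r0) xb)) => y yb.
    by have [] := form_flowP r0 fl sl yb.
  - exact: form_smooth.
have [D1 _] := HD 1 one1; rewrite D0 subr0 D1 b00 in const.
have lw : lv w 0 = lsubmx w by rewrite /lv /u M0 mulmx1.
rewrite lw /lv /u -mulmx_lsub in const.
have E : b 1 *m (w *m lsubmx (M 1))^T = b0 *m (lsubmx w)^T + v *m extd exp_form x *m w^T by rewrite -const subrK.
have El : b0 *m (lsubmx w)^T = row_mx b0 0 *m w^T by rewrite -{2}[w]hsubmxK tr_row_mx mul_row_col mul0mx addr0.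
move: E; rewrite El -mulmxDl trmx_mul mulmxA /w trmx_delta -!colE => /colP/(_ 0).
by rewrite [LHS]mxE [RHS]mxE.
Qed.

(** At a zero covector the linearised flow is explicit: it sends [(u_q, u_p)] to
    [(u_q + t u_p P, u_p)]. Hence the form can be integrated by hand. *)
Lemma exp_rest x : ball x0 r x -> Y x = 0 -> rsubmx x = 0 -> smooth_at (lsubmx x) P -> (P (lsubmx x))^T = - P (lsubmx x) ->
  (forall u, 'D_u Y x = row_mx (rsubmx u *m P (lsubmx x)) 0) ->
  [/\ phi 1 x = x, exp_form x = 0 & forall v w : 'rV_(m + m),
    v *m extd exp_form x *m w^T = rsubmx v *m (lsubmx w)^T - rsubmx w *m (lsubmx v)^T - rsubmx v *m P (lsubmx x) *m (rsubmx w)^T].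
Proof.
move=> xb Y0 p0 sP aP DY.
have [ph0 tr] := fl xb; have zero1 : `|0 : R| <= 1 by rewrite normr0.
have sY : smooth_at x Y by have [_] := tr 0 zero1; rewrite ph0.
have phx (t : R) : `|t| <= 1 -> phi t x = x.
  apply: (trajectory_unique (w := fun=> x) tr); last by rewrite ph0.
  by move=> s _; split => //; rewrite Y0; exact: is_derive_cst.
have [M [M0 dM HM]] := flow_jac r0 fl xb.
pose Q := P (lsubmx x).
have uM (u : 'rV_(m + m)) (t : R) : `|t| <= 1 -> u *m M t = row_mx (lsubmx u + t *: (rsubmx u *m Q)) (rsubmx u).
  pose c (t : R) := row_mx (lsubmx u + t *: (rsubmx u *m Q)) (rsubmx u).
  move=> t1; apply/eqP; rewrite -subr_eq0 -/(c t); apply/eqP.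
  have hc (s : R) : `|s| <= 1 -> {for s, continuous (fun _ : R => jacobian Y x)} by move=> _; exact: cst_continuous.
  have hd (s : R) : `|s| <= 1 -> is_derive s 1 (fun t => u *m M t - c t) ((u *m M s - c s) *m jacobian Y x).
    move=> s1; have h1 := is_derive_mulmxl u (dM s s1); rewrite phx// in h1.
    have h2 : is_derive s 1 c (row_mx (rsubmx u *m Q) (0 : 'rV_m)).
      rewrite /c; apply: isd_row_mx.
      exact: is_deriveDc (is_derive_scalev (rsubmx u *m Q) s).
    have h3 := is_deriveB h1 h2; suff E : u *m (M s *m jacobian Y x) - row_mx (rsubmx u *m Q) 0 = (u *m M s - c s) *m jacobian Y x by rewrite -E.
    rewrite mulmxBl mulmxA; congr (_ - _).
    by rewrite -(derive_mulE _ (sm_diff sY)) DY row_mxKr.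
  have h0 : u *m M 0 - c 0 = 0 by rewrite M0 mulmx1 /c scale0r addr0 hsubmxK subrr.
  exact: (@linear_ode_unique 1 (m + m) (fun t => u *m M t - c t) (fun=> jacobian Y x) 1 ler01 hc hd h0 t t1).
split; first exact: phx.
  have [a0 da] := form_flowP r0 fl sl xb.
  rewrite -[RHS]a0; apply: (@derive0_const 1 _ (form_flow r0 fl sl ^~ x) 0 1 ler01) => t /andP[t0 t1].
  have t1' : `|t| <= 1 by rewrite ger0_norm.
  have := da t t1'; rewrite phx// /liou p0.
  by have -> : row_mx (0 : 'rV_m) (0 : 'rV_m) = 0 by [exact: row_mx0]; rewrite mul0mx.
move=> v w; have [D HD] := form_extd r0 fl sl v w xb; have [D1 _] := HD 1 one1.
pose K1 := rsubmx v *m (lsubmx w)^T - rsubmx w *m (lsubmx v)^T.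
pose K2 := rsubmx v *m Q *m (rsubmx w)^T.
have K2E : rsubmx w *m Q *m (rsubmx v)^T = - K2.
  by rewrite /K2 -[LHS]scal1_tr !trmx_mul trmxK aP mulNmx mulmxN mulmxA.
(* The primitive of the rate [K1 - 2 t K2] obtained by inserting the linearised flow into [d liou];
   the two terms linear in [t] add up because [P] is antisymmetric. *)
pose H (t : R) := t *: K1 - (t * t) *: K2.
have dH (t : R) : is_derive t 1 H (K1 - (2 * t) *: K2).
  have h1 := is_derive_scalev K1 t.
  have h2 : is_derive t 1 (fun t : R => t * t) (2 * t).
    have := is_deriveM (is_derive_id t 1) (is_derive_id t 1).
    by rewrite /GRing.scale/= mulr1 -mulr2n mulr_natl.
  have h3 : is_derive t 1 (fun t : R => (t * t) *: K2) ((2 * t) *: K2).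
    apply: isd_mx => i j; rewrite mxE mulrC.
    rewrite (_ : (fun s => _) = (fun s : R => K2 i j *: (s * s))); last by apply/funext => s; rewrite mxE mulrC.
    exact: is_deriveZ.
  exact: is_deriveB h1 h3.
have D0 : D 0 = 0.
  have [-> _] := HD 0 zero1; rewrite (extd_near (b := fun=> 0)).
  - rewrite (extd_bilin v w (sm_cst x (0 : 'rV_(m + m)))) !derive_cst !mul0mx subr0.
    by [].
  - apply: filterS (open_nbhs_nbhs (conj (@open_ballrV _ x0 r r0) xb)) => y yb.
    by have [] := form_flowP r0 fl sl yb.
  - exact: form_smooth.
have : D 1 - H 1 = D 0 - H 0.
  apply: (@derive0_const 1 1 (fun s => D s - H s) 0 1 ler01) => t /andP[t0 t1].
  have t1' : `|t| <= 1 by rewrite ger0_norm.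
  have [_ h1] := HD t t1'; rewrite -(HM t t1') extd_liou !uM// !row_mxKl !row_mxKr in h1.
  have := is_deriveB h1 (dH t); suff -> : rsubmx v *m (lsubmx w + t *: (rsubmx w *m Q))^T - rsubmx w *m (lsubmx v + t *: (rsubmx v *m Q))^T - (K1 - (2 * t) *: K2) = 0 by [].
  have TE (a b c : 'rV_m) : a *m (b + t *: (c *m Q))^T = a *m b^T - t *: (a *m Q *m c^T).
    have -> : (b + t *: (c *m Q))^T = b^T + t *: (Q^T *m c^T) by rewrite [LHS]linearD/= linearZ/= trmx_mul.
    by rewrite mulmxDr -scalemxAr aP mulNmx mulmxN scalerN mulmxA.
  rewrite !TE K2E -/K2 /K1.
  by apply/matrixP => i j; rewrite !mxE; ring.
rewrite D0 /H scale0r mulr0 scale0r subrr subr0 mulr1 !scale1r => /eqP; rewrite subr_eq0 => /eqP E; exact: (eq_trans (esym D1) E).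
Qed.
End LocalExp.

Lemma covec_cancel (K : fieldType) p (T F : 'M[K]_p) (a : 'rV[K]_p) : T *m F = 1%:M -> a *m F^T *m T^T = a.
Proof. by move=> TF; rewrite -mulmxA -trmx_mul TF trmx1 mulmx1. Qed.

(** * Cotangent and dual bundles *)

Section Bundle.
Variables (n r : nat) (X : premanifold R n) (N : premanifold R (n + r)) (p : N -> X).
Variable bd : chart R (n + r) N -> chart R n X -> set X -> (N -> 'rV_r) -> Prop.
Hypothesis hX : hmfd X.

(** [bd c q U Y] reads: the chart [c] of the total space lies over the open set [U] of the base,
    with base coordinates [q] and fibre coordinates [Y]. The record isolates what the cotangent
    bundle and the dual bundle have in common, so that their manifold structure is built once. *)
Record bundle_charts : Prop := BundleCharts {
  bdI : forall c, atlas c -> exists q U Y, bd c q U Y;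
  bdE : forall c q U Y, bd c q U Y -> [/\ atlas q, mopen U, U `<=` cdom q &
    [/\ forall e, cdom c e <-> U (p e), forall e, cdom c e -> cmap c e = row_mx (cmap q (p e)) (Y e) &
        forall e, cdom c e -> cinv c (cmap c e) = e]];
  bd_onto : forall c q U Y, bd c q U Y -> forall x, U x -> forall y, exists e, p e = x /\ Y e = y;
  bd_trans : forall c q U Y c' q' U' Y', bd c q U Y -> bd c' q' U' Y' -> exists g : X -> 'M[R]_r,
    (forall x, U x -> U' x -> msm g x) /\ forall e, U (p e) -> U' (p e) -> Y' e = Y e *m g (p e);
  bd_cover : forall e, exists c q U Y, [/\ atlas c, bd c q U Y & U (p e)] }.

Hypothesis bc : bundle_charts.

Lemma bundle_image c q U Y (V : set X) : bd c q U Y -> mopen V ->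
  cmap c @` (p @^-1` V `&` cdom c) = (fun w : 'rV_(n + r) => lsubmx w) @^-1` (cmap q @` (V `&` U `&` cdom q)).
Proof.
move=> hb oV; have [aq oU Uq [dE mE iE]] := bdE bc hb; apply/seteqP; split => w /=.
  by move=> [e [Ve de] <-]; rewrite mE// row_mxKl; have Ue := (dE e).1 de; exists (p e) => //; split => //; exact: Uq.
move=> [x [[Vx Ux] dx] Ew]; have [e [pe Ye]] := bd_onto bc hb Ux (rsubmx w).
have de : cdom c e by apply/dE; rewrite pe.
by exists e; [split => //; rewrite /= pe|rewrite mE// pe Ye Ew hsubmxK].
Qed.

Lemma open_lsub (A : set 'rV_n) : open A -> open ((fun w : 'rV_(n + r) => lsubmx w) @^-1` A).
Proof. by move=> oA; apply: open_comp => // w _; exact: sm_cont (sm_lsubid w). Qed.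

Lemma bundle_mopen (V : set X) : mopen V -> mopen (p @^-1` V).
Proof.
move=> oV c ac; have [q [U [Y hb]]] := bdI bc ac; have [aq oU _ _] := bdE bc hb.
rewrite (bundle_image hb oV); apply: open_lsub; exact: (mopenI hX oV oU aq).
Qed.

Lemma bundle_dom_mopen (c : chart R (n + r) N) : atlas c -> mopen (cdom c).
Proof.
move=> ac; have [q [U [Y hb]]] := bdI bc ac; have [aq oU _ [dE _ _]] := bdE bc hb.
by rewrite (_ : cdom c = p @^-1` U); [exact: bundle_mopen|apply/seteqP; split => e /dE].
Qed.

Lemma bundle_trans (c c' : chart R (n + r) N) e : atlas c -> atlas c' -> cdom c e -> cdom c' e ->
  smooth_at (cmap c' e) (fun w => cmap c (cinv c' w)).
Proof.
move=> ac ac' d d'; have [q [U [Y hb]]] := bdI bc ac; have [q' [U' [Y' hb']]] := bdI bc ac'.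
have [aq oU Uq [dE mE iE]] := bdE bc hb; have [aq' oU' Uq' [dE' mE' iE']] := bdE bc hb'.
have [g [sg Yg]] := bd_trans bc hb' hb.
have Ux := (dE e).1 d; have Ux' := (dE' e).1 d'.
have dq := Uq _ Ux; have dq' := Uq' _ Ux'.
have El : lsubmx (cmap c' e) = cmap q' (p e) by rewrite mE'// row_mxKl.
have s1 : smooth_at (cmap c' e) (fun w => cmap q (cinv q' (lsubmx w))).
  by apply: (sm_comp (g := fun y => cmap q (cinv q' y)) (sm_lsubid _)); rewrite El; exact: (sm_trans hX).
have s2 : smooth_at (cmap c' e) (fun w => g (cinv q' (lsubmx w))).
  by apply: (sm_comp (g := fun y => g (cinv q' y)) (sm_lsubid _)); rewrite El; exact: (msm_chart hX (sg _ Ux' Ux)).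
apply: sm_ext (sm_row_mx s1 (sm_mulmx (sm_rsubid _) s2)).
have oI := bundle_mopen oU ac'.
have : nbhs (cmap c' e) (cmap c' @` (p @^-1` U `&` cdom c')) by apply: open_nbhs_nbhs; split => //; exists e.
apply: filterS => _ [e1 [U1 d1] <-]; rewrite iE' ?mE' ?row_mxKl ?row_mxKr//.
have U1' := (dE' e1).1 d1; have d1' : cdom c e1 by apply/dE.
by rewrite mE// (cinvK hX aq') ?Yg//; exact: Uq'.
Qed.

(** Points over different base points are separated below; points of one fibre lie in a common chart
    and are separated by balls there. *)
Lemma bundle_hmfd : hmfd N.
Proof.
split.
- by move=> e; have [c [q [U [Y [ac hb Ue]]]]] := bd_cover bc e; exists c => //; have [_ _ _ [dE _ _]] := bdE bc hb; apply/dE.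
- move=> c ac; split; last 2 first.
  + exact: bundle_dom_mopen.
  + by move=> c' ac'; apply: sm_CinftyP => _ [e [d d'] <-]; exact: bundle_trans.
  have [q [U [Y hb]]] := bdI bc ac; by have [_ _ _ [_ _ iE]] := bdE bc hb.
move=> e e' ne; have [pe|pe] := EM (p e = p e'); last first.
  have [_ _ haus] := hX; have [U [V [oU oV Ux Vx UV]]] := haus _ _ pe.
  exists (p @^-1` U), (p @^-1` V); split => //; try exact: bundle_mopen.
  by apply/seteqP; split => // z [Uz Vz]; have : (U `&` V) (p z) by []; rewrite UV.
have [c [q [U [Y [ac hb Ue]]]]] := bd_cover bc e; have [aq oU Uq [dE mE iE]] := bdE bc hb.
have d : cdom c e by apply/dE. have d' : cdom c e' by apply/dE; rewrite -pe.
have dist : 0 < `|cmap c e - cmap c e'|.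
  by rewrite normr_gt0 subr_eq0; apply: contra_notN ne => /eqP E; rewrite -(iE e d) -(iE e' d') E.
set D := `|_| in dist; have D2 : 0 < D / 2 by lra.
pose B e0 : set N := [set z | cdom c z /\ ball (cmap c e0) (D / 2) (cmap c z)].
have oB e0 : cdom c e0 -> mopen (B e0).
  move=> d0 c' ac'; rewrite openE => _ [z [[dz bz] dz'] <-]; rewrite /interior.
  have st := bundle_trans ac ac' dz dz'.
  have iE' : forall e, cdom c' e -> cinv c' (cmap c' e) = e.
    by have [q' [U' [Y' hb']]] := bdI bc ac'; have [_ _ _ [_ _ h]] := bdE bc hb'.
  have ct := sm_cont st; rewrite /prop_for /continuous_at iE'// in ct.
  have n1 : \forall w \near cmap c' z, ball (cmap c e0) (D / 2) (cmap c (cinv c' w)) := ct _ (open_nbhs_nbhs (conj (@open_ballrV _ (cmap c e0) _ D2) bz)).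
  have n2 : nbhs (cmap c' z) (cmap c' @` (cdom c `&` cdom c')).
    by apply: open_nbhs_nbhs; split; [exact: (bundle_dom_mopen ac)|exists z].
  apply: filterS2 n1 n2 => w + [z1 [d1 d1'] Ew]; rewrite -Ew iE'// => b1.
  by exists z1.
exists (B e), (B e'); split; try exact: oB.
- by split => //; exact: ballxx.
- by split => //; exact: ballxx.
apply/seteqP; split => // z [[_ b1] [_ b2]]; move: b1 b2; rewrite -!ball_normE /= => b1 b2.
have : D <= `|cmap c e - cmap c z| + `|cmap c z - cmap c e'|.
  by rewrite /D -[cmap c e - cmap c e'](subrKA (cmap c z)) ler_normD.
by rewrite (distrC (cmap c z)); lra.
Qed.

Lemma bundle_proj_near c q U Y e : bd c q U Y -> atlas c -> cdom c e ->
  \forall w \near cmap c e, [/\ cdom c (cinv c w), U (p (cinv c w)), lsubmx w = cmap q (p (cinv c w)) & rsubmx w = Y (cinv c w)].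
Proof.
move=> hb ac d; have [aq oU Uq [dE mE iE]] := bdE bc hb.
apply: filterS (near_cdom bundle_hmfd ac d) => w [d1 E]; have U1 := (dE _).1 d1; split => //.
  by rewrite -{1}E mE// row_mxKl.
by rewrite -{1}E mE// row_mxKr.
Qed.

Lemma bundle_proj_smooth e : msmap p e.
Proof.
have [c [q [U [Y [ac hb Ue]]]]] := bd_cover bc e; have [aq oU Uq [dE mE iE]] := bdE bc hb.
have d : cdom c e by apply/dE.
have nn := bundle_proj_near hb ac d.
apply: (msmapI bundle_hmfd hX ac d aq (Uq _ Ue)).
  by apply: filterS nn => w [_ U1 _ _]; exact: Uq.
by apply: sm_ext (sm_lsubid _); apply: filterS nn => w [].
Qed.

Lemma jac_lsub k l (w : 'rV_(k + l)) : jacobian (fun w : 'rV_(k + l) => lsubmx w) w = col_mx 1%:M 0.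
Proof.
apply/row_matrixP => i; rewrite row_jac; last exact: sm_diff (sm_lsubid w).
have [_] := isd_lsub (smooth_isd (delta_mx 0 i) (sm_id w)); rewrite derive_id => ->.
rewrite rowE -[delta_mx 0 i in RHS]hsubmxK mul_row_col mulmx1 mulmx0 addr0.
by [].
Qed.

Lemma bundle_mder c q U Y e : bd c q U Y -> atlas c -> cdom c e ->
  mder p e = tcoord e c *m col_mx 1%:M 0 *m fcoord (p e) q.
Proof.
move=> hb ac d; have [aq oU Uq [dE mE iE]] := bdE bc hb; have Ue := (dE e).1 d.
rewrite (mderE bundle_hmfd hX (bundle_proj_smooth e) ac d aq (Uq _ Ue)); congr (_ *m _ *m _).
rewrite -(jac_lsub (cmap c e)); apply: esym; apply: jac_near; last exact: sm_diff (sm_lsubid _).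
by apply: filterS (bundle_proj_near hb ac d) => w [].
Qed.
End Bundle.

Section Cotangent.
Variables (n : nat) (M : premanifold R n).
Hypothesis hM : hmfd M.
Let CT := cotangent M.

Definition cot_bd (c : chart R (n + n) CT) (q : chart R n M) (U : set M) (Y : CT -> 'rV_n) :=
  [/\ atlas q, U = cdom q, Y = (fun z => z.2 *m (fcoord z.1 q)^T) &
    [/\ cdom c = [set z | cdom q z.1], forall z, cdom c z -> cmap c z = row_mx (cmap q z.1) (z.2 *m (fcoord z.1 q)^T) &
        forall z, cdom c z -> cinv c (cmap c z) = z]].

Lemma covec_inj (q : chart R n M) (x : M) (a b : 'rV_n) : atlas q -> cdom q x -> a *m (fcoord x q)^T = b *m (fcoord x q)^T -> a = b.
Proof.
move=> aq d E; have := congr1 (mulmx^~ (tcoord x q)^T) E.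
by rewrite -!mulmxA -trmx_mul (tfcoord hM aq d) trmx1 !mulmx1.
Qed.

Lemma cot_chart q (z0 : CT) : atlas q -> cdom q z0.1 -> exists2 c : chart R (n + n) CT, atlas c & cot_bd c q (cdom q) (fun z => z.2 *m (fcoord z.1 q)^T).
Proof.
move=> aq d; pose mp (z : CT) := row_mx (cmap q z.1) (z.2 *m (fcoord z.1 q)^T).
pose iv w := choose_or z0 (fun z : CT => cdom q z.1 /\ mp z = w).
have ivE z : cdom q z.1 -> iv (mp z) = z.
  move=> dz; have [|d' E] := @choose_orP CT z0 (fun z' : CT => cdom q z'.1 /\ mp z' = mp z); first by exists z.
  rewrite /iv; move: E d'; set z' := choose_or _ _ => /eq_row_mx[E1 E2] d'.
  have E3 : z'.1 = z.1 by rewrite -(cinvK hM aq d') E1 (cinvK hM aq dz).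
  move: z' E1 E2 d' E3 => [x a]; case: z dz => y b /= dy E1 E2 d' E3; subst x.
  by rewrite (covec_inj aq dy E2).
exists (Chart [set z : CT | cdom q z.1] mp iv); first by exists q => //; split => //= z dz; rewrite ivE.
by split => //; split => //= z dz; rewrite ivE.
Qed.

Lemma cot_bundle : @bundle_charts n n M CT (@cot_proj R n M) cot_bd.
Proof.
split.
- move=> c [q aq [dE mE iE]]; exists q, (cdom q), (fun z => z.2 *m (fcoord z.1 q)^T); split => //.
- move=> c q U Y [aq -> -> [dE mE iE]]; split => //; first exact: mopen_cdom.
  by split => //; rewrite dE.
- move=> c q U Y [aq -> -> [dE mE iE]] x dx y; exists (x, y *m (tcoord x q)^T); split => //=.
  by rewrite -mulmxA -trmx_mul (ftcoord hM aq dx) trmx1 mulmx1.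
- move=> c q U Y c' q' U' Y' [aq -> -> _] [aq' -> -> _].
  exists (fun x => (jacobian (cmap q \o cinv q') (cmap q' x))^T); split.
    move=> x dx dx'; apply: msm_lift1 (msm_tcoord hM aq' dx' aq dx) => y c0; exact: sm_tr.
  move=> [x a] /= dx dx'.
  have := jac_trans hM aq' (at_atlas hM x) aq dx' (at_dom hM x) dx.
  rewrite -/(fcoord x q') -/(tcoord x q) => <-; rewrite trmx_mul !mulmxA.
  exact: (esym (congr1 (mulmx^~ _) (covec_cancel a (tfcoord hM aq dx)))).
- move=> z; have aq := at_atlas hM z.1; have dq := at_dom hM z.1.
  have [c ac hb] := cot_chart aq dq; exists c, (chart_at z.1), (cdom (chart_at z.1)), (fun z' => z'.2 *m (fcoord z'.1 (chart_at z.1))^T).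
  by split; [exact: ac|exact: hb|exact: dq].
Qed.

Lemma cot_hmfd : hmfd CT.
Proof. exact: bundle_hmfd hM cot_bundle. Qed.
End Cotangent.

(** [u *m S] paired with itself is a sum of squares. The inverse Gram matrix gives smooth formulas
    for one-sided inverses of frames, used whenever coordinates in a moving frame must depend
    smoothly on the point. *)
Lemma gram_unit r n (S : 'M[R]_(r, n)) : row_free S -> S *m S^T \in unitmx.
Proof.
move=> fS; rewrite -row_free_unit -kermx_eq0; apply/eqP/row_matrixP => i; rewrite row0.
set u := row i _; have uS : u *m (S *m S^T) = 0 by apply/sub_kermxP; exact: row_sub.
have : (u *m S) *m (u *m S)^T = 0 by rewrite trmx_mul mulmxA -(mulmxA u) uS mul0mx.
move=> /matrixP/(_ 0 0); rewrite !mxE => /eqP; rewrite psumr_eq0 => [/allP H|j _]; last first.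
  by rewrite [X in _ * X]mxE -expr2 sqr_ge0.
have uS0 : u *m S = 0.
  apply/rowP => j; have := H j (mem_index_enum j); rewrite [X in _ * X]mxE mulf_eq0 orbb => /eqP ->.
  by rewrite mxE.
by apply/eqP; rewrite -(mulmx_free_eq0 _ fS); apply/eqP.
Qed.

Section DualEval.
Variables (n r : nat) (W : {vspace 'rV_n}).
Implicit Types (xi : dual_fiber W).

Lemma dual_evalD xi u v : dual_eval xi (u + v) = dual_eval xi u + dual_eval xi v.
Proof. by rewrite /dual_eval linearD /= linearD. Qed.

Lemma dual_evalZ xi (a : R) v : dual_eval xi (a *: v) = a * dual_eval xi v.
Proof. by rewrite /dual_eval linearZ /= linearZ. Qed.

Lemma dual_eval0 xi : dual_eval xi 0 = 0.
Proof. by rewrite -(scale0r 0) dual_evalZ mul0r. Qed.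

Lemma dual_eval_sum xi (I : finType) (f : I -> 'rV_n) : dual_eval xi (\sum_i f i) = \sum_i dual_eval xi (f i).
Proof. by apply: (big_morph (dual_eval xi)); [exact: dual_evalD|exact: dual_eval0]. Qed.

Variables (s : 'I_r -> 'rV_n).
Hypothesis bs : basis_of W [tuple s a | a < r].

Lemma basis_coords v : v \in W -> v = \sum_a coord [tuple s a | a < r] a v *: s a.
Proof.
move=> vW; rewrite {1}(coord_basis bs vW); apply: eq_bigr => a _; congr (_ *: _).
by rewrite -tnth_nth tnth_mktuple.
Qed.

Lemma basis_memv a : s a \in W.
Proof. by apply: (basis_mem bs); apply/tnthP; exists a; rewrite tnth_mktuple. Qed.

Lemma frame_free (u : 'rV_r) : \sum_a u 0 a *: s a = 0 -> u = 0.
Proof.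
move=> E; have fs := vector.basis_free bs; apply/rowP => a; rewrite mxE.
move/freeP: fs => /(_ (fun a => u 0 a)); apply.
by rewrite -[RHS]E; apply: eq_bigr => b _; rewrite -tnth_nth tnth_mktuple.
Qed.

Lemma dual_ext xi xi' : (forall a, dual_eval xi (s a) = dual_eval xi' (s a)) -> xi = xi'.
Proof.
move=> H; apply/lfunP => v; rewrite -[v]vsvalK.
have E : forall xi, (xi : 'Hom(subvs_of W, R^o)) (vsproj W (vsval v)) = dual_eval xi (vsval v) by [].
rewrite !E (basis_coords (subvsP v)) !dual_eval_sum; apply: eq_bigr => a _.
by rewrite !dual_evalZ H.
Qed.

Lemma dual_onto (y : 'rV_r) : exists xi : dual_fiber W, forall a, dual_eval xi (s a) = y 0 a.
Proof.
pose f (v : subvs_of W) : R^o := \sum_a coord [tuple s a | a < r] a (vsval v) * y 0 a.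
have lf : linear f.
  move=> k u v; rewrite /f scaler_sumr -big_split; apply: eq_bigr => a _ /=.
  by rewrite linearP /= /GRing.scale /= mulrDl mulrA.
pose fl := GRing.isLinear.Build _ _ _ _ f lf; pose F : {linear _ -> _} := HB.pack f fl.
exists (linfun F) => a; rewrite /dual_eval lfunE /= /f.
rewrite vsprojK ?basis_memv// (bigD1 a)//= big1 ?addr0 => [|b ba].
  have := coord_free a a (vector.basis_free bs); rewrite -tnth_nth tnth_mktuple => ->.
  by rewrite eqxx mul1r.
have := coord_free a b (vector.basis_free bs); rewrite -tnth_nth tnth_mktuple => ->.
by rewrite eq_sym (negbTE ba) mul0r.
Qed.
End DualEval.

Section Dual.
Variables (n r : nat) (X : premanifold R n) (W : X -> {vspace 'rV_n}).
Hypothesis hX : hmfd X.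
Hypothesis hW : forall x : X, exists U, exists s : 'I_r -> X -> 'rV_n, [/\ mopen U, U x & local_frame idfun W U s].
Let E := dual_bundle r W.

Definition fcomp (s : 'I_r -> X -> 'rV_n) (e : E) : 'rV_r := \row_a dual_eval (projT2 e) (s a (projT1 e)).

Definition dual_bd_frame (c : chart R (n + r) E) (q : chart R n X) (U : set X) (s : 'I_r -> X -> 'rV_n) :=
  [/\ atlas q, mopen U, U `<=` cdom q & local_frame idfun W U s] /\
  [/\ cdom c = [set e | U (projT1 e)], forall e, cdom c e -> cmap c e = row_mx (cmap q (projT1 e)) (fcomp s e) &
      forall e, cdom c e -> cinv c (cmap c e) = e].

Definition dual_bd c q U (Y : E -> 'rV_r) := exists2 s, dual_bd_frame c q U s & Y = fcomp s.

Definition fmat (q : chart R n X) (s : 'I_r -> X -> 'rV_n) (x : X) : 'M[R]_(r, n) := \matrix_(a < r) (s a x *m tcoord x q).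

Lemma fmat_msm q U s x : atlas q -> mopen U -> local_frame idfun W U s -> U x -> cdom q x -> msm (fmat q s) x.
Proof.
move=> aq oU [ss _] Ux dx; exists q; split => //; apply: sm_mx => a j.
have oV : mopen (U `&` cdom q) by apply: mopenI => //; exact: mopen_cdom.
have H := msm_chart hX (smooth_on_msm hX oV (ss a q aq) (conj Ux dx)) aq dx.
by apply: sm_ext (sm_coord 0 j H); near=> y; rewrite [RHS]mxE.
Unshelve. all: by end_near. Qed.

Lemma fmat_mul q s x (u : 'rV_r) : u *m fmat q s x = (\sum_a u 0 a *: s a x) *m tcoord x q.
Proof.
rewrite mulmx_suml; apply/rowP => j; rewrite mxE summxE; apply: eq_bigr => a _.
by rewrite mxE -scalemxAl [RHS]mxE.
Qed.

Lemma fmat_free q s x : atlas q -> cdom q x -> basis_of (W x) [tuple s a x | a < r] -> row_free (fmat q s x).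
Proof.
move=> aq dx bs; rewrite -kermx_eq0; apply/eqP/row_matrixP => i; rewrite row0.
set u := row i _; have uS : u *m fmat q s x = 0 by apply/sub_kermxP; exact: row_sub.
rewrite fmat_mul in uS; apply: (frame_free bs).
have [ut _] := mulmx1_unit (tfcoord hX aq dx); apply: (can_inj (mulmxK ut)).
by rewrite uS mul0mx.
Qed.

Lemma dual_chart q U s (e0 : E) : atlas q -> mopen U -> U `<=` cdom q -> local_frame idfun W U s ->
  exists2 c : chart R (n + r) E, atlas c & dual_bd_frame c q U s.
Proof.
move=> aq oU Uq lf; pose mp (e : E) := row_mx (cmap q (projT1 e)) (fcomp s e).
pose iv w := choose_or e0 (fun e : E => U (projT1 e) /\ mp e = w).
have ivE (e : E) : U (projT1 e) -> iv (mp e) = e.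
  move=> Ue; have [|Ue' Ee] := @choose_orP E e0 (fun e' : E => U (projT1 e') /\ mp e' = mp e); first by exists e.
  rewrite /iv; move: Ee Ue'; set e' := choose_or _ _ => /eq_row_mx[E1 E2] Ue'.
  have E3 : projT1 e' = projT1 e by rewrite -(cinvK hX aq (Uq _ Ue')) E1 (cinvK hX aq (Uq _ Ue)).
  move: e' E1 E2 Ue' E3 => [x xi]; case: e Ue => y et /= Uy E1 E2 Ux E3; subst x.
  have [_ bs] := lf; congr existT; apply: (dual_ext (bs y Uy)) => a.
  by move/rowP: E2 => /(_ a); rewrite !mxE.
exists (Chart [set e : E | U (projT1 e)] mp iv).
  exists q, U, s; split; first by split.
  by split => //= e Ue; rewrite ivE.
by split; [split|split => //= e Ue; rewrite ivE].
Qed.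

Lemma dual_chart_ex (e0 : E) : exists c q U s, [/\ atlas c, dual_bd_frame c q U s & U (projT1 e0)].
Proof.
have [U [s [oU Ux lf]]] := hW (projT1 e0); have aq := at_atlas hX (projT1 e0); have dq := at_dom hX (projT1 e0).
set q := chart_at _ in aq dq.
have oV : mopen (U `&` cdom q) by apply: mopenI => //; exact: mopen_cdom.
have lfV : local_frame idfun W (U `&` cdom q) s.
  have [h1 h2] := lf; split => [a c ac|x [Ux' _]]; last exact: h2.
  move=> c' ac' k; apply: Ck_sub (h1 a c ac c' ac' k) => _ [x [[[Ux' _] dx] dx'] <-].
  by exists x.
have Vq : U `&` cdom q `<=` cdom q by move=> ? [].
have [c ac hb] := dual_chart e0 aq oV Vq lfV.
by exists c, q, (U `&` cdom q), s; split.
Qed.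

Lemma dual_bundle_charts : @bundle_charts n r X E (@dual_proj R n r X W) dual_bd.
Proof.
split.
- move=> c [q [U [s [h1 h2]]]]; exists q, U, (fcomp s), s => //.
- move=> c q U Y [s [[aq oU Uq lf] [dE mE iE]] ->]; split => //; split => //.
  by rewrite dE.
- move=> c q U Y [s [[aq oU Uq lf] [dE mE iE]] ->] x Ux y.
  have [xi Hxi] := dual_onto (lf.2 x Ux) y; exists (existT _ x xi); split => //.
  by apply/rowP => a; rewrite mxE Hxi.
- move=> c q U Y c' q' U' Y' [s [[aq oU Uq lf] [dE mE iE]] ->] [s' [[aq' oU' Uq' lf'] _] ->].
  (* Both frames span the same space, so the least squares solution of [S' = G S] is exact, and its
     formula by the Gram matrix is visibly smooth. *)
  exists (fun x => (fmat q s' x *m (fmat q s x)^T *m invmx (fmat q s x *m (fmat q s x)^T))^T); split.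
    move=> x Ux Ux'; have dq := Uq _ Ux.
    have m1 := fmat_msm aq oU lf Ux dq; have m2 := fmat_msm aq oU' lf' Ux' dq.
    have uG := gram_unit (fmat_free aq dq (lf.2 x Ux)).
    exists q; split => //; have s1 := msm_chart hX m1 aq dq; have s2 := msm_chart hX m2 aq dq.
    have sG := sm_mulmx s1 (sm_tr s1).
    apply: sm_tr; apply: sm_mulmx; first by apply: sm_mulmx => //; exact: sm_tr.
    by apply: sm_invmx sG; rewrite (cinvK hX aq dq); exact: uG.
  move=> [x xi] /= Ux Ux'; have dq := Uq _ Ux.
  have uG := gram_unit (fmat_free aq dq (lf.2 x Ux)).
  set S := fmat q s x; set S' := fmat q s' x; set G := S' *m S^T *m _.
  have GS a : s' a x = \sum_b G a b *: s b x.
    have inW : s' a x \in W x by exact: (basis_memv (lf'.2 x Ux')).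
    pose u := \row_b coord [tuple s b x | b < r] b (s' a x).
    have Eu : s' a x = \sum_b u 0 b *: s b x.
      by rewrite {1}(basis_coords (lf.2 x Ux) inW); apply: eq_bigr => b _; rewrite mxE.
    have rS' : row a S' = u *m S by rewrite fmat_mul -Eu rowK.
    have rG : row a G = u by rewrite /G !row_mul rS' -(mulmxA u) -mulmxA mulmxV// mulmx1.
    have Gb b : G a b = u 0 b by rewrite -rG [RHS]mxE.
    by rewrite Eu; apply: eq_bigr => b _; rewrite Gb.
  apply/rowP => a; rewrite !mxE {1}GS dual_eval_sum; apply: eq_bigr => b _.
  by rewrite dual_evalZ !mxE mulrC.
- move=> e; have [c [q [U [s [ac hb Ue]]]]] := dual_chart_ex e.
  by exists c, q, U, (fcomp s); split => //; exists s.
Qed.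

Lemma dual_hmfd : hmfd E.
Proof. exact: bundle_hmfd hX dual_bundle_charts. Qed.
End Dual.

Lemma one_neq_four : (1 - 2 * 2 : R) != 0. Proof. by apply/eqP; lra. Qed.

(** * Poisson sprays and their exponential maps *)

Section FiberScaling.
Variables (m : nat).

Definition fscale (t : R) (w : 'rV_(m + m)) : 'rV_(m + m) := row_mx (lsubmx w) (t *: rsubmx w).

Lemma sm_fscale t w : smooth_at w (fscale t).
Proof. by apply: sm_row_mx; [exact: sm_lsubid|apply: smZ; [exact: sm_cst|exact: sm_rsubid]]. Qed.

Lemma derive_fscale t w v : 'D_v (fscale t) w = fscale t v.
Proof.
have h1 := isd_rsub (smooth_isd v (sm_id w)); rewrite derive_id in h1.
have h2 : is_derive w v (fun w : 'rV_(m + m) => t *: rsubmx w) (t *: rsubmx v) by exact: is_deriveZ.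
have h3 := isd_lsub (smooth_isd v (sm_id w)); rewrite derive_id in h3.
by have [_ ->] := isd_row_mx h3 h2.
Qed.
End FiberScaling.

Lemma exp_transport (K : fieldType) p (b b0 : 'rV[K]_p) (v : 'rV[K]_(p + p)) (T1 F1 A F : 'M[K]_p) (J : 'M[K]_(p + p, p)) (T D : 'M[K]_(p + p)) :
  T1 *m F1 = 1%:M -> b *m (T1^T *m A *m T1) = v *m T *m J -> b *m J^T = row_mx (b0 *m F^T) 0 + v *m T *m D ->
  b *m T1^T *m A = v *m (T *m J *m F1) /\ b *m T1^T *m (T *m J *m F1)^T = b0 *m (T *m col_mx 1%:M 0 *m F)^T + v *m (T *m D *m T^T).
Proof.
move=> TF b1 b2; split.
  by rewrite !mulmxA -b1 !mulmxA -(mulmxA _ T1) TF mulmx1.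
rewrite !trmx_mul !mulmxA -[b *m T1^T *m F1^T]mulmxA -trmx_mul (mulmx1C TF) trmx1 mulmx1 b2 mulmxDl.
by rewrite tr_col_mx trmx1 trmx0 mul_mx_row mulmx1 mulmx0.
Qed.

Section PoissonSpray.
Variables (m : nat) (M : premanifold R m) (Pi : M -> 'M[R]_m).
Hypotheses (hM : hmfd M) (hPi : forall x, poisson_pt Pi x).
Let CT := cotangent M.
Let hCT : hmfd CT := cot_hmfd hM.
Variable chi : CT -> 'rV_(m + m).
Hypothesis hchi : poisson_spray Pi chi.
Let pr := @cot_proj R m M.

Lemma cfield_smooth c (z : CT) : atlas c -> cdom c z -> smooth_at (cmap c z) (cfield chi c).
Proof.
move=> ac d; have [sx _ _] := hchi.
have oV : mopen (setT `&` (@idfun CT) @^-1` cdom c) by apply: (mopenI hCT (mopenT hCT)); exact: (mopen_cdom hCT ac).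
exact: (msm_chart hCT (smooth_on_msm hCT oV (sx c ac) (conj I d)) ac d).
Qed.

Definition expflow (z : CT) : R -> CT := choose_or (fun=> z) (fun g => integral_curve chi g /\ g 0 = z).
Definition expmap (z : CT) : M := pr (expflow z 1).
(* The form is [int_0^1 phi_t^* lambda dt], where [phi_t] is the flow of [chi] and [lambda] the Liouville form. *)
Definition expform_value (z : CT) (a : 'rV_(m + m)) := exists A : R -> 'rV_(m + m), [/\ A 0 = 0, A 1 = a &
  forall t : R, 0 <= t <= 1 -> is_derive t 1 A ((expflow z t).2 *m (mder (fun z' => pr (expflow z' t)) z)^T)].
Definition expform (z : CT) : 'rV_(m + m) := choose_or 0 (expform_value z).

Lemma chi_freg t z : freg (fun _ => chi) t z.
Proof.
have ac := at_atlas hCT z; have d := at_dom hCT z.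
exact: (cfield_freg t ac d (cfield_smooth ac d)).
Qed.

Lemma expflowE g z (t : R) : integral_curve chi g -> g 0 = z -> 0 <= t <= 1 -> expflow z t = g t.
Proof.
move=> cg g0 t01; have [|ch h0] := @choose_orP (R -> CT) (fun=> z) (fun g => integral_curve chi g /\ g 0 = z); first by exists g.
apply: (curve_unique hCT (X := fun _ => chi) cg _ ch _ t01); last by rewrite h0 g0.
by move=> s _; exact: chi_freg.
Qed.

Section InChart.
Variables (c : chart R (m + m) CT) (q : chart R m M).
Hypotheses (ac : atlas c) (hc : cot_bd c q (cdom q) (fun z : CT => z.2 *m (fcoord z.1 q)^T)).
Let P := pcoord q Pi.
Let aq : atlas q. Proof. by case: hc. Qed.
Let dE (z : CT) : cdom c z = cdom q z.1. Proof. by case: hc => _ _ _ [-> _ _]. Qed.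
Let mE (z : CT) : cdom q z.1 -> cmap c z = row_mx (cmap q z.1) (z.2 *m (fcoord z.1 q)^T).
Proof. by case: hc => _ _ _ [dd h _] dz; apply: h; rewrite dd. Qed.
Let iE (z : CT) : cdom q z.1 -> cinv c (cmap c z) = z.
Proof. by case: hc => _ _ _ [dd _ h] dz; apply: h; rewrite dd. Qed.

Lemma cot_inv w : cdom c (cinv c w) -> cmap c (cinv c w) = w ->
  [/\ cdom q (cinv c w).1, lsubmx w = cmap q (cinv c w).1 & rsubmx w = (cinv c w).2 *m (fcoord (cinv c w).1 q)^T].
Proof.
move=> d E; have dq : cdom q (cinv c w).1 by rewrite -dE.
by split => //; rewrite -{1}E (mE dq) ?row_mxKl ?row_mxKr.
Qed.

Lemma spray_lsub w : cdom c (cinv c w) -> cmap c (cinv c w) = w -> lsubmx (cfield chi c w) = rsubmx w *m P (lsubmx w).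
Proof.
move=> d E; have [dq El Er] := cot_inv d E; set z := cinv c w in d E dq El Er *.
have [_ sp _] := hchi; have := sp z; rewrite (bundle_mder hM (cot_bundle hM) hc ac d) => H.
have H2 := congr1 (mulmx^~ (tcoord z.1 q)) H; rewrite !mulmxA -(mulmxA _ (fcoord _ _)) in H2.
have E1 := ftcoord hM aq dq; rewrite (E1 : fcoord (pr z) q *m tcoord z.1 q = 1%:M) mulmx1 in H2.
have -> : lsubmx (cfield chi c w) = chi z *m tcoord z c *m col_mx 1%:M 0.
  by rewrite /cfield -/z -{2}[chi z *m tcoord z c]hsubmxK mul_row_col mulmx1 mulmx0 addr0.
rewrite H2 /P /pcoord El (cinvK hM aq dq) Er !mulmxA.
exact: (congr1 (fun a : 'rV_m => a *m Pi z.1 *m tcoord z.1 q) (esym (covec_cancel z.2 (tfcoord hM aq dq)))).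
Qed.

Lemma spray_homogeneous w (t : R) : 0 < t -> cdom c (cinv c w) -> cmap c (cinv c w) = w ->
  cfield chi c (row_mx (lsubmx w) (t *: rsubmx w)) = t *: row_mx (lsubmx (cfield chi c w)) (t *: rsubmx (cfield chi c w)).
Proof.
move=> t0 d E; have [dq El Er] := cot_inv d E; set z := cinv c w in d E dq El Er *.
have [_ _ hom] := hchi; have := hom t z t0.
set z' := cot_scale t z.
have dq' : cdom q z'.1 by [].
have d' : cdom c z' by rewrite dE.
have Ez' : cmap c z' = row_mx (lsubmx w) (t *: rsubmx w).
  by rewrite (mE dq') /= El Er scalemxAl.
pose S := @fscale m t; have sS w' : smooth_at w' S by exact: sm_fscale.
have nS : \forall y \near cmap c z, S y = cmap c (@cot_scale R m M t (cinv c y)).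
  apply: filterS (near_cdom hCT ac d) => y [d1 E1]; have [dq1 El1 Er1] := cot_inv d1 E1.
  by rewrite (mE (z := cot_scale t (cinv c y)) dq1) /S /fscale El1 Er1 /= scalemxAl.
have sscale : msmap (@cot_scale R m M t) z.
  apply: (msmapI hCT hCT ac d ac d'); last by apply: sm_ext nS (sS _).
  by apply: filterS (near_cdom hCT ac d) => y [d1 E1]; rewrite dE; have [] := cot_inv d1 E1.
rewrite (mderE hCT hCT sscale ac d ac d') => H.
have H2 := congr1 (mulmx^~ (tcoord z' c)) H.
rewrite -scalemxAl !mulmxA -(mulmxA _ (fcoord _ _)) (ftcoord hCT ac d') mulmx1 in H2.
have EJ : jacobian (cmap c \o @cot_scale R m M t \o cinv c) (cmap c z) = jacobian S (cmap c z).
  by apply: esym; apply: jac_near nS (sm_diff (sS _)).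
rewrite EJ in H2.
have JS (u : 'rV_(m + m)) : u *m jacobian S (cmap c z) = row_mx (lsubmx u) (t *: rsubmx u).
  by rewrite -(derive_mulE _ (sm_diff (sS _))); exact: derive_fscale.
rewrite JS in H2; rewrite {1}/cfield -Ez' (iE (z := z') dq') H2 /cfield -/z.
by [].
Qed.

(** Scaling momenta by 2 multiplies the momentum component of the field by 4. On the zero section
    that component therefore vanishes, and so does its derivative: base and fibre directions are
    eigenvectors of the scaling with eigenvalues 1 and 2, neither of them 4. *)
Lemma spray_zero w : cdom c (cinv c w) -> cmap c (cinv c w) = w -> rsubmx w = 0 ->
  cfield chi c w = 0 /\ forall u, 'D_u (cfield chi c) w = row_mx (rsubmx u *m P (lsubmx w)) 0.
Proof.
move=> d E p0; have [dq El Er] := cot_inv d E.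
have Sw : row_mx (lsubmx w) ((2 : R) *: rsubmx w) = w by rewrite p0 scaler0 -[RHS]hsubmxK p0.
have two0 : (0 : R) < 2 by [].
have Yl := spray_lsub d E; rewrite p0 mul0mx in Yl.
split.
  have := spray_homogeneous two0 d E; rewrite Sw => /(congr1 rsubmx).
  rewrite [rsubmx (2 *: _)]linearZ /= row_mxKr scalerA => H.
  rewrite -[LHS]hsubmxK Yl; have -> : rsubmx (cfield chi c w) = 0; last exact: row_mx0.
  move/eqP: H; rewrite -subr_eq0 -{1}[rsubmx _]scale1r -scalerBl scaler_eq0 (negbTE (one_neq_four)) => /eqP H1; exact: H1.
have sY : smooth_at w (cfield chi c) by rewrite -E; exact: cfield_smooth.
have nw := near_cdom hCT ac d; rewrite E in nw.
have eg : expgood (cfield chi c) P w.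
  have [sP aP jP] := poisson_pt_chart hM (hPi (cinv c w).1) aq dq.
  rewrite /expgood El; split => //; apply: filterS nw => y [d1 E1]; exact: spray_lsub.
move=> u; rewrite -[LHS]hsubmxK (lsub_derive_field u sY eg) p0 mul0mx addr0; congr row_mx.
pose S := @fscale m 2; have sS w' : smooth_at w' S by exact: sm_fscale.
have DS v : 'D_v S w = S v by exact: derive_fscale.
have sSw : S w = w by exact: Sw.
have H v : rsubmx ('D_(S v) (cfield chi c) w) = 4 *: rsubmx ('D_v (cfield chi c) w).
  have sYS : smooth_at (S w) (cfield chi c) by rewrite sSw.
  have E1 := derive_comp v (sm_diff (sS w)) (sm_diff sYS); rewrite DS sSw in E1.
  have [_ E2] := isd_rsub (smooth_isd v (sm_comp (sS w) sYS)).
  have [_ E3] := isd_rsub (smooth_isd v sY).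
  apply: (eq_trans (eq_trans (congr1 (fun a : 'rV_(m + m) => rsubmx a) (esym E1)) (esym E2))).
  apply: (eq_trans _ (congr1 (fun a : 'rV_m => 4 *: a) E3)).
  have s4 : smooth_at w (fun w => rsubmx (cfield chi c w)) by exact: sm_rsub.
  have E4 : 'D_v (fun w => 4 *: rsubmx (cfield chi c w)) w = 4 *: 'D_v (fun w => rsubmx (cfield chi c w)) w.
    by apply: deriveZ; apply: diff_derivable; exact: sm_diff.
  rewrite -E4; apply: derive_near; apply: filterS nw => y [d1 E5].
  rewrite /S /fscale (spray_homogeneous two0 d1 E5) [rsubmx (2 *: _)]linearZ /= row_mxKr scalerA.
  by congr (_ *: _); ring.
have dY := sm_diff sY.
have H0 v (k : R) : S v = k *: v -> k != 4 -> rsubmx ('D_v (cfield chi c) w) = 0.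
  move=> Sv k4; have := H v; rewrite Sv.
  have -> : 'D_(k *: v) (cfield chi c) w = k *: 'D_v (cfield chi c) w by rewrite !deriveE// linearZ.
  rewrite linearZ /= => /eqP; rewrite -subr_eq0 -scalerBl scaler_eq0 subr_eq0 (negbTE k4) /= => /eqP ->.
  by [].
rewrite -[u]hsubmxK -[row_mx _ _]addr0.
have -> : row_mx (lsubmx u) (rsubmx u) + 0 = row_mx (lsubmx u) 0 + row_mx 0 (rsubmx u).
  by rewrite addr0 add_row_mx addr0 add0r.
rewrite (derive_dir_add _ _ dY) linearD /=.
have e1 : S (row_mx (lsubmx u) 0) = 1 *: row_mx (lsubmx u) 0 by rewrite /S /fscale row_mxKl row_mxKr scaler0 scale1r.
have e2 : S (row_mx 0 (rsubmx u)) = 2 *: row_mx 0 (rsubmx u) by rewrite /S /fscale row_mxKl row_mxKr scale_row_mx scaler0.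
have n1 : (1 : R) != 4 by rewrite (eqr_nat R 1 4).
have n2 : (2 : R) != 4 by rewrite (eqr_nat R 2 4).
exact: (eq_trans (congr2 (fun a b : 'rV_m => a + b) (H0 _ 1 e1 n1) (H0 _ 2 e2 n2)) (addr0 _)).
Qed.
Lemma cot_zero z : cdom c z -> z.2 = 0 -> [/\ rsubmx (cmap c z) = 0, cmap c (cinv c (cmap c z)) = cmap c z & cdom c (cinv c (cmap c z))].
Proof. by move=> d z0; rewrite (cinvK hCT ac d) mE -?dE// row_mxKr z0 mul0mx. Qed.

Let domq (z : CT) : cdom c z -> cdom q z.1. Proof. by rewrite dE. Qed.

Lemma expform_near x0 r phi (r0 : 0 < r) (fl : flow_on (cfield chi c) 1 (ball x0 r) phi) z :
  (forall z, cdom c z -> ball x0 r (cmap c z) -> expform z = exp_form r0 fl (cmap c z) *m (tcoord z c)^T) ->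
  cdom c z -> ball x0 r (cmap c z) ->
  [/\ smooth_at (cmap c z) (exp_form r0 fl), \forall y \near cmap c z, exp_form r0 fl y = aform c expform y & asm expform z].
Proof.
move=> H d bz; have nb : \forall y \near cmap c z, ball x0 r y by apply: open_nbhs_nbhs; split => //; exact: open_ballrV.
have se : smooth_at (cmap c z) (exp_form r0 fl) by exact: exp_form_smooth.
have ne : \forall y \near cmap c z, exp_form r0 fl y = aform c expform y.
  apply: filterS2 nb (near_cdom hCT ac d) => y yb [dy Ey].
  by rewrite /aform H ?Ey// -mulmxA -trmx_mul (ftcoord hCT ac dy) trmx1 mulmx1.
by split => //; exists c; split => //; exact: sm_ext ne se.
Qed.

(** Zero covectors are rest points of the spray, so around them the flow in one canonical chart
    exists up to time one; by uniqueness of curves it computes the globally chosen [expflow] and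
    [expform]. *)
Lemma exp_local z0 : cdom c z0 -> z0.2 = 0 -> exists r phi (r0 : 0 < r) (fl : flow_on (cfield chi c) 1 (ball (cmap c z0) r) phi),
  forall z, cdom c z -> ball (cmap c z0) r (cmap c z) ->
  [/\ (forall t : R, 0 <= t <= 1 -> expflow z t = cinv c (phi t (cmap c z))) /\ integral_curve chi (expflow z) /\ expflow z 0 = z,
   forall t : R, `|t| <= 1 -> cdom c (cinv c (phi t (cmap c z))) /\ cmap c (cinv c (phi t (cmap c z))) = phi t (cmap c z),
   forall t : R, 0 <= t <= 1 -> msmap (fun z => pr (expflow z t)) z /\
     mder (fun z => pr (expflow z t)) z = tcoord z c *m lsubmx (jacobian (phi t) (cmap c z)) *m fcoord (pr (expflow z t)) q &
   expform z = exp_form r0 fl (cmap c z) *m (tcoord z c)^T].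
Proof.
move=> d z00; have sY := cfield_smooth ac d.
have [p0 E0 dd] := cot_zero d z00.
have chi0 : chi z0 = 0.
  have [H _] := spray_zero dd E0 p0; have := congr1 (mulmx^~ (fcoord z0 c)) H.
  rewrite /cfield (cinvK hCT ac d) -mulmxA (tfcoord hCT ac d) mulmx1 mul0mx.
  by [].
have [r [phi [r0 fl H]]] := rest_flow_auto hCT ac d ltr01 sY chi0.
have oB := @open_ballrV _ (cmap c z0) r r0.
exists r, phi, r0, fl => z dz bz.
have flowE z' (t : R) : cdom c z' -> ball (cmap c z0) r (cmap c z') -> 0 <= t <= 1 -> expflow z' t = cinv c (phi t (cmap c z')).
  move=> dz' bz' t01; have [_ _ _ cv] := H _ bz'.
  by apply: (expflowE cv) => //; rewrite (fl _ bz').1 (cinvK hCT ac dz').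
have nb : \forall y \near cmap c z, ball (cmap c z0) r y by apply: open_nbhs_nbhs.
have flowN (t : R) : 0 <= t <= 1 -> \forall y \near cmap c z, pr (expflow (cinv c y) t) = pr (cinv c (phi t y)) /\
     cdom q (pr (cinv c (phi t y))) /\ cmap q (pr (cinv c (phi t y))) = lsubmx (phi t y).
  move=> /andP[t0 t1]; apply: filterS nb => y yb; have [dy Ey Ht _] := H y yb.
  have t1' : `|t| <= 1 by rewrite ger0_norm.
  rewrite flowE ?Ey ?t0//; have [_ d1 E1] := Ht t t1'; split => //.
  by have [h1 h2 _] := cot_inv d1 E1; split; [exact: h1|exact: esym].
have sphi (t : R) : `|t| <= 1 -> smooth_at (cmap c z) (phi t) by move=> t1; exact: (flow_smooth ler01 oB fl bz).
have sm (t : R) : 0 <= t <= 1 -> msmap (fun z => pr (expflow z t)) z /\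
     mder (fun z => pr (expflow z t)) z = tcoord z c *m lsubmx (jacobian (phi t) (cmap c z)) *m fcoord (pr (expflow z t)) q.
  move=> t01; have /andP[t0 t1] := t01; have t1' : `|t| <= 1 by rewrite ger0_norm.
  have sl : smooth_at (cmap c z) (fun y => lsubmx (phi t y)) by apply: sm_lsub; exact: sphi.
  have dq : cdom q (pr (expflow z t)).
    by rewrite flowE//; have [_ [h _]] := nbhs_singleton (flowN t t01); exact: h.
  have s1 : msmap (fun z => pr (expflow z t)) z.
    apply: (msmapI hCT hM ac dz aq dq).
      by apply: filterS (flowN t t01) => y [-> [h _]]; exact: h.
    by apply: sm_ext sl; apply: filterS (flowN t t01) => y [-> [_ h]].
  split; first exact: s1.
  rewrite (mderE hCT hM s1 ac dz aq dq); congr (_ *m _ *m _).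
  apply: (eq_trans (y := jacobian (fun y => lsubmx (phi t y)) (cmap c z))).
    apply: esym; apply: (jac_near _ (sm_diff sl)); apply: filterS (flowN t t01) => y [h1 [_ h2]].
    by rewrite /= h1 h2.
  apply/row_matrixP => i; rewrite row_jac; last exact: sm_diff sl.
  have [_ ->] := isd_lsub (smooth_isd (delta_mx 0 i) (sphi t t1')).
  by rewrite (derive_mulE _ (sm_diff (sphi t t1'))) -rowE; apply/rowP => l; rewrite !mxE.
have [_ _ Ht cv] := H _ bz.
have ic : integral_curve chi (expflow z) /\ expflow z 0 = z.
  apply: (@choose_orP (R -> CT) (fun=> z) (fun g => integral_curve chi g /\ g 0 = z)).
  by exists (fun t => cinv c (phi t (cmap c z))); split; [exact: cv|rewrite (fl _ bz).1 (cinvK hCT ac dz)].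
split => //.
- by split => // t t01; exact: flowE.
- by move=> t t1; have [] := Ht t t1.
have [A0 dA] := form_flowP r0 fl (fun x (xb : ball (cmap c z0) r x) (t : R) (t1 : `|t| <= 1) => sm_liou (phi t x)) bz.
set FF := form_flow _ _ _ in A0 dA.
pose A (t : R) := FF t (cmap c z) *m (tcoord z c)^T.
have dA' (t : R) : 0 <= t <= 1 -> is_derive t 1 A ((expflow z t).2 *m (mder (fun z' => pr (expflow z' t)) z)^T).
  move=> t01; have /andP[t0 t1] := t01; have t1' : `|t| <= 1 by rewrite ger0_norm.
  have [_ ->] := sm t t01; have h := is_derive_mulmxr (tcoord z c)^T (dA t t1').
  suff E : liou (phi t (cmap c z)) *m (jacobian (phi t) (cmap c z))^T *m (tcoord z c)^T =
     (expflow z t).2 *m (tcoord z c *m lsubmx (jacobian (phi t) (cmap c z)) *m fcoord (pr (expflow z t)) q)^T by rewrite -E.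
  have [_ d1 E1] := Ht t t1'; have [_ _ h2] := cot_inv d1 E1; rewrite -(flowE z t dz bz t01) in h2.
  rewrite /liou h2 /pr /cot_proj; move: (fcoord _ q) (jacobian _ _) (tcoord z c) (expflow z t).2 => F J T p.
  by rewrite -{1}[J]hsubmxK tr_row_mx mul_row_col mul0mx addr0 !trmx_mul !mulmxA.
have [|B [B0 B1 dB]] := @choose_orP _ 0 (expform_value z).
  by exists (A 1), A; split => //; rewrite /A A0 mul0mx.
rewrite /expform -B1; apply/eqP; rewrite -subr_eq0; apply/eqP.
have B00 : B 0 - A 0 = 0 by rewrite B0 /A A0 mul0mx subrr.
rewrite -B00; apply: (@derive0_const 1 _ (fun s => B s - A s) 0 1 ler01) => t t01.
by have := is_deriveB (dB t t01) (dA' t t01); rewrite subrr.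
Qed.

Lemma exp_near z0 : cdom c z0 -> z0.2 = 0 -> exists W, [/\ mopen W, W z0 & forall z, W z ->
  [/\ msmap expmap z, asm expform z, exp_rel chi z (expmap z) & forall (v : 'rV_(m + m)) (b0 : 'rV_m), b0 *m Pi z.1 = v *m mder pr z ->
     exists b : 'rV_m, b *m Pi (expmap z) = v *m mder expmap z /\
       b *m (mder expmap z)^T = b0 *m (mder pr z)^T + v *m mdform expform z]].
Proof.
move=> d z00; have [r [phi [r0 [fl H]]]] := exp_local d z00.
have I01 : (0 : R) <= 1 <= (1 : R) by rewrite ler01 lexx.
have one1 : `|1 : R| <= 1 by rewrite normr1.
have oB := @open_ballrV _ (cmap c z0) r r0.
have oW := mopen_chart hCT ac oB.
exists [set z | cdom c z /\ ball (cmap c z0) r (cmap c z)]; split => //; first by split => //; exact: ballxx.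
move=> z [dz bz]; have [[flE [ic i0]] Ht /(_ 1 I01)[sE mE1] fE] := H z dz bz.
have [se ne sA] := expform_near (fun z dz bz => let: And4 _ _ _ E := H z dz bz in E) dz bz.
split => //; first by exists (expflow z).
move=> v b0 hb.
pose F := fcoord z.1 q; pose T := tcoord z c; pose F' := fcoord (expmap z) q; pose T' := tcoord (expmap z) q.
have dq := domq dz; have TF := tfcoord hM aq dq.
have d1 : cdom c (expflow z 1) by rewrite flE//; have [] := Ht 1 one1.
have dq1 : cdom q (expmap z) := domq d1; have TF1 := tfcoord hM aq dq1.
have [dz' Ez'] : cdom c (cinv c (cmap c z)) /\ cmap c (cinv c (cmap c z)) = cmap c z by rewrite (cinvK hCT ac dz).
have eg (t : R) : `|t| <= 1 -> expgood (cfield chi c) P (phi t (cmap c z)).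
  move=> t1; have [d2 E2] := Ht t t1; have [dq2 E3 _] := cot_inv d2 E2.
  have [sP aP jP] := poisson_pt_chart hM (hPi (cinv c (phi t (cmap c z))).1) aq dq2.
  rewrite /expgood E3; split; [exact: sP|exact: aP|exact: jP|].
  have := near_cdom hCT ac d2; rewrite E2 => nw; apply: filterS nw => y [d3 E4].
  exact: (spray_lsub d3 E4).
have PE x (y : 'rV_m) : cdom q x -> y = cmap q x -> P y = (tcoord x q)^T *m Pi x *m tcoord x q.
  by move=> dx ->; exact: (pcoord_at hM).
have [h1 h2 _] := cot_inv dz' Ez'; rewrite (cinvK hCT ac dz) in h1 h2.
have mp := bundle_mder hM (cot_bundle hM) hc ac dz.
have bP : b0 *m F^T *m P (lsubmx (cmap c z)) = lsubmx (v *m T).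
  rewrite (PE _ _ h1 h2); move: hb; rewrite mp -/T /F; move: (tcoord z.1 q) TF => T0 TF.
  rewrite -[fcoord (cot_proj z) q]/(fcoord z.1 q); move: (fcoord z.1 q) TF => F0 TF hb.
  have FT := mulmx1C TF.
  rewrite !mulmxA -[_ *m F0^T *m T0^T]mulmxA -trmx_mul TF trmx1 mulmx1 hb -!mulmxA FT mulmx1.
  by rewrite mulmxA -{1}[v *m T]hsubmxK mul_row_col mulmx1 mulmx0 addr0.
have [b [b1 b2]] := exp_homotopy r0 fl bz eg bP.
have [d2 E2] := Ht 1 one1; have [dq2 E3 _] := cot_inv d2 E2.
have eE : expmap z = (cinv c (phi 1 (cmap c z))).1 by rewrite /expmap flE.
have PE1 := PE (expmap z) (lsubmx (phi 1 (cmap c z))) dq1; rewrite {1}eE in PE1; have {}PE1 := PE1 E3.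
rewrite PE1 in b1.
have mE' : mder expmap z = T *m lsubmx (jacobian (phi 1) (cmap c z)) *m F' by exact: mE1.
have dE' : mdform expform z = T *m extd (exp_form r0 fl) (cmap c z) *m T^T.
  rewrite (mdform_chart hCT sA ac dz) (extd_near ne se).
  by [].
exists (b *m T'^T); rewrite mE' dE' mp.
exact: (exp_transport TF1 b1 b2).
Qed.

Lemma exp_at_zero z0 : cdom c z0 -> z0.2 = 0 -> [/\ expmap z0 = z0.1, expform z0 = 0 &
  forall v w : 'rV_(m + m), let v' := v *m tcoord z0 c in let w' := w *m tcoord z0 c in
    v *m mdform expform z0 *m w^T =
    rsubmx v' *m (lsubmx w')^T - rsubmx w' *m (lsubmx v')^T - rsubmx v' *m P (cmap q z0.1) *m (rsubmx w')^T].
Proof.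
move=> d z00; have [r [phi [r0 [fl H]]]] := exp_local d z00.
have I01 : (0 : R) <= 1 <= (1 : R) by rewrite ler01 lexx.
have bz : ball (cmap c z0) r (cmap c z0) by exact: ballxx.
have [se ne sA] := expform_near (fun z dz bz => let: And4 _ _ _ E := H z dz bz in E) d bz.
have [[flE _] _ _ fE] := H z0 d bz.
have [p0 E0 dd] := cot_zero d z00.
have [Y0 DY] := spray_zero dd E0 p0.
have dq := domq d; have [sP aP jP] := poisson_pt_chart hM (hPi z0.1) aq dq.
have [_ El _] := cot_inv dd E0; rewrite (cinvK hCT ac d) in El.
have sP' : smooth_at (lsubmx (cmap c z0)) P by rewrite El; exact: sP.
have aP' : (P (lsubmx (cmap c z0)))^T = - P (lsubmx (cmap c z0)) by rewrite El; exact: (nbhs_singleton aP).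
have [ph ef df] := exp_rest r0 fl bz Y0 p0 sP' aP' DY.
split.
- by rewrite /expmap flE// ph (cinvK hCT ac d).
- by rewrite fE ef mul0mx.
move=> v w v' w'; rewrite (mdform_chart hCT sA ac d) -(extd_near ne se) -El -df /v' /w' trmx_mul !mulmxA.
by [].
Qed.
End InChart.
End PoissonSpray.

(** * Linear algebra of frames *)

Section Vspaces.
Variables (n : nat).

Lemma basis_rows (W : {vspace 'rV_n}) r (S : 'M[R]_(r, n)) : row_free S -> (forall v, (v \in W) = (v <= S)%MS) ->
  basis_of W [tuple row a S | a < r].
Proof.
move=> fS WE; set X := [tuple row a S | a < r].
have XE (a : 'I_r) : X`_a = row a S by rewrite -tnth_nth tnth_mktuple.
have sumE (u : 'I_r -> R) : \sum_a u a *: X`_a = (\row_a u a) *m S.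
  by rewrite mulmx_sum_row; apply: eq_bigr => a _; rewrite XE mxE.
rewrite /basis_of; apply/andP; split.
  rewrite eqEsubv; apply/andP; split.
    by apply/span_subvP => v /tnthP[a ->]; rewrite tnth_mktuple WE row_sub.
  apply/subvP => v; rewrite WE => /submxP[u ->].
  have -> : u *m S = \sum_a u 0 a *: X`_a.
    by rewrite sumE; congr (_ *m _); apply/rowP => a; rewrite mxE.
  by apply: memv_suml => a _; apply: memvZ; apply: memv_span; apply: mem_nth; rewrite size_tuple.
apply/freeP => u E a; rewrite sumE in E.
have : (\row_a u a) = 0 by apply/eqP; rewrite -(mulmx_free_eq0 _ fS); apply/eqP.
by move=> /rowP/(_ a); rewrite !mxE.
Qed.

Lemma dim_rank (W : {vspace 'rV_n}) p (A : 'M[R]_(p, n)) : (forall v, (v \in W) = (v <= A)%MS) -> \dim W = \rank A.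
Proof.
move=> WE; have h : forall v, (v \in W) = (v <= row_base A)%MS by move=> v; rewrite WE eq_row_base.
have := size_basis (basis_rows (row_base_free A) h).
by [].
Qed.

Lemma basis_rows_dim (W : {vspace 'rV_n}) r (S : 'M[R]_(r, n)) : row_free S -> (forall a, row a S \in W) -> \dim W = r ->
  basis_of W [tuple row a S | a < r].
Proof.
move=> fS SW dW; set X := [tuple row a S | a < r].
have h := basis_rows fS (W := <<X>>%VS); have sX : (<<X>> <= W)%VS.
  by apply/span_subvP => v /tnthP[a ->]; rewrite tnth_mktuple.
have fX : free X.
  apply/freeP => u E a; have sumE : \sum_a u a *: X`_a = (\row_a u a) *m S.
    by rewrite mulmx_sum_row; apply: eq_bigr => b _; rewrite -tnth_nth tnth_mktuple mxE.
  rewrite sumE in E; have : (\row_a u a) = 0 by apply/eqP; rewrite -(mulmx_free_eq0 _ fS); apply/eqP.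
  by move=> /rowP/(_ a); rewrite !mxE.
by rewrite basisEfree fX sX size_tuple dW leqnn.
Qed.

Lemma mem_limg_mx p (A : 'M[R]_(p, n)) v : (v \in limg (linfun (mulmxr A) : 'Hom('rV_p, 'rV_n))) = (v <= A)%MS.
Proof.
apply/memv_imgP/submxP => [[u _ ->]|[u ->]]; first by exists u; rewrite lfunE.
by exists u; rewrite ?memvf// lfunE.
Qed.
End Vspaces.

(** Constants [s] and [c] are chosen with [s A c] the identity at [x], hence invertible nearby. By
    constant rank the rows of [s A] still span those of [A] near [x], and subtracting from [K0] its
    component along [s] brings it back into the kernel. *)
Lemma kernel_frame d n l p (A : 'rV_d -> 'M[R]_(p, l)) x rho (K0 : 'M[R]_(n, p)) : smooth_at x A ->
  (\forall y \near x, \rank (A y) = rho) -> K0 *m A x = 0 ->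
  exists K : 'rV_d -> 'M[R]_(n, p), [/\ smooth_at x K, K x = K0 & \forall y \near x, K y *m A y = 0].
Proof.
move=> sA rA KA.
have [s sE] := row_fullP (col_base_full (A x)); have [c cE] := row_freeP (row_base_free (A x)).
have E1 : s *m A x *m c = 1%:M.
  apply: (eq_trans (congr1 (fun X => s *m X *m c) (esym (mulmx_base (A x))))).
  by rewrite mulmxA sE mul1mx.
pose M y := s *m A y *m c.
have sM : smooth_at x M by apply: sm_mulmx (sm_cst x c); exact: sm_mulmx (sm_cst x s) sA.
have uM : M x \in unitmx by rewrite /M E1 unitmx1.
pose K y := K0 - K0 *m A y *m c *m invmx (M y) *m s.
exists K; split.
- apply: smB; first exact: sm_cst.
  apply: sm_mulmx (sm_cst x s); apply: sm_mulmx (sm_invmx uM sM).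
  by apply: sm_mulmx (sm_cst x c); exact: sm_mulmx (sm_cst x K0) sA.
- by rewrite /K KA !mul0mx subr0.
have rAx : \rank (A x) = rho := nbhs_singleton rA.
apply: filterS2 rA (near_unitmx sM uM) => y ry uy.
have sub : (A y <= s *m A y)%MS.
  have h : (s *m A y <= A y)%MS by exact: submxMl.
  have h2 := mxrank_leqif_sup h; rewrite -(geq_leqif h2) ry -rAx.
  have E2 : \rank (M y) = \rank (A x) by exact: mxrank_unit.
  have h3 : (\rank (M y) <= \rank (s *m A y))%N by exact: mxrankM_maxl.
  by move: h3; rewrite E2.
have [X EX] := submxP sub.
have XE : X = A y *m c *m invmx (M y) by rewrite [in RHS]EX -!mulmxA -/(M y) [s *m _]mulmxA [s *m A y *m _]mulmxA -/(M y) mulmxV// mulmx1.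
rewrite mulmxBl -!mulmxA [A y *m (c *m _)]mulmxA [A y *m c *m (_ *m _)]mulmxA -XE -EX subrr.
by [].
Qed.

Lemma rank_conj (K : fieldType) p n (A : 'M[K]_p) (B : 'M[K]_(p, n)) (C : 'M[K]_n) : A \in unitmx -> C \in unitmx ->
  \rank (A *m B *m C) = \rank B.
Proof.
move=> uA uC; rewrite mxrankMfree ?row_free_unit//; apply: eqmx_rank; apply/eqmxP.
by apply: eqmxMfull; rewrite row_full_unit.
Qed.

Lemma lift_conj (K : fieldType) l p n (a : 'M[K]_(l, n)) (v : 'M[K]_(l, p)) (T F : 'M[K]_p) (T1 F1 A : 'M[K]_n) (D : 'M[K]_(p, n)) :
  T *m F = 1%:M -> T1 *m F1 = 1%:M -> a *m A = v *m D -> a *m F1^T *m (T1^T *m A *m T1) = v *m T *m (F *m D *m T1).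
Proof.
move=> TF TF1 E; rewrite !mulmxA -[a *m _ *m _]mulmxA -trmx_mul TF1 trmx1 mulmx1 E.
by rewrite -[v *m T *m _]mulmxA TF mulmx1.
Qed.

(** * Linear algebra of a pulled-back and gauged Lagrangian subspace *)

Section Lagrangian.
Variables (K : fieldType).

(** The subspace is isotropic and contains the rows of [(V, Q)]. With [Q] invertible, pairing an
    element with these rows already determines its vector part from its covector part. *)
Lemma lagr_graph n m (JF : 'M[K]_(n, m)) (Pi : 'M[K]_m) (eta V : 'M[K]_n) (b : 'M[K]_(n, m)) : Pi^T = - Pi -> eta^T = - eta ->
  V *m JF = b *m Pi -> b *m JF^T + V *m eta \in unitmx -> forall v a : 'rV[K]_n,
  (exists2 b', v *m JF = b' *m Pi & a = b' *m JF^T + v *m eta) <-> v = a *m (invmx (b *m JF^T + V *m eta) *m V).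
Proof.
move=> aP ae VE uQ v a; set Q := _ + _ in uQ *; split => [[b' h1 h2]|->]; last first.
  exists (a *m invmx Q *m b); first by rewrite -!mulmxA VE.
  by rewrite -!mulmxA -mulmxDr -mulmxDr -/Q mulVmx// mulmx1.
have E p (v1 a1 : 'M[K]_(p, n)) (b1 : 'M[K]_(p, m)) : v1 *m JF = b1 *m Pi -> a1 = b1 *m JF^T + v1 *m eta -> a1 *m V^T = - (v1 *m Q^T).
  move=> e1 ->; apply/eqP; rewrite -addr_eq0 /Q [(_ + V *m eta)^T]linearD /= !trmx_mul trmxK ae mulmxDl mulmxDr.
  rewrite mulNmx !mulmxN -!mulmxA addrACA subrr addr0 -trmx_mul VE trmx_mul aP mulNmx mulmxN !mulmxA e1.
  by rewrite addNr.
have E1 := E _ v a b' h1 h2; have E2 := E _ V Q b VE erefl.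
have uQT : Q^T \in unitmx by rewrite unitmx_tr.
apply: (can_inj (mulmxK uQT)); rewrite -[LHS]opprK -E1 !mulmxA -[a *m _ *m V *m Q^T]mulmxA.
have -> : V *m Q^T = - (Q *m V^T) by rewrite E2 opprK.
by rewrite mulmxN mulmxA mulmxKV.
Qed.

Lemma rank_alt_tr n m (JF : 'M[K]_(n, m)) (Pi : 'M[K]_m) : Pi^T = - Pi -> \rank (row_mx JF^T Pi) = \rank (col_mx JF Pi).
Proof.
move=> aP; rewrite -[LHS]mxrank_tr tr_row_mx trmxK aP -addsmxE -[RHS]addsmxE.
by apply/eqmx_rank; apply/eqmxP; apply: adds_eqmx => //; exact: eqmx_opp.
Qed.

(** Solutions of [v JF = b Pi] form a space of dimension [m], and the map to the covector part has
    kernel of dimension at most [m - n] once its elements have [v = 0]. The image is then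
    everything, so the identity matrix can be hit. *)
Lemma lagr_frame n m (JF : 'M[K]_(n, m)) (Pi : 'M[K]_m) (eta : 'M[K]_n) : \rank (col_mx JF Pi) = n -> Pi^T = - Pi ->
  (forall (v : 'rV[K]_n) (b : 'rV[K]_m), v *m JF = b *m Pi -> b *m JF^T = - v *m eta -> v = 0) ->
  exists V b, V *m JF = b *m Pi /\ b *m JF^T + V *m eta = 1%:M.
Proof.
move=> rk aP H; pose A := col_mx JF (- Pi); pose B := col_mx eta JF^T.
have rA : \rank A = n.
  apply: (eq_trans _ rk); apply/eqmx_rank; apply/eqmxP.
  apply: (eqmx_trans (eqmx_sym (addsmxE _ _))); apply: (eqmx_trans _ (addsmxE _ _)).
  by apply: adds_eqmx => //; exact: eqmx_opp.
suff fB : row_full (kermx A *m B).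
  have [Z ZE] := row_fullP fB; pose Y := Z *m kermx A.
  have YA : Y *m A = 0 by rewrite /Y -mulmxA mulmx_ker mulmx0.
  have YB : Y *m B = 1%:M by rewrite /Y -mulmxA.
  exists (lsubmx Y), (rsubmx Y); split.
    by move: YA; rewrite -{1}[Y]hsubmxK mul_row_col mulmxN => /eqP; rewrite subr_eq0 => /eqP.
  by move: YB; rewrite -{1}[Y]hsubmxK mul_row_col addrC.
have rK : \rank (kermx A) = m by rewrite mxrank_ker rA addKn.
have nm : (n <= m)%N by rewrite -[X in (X <= _)%N]rk rank_leq_col.
have rI : (\rank (kermx A :&: kermx B)%MS <= m - n)%N.
  pose N := kermx (row_mx JF^T Pi).
  have -> : (m - n = \rank N)%N by rewrite mxrank_ker (rank_alt_tr _ aP) rk.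
  apply: (leq_trans _ (mxrankM_maxl N (row_mx (0 : 'M[K]_(m, n)) (1%:M : 'M[K]_m)))); apply: mxrankS.
  apply/rV_subP => w; rewrite sub_capmx => /andP[/sub_kermxP wA /sub_kermxP wB].
  rewrite -[w]hsubmxK in wA wB *; move: (lsubmx w) (rsubmx w) wA wB => v b; rewrite !mul_row_col mulmxN => /eqP.
  rewrite subr_eq0 => /eqP h1 /eqP; rewrite addrC addr_eq0 -mulNmx => /eqP h2.
  have v0 := H v b h1 h2; subst v; rewrite mul0mx in h1; rewrite oppr0 mul0mx in h2.
  have : (b <= N)%MS by apply/sub_kermxP; rewrite mul_mx_row h2 -h1 row_mx0.
  by move=> /submxP[D ->]; apply/submxP; exists D; rewrite mulmxA mul_mx_row mulmx0 mulmx1.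
have := mxrank_mul_ker (kermx A) B; rewrite rK => rE.
by rewrite /row_full eqn_leq rank_leq_col /=; lia.
Qed.

(** [S] is a frame of the orthogonal, lifted to conormal covectors [N]. The base part of the second
    equation reads [b J^T = y K1^T]; pairing it with [S] gives [y], and rewriting [S J] as [N Pi]
    gives zero. Then [b] is conormal, [u] lies in the span of [S], and [u K1 = 0] removes it. *)
Lemma lagr_trivial k r m (J : 'M[K]_(k, m)) (S : 'M[K]_(r, k)) (N : 'M[K]_(r, m)) (Pi : 'M[K]_m) (K1 : 'M[K]_(k, r)) s :
  Pi^T = - Pi -> N *m J^T = 0 -> N *m Pi = S *m J -> (forall u b : 'rV[K]_ _, u *m J = b *m Pi -> b *m J^T = 0 -> (u <= S)%MS) ->
  S *m K1 = 1%:M -> forall (v : 'rV[K]_(k + r)) (b : 'rV[K]_m), v *m col_mx J 0 = b *m Pi ->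
   b *m (col_mx J 0)^T = - v *m block_mx 0 K1 (- K1^T) s -> v = 0.
Proof.
move=> aP NJ NP HS SK v b; rewrite -[v]hsubmxK; move: (lsubmx v) (rsubmx v) => u y {v}.
rewrite mul_row_col mulmx0 addr0 tr_col_mx trmx0 mul_mx_row mulmx0 opp_row_mx mul_row_block => h1 /eq_row_mx[h2 h3].
rewrite mulmx0 add0r mulmxN mulNmx opprK in h2.
have y0 : y = 0.
  have : b *m J^T *m S^T = 0.
    rewrite -mulmxA -trmx_mul -NP trmx_mul aP mulNmx mulmxN mulmxA -h1 -mulmxA.
    by rewrite -[J *m N^T]trmxK trmx_mul trmxK NJ trmx0 mulmx0 oppr0.
  by rewrite h2 -mulmxA -trmx_mul SK trmx1 mulmx1.
subst y; rewrite mul0mx in h2; rewrite oppr0 mul0mx addr0 in h3.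
have [c Ec] := submxP (HS u b h1 h2).
have : u *m K1 = 0 by apply/eqP; rewrite -oppr_eq0 -mulNmx -h3.
by rewrite Ec -mulmxA SK mulmx1 => ->; rewrite mul0mx row_mx0.
Qed.
End Lagrangian.

Section DualIncl.
Variables (n r : nat) (W C : {vspace 'rV_n}).
Hypothesis WC : complement W C fullv.
Implicit Type xi : dual_fiber W.

Lemma dual_inclE xi v : dual_incl C xi *m v^T = (dual_eval xi (daddv_pi W C v))%:M.
Proof.
apply/matrixP => a b; rewrite !ord1 !mxE eqxx mulr1n {2}(row_sum_delta v) linear_sum dual_eval_sum.
by apply: eq_bigr => l _; rewrite linearZ dual_evalZ !mxE mulrC.
Qed.

Lemma dual_incl_in xi v : v \in W -> dual_incl C xi *m v^T = (dual_eval xi v)%:M.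
Proof. by move=> vW; rewrite dual_inclE daddv_pi_id//; case: WC. Qed.

Lemma dual_incl_out xi v : v \in C -> dual_incl C xi *m v^T = 0.
Proof.
move=> vC; have [W0 WT] := WC; rewrite dual_inclE.
have CW0 : (C :&: W = 0)%VS by rewrite capvC.
have /(congr1 (fun u => u - daddv_pi C W v)) : daddv_pi W C v + daddv_pi C W v = v by rewrite daddv_pi_add// WT memvf.
rewrite addrK (daddv_pi_id CW0 vC) subrr => ->.
by rewrite dual_eval0; exact: raddf0.
Qed.

(** The extended form is fixed by its values on a frame of [W] and by vanishing on a frame of [C];
    the Gram matrix solves these equations by a smooth formula. *)
Lemma dual_incl_frame r' (S : 'M[R]_(r, n)) (B : 'M[R]_(r', n)) (T F : 'M[R]_n) : T *m F = 1%:M ->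
  basis_of W [tuple row a S | a < r] -> basis_of C [tuple row a B | a < r'] ->
  let Bt := col_mx S B *m T in Bt^T *m Bt \in unitmx /\
  forall xi, dual_incl C xi *m F^T = row_mx (\row_a dual_eval xi (row a S)) 0 *m Bt *m invmx (Bt^T *m Bt).
Proof.
move=> TF bS bB Bt.
have inS a : row a S \in W by exact: (@basis_memv n r W (fun a => row a S) bS).
have inB a : row a B \in C by exact: (@basis_memv n r' C (fun a => row a B) bB).
have full : row_full (col_mx S B).
  rewrite -sub1mx; apply/rV_subP => v _; have [_ WT] := WC.
  have /memv_addP[w wW [c cC ->]] : v \in (W + C)%VS by rewrite WT memvf.
  rewrite -addsmxE; apply: addmx_sub_adds.
    rewrite (@basis_coords n r W (fun a => row a S) bS w wW); apply: summx_sub => a _.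
    by apply: scalemx_sub; exact: row_sub.
  rewrite (@basis_coords n r' C (fun a => row a B) bB c cC); apply: summx_sub => a _.
  by apply: scalemx_sub; exact: row_sub.
have [uT _] := mulmx1_unit TF.
have uG : Bt^T *m Bt \in unitmx.
  rewrite -{2}[Bt]trmxK; apply: gram_unit; rewrite /row_free mxrank_tr.
  by rewrite mxrankMfree ?row_free_unit.
split => // xi; apply: (can_inj (mulmxK uG)); rewrite mulmxKV//.
rewrite mulmxA; congr (_ *m _); rewrite trmx_mul !mulmxA -[_ *m F^T *m T^T]mulmxA -trmx_mul TF trmx1 mulmx1 tr_col_mx mul_mx_row.
congr row_mx; apply/rowP => a.
  have := dual_incl_in xi (inS a) => /matrixP/(_ 0 0); rewrite !mxE eqxx mulr1n => <-.
  by apply: eq_bigr => l _; rewrite !mxE.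
have H := congr1 (fun A : 'M[R]_1 => A 0 0) (dual_incl_out xi (inB a)); rewrite !mxE in H; rewrite !mxE.
by apply: etrans H; apply: eq_bigr => l _; rewrite !mxE.
Qed.
End DualIncl.

(** The rows of [K] are the dual frame of [S], extended by zero on [C], in the coordinates of [c];
    hence the relation [S K^T = 1]. *)
Lemma dual_incl_local (k p r : nat) (X : premanifold R k) (N : premanifold R p) (F : X -> N) (W C : X -> {vspace 'rV_p})
  (hX : hmfd X) (hN : hmfd N) (sF : forall x, msmap F x) (WC : forall x, complement (W x) (C x) fullv) (hC : subbundle F C)
  x c (S : X -> 'M[R]_(r, p)) (U : set X) : atlas c -> cdom c (F x) -> mopen U -> U x ->
  (forall z, U z -> basis_of (W z) [tuple row a (S z) | a < r]) -> (forall z, U z -> cdom c (F z) -> msm (fun z => S z *m tcoord (F z) c) z) ->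
  exists V (K : X -> 'M[R]_(r, p)), [/\ mopen V, V x, forall z, V z -> U z /\ cdom c (F z) &
    forall z, V z -> [/\ msm K z, S z *m tcoord (F z) c *m (K z)^T = 1%:M & forall xi : dual_fiber (W z),
      dual_incl (C z) xi *m (fcoord (F z) c)^T = (\row_a dual_eval xi (row a (S z))) *m K z]].
Proof.
move=> ac dc oU Ux bS sS; have [r' /(_ x)[U' [g [oU' Ux' [sg bg]]]]] := hC.
have [Uc [oUc Uxc HUc]] := (sF x).1 _ (mopen_cdom hN ac) dc.
pose B z := \matrix_(b < r') g b z; pose Bt z := col_mx (S z) (B z) *m tcoord (F z) c.
pose K z := row_mx (1%:M : 'M[R]_r) (0 : 'M[R]_(r, r')) *m Bt z *m invmx ((Bt z)^T *m Bt z).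
have bB z : U' z -> basis_of (C z) [tuple row b (B z) | b < r'].
  move=> Uz; have -> : [tuple row b (B z) | b < r'] = [tuple g b z | b < r']; last exact: bg.
  by apply: eq_from_tnth => b; rewrite !tnth_mktuple rowK.
exists (U `&` U' `&` Uc), K; split; first by apply: (mopenI hX) => //; exact: (mopenI hX).
- by [].
- by move=> z [[Uz _] /HUc dz].
move=> z [[Uz Uz'] /HUc dz]; have TF := tfcoord hN ac dz.
have [uG E] := dual_incl_frame (WC z) TF (bS z Uz) (bB z Uz').
have EK (xi : dual_fiber (W z)) : dual_incl (C z) xi *m (fcoord (F z) c)^T = (\row_a dual_eval xi (row a (S z))) *m K z.
  by rewrite E /K !mulmxA mul_mx_row mulmx1 mulmx0.
have mB : msm (fun z => B z *m tcoord (F z) c) z.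
  have aq := at_atlas hX z; have dq := at_dom hX z; exists (chart_at z); split => //; apply: sm_mx => b j.
  have [V [oV Vz HV]] := (sF z).1 _ (mopen_cdom hN ac) dz.
  have oV' : mopen (U' `&` F @^-1` cdom c).
    apply: (mopen_local hX) => y [Uy dy]; have [V' [oV1 Vy HV']] := (sF y).1 _ (mopen_cdom hN ac) dy.
    by exists (U' `&` V'); split => //; [exact: (mopenI hX)|move=> y' [Uy' /HV']].
  have H := msm_chart hX (smooth_on_msm hX oV' (sg b c ac) (conj Uz' dz)) aq dq.
  apply: sm_ext (sm_coord 0 j H); near=> y; rewrite /B; move: (tcoord _ c) => T.
  by rewrite !mxE; apply: eq_bigr => l _; rewrite mxE.
have aq := at_atlas hX z; have dq := at_dom hX z.
have sBt : smooth_at (cmap (chart_at z) z) (fun y => Bt (cinv (chart_at z) y)).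
  have s1 := msm_chart hX (sS z Uz dz) aq dq; have s2 := msm_chart hX mB aq dq.
  by apply: sm_ext (sm_col_mx s1 s2); near=> y; rewrite /Bt mul_col_mx.
split; last exact: EK.
  exists (chart_at z); split => //; apply: sm_mulmx.
    by apply: sm_mulmx (sm_cst _ _) sBt.
  apply: sm_invmx; first by rewrite (cinvK hX aq dq); exact: uG.
  exact: (sm_mulmx (sm_tr sBt) sBt).
apply: trmx_inj; rewrite trmx1 trmx_mul trmxK; apply/row_matrixP => a; rewrite row1 rowE.
have [xi Hxi] := dual_onto (s := fun a => row a (S z)) (bS z Uz) (delta_mx 0 a).
have Ey : \row_a dual_eval xi (row a (S z)) = delta_mx 0 a by apply/rowP => b; rewrite mxE Hxi.
rewrite mulmxA -Ey -EK trmx_mul mulmxA -[_ *m _^T *m (tcoord _ _)^T]mulmxA -trmx_mul TF trmx1 mulmx1.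
apply/rowP => b; have inS : row b (S z) \in W z by exact: (@basis_memv p r (W z) (fun a => row a (S z)) (bS z Uz)).
have := dual_incl_in (WC z) xi inS => /matrixP/(_ 0 0); rewrite [RHS]mxE eqxx mulr1n => H.
rewrite [RHS]mxE -H !mxE; by apply: eq_bigr => l _; rewrite !mxE.
Unshelve. all: by end_near. Qed.

(** * Fibrewise linear maps from the dual bundle into a cotangent bundle *)

Section CotLift.
Variables (k r p : nat) (X : premanifold R k) (W : X -> {vspace 'rV_k}) (N : premanifold R p) (F : X -> N).
Hypotheses (hX : hmfd X) (hN : hmfd N) (sF : forall x, msmap F x).
Hypothesis hW : forall x : X, exists U, exists s : 'I_r -> X -> 'rV_k, [/\ mopen U, U x & local_frame idfun W U s].
Let E := dual_bundle r W.
Let hE : hmfd E := dual_hmfd hX hW.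
Variables (kap : E -> 'rV_p) (c : chart R (k + r) E) (q : chart R k X) (U : set X) (s : 'I_r -> X -> 'rV_k).
Hypotheses (ac : atlas c) (hc : dual_bd_frame c q U s).
Variables (cN : chart R p N) (cc : chart R (p + p) (cotangent N)) (V : set X) (K : X -> 'M[R]_(r, p)).
Hypotheses (acc : atlas cc) (hcc : cot_bd cc cN (cdom cN) (fun z : cotangent N => z.2 *m (fcoord z.1 cN)^T)).
Hypotheses (oV : mopen V) (VU : forall x, V x -> U x /\ cdom cN (F x)) (sK : forall x, V x -> msm K x).
Hypothesis hkap : forall e : E, V (projT1 e) -> kap e *m (fcoord (F (projT1 e)) cN)^T = fcomp s e *m K (projT1 e).

Definition cot_lift (e : E) : cotangent N := (F (projT1 e), kap e).

Definition liftloc (w : 'rV_(k + r)) : 'rV_(p + p) := row_mx (cmap cN (F (cinv q (lsubmx w)))) (rsubmx w *m K (cinv q (lsubmx w))).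

Let aN : atlas cN. Proof. by case: hcc. Qed.
Let aq : atlas q. Proof. by case: hc => [[]]. Qed.

Section At.
Variable e : E.
Hypothesis Ve : V (projT1 e).

Lemma lift_dom : cdom c e. Proof. by have [_ [dE _ _]] := hc; rewrite dE /=; case: (VU Ve). Qed.

Lemma lift_base : cdom q (projT1 e) /\ lsubmx (cmap c e) = cmap q (projT1 e).
Proof.
have [[_ _ Uq _] [dE mE iE]] := hc; have [Ue _] := VU Ve.
by split; [exact: Uq|rewrite mE ?row_mxKl// dE].
Qed.

Lemma near_lift : \forall w \near cmap c e, [/\ cdom c (cinv c w), V (projT1 (cinv c w)), cinv q (lsubmx w) = projT1 (cinv c w) & rsubmx w = fcomp s (cinv c w)].
Proof.
have d := lift_dom; have oP := bundle_mopen hX (dual_bundle_charts hX hW) oV.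
have [[_ _ Uq _] [dE mE iE]] := hc.
have H : \forall w \near cmap c e, [/\ cdom c (cinv c w), cmap c (cinv c w) = w & V (projT1 (cinv c w))] := near_cinv hE ac d oP Ve.
apply: filterS H => w [d1 E1 V1].
have Em := mE _ d1; rewrite E1 in Em.
have dq : cdom q (projT1 (cinv c w)) by apply: Uq; have := d1; rewrite dE.
split; [exact: d1|exact: V1|by rewrite {1}Em row_mxKl (cinvK hX aq dq)|by rewrite {1}Em row_mxKr].
Qed.

Lemma sm_cinvq p1 p2 (f : X -> 'M[R]_(p1, p2)) : msm f (projT1 e) -> smooth_at (cmap c e) (fun w => f (cinv q (lsubmx w))).
Proof.
have [dq El] := lift_base => mf; apply: (sm_comp (g := fun y => f (cinv q y)) (sm_lsubid _)); rewrite El.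
exact: (msm_chart hX mf aq dq).
Qed.

Lemma sm_liftloc : smooth_at (cmap c e) liftloc.
Proof.
have [dq El] := lift_base; have [Ue dF] := VU Ve.
apply: sm_row_mx; last by apply: sm_mulmx (sm_rsubid _) _; exact: (sm_cinvq (sK Ve)).
apply: (sm_comp (g := fun y => cmap cN (F (cinv q y))) (sm_lsubid _)); rewrite El.
exact: (msmap_sm hX (sF _) aq dq aN dF).
Qed.

Lemma liftlocE : \forall w \near cmap c e, cdom cc (cot_lift (cinv c w)) /\ cmap cc (cot_lift (cinv c w)) = liftloc w.
Proof.
have [_ _ _ [dC mC iC]] := hcc.
apply: filterS near_lift => w [d1 V1 El Er]; have [U1 dF] := VU V1.
have dL : cdom cc (cot_lift (cinv c w)) by rewrite dC.
by split => //; rewrite mC// /liftloc El Er /= hkap.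
Qed.

Lemma cot_lift_smooth : msmap cot_lift e.
Proof.
have d := lift_dom; have [dL _] := nbhs_singleton liftlocE; rewrite (cinvK hE ac d) in dL.
apply: (msmapI hE (cot_hmfd hN) ac d acc dL); first by apply: filterS liftlocE => w [].
by apply: sm_ext sm_liftloc; apply: filterS liftlocE => w [].
Qed.

Lemma mder_lift : mder cot_lift e *m tcoord (cot_lift e) cc = tcoord e c *m jacobian liftloc (cmap c e).
Proof.
have d := lift_dom; have [dL _] := nbhs_singleton liftlocE; rewrite (cinvK hE ac d) in dL.
rewrite (mderE hE (cot_hmfd hN) cot_lift_smooth ac d acc dL) -mulmxA (ftcoord (cot_hmfd hN) acc dL) mulmx1.
have nn : \forall w \near cmap c e, liftloc w = (cmap cc \o cot_lift \o cinv c) w by apply: filterS liftlocE => w [_ Ew]; exact: esym.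
exact: (congr1 (fun A : 'M[R]_(k + r, p + p) => tcoord e c *m A) (esym (jac_near nn (sm_diff sm_liftloc)))).
Qed.

Lemma jac_liftloc (v : 'rV_(k + r)) : rsubmx (cmap c e) = 0 ->
  v *m jacobian liftloc (cmap c e) = row_mx (lsubmx v *m jacobian (cmap cN \o F \o cinv q) (cmap q (projT1 e))) (rsubmx v *m K (projT1 e)).
Proof.
move=> r0; have [dq El] := lift_base; have [Ue dF] := VU Ve.
rewrite -(derive_mulE _ (sm_diff sm_liftloc)).
have s1 : smooth_at (lsubmx (cmap c e)) (fun y => cmap cN (F (cinv q y))) by rewrite El; exact: (msmap_sm hX (sF _) aq dq aN dF).
have s2 : smooth_at (cmap c e) (fun w : 'rV_(k + r) => cmap cN (F (cinv q (lsubmx w)))) := sm_comp (sm_lsubid _) s1.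
have s3 := sm_cinvq (sK Ve).
have [_ Dl] := isd_lsub (smooth_isd v (sm_id (cmap c e))); rewrite derive_id in Dl.
have [_ Dr] := isd_rsub (smooth_isd v (sm_id (cmap c e))); rewrite derive_id in Dr.
have E1 : 'D_v (fun w : 'rV_(k + r) => cmap cN (F (cinv q (lsubmx w)))) (cmap c e) = lsubmx v *m jacobian (cmap cN \o F \o cinv q) (cmap q (projT1 e)).
  apply: (eq_trans (derive_comp v (sm_diff (sm_lsubid _)) (sm_diff s1))).
  apply: (eq_trans (congr1 (fun u => 'D_u _ _) Dl)); rewrite (derive_mulE _ (sm_diff s1)) El.
  by [].
have E2 : 'D_v (fun w : 'rV_(k + r) => rsubmx w *m K (cinv q (lsubmx w))) (cmap c e) = rsubmx v *m K (projT1 e).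
  rewrite (derive_mulmx v (sm_rsubid _) s3) r0 mul0mx addr0 Dr El (cinvK hX aq dq).
  by [].
have h1 := smooth_isd v s2; have h2 := smooth_isd v (sm_mulmx (sm_rsubid (cmap c e)) s3).
rewrite E1 in h1; rewrite E2 in h2.
by have [_ ->] := isd_row_mx h1 h2.
Qed.
End At.
End CotLift.

Definition complete_rV (p : nat) : completeNormedModType R :=
  HB.pack 'rV_p (NormedModule.on 'rV_p) (Complete.on 'rV_p).

(** * Dimension and local diffeomorphisms *)

Section LipschitzDimension.
Variables (p n : nat) (Rel : nat -> 'rV_p -> 'rV_n -> Prop) (w0 : 'rV_p) (rho : R).
Hypotheses (rho0 : 0 < rho) (cover : forall w, ball w0 rho w -> exists j a, Rel j w a).
Hypothesis lip : forall j w a, Rel j w a -> exists d K : R, [/\ 0 < d, 0 <= K &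
  forall w' a', Rel j w' a' -> `|a' - a| < d -> `|w' - w| <= K * `|a' - a|].

(** A single integer bounds the size of the parameter, the Lipschitz constant and the inverse
    radius, which cuts the relation into countably many pieces; Baire's theorem then makes one of
    them dense in a ball. *)
Definition lippiece (j N : nat) : set 'rV_p := [set w | ball w0 rho w /\ exists a, [/\ Rel j w a, `|a| <= N%:R &
  forall w' a', Rel j w' a' -> `|a' - a| < (N.+1%:R)^-1 -> `|w' - w| <= N%:R * `|a' - a|]].

Lemma lippiece_cover w : ball w0 rho w -> exists j N, lippiece j N w.
Proof.
move=> wb; have [j [a ra]] := cover wb; have [d [K [d0 K0 H]]] := lip ra.
pose b := Num.max (Num.max `|a| K) d^-1.
have [ba bK bd] : [/\ `|a| <= b, K <= b & d^-1 <= b] by rewrite /b !le_max !lexx !orbT.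
pose N := Num.truncn b.
have b0 : 0 <= b by apply: le_trans ba; exact: normr_ge0.
have bN : b < N.+1%:R by have := truncn_itv b0 => /andP[].
exists j, N.+1; split => //; exists a; split => //; first by apply: le_trans ba _; exact: ltW.
move=> w' a' ra' aa; apply: le_trans (H w' a' ra' _) _.
  apply: lt_le_trans aa _; rewrite -[leRHS]invrK lef_pV2 ?posrE ?invr_gt0//.
  by apply: le_trans bd (le_trans (ltW bN) _); rewrite ler_nat.
by rewrite ler_wpM2r//; apply: le_trans bK (ltW bN).
Qed.

Lemma lippiece_dense : exists j N u (s : R), 0 < s /\ ball u s `<=` closure (lippiece j N).
Proof.
apply: contrapT => /forallNP H.
pose F (l : nat) : set 'rV_p := ~` closure (lippiece (odflt (0, 0)%N (unpickle l)).1 (odflt (0, 0)%N (unpickle l)).2).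
have : dense (\bigcap_i F i).
  apply: (@Baire R (complete_rV p) F) => l; split; first by rewrite openC; exact: closed_closure.
  move=> D [x Dx] oD; apply: contrapT => nD.
  have [s /= s0 Hs] := (nbhs_ballP _ _).1 (open_nbhs_nbhs (conj oD Dx)).
  case: (H (odflt (0, 0)%N (unpickle l)).1); exists (odflt (0, 0)%N (unpickle l)).2, x, s; split => // y yb.
  by apply: contrapT => ny; apply: nD; exists y; split; [exact: Hs|exact: ny].
have b0 : ball w0 rho !=set0 by exists w0; exact: ballxx.
move=> /(_ _ b0 (@open_ballrV _ w0 rho rho0))[w [wb Fw]].
have [j [N jN]] := lippiece_cover wb; have := Fw (pickle (j, N)) I.
by rewrite /F pickleK /=; apply; exact: subset_closure.
Qed.

(* Some Lipschitz piece is dense in a ball.  The points of a grid of mesh [~ s / L] in that ball have parameters in distinct cells of side [~ 1 / L], so [L ^ p = O(L ^ n)]. *)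
Lemma lip_dim : (p <= n)%N.
Proof.
have [j [N [u [s [s0 Hs]]]]] := lippiece_dense.
rewrite leqNgt; apply/negP => np.
have N10 : 0 < (N.+1%:R : R) by rewrite ltr0n.
(* Separation constant: distinct grid points will have parameters at distance at least [c / L],
   either because the parameters leave the radius [1 / (N + 1)] or because of the Lipschitz
   bound. *)
pose c := Num.min (N.+1%:R^-1) (s / (4 * N.+1%:R)) : R.
have c0 : 0 < c by rewrite lt_min invr_gt0 N10 divr_gt0 ?mulr_gt0.
pose D := (Num.truncn (4 * N.+1%:R / c)).+1.
have ND : 4 * N.+1%:R / c < D%:R by have /andP[] := truncn_itv (ltW (divr_gt0 (mulr_gt0 (ltr0n R 4) N10) c0)).
(* The count will give [L ^ p <= (D * L) ^ n]. For [p > n] this would force [L <= D ^ n], which this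
   value of [L] violates. *)
pose L := ((D ^ n).+1)%N.
have L0 : 0 < (L%:R : R) by rewrite ltr0n.
pose gr (f : {ffun 'I_p -> 'I_L}) : 'rV_p := \row_i (u 0 i + s / 2 * ((f i : nat)%:R / L%:R)).
have grb f : ball u s (gr f).
  rewrite -ball_normE /= distrC; apply: (@le_lt_trans _ _ (s / 2)); last by lra.
  apply: mx_norm_le => [|i l]; first by lra.
  rewrite !mxE !ord1 addrAC subrr add0r ger0_norm; last by rewrite mulr_ge0 ?divr_ge0//; lra.
  by rewrite ler_piMr; [|lra|rewrite ler_pdivrMr// mul1r ler_nat ltnW].
have sL : 0 < s / (8 * L%:R) by rewrite divr_gt0 ?mulr_gt0.
(* The piece is only dense, so each grid point is replaced by a point of the piece within a quarter
   of half the mesh; distinct ones stay separated by [s / (4 L)]. *)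
have pick f : exists wa : 'rV_p * 'rV_n, [/\ `|wa.1 - gr f| < s / (8 * L%:R), Rel j wa.1 wa.2, `|wa.2| <= N%:R &
  forall w' a', Rel j w' a' -> `|a' - wa.2| < (N.+1%:R)^-1 -> `|w' - wa.1| <= N%:R * `|a' - wa.2|].
  have [w [[_ [a [h1 h2 h3]]] wb]] := Hs _ (grb f) _ (nbhsx_ballx (gr f) _ sL).
  by exists (w, a); split => //; move: wb; rewrite -ball_normE /= distrC.
have [wa Hwa] := choice pick.
have DL0 : (0 < D * L)%N by rewrite muln_gt0.
have cL : 0 < 2 * L%:R / c by rewrite divr_gt0 ?mulr_gt0.
have cellE f i : let t := (N%:R + (wa f).2 0 i) * (2 * L%:R / c) in 0 <= t /\ (Num.truncn t < D * L)%N.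
  move=> t; have [_ _ aN _] := Hwa f; have := le_trans (mx_coord_le (wa f).2 0 i) aN; rewrite ler_norml => /andP[a1 a2].
  have t0 : 0 <= t by apply: mulr_ge0; [lra|exact: ltW].
  split => //; rewrite -(ltr_nat R); apply: (@le_lt_trans _ _ t); first by rewrite truncn_le.
  have : t <= (2 * N.+1%:R) * (2 * L%:R / c).
    by rewrite ler_wpM2r ?ltW// -natr1; have : (0 : R) <= N%:R by []; lra.
  move=> /le_lt_trans; apply; rewrite natrM.
  have -> : 2 * N.+1%:R * (2 * L%:R / c) = 4 * N.+1%:R / c * L%:R :> R by field; rewrite gt_eqF.
  by rewrite ltr_pM2r.
pose cell f : {ffun 'I_n -> 'I_(D * L)} := [ffun i => Ordinal (cellE f i).2].
have cell_inj : injective cell.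
  move=> f f' E; apply: contrapT => ne.
  have [i fi] : exists i, f i != f' i by apply: contrapT => /forallNP H; apply: ne; apply/ffunP => i; have := H i; move/negP; rewrite negbK => /eqP.
  have [w1 r1 a1 l1] := Hwa f; have [w2 r2 a2 l2] := Hwa f'.
  have sep : s / (2 * L%:R) <= `|gr f - gr f'|.
    apply: le_trans (mx_coord_le _ 0 i); rewrite !mxE opprD addrACA subrr add0r -mulrBr -mulrBl normrM (ger0_norm (_ : 0 <= s / 2)); last by lra.
    have -> : s / (2 * L%:R) = s / 2 * (1 / L%:R) :> R by field; rewrite gt_eqF.
    rewrite ler_wpM2l//; first by lra.
    rewrite normrM [`|L%:R^-1|]ger0_norm ?invr_ge0// ler_wpM2r ?invr_ge0//.
    have [h|h|h] := ltngtP (f i) (f' i); last by rewrite (val_inj h) eqxx in fi.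
      by rewrite distrC -natrB ?(ltnW h)// normr_nat ler1n subn_gt0.
    by rewrite -natrB ?(ltnW h)// normr_nat ler1n subn_gt0.
  have sepw : s / (4 * L%:R) <= `|(wa f').1 - (wa f).1|.
    have e8 : s / (2 * L%:R) = s / (4 * L%:R) + s / (8 * L%:R) + s / (8 * L%:R) :> R by field; rewrite gt_eqF.
    have t1 := ler_distD (wa f).1 (gr f) (gr f'); have t2 := ler_distD (wa f').1 (wa f).1 (gr f').
    have t3 := distrC (gr f) (wa f).1; have t4 := distrC (wa f).1 (wa f').1; lra.
  have sepa : c / L%:R <= `|(wa f').2 - (wa f).2|.
    have [far|near] := leP (N.+1%:R^-1) `|(wa f').2 - (wa f).2|.
      apply: le_trans far; apply: (@le_trans _ _ c); last by rewrite ge_min lexx.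
      have L1 : 1 <= (L%:R : R) by rewrite ler1n.
      by rewrite ler_pdivrMr//; nra.
    have := l1 _ _ r2 near => h; have {}h := le_trans sepw h.
    have : s / (4 * L%:R) <= N.+1%:R * `|(wa f').2 - (wa f).2| by apply: le_trans h _; rewrite ler_wpM2r// ler_nat.
    rewrite -ler_pdivrMl// => /(le_trans _); apply.
    have -> : N.+1%:R^-1 * (s / (4 * L%:R)) = s / (4 * N.+1%:R) / L%:R :> R by field; rewrite !gt_eqF.
    by rewrite ler_pM2r ?invr_gt0// ge_min lexx orbT.
  suff : `|(wa f').2 - (wa f).2| <= c / (2 * L%:R).
    move=> /(le_trans sepa); rewrite ler_pdivrMr// mulrAC ler_pdivlMr ?mulr_gt0//.
    by move: L0 c0 => L0 c0; nra.
  apply: mx_norm_le => [|i0 l]; first by rewrite divr_ge0 ?mulr_ge0// ltW.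
  rewrite !ord1 !mxE; have [t0 tD] := cellE f l; have [t0' tD'] := cellE f' l.
  have := congr1 (fun g : {ffun 'I_n -> 'I_(D * L)} => (g l : nat)) E; rewrite !ffunE /= => Et.
  have := truncn_itv t0; have := truncn_itv t0'; rewrite -Et; move: (Num.truncn _) => T /andP[b1 b2] /andP[b3 b4].
  have : `|((wa f').2 0 l - (wa f).2 0 l) * (2 * L%:R / c)| <= 1.
    rewrite -natr1 in b2 b4; rewrite ler_norml; apply/andP; split; nra.
  rewrite normrM (ger0_norm (ltW cL)) -ler_pdivlMr// mul1r => /le_trans; apply.
  by rewrite invf_div.
have := leq_card cell cell_inj; rewrite !card_ffun !card_ord expnMn => LE.
have : (L ^ n.+1 <= L ^ p)%N by exact: leq_pexp2l.
move=> /leq_trans/(_ LE); rewrite expnS leq_pmul2r ?expn_gt0//.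
by rewrite ltnn.
Qed.
End LipschitzDimension.

(** Projecting with [A] turns [f] into a map with derivative 1, to which the inverse function
    theorem applies. *)
Lemma immersion_left_inverse n p (f : 'rV_n -> 'rV_p) x0 (A : 'M[R]_(p, n)) : smooth_at x0 f -> jacobian f x0 *m A = 1%:M ->
  exists g : 'rV_p -> 'rV_n, smooth_at (f x0) g /\ \forall x \near x0, g (f x) = x.
Proof.
move=> sf JA; pose h x := f x *m A.
have sh : smooth_at x0 h := sm_mulmx sf (sm_cst x0 A).
have Jh : jacobian h x0 = 1%:M.
  apply/row_matrixP => i; rewrite (row_jac i (sm_diff sh)) (derive_mulmx _ sf (sm_cst x0 A)) derive_cst mulmx0 addr0.
  by rewrite -(row_jac i (sm_diff sf)) -row_mul JA.
have uh : jacobian h x0 \in unitmx by rewrite Jh unitmx1.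
have [g [sg _ gh _]] := inverse_function sh uh.
exists (fun y => g (y *m A)); split; last exact: gh.
exact: (sm_comp (f := fun y => y *m A) (sm_mulmx (sm_id _) (sm_cst _ A)) sg).
Qed.

Lemma immersion_lip n p (f : 'rV_n -> 'rV_p) x0 (A : 'M[R]_(p, n)) : smooth_at x0 f -> jacobian f x0 *m A = 1%:M ->
  exists2 K : R, 0 <= K & \forall x \near x0, `|x - x0| <= K * `|f x - f x0|.
Proof.
move=> sf JA; have [g [sg gf]] := immersion_left_inverse sf JA.
have [d [K [d0 K0 HK]]] := lip_local sg; exists K => //.
have g0 := nbhs_singleton gf.
have nb : \forall x \near x0, ball (f x0) d (f x) := sm_cont sf (nbhsx_ballx _ _ d0).
apply: filterS2 gf nb => x gx fb; have [_ _] := HK _ _ fb (ballxx _ d0).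
by rewrite gx g0.
Qed.

Section Regular.
Variables (n : nat) (N : premanifold R n).
Hypothesis hN : hmfd N.

(** [D] is the image of a compact box of a chart; its complement is open by compactness of the box
    and the separation of points. *)
Lemma mfd_regular (O : set N) y : mopen O -> O y -> exists A D : set N, [/\ mopen A, A y, A `<=` D, mopen (~` D) & D `<=` O].
Proof.
move=> oO Oy; have ac := at_atlas hN y; have d := at_dom hN y; set c := chart_at y in ac d.
have [e e0 He] := ball_near (near_cinv hN ac d oO Oy).
pose K : set 'rV_n := [set v | forall i, `[cmap c y 0 i - e / 2, cmap c y 0 i + e / 2]%classic (v ord0 i)].
have cK : compact K by apply: (@rV_compact R n (fun i => `[cmap c y 0 i - e / 2, cmap c y 0 i + e / 2]%classic)) => i; exact: segment_compact.
have Kb v : K v -> ball (cmap c y) e v.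
  move=> Kv; rewrite -ball_normE /=; apply: (@le_lt_trans _ _ (e / 2)); last by lra.
  apply: mx_norm_le => [|i l]; first by lra.
  by rewrite !mxE !ord1; have := Kv l; rewrite /= in_itv /= => /andP[k1 k2]; rewrite ler_norml; apply/andP; split; lra.
have bK v : ball (cmap c y) (e / 2) v -> K v.
  rewrite -ball_normE /= => vb i; rewrite /= in_itv /=; have := mx_coord_le (cmap c y - v) 0 i; rewrite !mxE => h.
  by have := le_lt_trans h vb; rewrite ltr_norml => /andP[h1 h2]; apply/andP; split; lra.
pose D : set N := [set z | exists2 v, K v & z = cinv c v].
have e20 : 0 < e / 2 by lra.
exists [set z | cdom c z /\ ball (cmap c y) (e / 2) (cmap c z)], D; split.
- exact: (mopen_chart hN ac (@open_ballrV _ (cmap c y) _ e20)).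
- by split => //; exact: ballxx.
- by move=> z [dz bz]; exists (cmap c z); [exact: bK|rewrite (cinvK hN ac dz)].
- apply: (mopenP hN) => z nD; have ac' := at_atlas hN z; have d' := at_dom hN z; set c' := chart_at z in ac' d' *.
  exists c'; split => //.
  have : \forall u \near nbhs (cmap c' z), K `<=` (fun v => cinv c' u <> cinv c v).
    apply: ((compact_near_coveringP K).1 cK _ (nbhs (cmap c' z)) (fun u v => cinv c' u <> cinv c v)) => v Kv.
    have [dv Ev _] := He v (Kb v Kv).
    have nz : cinv c v <> z by move=> Ez; apply: nD; exists v.
    have [_ _ haus] := hN; have [U1 [U2 [oU1 oU2 U1v U2z U12]]] := haus _ _ nz.
    have n1 := near_cinv hN ac dv oU1 U1v; rewrite Ev in n1.
    have n2 := near_cinv hN ac' d' oU2 U2z.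
    exists ([set v | U1 (cinv c v)], [set u | U2 (cinv c' u)]).
      by split; [apply: filterS n1 => w []|apply: filterS n2 => w []].
    move=> [v' u'] /= [h1 h2] E; have : (U1 `&` U2) (cinv c' u') by split => //; rewrite E.
    by rewrite U12.
  by apply: filterS => u Hu [v Kv E]; exact: (Hu v Kv E).
- by move=> z [v /Kb/He[_ _ h] ->].
Qed.
End Regular.

Section LocalDiffeo.
Variables (n : nat) (N1 N2 : premanifold R n) (O : set N1) (F : N1 -> N2).
Hypotheses (hN1 : hmfd N1) (hN2 : hmfd N2) (oO : mopen O) (sF : forall e, O e -> msmap F e) (uF : forall e, O e -> mder F e \in unitmx).

Lemma local_inverse e : O e -> exists V V2 (G : N2 -> N1), [/\ mopen V /\ V `<=` O, V e, mopen V2, V2 (F e) &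
  (forall e', V e' -> G (F e') = e') /\ forall y, V2 y -> [/\ O (G y), F (G y) = y & msmap G y]].
Proof.
move=> Oe; have a1 := at_atlas hN1 e; have d1 := at_dom hN1 e; set c1 := chart_at e in a1 d1.
have a2 := at_atlas hN2 (F e); have d2 := at_dom hN2 (F e); set c2 := chart_at (F e) in a2 d2.
have sf := msmap_sm hN1 (sF Oe) a1 d1 a2 d2; set f := fun y => _ in sf.
have uf : jacobian f (cmap c1 e) \in unitmx.
  have -> : jacobian f (cmap c1 e) = fcoord e c1 *m mder F e *m tcoord (F e) c2 := mder_jac hN1 hN2 (sF Oe) a1 d1 a2 d2.
  have [_ u1] := mulmx1_unit (tfcoord hN1 a1 d1); have [u2 _] := mulmx1_unit (tfcoord hN2 a2 d2).
  exact: (eq_trans (unit_conj (mder F e) u1 u2) (uF Oe)).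
have [g [sg g0 gf fg]] := inverse_function sf uf.
have fe : f (cmap c1 e) = cmap c2 (F e) by rewrite /f (cinvK hN1 a1 d1).
rewrite fe in sg g0 fg.
have n1 := near_cinv hN1 a1 d1 oO Oe.
have nF := msmap_near hN1 (sF Oe) a1 d1 (mopen_cdom hN2 a2) d2.
have [A1 [op1 A1e] HA1] := near_open (filterI gf (filterI n1 nF)).
have cg := sm_cont sg; rewrite /prop_for /continuous_at g0 in cg.
have n2 : \forall v \near cmap c2 (F e), A1 (g v) := cg _ (open_nbhs_nbhs (conj op1 A1e)).
have [A2 [op2 A2e] HA2] := near_open (filterI fg (filterI n2 (sm_near sg))).
exists [set e | cdom c1 e /\ A1 (cmap c1 e)], [set y | cdom c2 y /\ A2 (cmap c2 y)], (fun y => cinv c1 (g (cmap c2 y))).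
split.
- split; first exact: (mopen_chart hN1 a1 op1).
  by move=> e' [de /HA1[_ [[_ _ h] _]]]; rewrite (cinvK hN1 a1 de) in h.
- by [].
- exact: (mopen_chart hN2 a2 op2).
- by [].
split.
  move=> e' [de /HA1[gE [_ dF]]]; rewrite (cinvK hN1 a1 de) in dF.
  by rewrite /f (cinvK hN1 a1 de) in gE; rewrite gE (cinvK hN1 a1 de).
move=> y [dy Ay]; have [fE [Ag sgy]] := HA2 _ Ay; have [_ [[dG EG OG] dF]] := HA1 _ Ag; split; first exact: OG.
  by have := congr1 (cinv c2) fE; rewrite /f (cinvK hN2 a2 dF) (cinvK hN2 a2 dy).
apply: (msmapI hN2 hN1 a2 dy a1 (F := fun y => cinv c1 (g (cmap c2 y))) dG).
  apply: filterS2 (near_cdom hN2 a2 dy) (open_nbhs_nbhs (conj op2 Ay)) => v [dv Ev] /HA2[_ [Agv _]].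
  by rewrite Ev; have [_ [[h _ _] _]] := HA1 _ Agv.
apply: sm_ext sgy; apply: filterS2 (near_cdom hN2 a2 dy) (open_nbhs_nbhs (conj op2 Ay)) => v [dv Ev] /HA2[_ [Agv _]].
by rewrite Ev; have [_ [[_ h _] _]] := HA1 _ Agv.
Qed.

Lemma local_diffeo_open U : mopen U -> U `<=` O -> mopen (F @` U).
Proof.
move=> oU UO; apply: (mopen_local hN2) => _ [e Ue <-].
have [V [V2 [G [_ Ve oV2 V2F [GF HG]]]]] := local_inverse (UO _ Ue).
have [_ _ [cG _]] := HG _ V2F; have UG : U (G (F e)) by rewrite GF.
have [V3 [oV3 V3F HV3]] := cG U oU UG.
exists (V2 `&` V3); split; [exact: (mopenI hN2)|by []|].
by move=> y [V2y V3y]; have [_ FG _] := HG y V2y; exists (G y); [exact: HV3|].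
Qed.

Lemma local_diffeo_inverse U (F' : N2 -> N1) : mopen U -> U `<=` O -> (forall e, U e -> F' (F e) = e) -> forall y, (F @` U) y -> msmap F' y.
Proof.
move=> oU UO F'F _ [e Ue <-]; have [V [V2 [G [_ Ve oV2 V2F [GF HG]]]]] := local_inverse (UO _ Ue).
have [_ _ sG] := HG _ V2F; have UG : U (G (F e)) by rewrite GF.
have [V3 [oV3 V3F HV3]] := sG.1 U oU UG.
apply: (msmap_ext hN2 hN1 (F := G) _ sG).
exists (V2 `&` V3); split; [exact: (mopenI hN2)|by []|].
by move=> y [V2y V3y]; have [_ FG _] := HG y V2y; rewrite -{2}FG F'F//; exact: HV3.
Qed.

(* [B] is a base of the topology of [N2].  A point [e] is kept when it lies in the injectivity domain attached to the first good B j containing F e,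
   so that two kept points with the same image lie in the same injectivity domain. *)
Lemma injective_neighborhood (Z : set N1) (B : nat -> set N2) : (forall j, mopen (B j)) ->
  (forall (U : set N2) x, mopen U -> U x -> exists j, B j x /\ B j `<=` U) -> Z `<=` O ->
  (forall e (V : set N1), Z e -> mopen V -> V e -> exists U, [/\ mopen U, U (F e) & forall e', Z e' -> U (F e') -> V e']) ->
  exists U, [/\ mopen U, Z `<=` U, U `<=` O & forall e e', U e -> U e' -> F e = F e' -> e = e'].
Proof.
move=> oB hB ZO hZ.
pose good j (S : set N1 * set N2) := [/\ mopen S.1, S.1 `<=` O, mopen (~` S.2), B j `<=` S.2 &
  (forall e e', S.1 e -> S.1 e' -> F e = F e' -> e = e') /\ forall e, Z e -> S.2 (F e) -> S.1 e].
pose Sj j := choose_or (set0, set0) (good j).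
pose ok j y := good j (Sj j) /\ B j y.
pose U0 : set N1 := [set e | O e /\ exists j, [/\ ok j (F e), forall l, (l < j)%N -> ~ ok l (F e) & (Sj j).1 e]].
pose U : set N1 := [set e | exists V, [/\ mopen V, V e & V `<=` U0]].
have first y j : ok j y -> exists l, ok l y /\ forall l', (l' < l)%N -> ~ ok l' y.
  move=> okj; pose Q l := `[< ok l y >]; have ex : exists l, Q l by exists j; apply/asboolP.
  by case: (ex_minnP ex) => l /asboolP okl min; exists l; split => // l' ll' /asboolP/min; rewrite leqNgt ll'.
exists U; split.
- by apply: (mopen_local hN1) => e [V [oV Ve VU]]; exists V; split => // e' Ve'; exists V.
- move=> e Ze; have Oe := ZO _ Ze.
  have ex : exists j, ok j (F e).
    have [V [V2 [G [[oV VO] Ve _ _ [GF _]]]]] := local_inverse Oe.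
    have [U1 [oU1 U1F HU1]] := hZ e V Ze oV Ve.
    have [A [D [oA AF AD oD DU]]] := mfd_regular hN2 oU1 U1F.
    have [j [Bj BA]] := hB _ _ oA AF; exists j; split => //.
    apply: (@choose_orP (set N1 * set N2) (set0, set0) (good j)); exists (V, D); split => //=; first by move=> y /BA/AD.
    split => [e1 e2 V1 V2' E12|e1 Z1 D1]; first by rewrite -(GF e1 V1) E12 GF.
    by apply: HU1 => //; exact: DU.
  have [j okj] := ex; have [l [okl minl]] := first _ _ okj.
  (* Smaller indices are the obstacle: one of them could become the first good one at a point near
     [e]. Either [F e] lies in the closed set of that index, and then [e] lies in its injectivity
     domain, or a whole neighbourhood of [e] is mapped off the closed set. *)
  have nbhd j' : exists V, [/\ mopen V, V e & forall e', V e' -> O e' /\ (ok j' (F e') -> (Sj j').1 e')].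
    have [g|ng] := EM (good j' (Sj j')); last by exists O; split => // e' Oe'; split => // -[].
    have [oS1 S1O oS2 BS [_ ZS]] := g.
    have [D|nD] := EM ((Sj j').2 (F e)).
      by exists (Sj j').1; split => [//||e' h]; [exact: ZS|split => //; exact: S1O].
    have [V [oV Ve HV]] := (sF Oe).1 _ oS2 nD.
    exists (O `&` V); split => [|//|e' [Oe' /HV h]]; first exact: (mopenI hN1).
    by split => // -[_ /BS].
  have [V1 [oV1 V1e HV1]] : exists V, [/\ mopen V, V e & forall j', (j' <= l)%N -> forall e', V e' -> O e' /\ (ok j' (F e') -> (Sj j').1 e')].
    elim: (l) => [|l' [V [oV Ve HV]]].
      by have [V [oV Ve HV]] := nbhd 0%N; exists V; split => // j'; rewrite leqn0 => /eqP ->.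
    have [V' [oV' V'e HV']] := nbhd l'.+1; exists (V `&` V'); split => [|//|j']; first exact: (mopenI hN1).
    by rewrite leq_eqVlt => /orP[/eqP -> e' [_ /HV']|/HV h e' [/h]].
  have [V2 [oV2 V2e HV2]] := (sF Oe).1 _ (oB l) okl.2.
  exists (V1 `&` V2); split => [|//|e' [V1e' /HV2 Bl]]; first exact: (mopenI hN1).
  have [Oe' _] := HV1 l (leqnn l) e' V1e'; split => //.
  have okl' : ok l (F e') by split => //; exact: okl.1.
  have [l' [okl'' min']] := first _ _ okl'; exists l'; split => //.
  have ll : (l' <= l)%N by rewrite leqNgt; apply/negP => /min'.
  by have [_ h] := HV1 l' ll e' V1e'; exact: h.
- by move=> e [V [_ Ve /(_ _ Ve)[]]].
move=> e e' [V [_ Ve /(_ _ Ve)[_ [j [okj minj Sj1]]]]] [V' [_ Ve' /(_ _ Ve')[_ [j' [okj' minj' Sj1']]]]] E.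
have Ejj : j = j'.
  apply/eqP; rewrite eqn_leq; apply/andP; split; rewrite leqNgt; apply/negP => lt.
    by apply: (minj _ lt); rewrite E.
  by apply: (minj' _ lt); rewrite -E.
by subst j'; have [[_ _ _ _ [inj _]] _] := okj; exact: inj.
Qed.
End LocalDiffeo.

Section Lifting.
Variables (n p m : nat) (N : premanifold R n) (P : premanifold R p) (M : premanifold R m) (iP : P -> M) (O : set N) (F : N -> M) (Fh : N -> P).
Hypotheses (hN : hmfd N) (hP : hmfd P) (hM : hmfd M) (siP : forall y, msmap iP y) (injP : injective iP) (fP : forall y, row_free (mder iP y)).
Hypothesis embP : forall U, mopen U -> exists2 V, mopen V & iP @` U = V `&` range iP.
Hypotheses (oO : mopen O) (sF : forall e, O e -> msmap F e) (FhE : forall e, O e -> iP (Fh e) = F e).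

(** Continuity of the lift comes from the subspace topology of the embedding, smoothness from a
    local left inverse of [iP] in charts. *)
Lemma embedding_lift e : O e -> msmap Fh e.
Proof.
move=> Oe; have ct : mcont Fh e.
  move=> U oU UF; have [V oV EV] := embP oU.
  have VF : V (F e) by have : (iP @` U) (F e) by [exists (Fh e) => //; exact: FhE]; rewrite EV => -[].
  have [V1 [oV1 V1e HV1]] := (sF Oe).1 V oV VF.
  exists (O `&` V1); split => [|//|e' [Oe' /HV1 Ve']]; first exact: (mopenI hN).
  have : (iP @` U) (iP (Fh e')) by rewrite EV; split; [rewrite FhE|exists (Fh e')].
  by move=> [y Uy /injP <-].
have ac := at_atlas hN e; have d := at_dom hN e; set c := chart_at e in ac d.
have aP := at_atlas hP (Fh e); have dP := at_dom hP (Fh e); set cP := chart_at (Fh e) in aP dP.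
have aM := at_atlas hM (F e); have dM := at_dom hM (F e); set cM := chart_at (F e) in aM dM.
have dM' : cdom cM (iP (Fh e)) by rewrite FhE.
have sC := msmap_sm hP (siP (Fh e)) aP dP aM dM'; set f := fun w => _ in sC.
have [A JA] : exists A, jacobian f (cmap cP (Fh e)) *m A = 1%:M.
  apply/row_freeP; have JE : jacobian f (cmap cP (Fh e)) = fcoord (Fh e) cP *m mder iP (Fh e) *m tcoord (iP (Fh e)) cM := mder_jac hP hM (siP (Fh e)) aP dP aM dM'.
  have [_ uF] := mulmx1_unit (tfcoord hP aP dP); have [uT _] := mulmx1_unit (tfcoord hM aM dM').
  by rewrite /row_free JE; apply/eqP; apply: (eq_trans (rank_conj (mder iP (Fh e)) uF uT)); exact: (eqP (fP (Fh e))).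
have [g [sg gE]] := immersion_left_inverse sC JA.
have nO : \forall w \near cmap c e, O (cinv c w) by apply: filterS (near_cinv hN ac d oO Oe) => w [].
have nd : \forall w \near cmap c e, cdom cP (Fh (cinv c w)).
  have [V [oV Ve HV]] := ct _ (mopen_cdom hP aP) dP.
  by apply: filterS (near_cinv hN ac d oV Ve) => w [_ _ /HV].
apply: (msmapI hN hP ac d aP dP nd).
have s1 := msmap_sm hN (sF Oe) ac d aM dM.
have fE : f (cmap cP (Fh e)) = cmap cM (F (cinv c (cmap c e))) by rewrite /f (cinvK hP aP dP) FhE// (cinvK hN ac d).
rewrite fE in sg; apply: sm_ext (sm_comp s1 sg).
have [U [oU Ue] HU] := near_open gE.
have [V [oV Ve HV]] := ct _ (mopen_chart hP aP oU) (conj dP Ue).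
apply: filterS2 nO (near_cinv hN ac d oV Ve) => w Ow [_ _ /HV[dw Uw]].
by have := HU _ Uw; rewrite /f (cinvK hP aP dw) FhE.
Qed.
End Lifting.

(** * A primitive of the canonical symplectic form *)

Section TautologicalForm.
Variables (k : nat) (X : premanifold R k).
Hypothesis hX : hmfd X.

(** The opposite of the Liouville form, since [omega_can] is the sum of the [dq /\ dp]. *)
Definition tautform (z : cotangent X) : 'rV_(k + k) := - z.2 *m (mder (@cot_proj R k X) z)^T.

Lemma tautform_chart (z : cotangent X) c q : atlas c -> cot_bd c q (cdom q) (fun z : cotangent X => z.2 *m (fcoord z.1 q)^T) -> cdom c z ->
  \forall w \near cmap c z, row_mx (- rsubmx w) (0 : 'rV_k) = aform c tautform w.
Proof.
move=> ac hc d; apply: filterS (near_cdom (cot_hmfd hX) ac d) => w [d1 E1].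
have [dq El Er] := cot_inv hc d1 E1.
rewrite /aform /tautform (bundle_mder hX (cot_bundle hX) hc ac d1) Er.
rewrite !trmx_mul -[cot_proj _]/((cinv c w).1); move: (cinv c w).2 (fcoord (cinv c w).1 q) (ftcoord (cot_hmfd hX) ac d1) => a f.
move: (fcoord _ c) (tcoord _ c) => F T FT; rewrite !mulmxA -[_ *m T^T *m F^T]mulmxA -trmx_mul FT trmx1 mulmx1.
by rewrite tr_col_mx trmx1 trmx0 mul_mx_row mulmx1 mulmx0 mulNmx.
Qed.

Lemma tautform_smooth z : asm tautform z.
Proof.
have [c [q [U [Y [ac hb Uz]]]]] := bd_cover (cot_bundle hX) z.
have [aq EU EY [dC mC iC]] := hb; subst U Y; have d : cdom c z by rewrite dC.
exists c; split; [exact: ac|exact: d|apply: sm_ext (tautform_chart ac hb d) _].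
by apply: sm_row_mx; [apply: smN; exact: sm_rsubid|exact: sm_cst].
Qed.

Lemma tautform_extd z : mdform tautform z = omega_can z.
Proof.
have ac := at_atlas (cot_hmfd hX) z; have d := at_dom (cot_hmfd hX) z.
have [q [U [Y hb]]] := bdI (cot_bundle hX) ac; have [aq EU EY _] := hb; subst U Y.
rewrite /mdform; set x := cmap _ z; have nn := tautform_chart ac hb d; rewrite -/x in nn.
have s1 : smooth_at x (fun w : 'rV_(k + k) => row_mx (- rsubmx w) (0 : 'rV_k)).
  by apply: sm_row_mx; [apply: smN; exact: sm_rsubid|exact: sm_cst].
rewrite -(extd_near nn s1); apply: bilin_ext => v w; rewrite (extd_bilin v w s1).
have D u : 'D_u (fun w : 'rV_(k + k) => row_mx (- rsubmx w) (0 : 'rV_k)) x = row_mx (- rsubmx u) 0.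
  have h := isd_rsub (smooth_isd u (sm_id x)); rewrite derive_id in h.
  by have [_ ->] := isd_row_mx (is_deriveN h) (is_derive_cst (0 : 'rV_k) x u).
rewrite !D /omega_can -[v]hsubmxK -[w]hsubmxK !row_mxKr; move: (lsubmx v) (rsubmx v) (lsubmx w) (rsubmx w) => a b a' b'.
rewrite mul_row_block !tr_row_mx !mul_row_col !mul0mx !mulmx0 !mulmxN !mulmx1 !addr0 add0r !mulNmx opprK; congr (_ + _).
by rewrite -[LHS]scal1_tr trmx_mul trmxK.
Qed.
End TautologicalForm.

Lemma conj_dirac (K : fieldType) n m (Te Fe om : 'M[K]_n) (T1 F1 A : 'M[K]_m) (D : 'M[K]_(n, m)) : Te *m Fe = 1%:M -> T1 *m F1 = 1%:M ->
  forall v a : 'rV[K]_n, (exists2 b, v *m D = b *m A & a = b *m D^T + v *m om) <->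
   (exists2 b', v *m Te *m (Fe *m D *m T1) = b' *m (T1^T *m A *m T1) &
      a *m Fe^T = b' *m (Fe *m D *m T1)^T + v *m Te *m (Fe *m om *m Fe^T)).
Proof.
move=> TF TF1 v a; have FT1 := mulmx1C TF1.
have E1 : v *m Te *m (Fe *m D *m T1) = v *m D *m T1 by rewrite !mulmxA -(mulmxA v) TF mulmx1.
have E2 : v *m Te *m (Fe *m om *m Fe^T) = v *m om *m Fe^T by rewrite !mulmxA -(mulmxA v) TF mulmx1.
rewrite E1 E2; split => [[b h1 h2]|[b' h1 h2]].
  exists (b *m F1^T); first by rewrite h1 !mulmxA -[b *m _ *m T1^T]mulmxA -trmx_mul TF1 trmx1 mulmx1.
  by rewrite h2 mulmxDl; congr (_ + _); rewrite !trmx_mul !mulmxA -[b *m _ *m T1^T]mulmxA -trmx_mul TF1 trmx1 mulmx1.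
have [u1 _] := mulmx1_unit TF1; have [_ uF] := mulmx1_unit TF.
exists (b' *m T1^T); first by apply: (can_inj (mulmxK u1)); rewrite h1 !mulmxA.
have uFT : Fe^T \in unitmx by rewrite unitmx_tr.
apply: (can_inj (mulmxK uFT)).
by rewrite h2 mulmxDl; congr (_ + _); rewrite !trmx_mul !mulmxA.
Qed.

Lemma conj_dirac_tangent (K : fieldType) n m (Te Fe om : 'M[K]_n) (T1 F1 A : 'M[K]_m) (D : 'M[K]_(n, m)) (v : 'rV[K]_n) (b : 'rV[K]_m) :
  Te *m Fe = 1%:M -> T1 *m F1 = 1%:M -> v *m (Fe *m D *m T1) = b *m (T1^T *m A *m T1) ->
  b *m (Fe *m D *m T1)^T = - v *m (Fe *m om *m Fe^T) ->
  exists2 b', v *m Fe *m D = b' *m A & b' *m D^T = - (v *m Fe) *m om.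
Proof.
move=> TF TF1 h1 h2; have Ev : v *m Fe *m Te = v by rewrite -mulmxA (mulmx1C TF) mulmx1.
have [|b' g1 g2] := (conj_dirac om A D TF TF1 (v *m Fe) 0).2; last first.
  by exists b' => //; move/eqP: g2; rewrite eq_sym addr_eq0 -mulNmx => /eqP.
by rewrite Ev; exists b => //; rewrite mul0mx h2 mulNmx addNr.
Qed.

Lemma rank_col_conj (K : fieldType) n m (f : 'M[K]_n) (g T P : 'M[K]_m) (D : 'M[K]_(n, m)) : f \in unitmx -> g \in unitmx -> T \in unitmx ->
  \rank (col_mx (f *m D *m T) (g *m P *m T)) = \rank (col_mx D P).
Proof.
move=> uf ug uT; rewrite -mul_col_mx mxrankMfree ?row_free_unit//; apply/eqmx_rank; apply/eqmxP.
apply: (eqmx_trans (eqmx_sym (addsmxE _ _))); apply: (eqmx_trans _ (addsmxE _ _)).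
by apply: adds_eqmx; apply: eqmxMfull; rewrite row_full_unit.
Qed.

Lemma bilin_sub n (A B : 'M[R]_n) (v w p1 p2 p3 p4 : 'rV_n) : v *m A *m w^T = p1 *m w^T - p2 *m v^T ->
  v *m B *m w^T = p3 *m w^T - p4 *m v^T -> (p1 - p3) *m w^T - (p2 - p4) *m v^T = v *m (A - B) *m w^T.
Proof. by move=> E1 E2; rewrite mulmxBr !mulmxBl E1 E2; apply/matrixP => i j; move: (p1 *m _) (p2 *m _) (p3 *m _) (p4 *m _) => a b c d; rewrite !mxE; ring. Qed.

Lemma extdB n (a b : 'rV_n -> 'rV_n) x : smooth_at x a -> smooth_at x b ->
  extd (fun y => a y - b y) x = extd a x - extd b x.
Proof.
move=> sa sb; apply: bilin_ext => v w.
have D u : 'D_u (fun y => a y - b y) x = 'D_u a x - 'D_u b x by have [_ E] := is_deriveB (smooth_isd u sa) (smooth_isd u sb).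
apply: (eq_trans (extd_bilin v w (smB sa sb))); rewrite !D.
exact: (bilin_sub (extd_bilin v w sa) (extd_bilin v w sb)).
Qed.

Section FormDiff.
Variables (n : nat) (N : premanifold R n).
Hypothesis hN : hmfd N.

Lemma asmB al be (z : N) : asm al z -> asm be z -> asm (fun z => al z - be z) z.
Proof.
move=> sa sb; have ac := at_atlas hN z; have d := at_dom hN z.
exists (chart_at z); split; [exact: ac|exact: d|].
apply: sm_ext (smB (asm_chart hN sa ac d) (asm_chart hN sb ac d)); near=> y; by rewrite /aform mulmxBl.
Unshelve. all: by end_near. Qed.

Lemma mdformB al be (z : N) : asm al z -> asm be z -> mdform (fun z => al z - be z) z = mdform al z - mdform be z.
Proof.
move=> sa sb; have ac := at_atlas hN z; have d := at_dom hN z.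
have s1 := asm_chart hN sa ac d; have s2 := asm_chart hN sb ac d.
have nn : \forall y \near cmap (chart_at z) z, aform (chart_at z) al y - aform (chart_at z) be y = aform (chart_at z) (fun z => al z - be z) y.
  by near=> y; rewrite /aform mulmxBl.
exact: (eq_trans (esym (extd_near nn (smB s1 s2))) (extdB s1 s2)).
Unshelve. all: by end_near. Qed.
End FormDiff.

Lemma basis_mx (n r : nat) (W : {vspace 'rV_n}) (s : 'I_r -> 'rV_n) : basis_of W [tuple s a | a < r] ->
  row_free (\matrix_(a < r) s a) /\ forall v, (v \in W) = (v <= \matrix_(a < r) s a)%MS.
Proof.
move=> bs; have sumE (u : 'rV_r) : u *m (\matrix_(a < r) s a) = \sum_a u 0 a *: s a.
  by rewrite mulmx_sum_row; apply: eq_bigr => a _; rewrite rowK.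
split.
  rewrite -kermx_eq0; apply/eqP/row_matrixP => a; rewrite row0; set u := row a _.
  have uS : u *m (\matrix_(a < r) s a) = 0 by apply/sub_kermxP; exact: row_sub.
  by apply: (frame_free bs); rewrite -sumE.
move=> v; apply/idP/submxP => [vW|[u ->]].
  exists (\row_a coord [tuple s a | a < r] a v); rewrite sumE {1}(basis_coords bs vW).
  by apply: eq_bigr => a _; rewrite mxE.
by rewrite sumE; apply: memv_suml => a _; apply: memvZ; exact: (basis_memv bs).
Qed.

Lemma pull_covector (K : fieldType) n l m (b b3 : 'rV[K]_m) (v a : 'rV[K]_n) (I : 'M[K]_(n, l)) (D X : 'M[K]_(l, m)) (Q : 'M[K]_l) (eta L : 'M[K]_n) :
  a = b *m (I *m D)^T + v *m eta -> b3 *m X^T = b *m D^T + v *m I *m Q -> L = I *m Q *m I^T - eta -> b3 *m (I *m X)^T = a + v *m L.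
Proof.
move=> -> E ->; rewrite !trmx_mul mulmxA E mulmxDl mulmxBr !mulmxA -addrA (addrC (v *m eta)) subrK.
by [].
Qed.

Lemma gauge_covector (K : fieldType) n (u w v : 'rV[K]_n) (eta L : 'M[K]_n) : u = w + v *m eta -> u = - (v *m L) -> w = - v *m (eta + L).
Proof. by move=> E1 E2; rewrite mulNmx mulmxDr opprD -E2 E1 addrC addrK. Qed.

Definition zsec n r (M : premanifold R n) (W : M -> {vspace 'rV_n}) (x : M) : dual_bundle r W :=
  existT (fun x : M => dual_fiber (W x)) x 0.

Lemma norm_lsub a b (v w : 'rV_(a + b)) : `|lsubmx v - lsubmx w| <= `|v - w|.
Proof.
apply: mx_norm_le => // l l'; have := mx_coord_le (v - w) l (lshift b l').
by rewrite !mxE.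
Qed.

(** * Coregular coisotropic submanifolds *)

Section Saturation.
Variables (m k r : nat) (M : premanifold R m) (Pi : M -> 'M[R]_m) (X : premanifold R k) (i : X -> M).
Hypotheses (hM : hmfd M) (hX : hmfd X) (hPi : forall y, poisson_pt Pi y) (aPi : forall y, (Pi y)^T = - Pi y).
Hypotheses (si : forall x, msmap i x) (fi : forall x, row_free (mder i x)).
Hypotheses (hreg : coregular i Pi r) (hcoi : coisotropic i Pi).
Let W := TperpX i Pi.

Lemma mem_conormal x (a : 'rV_m) : (a \in conormal i x) = (a *m (mder i x)^T == 0).
Proof. by rewrite memv_ker lfunE. Qed.

Lemma mem_Tperp x v : v \in Tperp i Pi x <-> exists2 a : 'rV_m, a *m (mder i x)^T = 0 & v = a *m Pi (i x).
Proof.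
split=> [/memv_imgP[a]|[a a0 ->]]; first by rewrite mem_conormal => /eqP a0 ->; exists a => //; rewrite lfunE.
by apply/memv_imgP; exists a; [rewrite mem_conormal a0|rewrite lfunE].
Qed.

Lemma mem_TperpX x v : v \in W x <-> exists2 a : 'rV_m, a *m (mder i x)^T = 0 & a *m Pi (i x) = v *m mder i x.
Proof.
rewrite /W /TperpX -memv_preim lfunE; split => [/mem_Tperp[a a0 E]|[a a0 E]]; first by exists a.
by apply/mem_Tperp; exists a.
Qed.

Lemma coiso x (a : 'rV_m) : a *m (mder i x)^T = 0 -> exists u : 'rV_k, a *m Pi (i x) = u *m mder i x.
Proof.
move=> a0; have : a *m Pi (i x) \in limg (tangent i x).
  by apply: (subvP (hcoi x)); apply/mem_Tperp; exists a.
by rewrite mem_limg_mx => /submxP.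
Qed.

(** Coregularity in matrix form: [TX] together with the image of [Pi] has the dimension of the dual
    bundle, which is the rank that [lagr_frame] asks for. *)
Lemma rank_coreg x : \rank (col_mx (mder i x) (Pi (i x))) = (k + r)%N.
Proof.
have E : \dim (limg (sharp Pi (i x)) + limg (tangent i x)) = \rank (col_mx (mder i x) (Pi (i x))).
  apply: dim_rank => v; rewrite -addsmxE addsmxC; apply/idP/idP.
    move=> /memv_addP[a + [b + ->]]; rewrite !mem_limg_mx => a1 b1.
    by apply: addmx_sub; [apply: submx_trans a1 _; exact: addsmxSl|apply: submx_trans b1 _; exact: addsmxSr].
  move=> /sub_addsmxP[[a b] ->] /=; apply/memv_addP; exists (a *m Pi (i x)); first by rewrite mem_limg_mx submxMl.
  by exists (b *m mder i x); first by rewrite mem_limg_mx submxMl.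
have Ek : \dim (limg (tangent i x)) = k.
  by rewrite (dim_rank (mem_limg_mx (mder i x))); exact: (eqP (fi x)).
have := hreg x; rewrite E Ek => H; rewrite -H subnKC// -E -[X in (X <= _)%N]Ek.
by apply: dimvS; exact: addvSr.
Qed.

(** [Pi] maps the conormal space, of dimension [m - k], onto the orthogonal. Its kernel there
    annihilates both [TX] and the image of [Pi], so it has dimension [m - (k + r)]. *)
Lemma dim_TperpX x : \dim (W x) = r.
Proof.
set J := mder i x; set P := Pi (i x); pose N := kermx J^T; pose S := N *m P *m pinvmx J.
have NP : N *m P = S *m J.
  apply/row_matrixP => a; have a0 : row a N *m J^T = 0 by apply/sub_kermxP; exact: row_sub.
  rewrite /S; move: (N) a0 => N' a0; rewrite !row_mul.
  have [u E] := coiso a0; rewrite -/P -/J in E; have sub : (row a N' *m P <= J)%MS by rewrite E submxMl.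
  exact: (esym (mulmxKpV sub)).
have rJ : \rank J = k := eqP (fi x).
rewrite (dim_rank (A := S)); last first.
  move=> v; apply/idP/submxP => [/mem_TperpX[a a0 E]|[D ->]]; last first.
    by apply/mem_TperpX; exists (D *m N); [rewrite -[LHS]mulmxA mulmx_ker mulmx0|exact: (etrans (esym (mulmxA D N P)) (etrans (congr1 (mulmx D) NP) (mulmxA D S J)))].
  have /submxP[D ED] : (a <= N)%MS by apply/sub_kermxP.
  by exists D; apply: (row_free_inj (fi x)); rewrite -/J -mulmxA -NP mulmxA -ED E.
rewrite -(mxrankMfree S (fi x)) -/J -NP.
have := mxrank_mul_ker N P; have -> : \rank (N :&: kermx P)%MS = (m - (k + r))%N.
  have -> : \rank (N :&: kermx P)%MS = \rank (kermx (row_mx J^T P)).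
    apply/eqmx_rank; apply/andP; split; apply/rV_subP => a.
      rewrite sub_capmx => /andP[/sub_kermxP h1 /sub_kermxP h2]; apply/sub_kermxP.
      by rewrite mul_mx_row h1 h2 row_mx0.
    move=> /sub_kermxP; rewrite mul_mx_row -row_mx0 => /eq_row_mx[h1 h2].
    by rewrite sub_capmx; apply/andP; split; apply/sub_kermxP.
  by rewrite mxrank_ker (rank_alt_tr _ (aPi _)) rank_coreg.
rewrite /N mxrank_ker mxrank_tr rJ => H.
have : (k + r <= m)%N by rewrite -(rank_coreg x) rank_leq_col.
by move: H; move: (\rank _) => t H; lia.
Qed.

Section InCharts.
Variables (x : X) (q : chart R k X) (c : chart R m M).
Hypotheses (aq : atlas q) (dq : cdom q x) (ac : atlas c) (dc : cdom c (i x)).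

Definition jloc y := jacobian (cmap c \o i \o cinv q) y.
Definition ploc y := pcoord c Pi (cmap c (i (cinv q y))).

Lemma sm_jloc : smooth_at (cmap q x) jloc.
Proof. by apply: sm_jac; exact: (msmap_sm hX (si x)). Qed.

Lemma sm_ploc : smooth_at (cmap q x) ploc.
Proof.
apply: (sm_comp (g := pcoord c Pi) (msmap_sm hX (si x) aq dq ac dc)).
rewrite (cinvK hX aq dq); have [sP _ _] := poisson_pt_chart hM (hPi (i x)) ac dc; exact: sP.
Qed.

Lemma near_i : \forall y \near cmap q x, [/\ cdom q (cinv q y), cmap q (cinv q y) = y & cdom c (i (cinv q y))].
Proof.
apply: filterS2 (near_cdom hX aq dq) (msmap_near hX (si x) aq dq (mopen_cdom hM ac) dc) => y [d1 E1] d2.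
by [].
Qed.
End InCharts.

Section AtPoint.
Variables (z : X) (q : chart R k X) (c : chart R m M).
Hypotheses (aq : atlas q) (dq : cdom q z) (ac : atlas c) (dc : cdom c (i z)).
Let J := jloc q c (cmap q z).
Let P := ploc q c (cmap q z).
Let T := tcoord z q.
Let T1 := tcoord (i z) c.
Let F1 := fcoord (i z) c.

Lemma mder_jloc : mder i z = T *m J *m F1.
Proof. exact: (mderE hX hM (si z)). Qed.

Lemma jlocE : J = fcoord z q *m mder i z *m T1.
Proof.
rewrite mder_jloc !mulmxA (ftcoord hX aq dq) mul1mx -mulmxA (ftcoord hM ac dc) mulmx1.
by [].
Qed.

Lemma plocE : P = T1^T *m Pi (i z) *m T1.
Proof. by rewrite /P /ploc (cinvK hX aq dq) (pcoord_at hM). Qed.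

Lemma jloc_conormal p (a : 'M[R]_(p, m)) : a *m J^T = 0 -> a *m T1^T *m (mder i z)^T = 0.
Proof.
move=> a0; rewrite mder_jloc !trmx_mul !mulmxA -[a *m _ *m _]mulmxA -trmx_mul (ftcoord hM ac dc) trmx1 mulmx1.
by rewrite a0 mul0mx.
Qed.

Lemma conormal_jloc p (a : 'M[R]_(p, m)) : a *m (mder i z)^T = 0 -> a *m F1^T *m J^T = 0.
Proof.
move=> a0; rewrite jlocE !trmx_mul !mulmxA -[a *m _ *m _]mulmxA -trmx_mul (tfcoord hM ac dc) trmx1 mulmx1.
by rewrite a0 mul0mx.
Qed.

Lemma jloc_free : row_free J.
Proof.
have [u1 u2] := mulmx1_unit (ftcoord hX aq dq); have [u3 u4] := mulmx1_unit (ftcoord hM ac dc).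
apply/eqP; apply: (eq_trans (esym (rank_conj J u2 u3))); apply: (eq_trans _ (eqP (fi z))).
exact: (congr1 (fun A => \rank A) (esym mder_jloc)).
Qed.

Lemma ploc_lift p (a : 'M[R]_(p, m)) (v : 'M[R]_(p, k)) : a *m P = v *m T *m J -> a *m T1^T *m Pi (i z) = v *m mder i z.
Proof.
rewrite plocE mder_jloc => E; have := congr1 (mulmx^~ F1) E.
rewrite /T1 /F1 !mulmxA -[_ *m tcoord (i z) c *m _]mulmxA (tfcoord hM ac dc) mulmx1.
by [].
Qed.

Lemma lift_ploc p (a : 'M[R]_(p, m)) (v : 'M[R]_(p, k)) : a *m Pi (i z) = v *m mder i z -> a *m F1^T *m P = v *m T *m J.
Proof.
rewrite plocE jlocE; exact: (lift_conj (tfcoord hX aq dq) (tfcoord hM ac dc)).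
Qed.

Lemma mem_loc (v : 'rV_k) : v \in W z <-> exists2 a : 'rV_m, a *m J^T = 0 & a *m P = v *m T *m J.
Proof.
split => [/mem_TperpX[a a0 E]|[a a0 E]].
  by exists (a *m F1^T); [exact: conormal_jloc|exact: lift_ploc].
by apply/mem_TperpX; exists (a *m T1^T); [exact: jloc_conormal|exact: ploc_lift].
Qed.
End AtPoint.

Lemma sm_section (F : X -> X) (U : set X) q (s : X -> 'rV_k) : mopen U -> atlas q -> U `<=` cdom q ->
  (forall z, U z -> msm (fun z => s z *m tcoord z q) z) -> smooth_section idfun U s.
Proof.
move=> oU aq Uq H c ac; apply: (msm_smooth_on hX) => z [Uz dc].
apply: (msm_ext hX (f := fun z => s z *m tcoord z q *m jacobian (cmap c \o cinv q) (cmap q z))).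
  exists (U `&` cdom c); split; [by apply: (mopenI hX oU); exact: mopen_cdom|by []|move=> y [Uy dy]].
  by rewrite -mulmxA (tcoord_trans hX aq (Uq _ Uy) ac dy).
have mj := msm_tcoord hX aq (Uq _ Uz) ac dc.
by apply: (msm_lift2 hX _ (H z Uz) mj) => x c1 s1 s2; exact: (sm_mulmx s1 s2).
Qed.

(** A basis at [x] is lifted to conormal covectors, which extend to a smooth conormal family by
    [kernel_frame]; applying [Pi] gives vectors that are tangent to [X] by coisotropy. *)
Lemma TperpX_frames x : exists U, exists s : 'I_r -> X -> 'rV_k, [/\ mopen U, U x & local_frame idfun W U s].
Proof.
have aq := at_atlas hX x; have dq := at_dom hX x; set q := chart_at x in aq dq.
have ac := at_atlas hM (i x); have dc := at_dom hM (i x); set c := chart_at (i x) in ac dc.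
pose J := jloc q c; pose P := ploc q c.
pose b := tcast (dim_TperpX x) (vbasis (W x)).
have bW : basis_of (W x) b by rewrite /b val_tcast; exact: vbasisP.
have H0 (a : 'I_r) : exists n : 'rV_m, n *m (J (cmap q x))^T = 0 /\ n *m P (cmap q x) = b`_a *m tcoord x q *m J (cmap q x).
  have bin : b`_a \in W x by apply: (basis_mem bW); apply: mem_nth; rewrite size_tuple.
  by have /(mem_loc aq dq ac dc)[n n0 E] := bin; exists n.
have [n0 Hn] := choice H0.
pose K0 := \matrix_(a < r) n0 a; pose S0 := \matrix_(a < r) (b`_a *m tcoord x q).
have KJ : K0 *m (J (cmap q x))^T = 0 by apply/row_matrixP => a; rewrite row_mul rowK row0; case: (Hn a).
have KP : K0 *m P (cmap q x) = S0 *m J (cmap q x) by apply/row_matrixP => a; rewrite !row_mul !rowK; case: (Hn a).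
have fS0 : row_free S0.
  rewrite -kermx_eq0; apply/eqP/row_matrixP => a; rewrite row0; set u := row a _.
  have uS : u *m S0 = 0 by apply/sub_kermxP; exact: row_sub.
  have [ut _] := mulmx1_unit (tfcoord hX aq dq).
  have E : \sum_a u 0 a *: b`_a = 0.
    apply: (can_inj (mulmxK ut)); rewrite mul0mx; apply: (eq_trans _ uS); rewrite mulmx_suml mulmx_sum_row.
    by apply: eq_bigr => a' _; rewrite rowK -scalemxAl.
  have /freeP/(_ (fun a => u 0 a) E) Hu := vector.basis_free bW.
  by apply/rowP => a'; rewrite Hu [RHS]mxE.
have sJ := sm_jloc aq dq ac dc; have sP := sm_ploc aq dq ac dc.
have fJ : \forall y \near cmap q x, \rank (J y)^T = k.
  apply: filterS (near_i aq dq ac dc) => y [d1 E1 d2]; rewrite mxrank_tr.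
  by have := jloc_free aq d1 ac d2; rewrite E1 => /eqP.
have [K [sK K0E KE]] := kernel_frame (sm_tr sJ) fJ KJ.
(* A left inverse of [J] built from its Gram matrix solves [S J = K P]; that a solution exists at
   nearby points is coisotropy there. *)
pose S y := K y *m P y *m (J y)^T *m invmx (J y *m (J y)^T).
have uJ y : row_free (J y) -> J y *m (J y)^T \in unitmx by exact: gram_unit.
have fJx : row_free (J (cmap q x)) by exact: (jloc_free aq dq ac dc).
have sS : smooth_at (cmap q x) S.
  apply: sm_mulmx; first by apply: sm_mulmx (sm_tr sJ); exact: sm_mulmx sK sP.
  by apply: sm_invmx (uJ _ fJx) _; exact: sm_mulmx sJ (sm_tr sJ).
have SE : S (cmap q x) = S0 by rewrite /S K0E KP -[S0 *m _ *m _]mulmxA mulmxK//; exact: uJ.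
have uG : S (cmap q x) *m (S (cmap q x))^T \in unitmx by rewrite SE; exact: gram_unit.
have nG := near_unitmx (sm_mulmx sS (sm_tr sS)) uG.
pose good y := [/\ cdom q (cinv q y), cmap q (cinv q y) = y, cdom c (i (cinv q y)), smooth_at y S & K y *m (J y)^T = 0 /\ S y *m (S y)^T \in unitmx].
have ng : \forall y \near cmap q x, good y.
  have n3 := sm_near sS; apply: filterS3 (near_i aq dq ac dc) n3 (filterI KE nG) => y [h1 h2 h3] h4 [h5 h6].
  by split.
have [A [oA Ax] Ag] := near_open ng.
pose U : set X := [set z | cdom q z /\ A (cmap q z)].
exists U, (fun a z => row a (S (cmap q z)) *m fcoord z q); split; first exact: mopen_chart.
  by [].
have oU : mopen U by exact: mopen_chart.
split=> [a|z [dz Az]].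
  apply: (sm_section idfun oU aq) => [z []//|z [dz Az]]; exists q; split => //.
  have [_ _ _ sSz _] := Ag _ Az.
  have srow : smooth_at (cmap q z) (fun y => row a (S y)) by rewrite (_ : (fun y => _) = fun y => delta_mx 0 a *m S y); [exact: sm_mulmx (sm_cst _ _) sSz|apply/funext => y; rewrite rowE].
  apply: sm_ext srow; apply: filterS (near_cdom hX aq dz) => y [d1 E1].
  by rewrite E1 -mulmxA (ftcoord hX aq d1) mulmx1.
have [_ _ dc1 _ [KJz uGz]] := Ag _ Az; rewrite (cinvK hX aq dz) in dc1.
pose Sz := S (cmap q z) *m fcoord z q.
have -> : [tuple row a (S (cmap q z)) *m fcoord z q | a < r] = [tuple row a Sz | a < r].
  by apply: eq_from_tnth => a; rewrite !tnth_mktuple /Sz row_mul.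
have [_ ut] := mulmx1_unit (tfcoord hX aq dz).
have fS : row_free (S (cmap q z)).
  apply/row_freeP; exists ((S (cmap q z))^T *m invmx (S (cmap q z) *m (S (cmap q z))^T)).
  by rewrite mulmxA mulmxV.
apply: basis_rows_dim; last exact: dim_TperpX.
  by rewrite /row_free /Sz mxrankMfree ?row_free_unit.
move=> a; apply/(mem_loc aq dz ac dc1); exists (row a (K (cmap q z))).
  by rewrite -row_mul KJz row0.
have a0 : row a (K (cmap q z)) *m (J (cmap q z))^T = 0 by rewrite -row_mul KJz row0.
have [u Eu] := coiso (jloc_conormal aq dz ac dc1 a0).
have E2 := etrans (congr1 (mulmx^~ _) (esym (covec_cancel _ (ftcoord hM ac dc1)))) (lift_ploc aq dz ac dc1 Eu).
rewrite E2 /Sz row_mul -[_ *m fcoord z q *m _]mulmxA (ftcoord hX aq dz) mulmx1; congr (_ *m _).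
have fJz : row_free (J (cmap q z)) by exact: (jloc_free aq dz ac dc1).
by rewrite /S !row_mul E2 -[_ *m J _ *m _]mulmxA mulmxK//; exact: uJ.
Qed.

(** * The gauged Dirac structure on the dual bundle *)

Variable G : X -> {vspace 'rV_k}.
Hypotheses (hG : subbundle idfun G) (hGc : forall x, complement (TperpX i Pi x) (G x) fullv).
Let E := dual_bundle r W.
Let hW := TperpX_frames.
Let hE : hmfd E := dual_hmfd hX hW.
Let bc := dual_bundle_charts hX hW.
Let pr : E -> X := @dual_proj R k r X W.
Let j : E -> cotangent X := bundle_incl G.

Lemma frame_matrix q (s : 'I_r -> X -> 'rV_k) x : (\matrix_(a < r) s a x) *m tcoord x q = fmat q s x.
Proof. by apply/row_matrixP => a; rewrite row_mul !rowK. Qed.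

Section Chart.
Variables (e0 : E) (c : chart R (k + r) E) (q : chart R k X) (U : set X) (s : 'I_r -> X -> 'rV_k).
Hypotheses (ac : atlas c) (hc : dual_bd_frame c q U s) (d0 : cdom c e0).

Let aq : atlas q. Proof. by case: hc => [[]]. Qed.
Let U0 : U (projT1 e0). Proof. by have [_ [dE _ _]] := hc; have := d0; rewrite dE. Qed.
Let lfr : local_frame idfun W U s. Proof. by case: hc => [[]]. Qed.

Lemma frame_basis x : U x -> basis_of (W x) [tuple row a (\matrix_(a < r) s a x) | a < r].
Proof.
move=> Ux; have -> : [tuple row a (\matrix_(a < r) s a x) | a < r] = [tuple s a x | a < r]; last exact: lfr.2.
by apply: eq_from_tnth => a; rewrite !tnth_mktuple rowK.
Qed.

Lemma incl_setup : exists V (K : X -> 'M[R]_(r, k)), [/\ mopen V, V (projT1 e0), forall x, V x -> U x /\ cdom q x &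
  [/\ forall x, V x -> msm K x, forall x, V x -> fmat q s x *m (K x)^T = 1%:M & forall e : E, V (projT1 e) ->
    dual_incl (G (projT1 e)) (projT2 e) *m (fcoord (projT1 e) q)^T = fcomp s e *m K (projT1 e)]].
Proof.
have [[_ oU Uq _] _] := hc.
have [|z Uz dz|V [K [oV Vx VU HV]]] := dual_incl_local (F := idfun) hX hX (msmap_id hX) hGc hG (S := fun x => \matrix_(a < r) s a x) aq (Uq _ U0) oU U0.
- by move=> x Ux; exact: frame_basis.
- have mf := fmat_msm hX aq oU lfr Uz (Uq _ Uz); apply: (msm_lift1 _ mf) => x c1 s1.
  by apply: sm_ext s1; near=> y; rewrite frame_matrix.
exists V, K; split => //; split => [x /HV[]//|x /HV[_ + _]|e /HV[_ _ ->]]; first by rewrite frame_matrix.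
by congr (_ *m _); apply/rowP => a; rewrite !mxE rowK.
Unshelve. all: by end_near. Qed.

Lemma mder_pr e : cdom c e -> mder pr e = tcoord e c *m col_mx 1%:M 0 *m fcoord (projT1 e) q.
Proof. by move=> d; apply: (bundle_mder hX bc _ ac d (U := U) (Y := fcomp s)); exists s. Qed.
End Chart.

Lemma j_smooth e : msmap j e.
Proof.
have [c [q [U [s [ac hc Ux]]]]] := dual_chart_ex hX hW e.
have d : cdom c e by have [_ [-> _ _]] := hc.
have [[aq oU Uq _] _] := hc.
have [V [K [oV Vx VU [sK _ hK]]]] := incl_setup hc d.
have [cc acc hcc] := cot_chart hX (z0 := j e) aq (Uq _ Ux).
exact: (cot_lift_smooth hX hX (msmap_id hX) hW ac hc acc hcc oV VU sK hK Vx).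
Qed.

(** The pull-back of [tautform] by [j], hence a primitive of the pulled-back symplectic form that
    vanishes on the zero section. *)
Definition al0 (e : E) : 'rV_(k + r) := - dual_incl (G (projT1 e)) (projT2 e) *m (mder pr e)^T.

Lemma al0_pull e : al0 e = tautform (j e) *m (mder j e)^T.
Proof.
rewrite /tautform -mulmxA -trmx_mul; congr (_ *m _^T).
exact: (mder_comp hE (cot_hmfd hX) hX (j_smooth e) (bundle_proj_smooth hX (cot_bundle hX) (j e))).
Qed.

Let jnear e : exists U, [/\ mopen U, U e & forall y, U y -> msmap j y].
Proof. by exists setT; split => [||y _]; [exact: mopenT|by []|exact: j_smooth]. Qed.

Lemma al0_asm e : asm al0 e.
Proof.
have := asm_pull hE (cot_hmfd hX) (j_smooth e) (tautform_smooth hX (j e)) (jnear e).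
by rewrite (_ : (fun y => _) = al0)//; apply/funext => y; rewrite al0_pull.
Qed.

Lemma al0_mdform e : mdform al0 e = form_pull j (@omega_can R k X) e.
Proof.
have := mdform_pull hE (cot_hmfd hX) (j_smooth e) (tautform_smooth hX (j e)) (jnear e).
rewrite (_ : (fun y => tautform _ *m _) = al0); last by apply/funext => y; rewrite al0_pull.
by move=> ->; rewrite (tautform_extd hX).
Qed.

(** Block form of a two-form in a bundle chart: no component on pairs of base directions, and a
    mixed block dual to the frame of the orthogonal. The component on fibre directions is left free,
    which is where the two forms of Moser's argument differ by more than the choice of
    complements. *)
Definition vert_form (e : E) (c : chart R (k + r) E) (q : chart R k X) (s : 'I_r -> X -> 'rV_k) (om : 'M[R]_(k + r)) :=
  exists (K1 : 'M[R]_(k, r)) s1, fmat q s (projT1 e) *m K1 = 1%:M /\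
    fcoord e c *m om *m (fcoord e c)^T = block_mx 0 K1 (- K1^T) s1.

Lemma vert_form_line e c q s om om' (t : R) : vert_form e c q s om -> vert_form e c q s om' ->
  vert_form e c q s (om + t *: (om' - om)).
Proof.
move=> [K [s1 [SK E1]]] [K' [s1' [SK' E1']]]; exists (K + t *: (K' - K)), (s1 + t *: (s1' - s1)); split.
  by rewrite mulmxDr -scalemxAr mulmxBr SK SK' subrr scaler0 addr0.
rewrite mulmxDr mulmxDl -scalemxAr -scalemxAl mulmxBr mulmxBl E1 E1' opp_block_mx add_block_mx scale_block_mx add_block_mx.
congr block_mx; first by rewrite subrr scaler0 addr0.
by apply/matrixP => a b; rewrite !mxE; ring.
Qed.

Lemma al0_vert e c q U s : atlas c -> dual_bd_frame c q U s -> cdom c e -> fcomp s e = 0 -> vert_form e c q s (mdform al0 e).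
Proof.
move=> ac hc d y0; have [[aq oU Uq _] [dE mE _]] := hc.
have [V [K [oV Vx VU [sK SK hK]]]] := incl_setup hc d.
have [cc acc hcc] := cot_chart hX (z0 := j e) aq (Uq _ (VU _ Vx).1).
exists (K (projT1 e))^T, 0; split; first exact: SK.
rewrite -(mdform_fcoord hE (al0_asm e) ac d).
pose A w := row_mx (- rsubmx (liftloc idfun q q K w)) (0 : 'rV_r).
have sl := sm_liftloc hX (msmap_id hX) hc hcc VU sK Vx.
have sA : smooth_at (cmap c e) A by apply: sm_row_mx; [apply: smN; exact: sm_rsub sl|exact: sm_cst].
have nA : \forall w \near cmap c e, A w = aform c al0 w.
  apply: filterS (near_lift hX hW ac hc oV VU Vx) => w [d1 V1 El Er].
  rewrite /A row_mxKr El Er -hK// /aform /al0 (mder_pr ac hc d1).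
  move: (dual_incl _ _) (fcoord (projT1 _) q) (fcoord _ c) (tcoord _ c) (ftcoord hE ac d1) => a f F T FT.
  rewrite !trmx_mul !mulmxA -[_ *m T^T *m F^T]mulmxA -trmx_mul FT trmx1 mulmx1 tr_col_mx trmx1 trmx0 mul_mx_row mulmx1 mulmx0.
  by rewrite mulNmx.
rewrite -(extd_near nA sA); apply: bilin_ext => v w; rewrite (extd_bilin v w sA).
have r0 : rsubmx (cmap c e) = 0 by rewrite mE// row_mxKr.
have D u : 'D_u A (cmap c e) = row_mx (- (rsubmx u *m K (projT1 e))) 0.
  have h := isd_rsub (smooth_isd u sl).
  have [_ ->] := isd_row_mx (is_deriveN h) (is_derive_cst (0 : 'rV_r) (cmap c e) u).
  by rewrite (derive_mulE _ (sm_diff sl)) (jac_liftloc hX (msmap_id hX) hc hcc VU sK Vx u r0) row_mxKr.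
rewrite !D -[v]hsubmxK -[w]hsubmxK !row_mxKr; move: (lsubmx v) (rsubmx v) (lsubmx w) (rsubmx w) (K _) => a b a' b' K'.
rewrite mul_row_block !tr_row_mx !mul_row_col !mulmx0 !mul0mx !addr0 add0r trmxK mulmxN !mulNmx opprK; congr (_ + _).
by rewrite -[LHS]scal1_tr !trmx_mul trmxK mulmxA.
Qed.

Section Chart.
Variables (c : chart R (k + r) E) (q : chart R k X) (U : set X) (s : 'I_r -> X -> 'rV_k) (e : E) (cM : chart R m M).
Hypotheses (ac : atlas c) (hc : dual_bd_frame c q U s) (d : cdom c e) (aM : atlas cM) (dM : cdom cM (i (pr e))).

Let aq : atlas q. Proof. by case: hc => [[]]. Qed.
Let Ue : U (projT1 e). Proof. by have [_ [dE _ _]] := hc; have := d; rewrite dE. Qed.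
Let dq : cdom q (projT1 e). Proof. by have [[_ _ Uq _] _] := hc; exact: Uq. Qed.
Let lfr : local_frame idfun W U s. Proof. by case: hc => [[]]. Qed.

Lemma mder_ipr : mder pr e *m mder i (pr e) = tcoord e c *m col_mx (jloc q cM (cmap q (projT1 e))) 0 *m fcoord (i (pr e)) cM.
Proof.
rewrite (mder_pr ac hc d) (mder_jloc aq dq aM dM).
move: (tcoord e c) (fcoord (projT1 e) q) (tcoord _ q) (ftcoord hX aq dq) (jloc _ _ _) (fcoord _ cM) => T f t ft J F.
by rewrite !mulmxA -[_ *m f *m t]mulmxA ft mulmx1 -[T *m _ *m J]mulmxA mul_col_mx mul1mx mul0mx.
Qed.

(** The gauged structure meets the tangent space of the bundle trivially, so it is a graph at such a
    point; this is [lagr_trivial] read in charts. *)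
Lemma vert_trivial om (v : 'rV_(k + r)) (b : 'rV_m) : vert_form e c q s om -> v *m (mder pr e *m mder i (pr e)) = b *m Pi (i (pr e)) ->
  b *m (mder pr e *m mder i (pr e))^T = - v *m om -> v = 0.
Proof.
move=> [K1 [s1 [SK omE]]] h1 h2; have TF := tfcoord hE ac d; have TF1 := tfcoord hM aM dM.
have [|b' g1 g2] := (conj_dirac om (Pi (i (pr e))) (mder pr e *m mder i (pr e)) TF TF1 v 0).1.
  by exists b => //; rewrite h2 mulNmx addNr.
pose J := jloc q cM (cmap q (projT1 e)); pose P := ploc q cM (cmap q (projT1 e)).
have FE : fcoord e c *m (mder pr e *m mder i (pr e)) *m tcoord (i (pr e)) cM = col_mx J 0.
  rewrite mder_ipr; move: (ftcoord hE ac d) (ftcoord hM aM dM); rewrite -/J.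
  move: (tcoord e c) (fcoord e c) (tcoord _ cM) (fcoord _ cM) => T F T1 F1 FT FT1.
  by rewrite !mulmxA FT mul1mx -mulmxA FT1 mulmx1.
have PE : P = (tcoord (i (pr e)) cM)^T *m Pi (i (pr e)) *m tcoord (i (pr e)) cM by exact: (plocE aq dq aM dM).
have aP : P^T = - P by rewrite PE; apply: antisym_conj; exact: aPi.
rewrite omE FE -PE mul0mx in g1 g2; move/eqP: g2; rewrite eq_sym addr_eq0 -mulNmx => /eqP g2.
have H0 (a : 'I_r) : exists n : 'rV_m, n *m J^T = 0 /\ n *m P = s a (projT1 e) *m tcoord (projT1 e) q *m J.
  have inW : s a (projT1 e) \in W (projT1 e) by exact: (basis_memv (lfr.2 _ Ue)).
  have [n n0 En] := (mem_loc aq dq aM dM _).1 inW; exists n; split; [exact: n0|exact: En].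
have [n0 Hn] := choice H0.
have v0 : v *m tcoord e c = 0.
  apply: (lagr_trivial (N := \matrix_(a < r) n0 a) aP _ _ _ SK g1 g2).
  - by apply/row_matrixP => a; rewrite row_mul rowK row0; case: (Hn a).
  - by apply/row_matrixP => a; rewrite !row_mul !rowK; case: (Hn a).
  - move=> u b1 e1 e2; have inW : u *m fcoord (projT1 e) q \in W (projT1 e).
      apply/(mem_loc aq dq aM dM); exists b1; first exact: e2.
      by rewrite -(mulmxA u) (ftcoord hX aq dq) mulmx1; exact: esym.
    have := congr1 (mulmx^~ (tcoord (projT1 e) q)) (basis_coords (lfr.2 _ Ue) inW).
    rewrite /= -{1}(mulmxA u) (ftcoord hX aq dq) mulmx1 => ->.
    rewrite mulmx_suml; apply: summx_sub => a _; rewrite -scalemxAl; apply: scalemx_sub.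
    by have -> : s a (projT1 e) *m tcoord (projT1 e) q = row a (fmat q s (projT1 e)); [rewrite rowK|exact: row_sub].
have [uT _] := mulmx1_unit TF; apply: (can_inj (mulmxK uT)).
by rewrite v0 mul0mx.
Qed.
End Chart.

Definition ipr (e : E) : M := i (pr e).

Lemma ipr_smooth e : msmap ipr e.
Proof. exact: (msmap_comp hE hX hM (bundle_proj_smooth hX bc e) (si _)). Qed.

Lemma mder_iprE e : mder ipr e = mder pr e *m mder i (pr e).
Proof. exact: (mder_comp hE hX hM (bundle_proj_smooth hX bc e) (si _)). Qed.

Lemma rank_ipr e : \rank (col_mx (mder ipr e) (Pi (ipr e))) = (k + r)%N.
Proof.
apply: (eq_trans _ (rank_coreg (pr e))); rewrite mder_iprE; apply/eqmx_rank; apply/eqmxP.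
apply: (eqmx_trans (eqmx_sym (addsmxE _ _))); apply: (eqmx_trans _ (addsmxE _ _)).
apply: adds_eqmx => //; apply: eqmxMfull.
have [c [q [U [s [ac hc Ux]]]]] := dual_chart_ex hX hW e.
have d : cdom c e by have [_ [-> _ _]] := hc.
have [[aq oU Uq _] _] := hc.
have -> := mder_pr ac hc d.
apply/row_fullP; exists (tcoord (projT1 e) q *m row_mx 1%:M 0 *m fcoord e c).
move: (ftcoord hE ac d) (tfcoord hX aq (Uq _ Ux)).
move: (tcoord e c) (fcoord e c) (tcoord (projT1 e) q) (fcoord (projT1 e) q) => T F t f FT tf.
by rewrite !mulmxA -[_ *m F *m T]mulmxA FT mulmx1 -[_ *m row_mx _ _ *m _]mulmxA mul_row_col mulmx1 mul0mx addr0 mulmx1 tf.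
Qed.

Let eta := form_pull j (@omega_can R k X).
Let etaE e : mdform (al0) e = eta e. Proof. exact: (al0_mdform). Qed.

Definition gaugeL : dirac_field E := dirac_gauge (dirac_pull pr (dirac_pull i (dirac_graph Pi))) eta.

Lemma gaugeLE e v a : gaugeL e (v, a) <-> exists2 b, v *m mder ipr e = b *m Pi (ipr e) & a = b *m (mder ipr e)^T + v *m eta e.
Proof.
split.
  rewrite mder_iprE; move=> [v1 [a1 [v2 [b2 [v3 [b3 [b4 [e1 e2]] [e3 e4]]] [e5 e6]]]] [e7 e8]]; subst.
  by exists b4; rewrite ?mulmxA -?e3 ?e1// trmx_mul mulmxA.
move=> [b h1 h2]; exists v, (b *m (mder ipr e)^T); last by rewrite h2.
exists v, (b *m (mder i (pr e))^T); last by rewrite mder_iprE trmx_mul mulmxA.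
exists (v *m mder pr e), b => //; exists b.
by apply: (congr1 (fun u => (u, b))); apply: (eq_trans _ h1); rewrite mder_iprE mulmxA.
Qed.

Definition gaugePi (e : E) : 'M[R]_(k + r) := choose_or 0 (fun Q => gaugeL e = [set w | exists a : 'rV_(k + r), w = (a *m Q, a)]).

Lemma gaugePiE e Q : gaugeL e = [set w | exists a : 'rV_(k + r), w = (a *m Q, a)] -> gaugePi e = Q.
Proof.
move=> H; have := @choose_orP _ 0 (fun Q => gaugeL e = [set w | exists a : 'rV_(k + r), w = (a *m Q, a)]) (ex_intro _ Q H).
rewrite -/(gaugePi e) H => E1; apply/row_matrixP => l; rewrite !rowE.
have : [set w | exists a : 'rV_(k + r), w = (a *m Q, a)] (delta_mx 0 l *m gaugePi e, delta_mx 0 l) by rewrite E1; exists (delta_mx 0 l).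
by move=> [a [-> <-]].
Qed.

(** Transversality is available only on the zero section. It gives there a frame with [Q = 1];
    constant rank extends the frame smoothly and invertibility of [Q] persists nearby, so the
    structure is the graph of [invmx Q *m V], whose Jacobi identity is [gauge_jacobi]. *)
Theorem gauge_poisson e0 : zero_section e0 -> exists V, [/\ mopen V, V e0 & forall e, V e ->
  gaugeL e = dirac_graph gaugePi e /\ poisson_pt gaugePi e].
Proof.
move=> z0; have [c [q [U [s [ac hc Ux]]]]] := dual_chart_ex hX hW e0.
have d : cdom c e0 by have [_ [-> _ _]] := hc.
pose cM := chart_at (ipr e0); have aM : atlas cM := at_atlas hM _; have dM : cdom cM (ipr e0) := at_dom hM _.
pose Fl w := cmap cM (ipr (cinv c w)); pose JF := jacobian Fl; pose P := pcoord cM Pi.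
pose et := extd (aform c (al0)); set w0 := cmap c e0.
have al_s e : asm (al0) e := al0_asm e.
have dom : \forall w \near w0, [/\ cdom c (cinv c w), cmap c (cinv c w) = w & cdom cM (ipr (cinv c w))].
  by apply: filterS2 (near_cdom hE ac d) (msmap_near hE (ipr_smooth e0) ac d (mopen_cdom hM aM) dM) => w [].
have atw w : cdom c (cinv c w) -> cmap c (cinv c w) = w -> cdom cM (ipr (cinv c w)) ->
   [/\ smooth_at w Fl, smooth_at w et, smooth_at (Fl w) P, (P (Fl w))^T = - P (Fl w) & jacobi P (Fl w)].
  move=> dw Ew dMw; have [sP aP jP] := poisson_pt_chart hM (hPi (ipr (cinv c w))) aM dMw.
  have := msmap_sm hE (ipr_smooth (cinv c w)) ac dw aM dMw; rewrite Ew => sF.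
  have sa := asm_chart hE (al_s (cinv c w)) ac dw; rewrite Ew in sa.
  split; [exact: sF|exact: sm_extd sa|exact: sP|exact: (nbhs_singleton aP)|exact: jP].
have JE w : cdom c (cinv c w) -> cmap c (cinv c w) = w -> cdom cM (ipr (cinv c w)) ->
   [/\ JF w = fcoord (cinv c w) c *m mder ipr (cinv c w) *m tcoord (ipr (cinv c w)) cM,
     P (Fl w) = (tcoord (ipr (cinv c w)) cM)^T *m Pi (ipr (cinv c w)) *m tcoord (ipr (cinv c w)) cM &
     et w = fcoord (cinv c w) c *m eta (cinv c w) *m (fcoord (cinv c w) c)^T].
  move=> dw Ew dMw; have E1 := mder_jac hE hM (ipr_smooth (cinv c w)) ac dw aM dMw; rewrite Ew in E1.
  have E3 := mdform_fcoord hE (al_s (cinv c w)) ac dw; rewrite Ew etaE in E3.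
  split; [exact: E1|exact: (pcoord_at hM)|exact: E3].
have rk w : cdom c (cinv c w) -> cmap c (cinv c w) = w -> cdom cM (ipr (cinv c w)) -> \rank (col_mx (JF w) (P (Fl w))) = (k + r)%N.
  move=> dw Ew dMw; have [-> -> _] := JE w dw Ew dMw; apply: (eq_trans _ (rank_ipr (cinv c w))).
  have [_ uF] := mulmx1_unit (tfcoord hE ac dw); have [uT _] := mulmx1_unit (tfcoord hM aM dMw).
  by apply: rank_col_conj => //; rewrite unitmx_tr.
have [dw0 Ew0 dMw0] := nbhs_singleton dom.
have [sF0 se0 sP0 aP0 _] := atw w0 dw0 Ew0 dMw0.
have iw0 : cinv c w0 = e0 by exact: (cinvK hE ac d).
have y0 : fcomp s e0 = 0.
  apply/rowP => a; rewrite !mxE /dual_eval; have -> : projT2 e0 = 0 :> 'Hom(subvs_of (W (projT1 e0)), R^o) by exact: z0.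
  by rewrite lfunE.
have vf : vert_form e0 c q s (eta e0) by rewrite -etaE; exact: (al0_vert ac hc d y0).
have Lag (v : 'rV_(k + r)) (b : 'rV_m) : v *m JF w0 = b *m P (Fl w0) -> b *m (JF w0)^T = - v *m et w0 -> v = 0.
  have [-> -> ->] := JE w0 dw0 Ew0 dMw0; rewrite iw0 => h1 h2.
  have TF := tfcoord hE ac d; have TF1 := tfcoord hM aM dM.
  have [b' g1 g2] := conj_dirac_tangent TF TF1 h1 h2.
  rewrite mder_iprE in g1 g2.
  have v0 := vert_trivial ac hc d aM dM vf g1 g2.
  have [_ uF] := mulmx1_unit TF; apply: (can_inj (mulmxK uF)).
  by rewrite v0 mul0mx.
have [V0 [b0 [VF0 Q0]]] := lagr_frame (rk w0 dw0 Ew0 dMw0) aP0 Lag.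
pose A w := col_mx (JF w) (P (Fl w)).
have sA : smooth_at w0 A by apply: sm_col_mx; [exact: sm_jac|exact: (sm_comp sF0 sP0)].
(* The frame is read as a left kernel of the stacked matrix, which has constant rank by
   coregularity, so that [kernel_frame] can extend it. *)
have KA : row_mx V0 (- b0) *m A w0 = 0 by rewrite mul_row_col mulNmx VF0 subrr.
have rkA : \forall w \near w0, \rank (A w) = (k + r)%N by apply: filterS dom => w [d1 E1 dM1]; exact: rk.
have [K [sK KE KN]] := kernel_frame sA rkA KA.
pose V w := lsubmx (K w); pose b w := - rsubmx (K w).
pose Q w := b w *m (JF w)^T + V w *m et w.
have VFw w : K w *m A w = 0 -> V w *m JF w = b w *m P (Fl w).
  by rewrite -{1}[K w]hsubmxK mul_row_col => /eqP; rewrite addr_eq0 -mulNmx => /eqP.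
have sQ w : smooth_at w K -> smooth_at w Fl -> smooth_at w et -> smooth_at w Q.
  move=> s1 s2 s3; apply: smD; last by apply: sm_mulmx => //; exact: sm_lsub s1.
  by apply: sm_mulmx; [apply: smN; exact: sm_rsub s1|apply: sm_tr; exact: sm_jac].
have uQ0 : Q w0 \in unitmx.
  by rewrite /Q /V /b KE row_mxKl row_mxKr opprK Q0 unitmx1.
pose good w := [/\ cdom c (cinv c w), cmap c (cinv c w) = w, cdom cM (ipr (cinv c w)), smooth_at w K & K w *m A w = 0 /\ Q w \in unitmx].
have ng : \forall w \near w0, good w.
  apply: filterS3 dom (sm_near sK) (filterI KN (near_unitmx (sQ w0 sK sF0 se0) uQ0)) => w [h1 h2 h3] h4 [h5 h6].
  by split.
have [B [oB Bw0] Bg] := near_open ng.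
exists [set e | cdom c e /\ B (cmap c e)]; split; [exact: (mopen_chart hE ac oB)|by split|].
pose Gm w := invmx (Q w) *m V w.
pose PP e := (fcoord e c)^T *m Gm (cmap c e) *m fcoord e c.
have graph e : cdom c e -> B (cmap c e) -> gaugePi e = PP e /\ gaugeL e = dirac_graph gaugePi e.
  move=> de Be; have [dw Ew dMw sKw [KAw uQw]] := Bg _ Be; rewrite (cinvK hE ac de) in dMw.
  have [dw' Ew' dMw' _ _] := Bg _ Be; have [sF se sP aP jP] := atw _ dw' Ew' dMw'.
  have [J1 J2 J3] := JE _ dw' Ew' dMw'; rewrite (cinvK hE ac de) in J1 J2 J3.
  have ae : (et (cmap c e))^T = - et (cmap c e) by exact: extd_antisym.
  have LE : gaugeL e = [set w | exists a : 'rV_(k + r), w = (a *m PP e, a)].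
    have TF := tfcoord hE ac de; have TF1 := tfcoord hM aM dMw.
    have key (v a : 'rV_(k + r)) : gaugeL e (v, a) <-> v *m tcoord e c = a *m (fcoord e c)^T *m Gm (cmap c e).
      apply: (iff_trans (gaugeLE e v a)); apply: (iff_trans (conj_dirac (eta e) (Pi (ipr e)) (mder ipr e) TF TF1 v a)).
      rewrite -J1 -J2 -J3; exact: (lagr_graph aP ae (VFw _ KAw) uQw).
    have [uT uF] := mulmx1_unit TF.
    apply/seteqP; split => [[v a] /key E1|_ [a ->]] /=.
      exists a; apply: (congr1 (fun u => (u, a))); rewrite /PP; move: (Gm _) E1 => g E1.
      by rewrite !mulmxA -E1 -mulmxA TF mulmx1.
    by apply/key; rewrite /PP; move: (Gm _) => g; rewrite !mulmxA -[_ *m fcoord e c *m _]mulmxA (ftcoord hE ac de) mulmx1.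
  have E1 := gaugePiE LE; split; first exact: E1.
  by rewrite LE -E1.
move=> e [de Be]; split; first by have [] := graph e de Be.
have nB : \forall w \near cmap c e, [/\ cdom c (cinv c w), cmap c (cinv c w) = w & B w].
  by apply: filterS2 (near_cdom hE ac de) (open_nbhs_nbhs (conj oB Be)) => w [].
have nG : \forall w \near cmap c e, Gm w = pcoord c gaugePi w.
  apply: filterS nB => w [d1 E1 B1]; rewrite /pcoord; have [|-> _] := graph (cinv c w) d1; first by rewrite E1.
  rewrite /PP E1; move: (Gm w) (tcoord _ c) (fcoord _ c) (ftcoord hE ac d1) => g T F FT.
  by rewrite !mulmxA -trmx_mul FT trmx1 mul1mx -mulmxA FT mulmx1.
have Gprop w : B w -> [/\ smooth_at w Gm, (Gm w)^T = - Gm w & jacobi Gm w].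
  move=> Bw; have [d1 E1 dM1 sKw [KAw uQw]] := Bg _ Bw; have [sF se sP aP jP] := atw _ d1 E1 dM1.
  have sV : smooth_at w V by exact: sm_lsub.
  have sb : smooth_at w b by apply: smN; exact: sm_rsub.
  have nVF : \forall y \near w, V y *m jacobian Fl y = b y *m P (Fl y).
    by apply: filterS (open_nbhs_nbhs (conj oB Bw)) => y /Bg[_ _ _ _ [KAy _]]; exact: VFw.
  have sa := asm_chart hE (al_s (cinv c w)) ac d1; rewrite E1 in sa.
  have ae : (et w)^T = - et w by exact: extd_antisym.
  split.
  - exact: (gauge_smooth sV sb sF se uQw).
  - exact: (gauge_antisym nVF aP ae uQw).
  - exact: (gauge_jacobi sV sb sF sP se nVF aP jP ae (extd_closed sa) uQw).
exists c; split; [exact: ac|exact: de|split].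
- by have [s1 _ _] := Gprop _ Be; exact: sm_ext nG s1.
- by apply: filterS2 nG nB => w <- [_ _ Bw]; have [] := Gprop w Bw.
- by have [_ _ jG] := Gprop _ Be; exact: jacobi_near nG jG.
Qed.

(** * The dual bundle inside the cotangent bundle of [M], and the form pulled back from there *)

Let CT := cotangent M.
Let hCT : hmfd CT := cot_hmfd hM.
Variable chi : CT -> 'rV_(m + m).
Hypothesis hchi : poisson_spray Pi chi.
Variable C : X -> {vspace 'rV_m}.
Hypotheses (hC : subbundle i C) (hCc : forall x, complement (Tperp i Pi x) (C x) fullv).

Definition exp_good (z : CT) := [/\ msmap (expmap chi) z, asm (expform chi) z, exp_rel chi z (expmap chi z) &
  forall (v : 'rV_(m + m)) (b0 : 'rV_m), b0 *m Pi z.1 = v *m mder (@cot_proj R m M) z ->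
     exists b : 'rV_m, b *m Pi (expmap chi z) = v *m mder (expmap chi) z /\
       b *m (mder (expmap chi) z)^T = b0 *m (mder (@cot_proj R m M) z)^T + v *m mdform (expform chi) z].

Lemma exp_open : exists A : set CT, [/\ mopen A, forall z : CT, z.2 = 0 -> A z & forall z, A z -> exp_good z].
Proof.
exists [set z | exists V, [/\ mopen V, V z & forall z, V z -> exp_good z]]; split.
- by apply: (mopen_local hCT) => z [V [oV Vz HV]]; exists V; split => // z' Vz'; exists V.
- move=> z z0; have aq := at_atlas hM z.1; have dq := at_dom hM z.1.
  have [c ac hc] := cot_chart hM aq dq; have d : cdom c z by case: hc => _ _ _ [-> _ _].
  exact: (exp_near hM hPi hchi ac hc d z0).
- by move=> z [V [_ Vz HV]]; exact: HV.
Qed.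

(* The form on [Tperp] corresponding to [e]; the sign is the one of [omega_can = sum dq /\ dp]. *)
Definition xiT (e : E) : dual_fiber (Tperp i Pi (projT1 e)) := choose_or 0 (fun xi : dual_fiber (Tperp i Pi (projT1 e)) =>
  forall v, v \in W (projT1 e) -> dual_eval xi (v *m mder i (projT1 e)) = - dual_eval (projT2 e) v).
Definition iota (e : E) : CT := cot_lift i (fun e : E => dual_incl (C (projT1 e)) (xiT e)) e.

Section Frames.
Variables (U : set X) (s : 'I_r -> X -> 'rV_k).
Hypothesis lfr : local_frame idfun W U s.
Let S x := (\matrix_(a < r) s a x) *m mder i x.

Lemma Tperp_frame x : U x -> basis_of (Tperp i Pi x) [tuple row a (S x) | a < r].
Proof.
move=> Ux; have [fs HW] := basis_mx (lfr.2 x Ux); apply: basis_rows.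
  by rewrite /row_free /S mxrankMfree //; exact: fi.
move=> v; apply/idP/submxP => [/mem_Tperp[a a0 Ev]|[u ->]].
  have [u Eu] := coiso a0; have : u \in W x by apply/mem_TperpX; exists a.
  by rewrite HW => /submxP[D ED]; exists D; rewrite Ev Eu ED mulmxA.
rewrite /S mulmxA; have : u *m (\matrix_(a < r) s a x) \in W x by rewrite HW submxMl.
by move=> /mem_TperpX[a a0 Ea]; apply/mem_Tperp; exists a.
Qed.

Lemma xiT_frame e : U (projT1 e) -> \row_a dual_eval (xiT e) (row a (S (projT1 e))) = - fcomp s e.
Proof.
move=> Ux; have bW := lfr.2 _ Ux; have bT := Tperp_frame Ux.
have [xi Hxi] := dual_onto (s := fun a => row a (S (projT1 e))) bT (- fcomp s e).
have rS a : row a (S (projT1 e)) = s a (projT1 e) *m mder i (projT1 e) by rewrite row_mul rowK.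
have ex : exists xi : dual_fiber (Tperp i Pi (projT1 e)), forall v, v \in W (projT1 e) -> dual_eval xi (v *m mder i (projT1 e)) = - dual_eval (projT2 e) v.
  exists xi => v vW; rewrite (basis_coords bW vW) mulmx_suml !dual_eval_sum -sumrN; apply: eq_bigr => a _.
  by rewrite -scalemxAl -rS !dual_evalZ Hxi !mxE mulrN.
have H := choose_orP 0 ex; apply/rowP => a; rewrite !mxE rS H//.
exact: (basis_memv bW).
Qed.
End Frames.

(** The minus sign is that of [xiT]. With it, [J *m (- K)^T] is dual to the frame of the orthogonal
    and can be the mixed block of [vert_form]. *)
Definition iota_frame (q : chart R k X) (U : set X) (s : 'I_r -> X -> 'rV_k) (cM : chart R m M) (V : set X) (K : X -> 'M[R]_(r, m)) (x0 : X) := [/\ mopen V, V x0, forall x, V x -> U x /\ cdom cM (i x) &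
  [/\ forall x, V x -> msm K x, forall x, V x -> fmat q s x *m (jloc q cM (cmap q x) *m (- K x)^T) = 1%:M & forall e : E, V (projT1 e) ->
    dual_incl (C (projT1 e)) (xiT e) *m (fcoord (i (projT1 e)) cM)^T = fcomp s e *m K (projT1 e)]].

Section Chart.
Variables (e0 : E) (c : chart R (k + r) E) (q : chart R k X) (U : set X) (s : 'I_r -> X -> 'rV_k) (cM : chart R m M).
Hypotheses (ac : atlas c) (hc : dual_bd_frame c q U s) (d0 : cdom c e0) (aM : atlas cM) (dM : cdom cM (i (projT1 e0))).

Let aq : atlas q. Proof. by case: hc => [[]]. Qed.
Let U0 : U (projT1 e0). Proof. by have [_ [dE _ _]] := hc; have := d0; rewrite dE. Qed.
Let lfr : local_frame idfun W U s. Proof. by case: hc => [[]]. Qed.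

Lemma iota_setup : exists V (K : X -> 'M[R]_(r, m)), iota_frame q U s cM V K (projT1 e0).
Proof.
have [[_ oU Uq _] _] := hc.
have SE z : U z -> cdom cM (i z) -> (\matrix_(a < r) s a z) *m mder i z *m tcoord (i z) cM = fmat q s z *m jloc q cM (cmap q z).
  move=> Uz dz; rewrite (jlocE aq (Uq _ Uz) aM dz) -(frame_matrix q s z).
  move: (tcoord z q) (fcoord z q) (tfcoord hX aq (Uq _ Uz)) => T f Tf.
  by rewrite !mulmxA -[_ *m T *m f]mulmxA Tf mulmx1.
have [|z Uz dz|V [K [oV Vx VU HV]]] := dual_incl_local hX hM si hCc hC (S := fun x => (\matrix_(a < r) s a x) *m mder i x) aM dM oU U0.
- by move=> x Ux; exact: (Tperp_frame lfr).
- have mf := fmat_msm hX aq oU lfr Uz (Uq _ Uz).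
  have mj : msm (fun z => jloc q cM (cmap q z)) z.
    exists q; split; [exact: aq|exact: Uq|].
    apply: sm_ext (sm_jloc aq (Uq _ Uz) aM dz).
    by apply: filterS (near_cdom hX aq (Uq _ Uz)) => y [_ Ey]; rewrite Ey.
  have mm : msm (fun z => fmat q s z *m jloc q cM (cmap q z)) z.
    by apply: (msm_lift2 hX _ mf mj) => x c1 s1 s2; exact: sm_mulmx.
  have [V [oV Vz HV]] := (si z).1 _ (mopen_cdom hM aM) dz.
  apply: (msm_ext hX _ mm); exists (U `&` V); split; [exact: (mopenI hX)|by split|].
  by move=> y [Uy /HV dy]; rewrite SE.
exists V, (fun x => - K x); split => //; split => [x /HV[mK _ _]|x Vx'|e /[dup] Ve /HV[_ _ ->]].
- by apply: (msm_lift1 _ mK) => y c1 s1; exact: smN.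
- have [_ E1 _] := HV x Vx'; have [Ux dx] := VU x Vx'; rewrite SE// in E1.
  by rewrite opprK mulmxA.
by rewrite (xiT_frame lfr (VU _ Ve).1) mulNmx mulmxN.
Qed.
End Chart.

Let iotaW (e : E) : exists (c : chart R (k + r) E) (q : chart R k X) (U : set X) (s : 'I_r -> X -> 'rV_k) (cM : chart R m M) (cc : chart R (m + m) CT) (V : set X) (K : X -> 'M[R]_(r, m)), [/\ atlas c, dual_bd_frame c q U s, cdom c e & [/\ atlas cc,
  cot_bd cc cM (cdom cM) (fun z : CT => z.2 *m (fcoord z.1 cM)^T), cdom cM (i (projT1 e)) & iota_frame q U s cM V K (projT1 e)]].
Proof.
have [c [q [U [s [ac hc Ux]]]]] := dual_chart_ex hX hW e.
have d : cdom c e by have [_ [-> _ _]] := hc.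
have aM := at_atlas hM (i (projT1 e)); have dM := at_dom hM (i (projT1 e)); set cM := chart_at _ in aM dM.
have [cc acc hcc] := cot_chart hM (z0 := iota e) aM dM.
have [V [K H]] := iota_setup hc d aM dM.
by exists c, q, U, s, cM, cc, V, K.
Qed.

Lemma iota_smooth e : msmap iota e.
Proof.
have [c [q [U [s [cM [cc [V [K [ac hc d [acc hcc dM [oV Vx VU [sK _ hK]]]]]]]]]]]] := iotaW e.
exact: (cot_lift_smooth hX hM si hW ac hc acc hcc oV VU sK hK Vx).
Qed.

Definition al1 (e : E) : 'rV_(k + r) := expform chi (iota e) *m (mder iota e)^T.

Let inear e : exists U, [/\ mopen U, U e & forall y, U y -> msmap iota y].
Proof. by exists setT; split => [||y _]; [exact: mopenT|by []|exact: iota_smooth]. Qed.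

Lemma al1_asm e : asm (expform chi) (iota e) -> asm al1 e.
Proof. by move=> sa; exact: (asm_pull hE hCT (iota_smooth e) sa (inear e)). Qed.

Lemma al1_mdform e : asm (expform chi) (iota e) -> mdform al1 e = mder iota e *m mdform (expform chi) (iota e) *m (mder iota e)^T.
Proof. by move=> sa; exact: (mdform_pull hE hCT (iota_smooth e) sa (inear e)). Qed.

Lemma zero_fcomp s (e : E) : zero_section e -> fcomp s e = 0.
Proof.
move=> z0; apply/rowP => a; rewrite !mxE /dual_eval; have -> : projT2 e = 0 :> 'Hom(subvs_of (W (projT1 e)), R^o) by exact: z0.
by rewrite lfunE.
Qed.

Lemma iota_zero e : zero_section e -> (iota e).2 = 0.
Proof.
move=> z0; have [c [q [U [s [cM [cc [V [K [ac hc d [acc hcc dM [oV Vx VU [sK _ hK]]]]]]]]]]]] := iotaW e.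
apply: (covec_inj hM (q := cM) (x := i (projT1 e))); [by case: hcc|exact: dM|].
by rewrite mul0mx; apply: (eq_trans (hK e Vx)); rewrite zero_fcomp// mul0mx.
Qed.

(** The explicit form at zero covectors from [exp_at_zero], pulled back by [iota]: its mixed terms
    give the dual block, and its quadratic term in the momenta gives the fibre block [- K P K^T]. *)
Lemma al1_vert e c q U s : atlas c -> dual_bd_frame c q U s -> cdom c e -> zero_section e -> asm (expform chi) (iota e) -> vert_form e c q s (mdform al1 e).
Proof.
move=> ac hc d z0 sa; have [[aq oU Uq _] [dE mE _]] := hc.
have aM := at_atlas hM (i (projT1 e)); have dM := at_dom hM (i (projT1 e)); set cM := chart_at _ in aM dM.
have [cc acc hcc] := cot_chart hM (z0 := iota e) aM dM.
have [V [K [oV Vx VU [sK SK hK]]]] := iota_setup hc d aM dM.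
have dI : cdom cc (iota e) by case: hcc => _ _ _ [-> _ _].
have [_ _ EF] := exp_at_zero hM hPi hchi acc hcc dI (iota_zero z0); move: (pcoord cM Pi _) EF => P EF.
pose J := jloc q cM (cmap q (projT1 e)).
exists (J *m (- K (projT1 e))^T), (- (K (projT1 e) *m P *m (K (projT1 e))^T)); split; first exact: SK.
have r0 : rsubmx (cmap c e) = 0 by rewrite mE// row_mxKr zero_fcomp.
have L (v : 'rV_(k + r)) : v *m fcoord e c *m mder iota e *m tcoord (iota e) cc = row_mx (lsubmx v *m J) (rsubmx v *m K (projT1 e)).
  rewrite -(jac_liftloc hX si hc hcc VU sK Vx v r0).
  have := mder_lift hX hM si hW ac hc acc hcc oV VU sK hK Vx => E1.
  rewrite -[_ *m mder iota e *m _]mulmxA E1 mulmxA -[v *m _ *m tcoord e c]mulmxA (ftcoord hE ac d) mulmx1.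
  by [].
rewrite (al1_mdform sa); apply: bilin_ext => v w.
have := EF (v *m fcoord e c *m mder iota e) (w *m fcoord e c *m mder iota e).
rewrite /= !L !row_mxKl !row_mxKr !trmx_mul !mulmxA => ->.
rewrite -[v in RHS]hsubmxK -[w in RHS]hsubmxK; move: (lsubmx v) (rsubmx v) (lsubmx w) (rsubmx w) (K _) (J) => a b a' b' K' J'.
have TN p1 p2 (A : 'M[R]_(p1, p2)) : (- A)^T = - A^T by rewrite raddfN.
rewrite !TN !trmxK mul_row_block tr_row_mx mul_row_col !mulmx0 add0r mulNmx opprK !mulmxN mulmxDl !mulNmx !mulmxA addrA; congr (_ - _ - _).
by rewrite -[LHS]scal1_tr !trmx_mul !trmxK !mulmxA.
Qed.

Lemma zero_section_smooth x : msmap (zsec r W) x.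
Proof.
have [c [q [U [s [ac hc Ue]]]]] := dual_chart_ex hX hW (zsec r W x).
have [[aq oU Uq lfr] [dE mE _]] := hc; have dq := Uq _ Ue.
have d : cdom c (zsec r W x) by rewrite dE.
have nU := near_cinv hX aq dq oU Ue.
apply: (msmapI hX hE (F := zsec r W) aq dq ac d); first by apply: filterS nU => y [_ _ Uy]; rewrite dE.
apply: sm_ext (sm_row_mx (sm_id (cmap q x)) (sm_cst (cmap q x) (0 : 'rV_r))).
by apply: filterS nU => y [_ Ey Uy]; rewrite mE ?dE//= Ey zero_fcomp.
Qed.

(** Every covector used in the definition of the saturation comes from the dual bundle, so points of
    [P] can be parametrised by [E]. *)
Lemma iota_onto x (xi : dual_fiber (Tperp i Pi x)) : exists e : E, iota e = (i x, dual_incl (C x) xi).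
Proof.
have [U [s [oU Ux lfr]]] := hW x; have bT := Tperp_frame lfr Ux.
pose S := (\matrix_(a < r) s a x) *m mder i x.
have [ze Hz] := dual_onto (lfr.2 x Ux) (- \row_a dual_eval xi (row a S)).
exists (existT _ x ze : E); rewrite /iota /cot_lift /=; congr (_, dual_incl _ _).
apply: (dual_ext (s := fun a => row a S) bT) => a.
have := @xiT_frame U s lfr (existT _ x ze : E) Ux => /rowP/(_ a).
by rewrite !mxE /= Hz !mxE opprK.
Qed.

(** * Upper bound for the dimension of a saturation *)

Section Dimension.
Variables (p : nat) (P : premanifold R p) (iP : P -> M) (B : nat -> set X).
Hypotheses (hP : hmfd P) (siP : forall y, msmap iP y) (injP : injective iP) (fP : forall y, row_free (mder iP y)).
Hypothesis embP : forall U, mopen U -> exists2 V, mopen V & iP @` U = V `&` range iP.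
Hypothesis hB : forall (U : set X) x, mopen U -> U x -> exists j, B j x /\ B j `<=` U.
Hypothesis range_exp : forall y, exists x, exists xi : dual_fiber (Tperp i Pi x), exp_rel chi (i x, dual_incl (C x) xi) (iP y).

Lemma exp_param y : exists e : E, exp_rel chi (iota e) (iP y).
Proof. by have [x [xi ex]] := range_exp y; have [e Ee] := iota_onto xi; exists e; rewrite Ee. Qed.

(** A chain of Lipschitz maps: [iota] in charts, the integral curves by [curve_lipschitz], the
    projection, and the inverse of the immersion [iP]. It concerns the relation only, since the
    curves through points far from the zero section are not known to form a flow. *)
Lemma exp_lipschitz (cP : chart R p P) (c : chart R (k + r) E) y e : atlas cP -> cdom cP y -> atlas c -> cdom c e -> exp_rel chi (iota e) (iP y) ->
  exists d K : R, [/\ 0 < d, 0 <= K & forall y' e', cdom cP y' -> cdom c e' -> exp_rel chi (iota e') (iP y') -> `|cmap c e' - cmap c e| < d ->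
    `|cmap cP y' - cmap cP y| <= K * `|cmap c e' - cmap c e|].
Proof.
move=> aP dP ac d [g [cg g0 g1]].
have aM := at_atlas hM (iP y); have dM := at_dom hM (iP y); set cM := chart_at _ in aM dM.
have dM1 : cdom cM (g 1).1 by have := dM; rewrite -g1.
have [c1 ac1 hc1] := cot_chart hM (z0 := g 1) aM dM1.
have d1 : cdom c1 (g 1) by case: hc1 => _ _ _ [-> _ _].
have I01 : (0 : R) <= 1 <= (1 : R) by rewrite ler01 lexx.
have [V [K [oV Vg K0 HV]]] := curve_lipschitz hCT cg (fun t _ => chi_freg hM hchi t (g t)) I01 ac1 d1 ltr01.
pose c0 := chart_at (g 0); have a0 : atlas c0 := at_atlas hCT _; have d0 : cdom c0 (iota e) by rewrite -g0; exact: (at_dom hCT).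
have [d2 [K2 [d20 K20 H2]]] := lip_local (msmap_sm hE (iota_smooth e) ac d a0 d0).
have Vio : V (iota e) by rewrite -g0.
have nV := msmap_near hE (iota_smooth e) ac d oV Vio.
have sC := msmap_sm hP (siP y) aP dP aM dM; set F := fun w => _ in sC.
have [A JA] : exists A, jacobian F (cmap cP y) *m A = 1%:M.
  apply/row_freeP; have JE : jacobian F (cmap cP y) = fcoord y cP *m mder iP y *m tcoord (iP y) cM := mder_jac hP hM (siP y) aP dP aM dM.
  have [_ uF] := mulmx1_unit (tfcoord hP aP dP); have [uT _] := mulmx1_unit (tfcoord hM aM dM).
  by rewrite /row_free JE; apply/eqP; apply: (eq_trans (rank_conj (mder iP y) uF uT)); exact: (eqP (fP y)).
have [K3 K30 n3] := immersion_lip sC JA.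
have [Bs [oBs Bsy] HBs] := near_open n3.
(* The inverse of [iP] is Lipschitz only on a small box of [P]. As [iP] is an embedding, points of
   [P] that are close in [M] do lie in that box. *)
have [V2 oV2 E2] := embP (mopen_chart hP aP oBs).
have V2y : V2 (iP y).
  have : (iP @` [set z | cdom cP z /\ Bs (cmap cP z)]) (iP y) by exists y.
  by rewrite E2 => -[].
have [eps eps0 Heps] := ball_near (near_cinv hM aM dM oV2 V2y).
have [dV dV0 HdV] := ball_near nV.
pose Q := K * K2; have Q0 : 0 <= Q by exact: mulr_ge0.
exists (Num.min (Num.min dV d2) (eps / (Q + 1))), (K3 * Q); split.
- by rewrite !lt_min dV0 d20 divr_gt0//; lra.
- exact: mulr_ge0.
move=> y' e' dP' d' [g' [cg' g0' g1']]; rewrite !lt_min => /andP[/andP[a1 a2] a3].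
have bb s : `|cmap c e' - cmap c e| < s -> ball (cmap c e) s (cmap c e') by rewrite -ball_normE /= distrC.
have Vg' : V (g' 0) by rewrite g0'; have := HdV _ (bb _ a1); rewrite (cinvK hE ac d').
have [dg' _ _ l1] := HV g' g cg' cg Vg' Vg.
have [_ _ l2] := H2 _ _ (bb _ a2) (ballxx _ d20); rewrite (cinvK hE ac d') (cinvK hE ac d) in l2.
have l3 : `|cmap c1 (g' 1) - cmap c1 (g 1)| <= Q * `|cmap c e' - cmap c e|.
  apply: le_trans l1 _; by rewrite -/c0 g0' g0 -mulrA ler_wpM2l.
have [dM' E1] : cdom cM (iP y') /\ lsubmx (cmap c1 (g' 1)) = cmap cM (iP y').
  by case: hc1 => _ _ _ [dE mE _]; have := dg'; rewrite dE -g1' => dd; split; [exact: dd|rewrite mE ?row_mxKl// dE].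
have E0 : lsubmx (cmap c1 (g 1)) = cmap cM (iP y).
  by case: hc1 => _ _ _ [dE mE _]; rewrite mE ?row_mxKl// -g1.
have l4 : `|cmap cM (iP y') - cmap cM (iP y)| <= Q * `|cmap c e' - cmap c e|.
  by rewrite -E1 -E0; apply: le_trans (norm_lsub _ _) l3.
have Qe : Q * `|cmap c e' - cmap c e| < eps.
  move: a3; rewrite ltr_pdivlMr; last by lra.
  by have := normr_ge0 (cmap c e' - cmap c e); nra.
have V2y' : V2 (iP y').
  have [|_ _] := Heps (cmap cM (iP y')); first by rewrite -ball_normE /= distrC; exact: le_lt_trans l4 Qe.
  by rewrite (cinvK hM aM dM').
have [z [dz Bz] Ez] : (iP @` [set z | cdom cP z /\ Bs (cmap cP z)]) (iP y') by rewrite E2; split => //; exists y'.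
rewrite (injP Ez) in Bz; have := HBs _ Bz; rewrite /F (cinvK hP aP dP') (cinvK hP aP dP) => /le_trans; apply.
by rewrite -mulrA ler_wpM2l.
Qed.

Lemma saturation_dim (y0 : P) : (p <= k + r)%N.
Proof.
have [e0 _] := exp_param y0; pose cP := chart_at y0; have aP : atlas cP := at_atlas hP y0; have dP : cdom cP y0 := at_dom hP y0.
have [rho rho0 Hrho] := ball_near (near_cdom hP aP dP).

(* [lip_dim] admits countably many parameter spaces. One chart of [E] is chosen over each member of
   the countable base of [X], and these charts cover [E]. *)
pose cj j : chart R (k + r) E := choose_or (chart_at e0) (fun c => atlas c /\ forall e, B j (pr e) -> cdom c e).
pose Rel j w a := ball (cmap cP y0) rho w /\ exists e, [/\ atlas (cj j), cdom (cj j) e, cmap (cj j) e = a & exp_rel chi (iota e) (iP (cinv cP w))].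
apply: (@lip_dim p (k + r) Rel (cmap cP y0) rho rho0) => [w wb|l w a [wb [e [aj dj <- ex]]]].
  have [e ex] := exp_param (cinv cP w); have [c [q [U [s [ac hc Ue]]]]] := dual_chart_ex hX hW e.
  have [[_ oU _ _] [dE _ _]] := hc; have [l [Bl BU]] := hB oU Ue.
  have [|aj Hj] := choose_orP (chart_at e0) (Q := fun c : chart R (k + r) E => atlas c /\ forall e, B l (pr e) -> cdom c e).
    by exists c; split => // e' /BU; rewrite dE.
  by exists l, (cmap (cj l) e); split => //; exists e; split => //; exact: Hj.
have [dw Ew] := Hrho w wb; have [d [K [d0 K0 H]]] := exp_lipschitz aP dw aj dj ex.
exists d, K; split => // w' a' [wb' [e' [_ dj' <- ex']]]; have [dw' Ew'] := Hrho w' wb'.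
by have := H _ e' dw' dj' ex'; rewrite Ew Ew'.
Qed.
End Dimension.

(** * The exponential map corrected by Moser's isotopy *)

Section Model.
Variables (Sg : set CT) (U : set E).
Hypotheses (oS : mopen Sg) (ZS : forall z : CT, z.2 = 0 -> Sg z).
Hypotheses (oU : mopen U) (ZU : zero_section (W := W) `<=` U).
Hypothesis hU : forall e, U e -> gaugeL e = dirac_graph gaugePi e /\ poisson_pt gaugePi e.

Definition alM (e : E) : 'rV_(k + r) := al1 e - al0 e.

Lemma al0_zero (e : E) : zero_section e -> al0 e = 0.
Proof.
move=> z0; rewrite /al0 (_ : dual_incl _ _ = 0) ?oppr0 ?mul0mx//.
apply/rowP => a; rewrite !mxE /dual_eval; have -> : projT2 e = 0 :> 'Hom(subvs_of (W (projT1 e)), R^o) by exact: z0.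
by rewrite lfunE.
Qed.

Lemma mder_ipr_iota e : mder (fun e : E => ipr e) e = mder iota e *m mder (@cot_proj R m M) (iota e).
Proof. exact: (mder_comp hE hCT hM (iota_smooth e) (bundle_proj_smooth hM (cot_bundle hM) (iota e))). Qed.

(** An element of the gauged structure comes from a covector [b] on [M]; transporting [b] by the
    exponential map adds [d al1] in place of the gauge form, so the resulting defect is exactly
    [d alM], the difference that Moser's argument removes. *)
Lemma iota_exp e (v a : 'rV_(k + r)) : U e -> exp_good (iota e) -> v = a *m gaugePi e ->
  exists b : 'rV_m, b *m Pi (expmap chi (iota e)) = v *m mder iota e *m mder (expmap chi) (iota e) /\
    b *m (mder iota e *m mder (expmap chi) (iota e))^T = a + v *m mdform alM e.
Proof.
move=> Ue [s1 sa _ H] Ev; have [LE _] := hU Ue.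
have : gaugeL e (v, a) by rewrite LE Ev; exists a.
move=> /gaugeLE[]; rewrite ?mder_ipr_iota; first [exact: hM|exact: hX|exact: hPi|exact: aPi|exact: si|exact: fi|exact: hreg|exact: hcoi|idtac].
move=> b h1 h2; have [|b3 [g1 g2]] := H (v *m mder iota e) b; first by rewrite -mulmxA.
exists b3; split; first exact: g1.
have a1 := al1_asm sa.
have a0 := al0_asm e.
have E1 : mdform alM e = mder iota e *m mdform (expform chi) (iota e) *m (mder iota e)^T - form_pull (@bundle_incl R k r X W G) (@omega_can R k X) e.
  apply: (eq_trans (mdformB hE a1 a0)); rewrite etaE; congr (_ - _).
  exact: (al1_mdform sa).
exact: (pull_covector h2 g2 E1).
Qed.

Theorem exp_model : exists O1 (F : E -> M), [/\ mopen O1, zero_section (W := W) `<=` O1, O1 `<=` U, forall e, zero_section e -> F e = i (pr e) &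
  forall e, O1 e -> [/\ msmap F e, exists e', Sg (iota e') /\ exp_rel chi (iota e') (F e) &
    forall a : 'rV_(k + r), exists b : 'rV_m, b *m Pi (F e) = a *m gaugePi e *m mder F e /\ b *m (mder F e)^T = a]].
Proof.
have [A [oA ZA HA]] := exp_open.
pose U1 : set E := U `&` iota @^-1` (A `&` Sg).
have oU1 : mopen U1.
  apply: (mopenI hE oU); apply: (mopen_local hE) => e Ie.
  by have [V [oV Ve HV]] := (iota_smooth e).1 _ (mopenI hCT oA oS) Ie; exists V.
have io0 e : zero_section e -> (iota e).2 = 0 by exact: (iota_zero).
have ZU1 : zero_section (W := W) `<=` U1.
  by move=> e ze; split; [exact: ZU|split; [apply: ZA|apply: ZS]; exact: io0].
have hal e : U1 e -> asm alM e.
  move=> [_ [Ae _]]; have [_ sa _ _] := HA _ Ae; apply: (asmB hE).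
    exact: (al1_asm sa).
  exact: (al0_asm e).
have exp0 e : zero_section e -> expmap chi (iota e) = i (pr e) /\ expform chi (iota e) = 0.
  move=> ze; have aM := at_atlas hM (i (projT1 e)); have dM := at_dom hM (i (projT1 e)); set cM := chart_at _ in aM dM.
  have [cc acc hcc] := cot_chart hM (z0 := iota e) aM dM.
  have dI : cdom cc (iota e) by case: hcc => _ _ _ [-> _ _].
  by have [E1 E2 _] := exp_at_zero hM hPi hchi acc hcc dI (io0 e ze).
have al_0 e : zero_section e -> alM e = 0.
  move=> ze; rewrite /alM al0_zero// subr0 /al1.
  have [_ E2] := exp0 e ze; have -> : expform chi (iota e) = 0 by exact: E2.
  by rewrite mul0mx.
(* A kernel vector [u] would make [u *m gaugePi e] an element of the structure gauged by the affine
   combination of the two forms with no covector part. That combination still has the block form, so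
   [vert_trivial] applies. *)
have unitZ e (t : R) : zero_section e -> 1%:M + t *: (gaugePi e *m mdform alM e) \in unitmx.
  move=> ze; have U1e := ZU1 e ze; have [Ue [Ae _]] := U1e; have [_ sa _ _] := HA _ Ae.
  rewrite -row_free_unit -kermx_eq0; apply/eqP/row_matrixP => l; rewrite row0.
  set u := row l _; have uK : u *m (1%:M + t *: (gaugePi e *m mdform alM e)) = 0 by apply/sub_kermxP; exact: row_sub.
  have [c [q [V [s [ac hc Vx]]]]] := dual_chart_ex hX hW e.
  have d : cdom c e by have [_ [-> _ _]] := hc.
  have aM := at_atlas hM (i (projT1 e)); have dM := at_dom hM (i (projT1 e)).
  have v1 := al1_vert ac hc d ze sa.
  have v0 := al0_vert ac hc d (zero_fcomp s ze).
  have vt := vert_form_line t v0 v1; have [LE _] := hU Ue.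
  have a1 := al1_asm sa.
  have a0 := al0_asm e.
  have Eom := congr2 (fun A B : 'M[R]_(k + r) => A + t *: B) (etaE e) (esym (mdformB hE a1 a0)).
  have {}vt := eq_ind _ (vert_form e c q s) vt _ Eom.
  have L : gaugeL e (u *m gaugePi e, u) by rewrite LE; exists u.
  have [b h1 h2] := (gaugeLE e _ _).1 L.
  rewrite (mder_iprE) in h1 h2.
  have uE : u = - (u *m gaugePi e *m (t *: mdform alM e)).
    by apply/eqP; rewrite -addr_eq0 -scalemxAr -mulmxA scalemxAr -{1}[u]mulmx1 -mulmxDr uK.
  have z : u *m gaugePi e = 0.
    apply: (vert_trivial ac hc d aM dM vt h1).
    exact: (gauge_covector h2 uE).
  by rewrite uE z mul0mx oppr0.
have hP e : U1 e -> poisson_pt gaugePi e by move=> [/hU[]].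
have [A1 [f [opA1 ZO1 OU f0 Hf]]] := moser hE oU1 ZU1 hP hal al_0 unitZ.
exists A1, (fun e => expmap chi (iota (f e))); split => //.
- by move=> e /OU[].
- by move=> e ze; rewrite f0//; have [] := exp0 e ze.
move=> e Oe; have [sf [Uf [Af Sf]] uf Hb] := Hf e Oe; have eg := HA _ Af; have [sx sa er _] := eg.
have sF2 : msmap (fun e => expmap chi (iota e)) (f e) := msmap_comp hE hCT hM (iota_smooth (f e)) sx.
have sF : msmap (fun e => expmap chi (iota (f e))) e := msmap_comp hE hE hM (G := fun e => expmap chi (iota e)) sf sF2.
split; [exact: sF|by exists (f e); split|move=> a].
have dF : mder (fun e => expmap chi (iota (f e))) e = mder f e *m (mder iota (f e) *m mder (expmap chi) (iota (f e))).
  by rewrite (mder_comp hE hE hM (G := fun e => expmap chi (iota e)) sf sF2) (mder_comp hE hCT hM (iota_smooth (f e)) sx).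
have [b1 [h1 h2]] := Hb a; rewrite scale1r in uf.
(* [b1] is a covector for the gauge transform at [f e]; [a2] is the covector for [gaugePi] with the
   same vector. The term [d alM] added by [iota_exp] turns [a2] back into [b1]. *)
pose a2 := b1 *m invmx (1%:M + gaugePi (f e) *m mdform alM (f e)).
have h3 : b1 = a2 + a2 *m gaugePi (f e) *m mdform alM (f e).
  by rewrite -mulmxA -{1}[a2]mulmx1 -mulmxDr /a2 mulmxKV.
have [b3 [g1 g2]] := iota_exp Uf eg (erefl (a2 *m gaugePi (f e))).
exists b3; rewrite dF; split.
  have h4 : a2 *m gaugePi (f e) = a *m gaugePi e *m mder f e by rewrite -h1 mulmxA.
  by rewrite g1 h4 !mulmxA.
by rewrite trmx_mul mulmxA g2 -h3.
Qed.
End Model.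
End Saturation.

Lemma poisson_pt_antisym n (N : premanifold R n) (Pi : N -> 'M[R]_n) z : hmfd N -> poisson_pt Pi z -> (Pi z)^T = - Pi z.
Proof.
move=> hN [c [ac d [_ aP _]]]; have := nbhs_singleton aP; rewrite (pcoord_at hN)// => E.
move: (tcoord z c) (fcoord z c) (tfcoord hN ac d) E => T F TF E.
have -> : Pi z = F^T *m (T^T *m Pi z *m T) *m F by rewrite !mulmxA -trmx_mul TF trmx1 mul1mx -mulmxA TF mulmx1.
by move: (T^T *m Pi z *m T) E => Q E; rewrite !trmx_mul E trmxK mulNmx mulmxN mulmxA.
Qed.
End RealField.

(** * The Poisson diffeomorphism onto a neighbourhood in a saturation *)

Theorem corollary4p1 (R : realType) (m k r : nat)
    (M : premanifold R m) (pi : M -> 'M[R]_m) (X : premanifold R k) (i : X -> M)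
    (G : X -> {vspace 'rV[R]_k})
    (hM : is_manifold M) (hpi : poisson_on setT pi)
    (hX : is_manifold X) (hi : embedding i)
    (hreg : coregular i pi r) (hcoi : coisotropic i pi)
    (hG : subbundle idfun G)
    (hGc : forall x, complement (TperpX i pi x) (G x) fullv) :
  let E := dual_bundle r (TperpX i pi) in
  let pr := @dual_proj R k r X (TperpX i pi) : E -> X in
  let j := @bundle_incl R k r X (TperpX i pi) G : E -> cotangent X in
  let L := dirac_gauge (dirac_pull pr (dirac_pull i (dirac_graph pi)))
                       (form_pull j (@omega_can R k X)) in
  let X0 := @zero_section R k r X (TperpX i pi) : set E in
  exists (U : set E) (piU : E -> 'M[R]_(k + r)),
    [/\ mopen U, X0 `<=` U, poisson_on U piU,
        (forall e, U e -> L e = dirac_graph piU e) &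
        forall (p : nat) (P : premanifold R p) (iP : P -> M)
               (piP : P -> 'M[R]_p),
          local_poisson_saturation i pi iP piP ->
          poisson_diffeo_around U piU piP X0 (iP @^-1` range i)].
Proof.
move=> E pr j L X0.
have nM := manifold_hmfd hM; have nX := manifold_hmfd hX.
have hPi y : poisson_pt pi y by exact: (poisson_on_pt nM (mopenT nM) hpi I).
have aPi y : (pi y)^T = - pi y by case: hpi => h _ _; exact: h.
have [smi inji fi embi] := hi.
have si x : msmap i x by exact: (smooth_map_msmap nX nM (mopenT nX) smi I).
have hE : hmfd E := dual_hmfd nX (TperpX_frames nM nX hPi aPi si fi hreg hcoi).
pose piU (e : E) := gaugePi G e.
pose nice (e : E) := L e = dirac_graph piU e /\ poisson_pt piU e.
(* The union of all open sets on which the structure is a Poisson graph: it is open at once, and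
   [gauge_poisson] is used one point at a time. *)
pose U : set E := [set e | exists V, [/\ mopen V, V e & forall e, V e -> nice e]].
have oU : mopen U by apply: (mopen_local hE) => e [V [oV Ve HV]]; exists V; split => // e' Ve'; exists V.
have HU e : U e -> nice e by move=> [V [_ Ve HV]]; exact: HV.
have ZU : X0 `<=` U by move=> e ze; exact: (gauge_poisson nM nX hPi aPi si fi hreg hcoi hG hGc ze).
exists U, piU; split; [exact: oU|exact: ZU| |by move=> e /HU[]|].
  by apply: (poisson_onI hE) => e /HU[_ h] //; exact: (poisson_pt_antisym hE h).
move=> p P iP piP [[hP [smP injP fP embP] _] [_ mapP] rXP [chi [Sigma [C [hchi [[Sg [oS ZS SgS]] _] [hC hCc] rP]]]]].
have nP := manifold_hmfd hP.
have siP y : msmap iP y by exact: (smooth_map_msmap nP nM (mopenT nP) smP I).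
(* Without a point of [X] there is no default value in [P] for the lift. In that case [E] and [P]
   are both empty, and the empty maps do. *)
have [[x0 _]|nX0] := EM (exists x : X, True); last first.
  have nE (e : E) : False by apply: nX0; exists (projT1 e).
  have nPt (y : P) : False.
    have : range iP (iP y) by exists y.
    by rewrite rP => -[x _]; apply: nX0; exists x.
  pose F (e : E) : P := False_rect P (nE e); pose F' (y : P) : E := False_rect E (nPt y).
  exists set0, set0, F, F'; split.
  - by split; [apply: (mopen_local hE)|move=> e; case: (nE e)|].
  - by split; [apply: (mopen_local nP)|move=> y; case: (nPt y)].
  - by split; [apply: (msmap_smooth_map hE nP) => //; apply: (mopen_local hE)|rewrite image_set0|].
  - by apply: (msmap_smooth_map nP hE) => //; apply: (mopen_local nP).
  - by [].
have [OA [F [opn ZO OU F0 HF]]] := exp_model nM nX hPi aPi si fi hreg hcoi hG hGc hchi hC hCc oS ZS oU ZU HU.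
have range_exp y : exists x, exists xi : dual_fiber (Tperp i pi x), exp_rel chi (i x, dual_incl (C x) xi) (iP y).
  have : range iP (iP y) by exists y.
  by rewrite rP => -[x [xi [_ h]]]; exists x, xi.
have [y00 _ _] : range iP (i x0) by apply: rXP; exists x0.
have [_ _ _ [BX [oBX hBX]]] := hX; have [_ _ _ [BP [oBP hBP]]] := hP.
have dim := saturation_dim nM nX hPi aPi si fi hreg hcoi hchi hC hCc nP siP injP fP embP hBX range_exp y00.
pose Fh (e : E) : P := choose_or y00 (fun y => iP y = F e).
have FhE e : OA e -> iP (Fh e) = F e.
  move=> Oe; apply: (@choose_orP P y00 (fun y => iP y = F e)).
  have [_ [e' [Se ex]] _] := HF e Oe.
  have : range iP (F e) by rewrite rP; exists (projT1 e'), (xiT e'); split; [exact: SgS|exact: ex].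
  by move=> [y _ Ey]; exists y.
have sFh (e : E) (Oe : OA e) : msmap Fh e.
  apply: (embedding_lift hE nP nM siP injP fP embP opn _ FhE Oe) => e1 Oe1.
  by have [h _ _] := HF e1 Oe1; exact: h.
have dF e : OA e -> mder F e = mder Fh e *m mder iP (Fh e).
  move=> Oe; rewrite -(mder_comp hE nP nM (sFh e Oe) (siP _)); apply: (mder_ext hE nM); last by have [h _ _] := HF e Oe.
  by exists OA; split => // e' Oe'; rewrite FhE.
(* The covectors on [M] are restricted to [P]; since [piP] is mapped to [pi] and the derivative of
   [iP] is injective, the relation descends from [F] to its lift. *)
have BDh e : OA e -> forall a : 'rV[R]_(k + r), exists b : 'rV[R]_p, b *m piP (Fh e) = a *m piU e *m mder Fh e /\ b *m (mder Fh e)^T = a.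
  move=> Oe a; have [_ _ /(_ a)[b [h1 h2]]] := HF e Oe.
  exists (b *m (mder iP (Fh e))^T); rewrite dF// in h1 h2; split; last by rewrite -mulmxA -trmx_mul.
  apply: (row_free_inj (fP (Fh e))); rewrite -[RHS]mulmxA -h1 -(FhE e Oe) -(mapP (Fh e)) !mulmxA.
  by [].
(* The remaining inequality holds at any zero of the bundle: all covectors on [E] there are
   pull-backs from [P], so [p] is at least [k + r]. *)
have pE : p = (k + r)%N.
  have [e0 ze0] : exists e : E, X0 e by exists (zsec r (TperpX i pi) x0).
  apply/eqP; rewrite eqn_leq dim /=; have Oe := ZO _ ze0.
  have : row_full (mder Fh e0)^T.
    by rewrite -sub1mx; apply/rV_subP => a _; have [b [_ <-]] := BDh e0 Oe a; exact: submxMl.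
  by move=> /eqP <-; exact: rank_leq_row.
subst p.
have uFh e : OA e -> mder Fh e \in unitmx.
  move=> Oe; rewrite -unitmx_tr -row_full_unit -sub1mx; apply/rV_subP => a _.
  by have [b [_ <-]] := BDh e Oe a; exact: submxMl.
(* On the zero section the lift is [i] read inside [P]. As [i] is an embedding, points of the zero
   section with nearby images are themselves near. *)
have zero_sec e V : X0 e -> mopen V -> V e -> exists U, [/\ mopen U, U (Fh e) & forall e', X0 e' -> U (Fh e') -> V e'].
  move=> ze oV Ve; pose z (x : X) : E := zsec r (TperpX i pi) x.
  have zE (e1 : E) : X0 e1 -> e1 = z (pr e1) by case: e1 => x xi h; have -> : xi = 0 := h.
  rewrite (zE e ze) in Ve.
  have [V1 [oV1 V1e HV1]] := (zero_section_smooth nM nX hPi aPi si fi hreg hcoi (pr e)).1 V oV Ve.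
  have [V2 oV2 E2] := embi V1 oV1.
  have V2e : V2 (iP (Fh e)).
    have : (i @` V1) (i (pr e)) by exists (pr e).
    by rewrite E2 FhE ?F0 => [[]||] //; exact: ZO.
  have [U1 [oU1 U1e HU1]] := (siP (Fh e)).1 V2 oV2 V2e.
  exists U1; split => // e' ze' /HU1; rewrite FhE; last exact: ZO.
  rewrite F0// => V2e'; have : (i @` V1) (i (pr e')) by rewrite E2; split => //; exists (pr e').
  by move=> [x' V1x' /inji E1]; rewrite (zE e' ze') -E1; exact: HV1.
have [UA [oUA ZUA UAO inj]] := injective_neighborhood hE nP opn sFh uFh oBP hBP ZO zero_sec.
pose F' y : E := choose_or (zsec r (TperpX i pi) x0 : E) (fun e => UA e /\ Fh e = y).
have F'F e : UA e -> F' (Fh e) = e.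
  move=> Ue; have [|U1 E1] := @choose_orP E (zsec r (TperpX i pi) x0) (fun e' => UA e' /\ Fh e' = Fh e); first by exists e.
  exact: inj.
exists UA, (Fh @` UA), Fh, F'; split.
- by split => // e /UAO/OU.
- split; first exact: (local_diffeo_open hE nP opn sFh uFh oUA UAO).
  move=> y [x _ Ex]; pose e : E := zsec r (TperpX i pi) x; have ze : X0 e by [].
  exists e; first exact: ZUA.
  by apply: injP; rewrite FhE; [rewrite F0|exact: ZO].
- split; [|by []|exact: F'F].
  by apply: (msmap_smooth_map hE nP oUA) => e /UAO; exact: sFh.
- apply: (msmap_smooth_map nP hE); first exact: (local_diffeo_open hE nP opn sFh uFh oUA UAO).
  exact: (local_diffeo_inverse hE nP opn sFh uFh oUA UAO F'F).
move=> e /UAO Oe; rewrite /poisson_map_at; have uD := uFh e Oe; have uDT : (mder Fh e)^T \in unitmx by rewrite unitmx_tr.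
apply/row_matrixP => l; rewrite !rowE.
(* The derivative of [Fh] is invertible, so a covector with the same pull-back as the basis covector
   is that covector; relatedness thus becomes the equation of a Poisson map, row by row. *)
have [b [h1 h2]] := BDh e Oe (delta_mx 0 l *m (mder Fh e)^T).
have E1 : b = delta_mx 0 l by apply: (can_inj (mulmxK uDT)).
by rewrite E1 in h1; rewrite h1 !mulmxA.
Qed.
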